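(* Let $\mathcal{D}$ be the distribution $dz_1=\omega_1,\dots,dz_N=\omega_N$ on $U\times\mathbb{C}^N$, where $M\ge2$, $N\ge1$ and $\omega_1,\dots,\omega_N$ are holomorphic $1$-forms, in the variables $x=(x_1,\dots,x_M)$ only, on a neighborhood $U$ of $0\in\mathbb{C}^M$. Let $H_{\mathcal{D}}$ be as defined in the context. There exists a holomorphic vector field $Z$ on $U\times\mathbb{C}^N$, Legendrian for $\mathcal{D}$, such that the following density property holds: given any neighborhood $\Delta$ of the origin in $\mathbb{C}^{M+N}$, there is a nonempty open set $\Delta^*\subset\Delta$ (contained in the domains of $Z$ and $H_{\mathcal{D}}$) such that each leaf $L$ of $Z|_{\Delta^*}$ is dense in the level of $H_{\mathcal{D}}|_{\Delta^*}$ containing $L$; moreover, if $M=2$, there is a hypersurface $\mathcal{S}$ through $0\in\mathbb{C}^{2+N}$, invariant by $Z$, such that for every $\Delta$ the set $\Delta^*$ can be chosen of the form $\mathcal{B}\setminus\mathcal{S}$ with $\mathcal{B}$ a neighborhood of the origin; and such that, in addition: (1) There exists a polynomial vector field $X(x)=A_1(x)\frac{\partial}{\partial x_1}+\dots+A_M(x)\frac{\partial}{\partial x_M}$ on $\mathbb{C}^M$, depending only on a finite jet of the power series of $d\omega$ at $0$, such that $$Z(x,z)=\sum_{i=1}^M A_i(x)\frac{\partial}{\partial x_i}+\sum_{j=1}^N\big[\omega_j(x)\cdot X(x)\big]\frac{\partial}{\partial z_j},$$ where the dot denotes evaluation of a $1$-form on a vector field. In particular, the coefficients of $Z$ depend only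 on the variables $(x_1,\dots,x_M)$. (2) There exists a hypersurface $S\subset\mathbb{C}^M$, which is a union of (finitely many) hyperplanes through the origin of $\mathbb{C}^M$, that is invariant by $X$ and such that the orbits of $X$ through points of $\mathbb{C}^M\setminus S$ are everywhere dense (in $\mathbb{C}^M$).
   Context: Coordinates on $\mathbb{C}^{M+N}=\mathbb{C}^M\times\mathbb{C}^N$ are $(x,z)=(x_1,\dots,x_M,z_1,\dots,z_N)$; $U$ is a connected open neighborhood of $0$. The distribution $\mathcal{D}$ has rank $M$ and its fiber at $(x,z)\in U\times\mathbb{C}^N$ is $\{(v,w)\in\mathbb{C}^M\times\mathbb{C}^N: w_j=\omega_j(x)(v),\ j=1,\dots,N\}$. Write $\omega=(\omega_1,\dots,\omega_N)$, $d\omega=(d\omega_1,\dots,d\omega_N)$ and expand at $0$: $d\omega=\sum c_K^{ij}x^K\,dx_i\wedge dx_j$, with $c_K^{ij}\in\mathbb{C}^N$, $K\in(\mathbb{Z}_{\ge0})^M$, $1\le i<j\le M$. Let $W_{\mathcal{D}}\subset\mathbb{C}^N$ be the complex vector subspace spanned by all the $c_K^{ij}$, and $\kappa=\operatorname{codim}W_{\mathcal{D}}$. If $\kappa\ge1$, choose a surjective linear map $T=(T_1,\dots,T_\kappa):\mathbb{C}^N\to\mathbb{C}^\kappa$ with $\ker T=W_{\mathcal{D}}$. The forms $T_j(\omega_1,\dots,\omega_N)$ are closed, so on a ball $V\subset U$ centered at $0$ there is a unique holomorphic map $g=(g_1,\dots,g_\kappa)$ with $g(0)=0$ and $dg_j=T_j(\omega_1,\dots,\omega_N)$;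 set $H_{\mathcal{D}}(x,z)=T(z)-g(x)$ on $V\times\mathbb{C}^N$. If $\kappa=0$, $H_{\mathcal{D}}$ is the constant map to $\mathbb{C}^0$. A holomorphic vector field (not identically zero) generates a one-dimensional singular holomorphic foliation; its leaves (also called orbits) are the leaves of the regular foliation it defines off its zero set. $Z$ is Legendrian for $\mathcal{D}$ if $Z$ takes values in $\mathcal{D}$. The level of $H_{\mathcal{D}}|_{\Delta^*}$ containing $L$ is the set of points of $\Delta^*$ where $H_{\mathcal{D}}$ takes the constant value it takes on $L$. ''Depending only on a finite jet'' means: to each $\omega$ (with $M,N$ fixed) one can associate an integer $d(\omega)\ge0$ and a vector field $X=X_\omega$ as in the claim, in such a way that $X_\omega$ is determined by $d(\omega)$ and the coefficients $c_K^{ij}$ with $|K|\le d(\omega)$; that is, if $d(\omega)=d(\omega')$ and $d\omega,d\omega'$ have the same coefficients for $|K|\le d(\omega)$ then $X_\omega=X_{\omega'}$. *)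

(* Defs.v *)
(* C^n is 'rV[R[i]]_n for R : realType, and a point (x, z) of C^M x C^N is
   row_mx x z : 'rV[R[i]]_(M + N), so that x = lsubmx p and z = rsubmx p. *)
From HB Require Import structures.
From Stdlib Require Import Relation_Operators.
From mathcomp Require Import all_boot all_order all_algebra.
From mathcomp Require Import complex.
From mathcomp Require Import all_classical all_reals all_analysis.
(* The notations of mpoly clash with those of all_analysis. *)
From mathcomp Require Import -(notations) mpoly.

Set Implicit Arguments.
Unset Strict Implicit.
Unset Printing Implicit Defensive.

Import Order.TTheory GRing.Theory Num.Theory.
Import numFieldNormedType.Exports.

Local Open Scope classical_set_scope.
Local Open Scope ring_scope.

#[warnings="-redundant-canonical-projection"]
HB.instance Definition _ (R : realType) := NormedModule.copy R[i] R[i]^o.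

Section VectorFields.
Context {R : realType}.
Local Notation C := R[i].

(* [differentiable] is Frechet differentiability over the scalar field, here
   C, hence holomorphy when it holds at every point of an open set. *)
Definition holomorphic_on {V W : normedModType C} (A : set V) (f : V -> W) :=
  forall x, A x -> differentiable f x.

(* p and q lie on one local holomorphic integral curve of Z, contained in
   Omega minus the zeros of Z; the domain D of the curve lies in C. *)
Definition integral_arc n (Omega : set 'rV[C]_n) (Z : 'rV[C]_n -> 'rV[C]_n)
    (p q : 'rV[C]_n) : Prop :=
  exists (D : set C) (phi : C -> 'rV[C]_n) (s t : C),
    [/\ open D, connected D, D s /\ D t, phi s = p /\ phi t = q &
      forall u : C, D u -> [/\ Omega (phi u), Z (phi u) != 0 &
        is_derive u (1 : C) phi (Z (phi u))]].

(* Integral arcs are plaques of the foliation generated by Z, so that leaves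
   are the sets of points reached from a nonsingular point by finite chains of
   arcs. At a singular point p this set is [set p]. *)
Definition leaf_through n (Omega : set 'rV[C]_n) (Z : 'rV[C]_n -> 'rV[C]_n)
    (p : 'rV[C]_n) : set 'rV[C]_n :=
  [set q | clos_refl_trans _ (integral_arc Omega Z) p q].

Definition is_leaf n (Omega : set 'rV[C]_n) (Z : 'rV[C]_n -> 'rV[C]_n)
    (L : set 'rV[C]_n) : Prop :=
  exists p, [/\ Omega p, Z p != 0 & L = leaf_through Omega Z p].

Definition invariant_by n (Omega : set 'rV[C]_n) (Z : 'rV[C]_n -> 'rV[C]_n)
    (S : set 'rV[C]_n) : Prop :=
  forall p, Omega p -> S p -> leaf_through Omega Z p `<=` S.

(* Closed complex analytic subset of Omega of pure codimension one, possibly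
   singular or empty. The last condition says that the local equation f
   vanishes identically on no nonempty open set. *)
Definition hypersurface n (Omega S : set 'rV[C]_n) : Prop :=
  S `<=` Omega /\
  forall p, Omega p -> exists (B : set 'rV[C]_n) (f : 'rV[C]_n -> C),
    [/\ open_nbhs p B, B `<=` Omega, holomorphic_on B f,
        S `&` B = [set q | B q /\ f q = 0] & interior (S `&` B) = set0].

End VectorFields.

Section Distribution.
Context {R : realType}.
Local Notation C := R[i].
Context {M N : nat}.

(* [form omega x] is the matrix whose entry (i, j) is the coefficient of dx_i
   in omega_j at x, so that omega_j(x)(v) is entry j of v *m form omega x. *)
Record one_forms := OneForms {
  dom : set 'rV[C]_M;
  form :> 'rV[C]_M -> 'M[C]_(M, N);
  dom_open : open dom;
  dom_connected : connected dom;
  dom_0 : dom 0;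
  form_holomorphic : holomorphic_on dom form }.

Definition cylinder (A : set 'rV[C]_M) : set 'rV[C]_(M + N) :=
  [set p | A (lsubmx p)].

Definition distribution (omega : one_forms) (p : 'rV[C]_(M + N)) :
    set 'rV[C]_(M + N) :=
  [set u | rsubmx u = lsubmx u *m omega (lsubmx p)].

Definition legendrian (omega : one_forms)
    (Z : 'rV[C]_(M + N) -> 'rV[C]_(M + N)) : Prop :=
  forall p, cylinder (dom omega) p -> distribution omega p (Z p).

Definition partial {W : normedModType C} (i : 'I_M) (f : 'rV[C]_M -> W) :
    'rV[C]_M -> W :=
  fun x => 'D_(delta_mx 0 i) f x.

Definition mpartial {W : normedModType C} (K : multinom M)
    (f : 'rV[C]_M -> W) : 'rV[C]_M -> W :=
  foldr (fun i h => iter (K i) (partial i) h) f (enum 'I_M).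

(* Coefficient of dx_i /\ dx_j in (d omega_1, ..., d omega_N), for i < j. *)
Definition dform (omega : one_forms) (i j : 'I_M) (x : 'rV[C]_M) : 'rV[C]_N :=
  partial i (fun y => row j (omega y)) x -
  partial j (fun y => row i (omega y)) x.

(* c_K^{ij}, the Taylor coefficient at 0. *)
Definition dcoef (omega : one_forms) (K : multinom M) (i j : 'I_M) :
    'rV[C]_N :=
  (\prod_(k < M) (K k)`!)%:R^-1 *: mpartial K (dform omega i j) 0.

Definition dcoefs (omega : one_forms) : set 'rV[C]_N :=
  [set c | exists K (i j : 'I_M), (i < j)%N /\ c = dcoef omega K i j].

Definition is_span (A : set 'rV[C]_N) (W : {vspace 'rV[C]_N}) : Prop :=
  (forall v, A v -> v \in W) /\
  (forall W' : {vspace 'rV[C]_N}, (forall v, A v -> v \in W') ->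
     (W <= W')%VS).

Definition euclidean_ball (r : C) : set 'rV[C]_M :=
  [set x | \sum_(i < M) `|x 0 i| ^+ 2 < r ^+ 2].

(* The data W_D, T, V, g entering the definition of H_D. The order of C being
   that of the reals, 0 < HD_radius makes it a positive real. When the
   codimension is 0, T and g take values in the zero space. *)
Record first_integral (omega : one_forms) := FirstIntegral {
  WD : {vspace 'rV[C]_N};
  WD_span : is_span (dcoefs omega) WD;
  HD_T : 'Hom('rV[C]_N, 'rV[C]_(N - \dim WD));
  HD_T_surjective : limg HD_T = fullv;
  HD_T_kernel : lker HD_T = WD;
  HD_radius : C;
  HD_radius_gt0 : 0 < HD_radius;
  HD_V := euclidean_ball HD_radius;
  HD_V_dom : HD_V `<=` dom omega;
  HD_g : 'rV[C]_M -> 'rV[C]_(N - \dim WD);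
  HD_g_holomorphic : holomorphic_on HD_V HD_g;
  HD_g_0 : HD_g 0 = 0;
  HD_g_diff : forall x, HD_V x -> forall v, 'd HD_g x v = HD_T (v *m omega x) }.

Definition HD (omega : one_forms) (h : first_integral omega)
    (p : 'rV[C]_(M + N)) : 'rV[C]_(N - \dim (WD h)) :=
  HD_T h (rsubmx p) - HD_g h (lsubmx p).

Definition level (omega : one_forms) (h : first_integral omega)
    (A : set 'rV[C]_(M + N)) (p : 'rV[C]_(M + N)) : set 'rV[C]_(M + N) :=
  [set q | A q /\ HD h q = HD h p].

(* A is admissible as Delta^* for the neighborhood Delta. *)
Definition dense_leaves_on (omega : one_forms) (h : first_integral omega)
    (Z : 'rV[C]_(M + N) -> 'rV[C]_(M + N))
    (Delta A : set 'rV[C]_(M + N)) : Prop :=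
  [/\ open A, A !=set0, A `<=` Delta,
      A `<=` cylinder (dom omega) `&` cylinder (HD_V h) &
      forall L, is_leaf A Z L -> forall p, L p ->
        L `<=` level h A p /\ level h A p `<=` closure L].

Definition polynomial_field := {ffun 'I_M -> mpoly M C}.

Definition field_at (X : polynomial_field) (x : 'rV[C]_M) : 'rV[C]_M :=
  \row_(i < M) meval (x 0) (X i).

Definition lift_field (omega : one_forms) (X : polynomial_field)
    (p : 'rV[C]_(M + N)) : 'rV[C]_(M + N) :=
  row_mx (field_at X (lsubmx p))
         (field_at X (lsubmx p) *m omega (lsubmx p)).

Definition hyperplanes k (l : 'I_k -> 'cV[C]_M) : set 'rV[C]_M :=
  [set x | exists i, x *m l i = 0].

(* The polynomial field is determined by the order d omega and the jet of
   that order of the power series of d omega at 0. *)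
Definition finite_jet (d : one_forms -> nat) (X : one_forms -> polynomial_field) :
    Prop :=
  forall omega omega' : one_forms, d omega = d omega' ->
    (forall (K : multinom M) (i j : 'I_M), (mdeg K <= d omega)%N ->
       (i < j)%N -> dcoef omega K i j = dcoef omega' K i j) ->
    X omega = X omega'.

End Distribution.

Arguments one_forms R M N : clear implicits.
Arguments polynomial_field R M : clear implicits.

(* Submission.v *)
(** Along an orbit of X the ratio t = x_1 / x_0 moves freely off finitely many real
poles and the other coordinates are multiplied by powers. Loops in the t-plane act
by multipliers, dense since the exponents involve 1 and sqrt 2. In the fibre, loops
with trivial multiplier translate z by periods of the forms; for small exponents
these span ker T, as a combination with vanishing periods is closed to high order. *)
Require Import Defs.
From HB Require Import structures.
From mathcomp Require Import all_boot all_order all_algebra.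
From mathcomp Require Import complex.
From mathcomp Require Import all_classical all_reals all_analysis.
From mathcomp Require Import -(notations) mpoly.
From mathcomp Require Import ring lra.

Set Implicit Arguments.
Unset Strict Implicit.
Unset Printing Implicit Defensive.

Import Order.TTheory GRing.Theory Num.Theory.
Import numFieldNormedType.Exports.
Import ComplexField.Normc Relation_Operators.

Local Open Scope classical_set_scope.
Local Open Scope ring_scope.
Local Open Scope complex_scope.

(** The poles $t_b$ are positive integers and loops start at $t=i$. The field may depend on a finite
    jet only, so translations of $z$ are controlled through their homogeneous parts of degree at
    most $D$, where $D$ exceeds the orders of finitely many $c_K^{ij}$ spanning $W$. Each $\eta_j$
    has $4+L$ poles with exponents $-\varepsilon\beta$: the first four values of $\beta$ make the
    multipliers dense, the others repeat $\beta=1$, so that differences of their loops fix $\eta$.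
    Each $\eta_j$ with $j\ge1$ also has $p$ poles of exponent 1; they have no monodromy but bend the
    curves, which makes the linear system for $d\theta$ solvable. As $\varepsilon\to0$, a period
    divided by $\varepsilon$ tends to $2\pi i$ times the value at the pole of a polynomial of degree
    at most $D(p+1)$; hence $L>D(p+1)$ and $p\ge D$. Contracting $\eta$ before repeating a loop
    isolates the lowest homogeneous part not yet obtained. For $M=2$ every point near 0 outside
    $\mathcal S$ must reach $t=i$ at a cost linear in $|x|$, even from near a pole or infinity; this
    needs exponents of negative real part at the poles and a further bound on $\varepsilon$. *)

Notation "'somepos' r , P" := (exists2 r, 0 < r & P) (at level 200, r name).
Local Notation Re := (@complex.Re _).
Local Notation nc := (normc).
Local Notation minr := Num.min.
Local Notation Im := (@complex.Im _).

(** * The modulus on C as a real number *)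

Section ComplexNorm.
Context {R : realType}.
Local Notation C := R[i].
Implicit Types x y z w : C.
Lemma normc_ge0 z : 0 <= nc z.
by case: z => a b; rewrite /nc sqrtr_ge0. Qed.
 Lemma normcE z : `|z| = (nc z)%:C.
by []. Qed.
 Lemma normc_eq0 z : (nc z == 0) = (z == 0).
by apply/eqP/eqP => [/eq0_normc|->]; last exact: normc0. Qed.
 Lemma normc_gt0 z : (0 < nc z) = (z != 0).
by rewrite lt_def normc_ge0 andbT normc_eq0. Qed.
 Lemma ler_normcD x y : nc (x + y) <= nc x + nc y.
exact: le_normcD. Qed.
 Lemma ler_normcB x y : nc (x - y) <= nc x + nc y.
by apply: le_trans (ler_normcD _ _) _; rewrite normcN. Qed.
 Lemma normc_distC x y : nc (x - y) = nc (y - x).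
by rewrite -opprB normcN. Qed.
 Lemma ler_normc_dist x y z : nc (x - z) <= nc (x - y) + nc (y - z).
by have := ler_normcD (x - y) (y - z); rewrite addrA subrK. Qed.
 Lemma lerB_normc x y : nc x - nc y <= nc (x - y).
by rewrite lerBlDr; have := ler_normcD (x - y) y; rewrite subrK. Qed.
 Lemma normc_real (a : R) : nc a%:C = `|a|.
by rewrite /nc /= expr0n /= addr0 sqrtr_sqr. Qed.
 Lemma normcX z n : nc (z ^+ n) = nc z ^+ n.
by elim: n => [|n IH]; rewrite ?normc1 // !exprS normcM IH. Qed.
 Lemma normc_prod (I : Type) (r : seq I) (P : pred I) (F : I -> C) : nc (\prod_(i <- r | P i) F i) = \prod_(i <- r | P i) nc (F i).
elim/big_rec2: _ => [|i y x _ IH]; first by rewrite normc1. by rewrite normcM IH.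
Qed.
Lemma ler_normc_sum (I : Type) (r : seq I) (P : pred I) (F : I -> C) :
  nc (\sum_(i <- r | P i) F i) <= \sum_(i <- r | P i) nc (F i).
elim/big_rec2: _ => [|i y x _ IH]; first by rewrite normc0. by apply: le_trans (ler_normcD _ _) _; rewrite lerD2l.
Qed.
Lemma ler_Re_normc z : `|Re z| <= nc z.
by have := normc_ge_Re z; rewrite normcE lecR. Qed.
 Lemma ler_Im_normc z : `|Im z| <= nc z.
case: z => a b /=; rewrite -sqrtr_sqr ler_wsqrtr // lerDr sqr_ge0 //.
Qed.
Lemma ler_normc_ReIm z : nc z <= `|Re z| + `|Im z|.
rewrite [z in nc z]complexE; apply: le_trans (ler_normcD _ _) _. rewrite normcM !normc_real lerD2l /nc /= expr0n /= add0r expr1n sqrtr1.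
by rewrite mul1r.
Qed.
Lemma normc_i : nc ('i : C) = 1.
by rewrite /nc /= expr0n /= add0r expr1n sqrtr1. Qed.
 Lemma ReD x y : Re (x + y) = Re x + Re y.
by case: x; case: y. Qed.
 Lemma ImD x y : Im (x + y) = Im x + Im y.
by case: x; case: y. Qed.
 Lemma ReB x y : Re (x - y) = Re x - Re y.
by case: x; case: y. Qed.
 Lemma ImB x y : Im (x - y) = Im x - Im y.
by case: x; case: y. Qed.
 Lemma normc_nat n : nc (n%:R : C) = n%:R.
by rewrite -[n%:R](rmorph_nat (real_complex R)) normc_real ger0_norm. Qed.
 Lemma Re_realM (a : R) z : Re (a%:C * z) = a * Re z.
by case: z => u v /=; rewrite mul0r subr0. Qed.
 Lemma Im_realM (a : R) z : Im (a%:C * z) = a * Im z.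
by case: z => u v /=; rewrite mul0r addr0. Qed.
 Lemma pos_complex (e : C) : 0 < e -> 0 < Re e /\ e = (Re e)%:C.
by case: e => a b; rewrite ltcE /= => /andP[/eqP -> h]; split. Qed.
 Lemma ltr_normc (z : C) (e : R) : (`|z| < e%:C) = (nc z < e).
by rewrite normcE ltcR. Qed.
 Lemma nbhs_normc (z : C) (A : set C) : nbhs z A <-> somepos r, forall w, nc (w - z) < r -> A w.
split=> [/nbhs_ballP[e /= e0 h]|[r r0 h]].
  have [e1 e2] := pos_complex e0; exists (Re e) => // w hw; apply: h. by rewrite -ball_normE /= e2 ltr_normc normc_distC.
apply/nbhs_ballP; exists r%:C; first by rewrite /= ltcR. by move=> w; rewrite -ball_normE /= ltr_normc normc_distC; exact: h.
Qed.
End ComplexNorm.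

#[local] Hint Extern 0 (is_true (@Order.le _ _ _ (nc _))) => exact: normc_ge0 : core.
Lemma eq_ler (R : numDomainType) (x y : R) : x = y -> x <= y.
by move=> ->. Qed.
 Lemma lt_minP (R : realDomainType) (x y z : R) : reflect (x < y /\ x < z) (x < minr y z).
by rewrite lt_min; exact: andP. Qed.
 Ltac pos := first [ done | exact: ltr0Sn | exact: ltW | exact: expR_gt0
  | apply: exprn_gt0; pos | apply: exprn_ge0; pos | rewrite invr_gt0; pos | rewrite invr_ge0; pos
  | apply: mulr_gt0; pos | apply: mulr_ge0; pos | apply: ltr_wpDl; pos | apply: ltr_pwDl; pos
  | apply: addr_ge0; pos | apply: sumr_ge0 => ? _; pos | rewrite lt_min; apply/andP; split; pos ].

(* Forgetting the context before calling lra makes it much faster. *)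
Ltac nlra := repeat match goal with | h : is_true (Order.le _ _) |- _ => revert h | h : is_true (Order.lt _ _) |- _ => revert h end;
  repeat match goal with |- context [@normc ?R ?x] => generalize (@normc R x) end; clear; intros; lra.

 (** * Induction along an interval and geometric convergence *)

 Section Cousin.
Context {R : realType}.
 (** The supremum of the [s] with [P 0 s] cannot lie below 1, since [P] holds on every short
     interval around it. This stands in for the compactness of [0, 1] in the uniform statements on
     segments below. *)
 Lemma cousin (P : R -> R -> Prop) : (forall a b c : R, 0 <= a -> a <= b -> b <= c -> c <= 1 -> P a b -> P b c -> P a c) ->
    (forall x : R, 0 <= x <= 1 -> somepos d, forall a b : R, 0 <= a -> a <= x -> x <= b -> b <= 1 -> b - a < d -> P a b) ->
  P 0 1.
move=> Padd Ploc. pose S : set R := [set s | 0 <= s <= 1 /\ P 0 s]. have S0 : S 0.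
  split; first by rewrite lexx ler01. have [|d d0 Hd] := Ploc 0; first by rewrite lexx ler01. by apply: Hd; rewrite ?subrr ?lexx ?ler01.
have bS : ubound S 1 by move=> s [/andP[]]. have hS : has_sup S by split; [exists 0 | exists 1]. have s01 : 0 <= sup S <= 1.
  apply/andP; split; first by apply: (sup_upper_bound hS). by apply: sup_le_ub => //; exists 0.
have [d d0 Hd] := Ploc _ s01. have d2 : 0 < d / 2 by lra. have [s [/andP[s0 s1] Ps] ss] := sup_adherent d2 hS.
have les : s <= sup S by apply: (sup_upper_bound hS); split => //; apply/andP. move: s01 => /andP[S0' S1].
have [h|h] := lerP 1 (sup S + d / 4).
  apply: (Padd 0 s 1) => //; apply: Hd => //; lra.
suff : S (sup S + d / 4).
  by move=> /(sup_upper_bound hS); lra.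
split; first lra. by apply: (Padd 0 s) => //; [lra|lra|apply: Hd => //; lra].
Qed.
(** The intervals of radius [c / 2 ^+ n] around [s n] are nested, so the supremum of their left ends
    lies in all of them. *)
Lemma geometric_limit (s : nat -> R) (c : R) :
    (forall n, `|s n.+1 - s n| <= c / 2 ^+ n.+1) ->
  exists L, forall n, `|s n - L| <= 2 * c / 2 ^+ n.
move=> hs. have e n : c / 2 ^+ n.+1 = c / 2 ^+ n / 2 by rewrite exprSr invfM mulrA.
have cn n : 0 <= c / 2 ^+ n.+1 by apply: le_trans (hs n). have mono n m : (n <= m)%N -> s n - c / 2 ^+ n <= s m - c / 2 ^+ m.
  elim: m => [|m IH]; first by rewrite leqn0 => /eqP ->. rewrite leq_eqVlt => /orP[/eqP -> //|]; rewrite ltnS => /IH.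
  by have := hs m; have := e m; rewrite ler_norml => -> /andP[]; lra.
have mono2 n m : (n <= m)%N -> s m + c / 2 ^+ m <= s n + c / 2 ^+ n.
  elim: m => [|m IH]; first by rewrite leqn0 => /eqP ->. rewrite leq_eqVlt => /orP[/eqP -> //|]; rewrite ltnS => /IH.
  by have := hs m; have := e m; rewrite ler_norml => -> /andP[]; lra.
have cn' n : 0 <= c / 2 ^+ n by have := cn n; rewrite e; lra. have cross n m : s n - c / 2 ^+ n <= s m + c / 2 ^+ m.
  have h1 := mono _ _ (leq_maxl n m); have h2 := mono2 _ _ (leq_maxr n m). by have := cn' (maxn n m); lra.
pose A : set R := [set y | exists n, y = s n - c / 2 ^+ n]. have A0 : A !=set0 by exists (s 0%N - c / 2 ^+ 0); exists 0%N.
have hA : has_sup A.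
  by split=> //; exists (s 0%N + c / 2 ^+ 0) => _ [n ->]; exact: cross.
exists (sup A) => n. have l1 : s n - c / 2 ^+ n <= sup A by apply: (sup_upper_bound hA); exists n. have l2 : sup A <= s n + c / 2 ^+ n.
  by apply: (sup_le_ub A0) => _ [m ->]; exact: cross.
by have := cn' n; rewrite -mulrA ler_norml; lra.
Qed.
Lemma half_pow_small (c e : R) : 0 < e -> exists n : nat, c / 2 ^+ n < e.
move=> e0; pose n := Num.bound `|c / e|; exists n. have le : c / e < n%:R.
  by apply: le_lt_trans (ler_norm _) _; apply: archi_boundP.
rewrite ltr_pdivrMr ?exprn_gt0 // mulrC -ltr_pdivrMr //. apply: lt_trans le _; rewrite -natrX ltr_nat; exact: ltn_expl.
Qed.
End Cousin.

(** * Continuity and complex derivative at a point *)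

Section ComplexDerivative.
Context {R : realType}.
Local Notation C := R[i].
Implicit Types (f g : C -> C) (z w d : C).
Definition cts f z := forall e : R, 0 < e -> somepos d, forall w, nc (w - z) < d -> nc (f w - f z) < e.
Lemma ctsP f z : cts f z <-> f @ z --> f z.
split=> [cf A /nbhs_normc[e /cf[d d0 hd] hA]|cf e e0].
  by apply/nbhs_normc; exists d => // w /hd /hA.
by apply/nbhs_normc; apply: (cf [set y | nc (y - f z) < e]); apply/nbhs_normc; exists e.
Qed.
Lemma cts_near f g z (r : R) : 0 < r ->
  (forall w, nc (w - z) < r -> f w = g w) -> cts f z -> cts g z.
move=> r0 fg cf e /cf[d d0 Hd]; exists (minr d r); first by pos. move=> w /lt_minP[wd wr]; rewrite -!fg ?subrr ?normc0 //. exact: Hd.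
Qed.
Lemma cts_ext f g z : f =1 g -> cts f z -> cts g z.
by move=> /funext ->. Qed.
 Lemma cts_cst (a : C) z : cts (fun=> a) z.
by move=> e e0; exists 1 => // w _; rewrite subrr normc0. Qed.
 Lemma cts_id z : cts id z.
by move=> e e0; exists e. Qed.
 Lemma ctsD f g z : cts f z -> cts g z -> cts (fun w => f w + g w) z.
by move=> /ctsP cf /ctsP cg; apply/ctsP; exact: cvgD cf cg. Qed.
 Lemma ctsM f g z : cts f z -> cts g z -> cts (fun w => f w * g w) z.
by move=> /ctsP cf /ctsP cg; apply/ctsP; exact: cvgM cf cg. Qed.
 Lemma ctsN f z : cts f z -> cts (fun w => - f w) z.
by move=> cf; apply: cts_ext (ctsM (cts_cst (-1) z) cf) => w; rewrite mulN1r.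
Qed.
Lemma ctsB f g z : cts f z -> cts g z -> cts (fun w => f w - g w) z.
by move=> cf cg; exact: ctsD cf (ctsN cg). Qed.
 Lemma cts_away f z : cts f z -> f z != 0 -> somepos d, forall w, nc (w - z) < d -> nc (f z) / 2 < nc (f w).
rewrite -normc_gt0 => cf fz; have f2 : 0 < nc (f z) / 2 by lra. have [d d0 Hd] := cf _ f2.
exists d => // w /Hd; have := lerB_normc (f z) (f w). by rewrite [nc (f z - _)]normc_distC; lra.
Qed.
Lemma ctsV f z : f z != 0 -> cts f z -> cts (fun w => (f w)^-1) z.
by move=> fz /ctsP cf; apply/ctsP; exact: cvgV fz cf. Qed.
 Lemma cts_comp f g z : cts f z -> cts g (f z) -> cts (fun w => g (f w)) z.
move=> cf cg e /cg[d1 d10 H1]; have [d2 d20 H2] := cf _ d10. by exists d2 => // w /H2 /H1.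
Qed.
Lemma cts_sum (I : Type) (r : seq I) (F : I -> C -> C) z :
  (forall i, cts (F i) z) -> cts (fun w => \sum_(i <- r) F i w) z.
move=> cF; elim: r => [|i r IH].
  by apply: cts_ext (cts_cst 0 z) => w; rewrite big_nil.
by apply: cts_ext (ctsD (cF i) IH) => w; rewrite big_cons.
Qed.
Lemma ctsX f z n : cts f z -> cts (fun w => f w ^+ n) z.
move=> cf; elim: n => [|n IH]; first exact: cts_cst. by apply: cts_ext (ctsM cf IH) => w; rewrite exprS.
Qed.
(** Carathéodory's form of the derivative: the difference quotient extends continuously to [z]. The
    product, quotient and chain rules become algebraic identities between such quotients; [cdP]
    recovers the usual estimate. *)
Definition cd f z d := exists phi : C -> C,
  [/\ cts phi z, phi z = d & forall w, f w = f z + phi w * (w - z)].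
Lemma cdP f z d : cd f z d <-> forall e : R, 0 < e -> somepos r, forall w, nc (w - z) < r ->
    nc (f w - f z - d * (w - z)) <= e * nc (w - z).
split=> [[phi [cphi <- fE]] e /cphi[r r0 Hr]|H].
  exists r => // w /Hr h; rewrite fE. rewrite (_ : _ - _ = (phi w - phi z) * (w - z)); last by ring. by rewrite normcM ler_wpM2r // ltW.
exists (fun w => if w == z then d else (f w - f z) / (w - z)); split.
- move=> e e0; have e2 : 0 < e / 2 by lra. have [r r0 Hr] := H _ e2; exists r => // w /Hr; rewrite eqxx.
  have [->|wz] := eqVneq w z; first by move=> _; rewrite subrr normc0. have wz0 : w - z != 0 by rewrite subr_eq0.
  have wz1 := wz0; rewrite -normc_gt0 in wz1. have -> : (f w - f z) / (w - z) - d = (f w - f z - d * (w - z)) / (w - z).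
    by field.
  move=> h; rewrite normcM normcV ltr_pdivrMr //; nra.
- by rewrite eqxx.
- move=> w; have [->|wz] := eqVneq w z; first by rewrite subrr mulr0 addr0. by rewrite divfK ?subr_eq0 // addrC subrK.
Qed.
Lemma cd_cts f z d : cd f z d -> cts f z.
move=> [phi [cphi _ fE]]. apply: cts_ext (ctsD (cts_cst (f z) z) (ctsM cphi (ctsB (@cts_id z) (cts_cst z z)))) => w. by rewrite -fE.
Qed.
Lemma cd_near f g z d (r : R) : 0 < r ->
  (forall w, nc (w - z) < r -> f w = g w) -> cd f z d -> cd g z d.
move=> r0 fg /cdP H; apply/cdP => e /H[s s0 Hs]. exists (minr s r); first by pos. move=> w /lt_minP[ws wr].
by rewrite -!fg ?subrr ?normc0 //; exact: Hs.
Qed.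
Lemma cd_ext f g z d d' : f =1 g -> d = d' -> cd f z d -> cd g z d'.
by move=> fg ->; apply: (@cd_near _ _ _ _ 1) => // w _; exact: fg. Qed.
 Lemma cd_unique f z d d' : cd f z d -> cd f z d' -> d = d'.
move=> [p [cp <- pE]] [q [cq <- qE]]; apply/eqP/negPn/negP => n0. have [|r r0 hr] := cts_away (ctsB cp cq); first by rewrite subr_eq0.
have r20 : (r / 2)%:C != 0 :> C by rewrite fmorph_eq0; lra. have zr : z + (r / 2)%:C - z = (r / 2)%:C by ring.
have := hr (z + (r / 2)%:C); rewrite zr normc_real ger0_norm; last by lra. have -> : p (z + (r / 2)%:C) = q (z + (r / 2)%:C).
  by rewrite -zr in r20; apply: (mulIf r20); apply: (addrI (f z)); rewrite -pE -qE.
by rewrite subrr normc0 => /(_ ltac:(lra)); have := normc_ge0 (p z - q z); lra.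
Qed.
Lemma cd_cst (a : C) z : cd (fun=> a) z 0.
by exists (fun=> 0); split=> // [|w]; [exact: cts_cst | rewrite mul0r addr0].
Qed.
Lemma cd_id z : cd id z 1.
by exists (fun=> 1); split=> // [|w]; [exact: cts_cst | rewrite mul1r addrC subrK].
Qed.
Lemma cdD f g z d1 d2 : cd f z d1 -> cd g z d2 -> cd (fun w => f w + g w) z (d1 + d2).
move=> [p [cp <- fE]] [q [cq <- gE]]; exists (fun w => p w + q w); split=> //.
  exact: ctsD.
by move=> w; rewrite fE gE; ring.
Qed.
Lemma cdM f g z d1 d2 : cd f z d1 -> cd g z d2 ->
  cd (fun w => f w * g w) z (d1 * g z + f z * d2).
move=> Hf Hg; have cg := cd_cts Hg; move: Hf Hg => [p [cp <- fE]] [q [cq <- gE]]. exists (fun w => p w * g w + f z * q w); split=> //.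
  by apply: ctsD; apply: ctsM => //; exact: cts_cst.
by move=> w; rewrite fE gE; ring.
Qed.
Lemma cdZ (a : C) f z d : cd f z d -> cd (fun w => a * f w) z (a * d).
move=> /(cdM (cd_cst a z)); apply: cd_ext => //; by rewrite mul0r add0r.
Qed.
Lemma cdN f z d : cd f z d -> cd (fun w => - f w) z (- d).
by move=> /(cdZ (-1)); apply: cd_ext => [w|]; rewrite mulN1r. Qed.
 Lemma cdB f g z d1 d2 : cd f z d1 -> cd g z d2 -> cd (fun w => f w - g w) z (d1 - d2).
by move=> Hf Hg; exact: cdD Hf (cdN Hg). Qed.
 Lemma cd_comp f g z d1 d2 : cd f z d1 -> cd g (f z) d2 -> cd (fun w => g (f w)) z (d2 * d1).
move=> Hf; have cf := cd_cts Hf; move: Hf => [p [cp <- fE]] [q [cq <- gE]]. exists (fun w => q (f w) * p w); split=> //.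
  by apply: ctsM => //; exact: cts_comp cf cq.
move=> w; rewrite gE; congr (_ + _); rewrite -mulrA; congr (_ * _). by rewrite [f w]fE addrC addKr.
Qed.
Lemma cdV f z d : f z != 0 -> cd f z d -> cd (fun w => (f w)^-1) z (- d / (f z) ^+ 2).
move=> fz Hf; have cf := cd_cts Hf; have [r r0 Hr] := cts_away cf fz.
have nf w : nc (w - z) < r -> f w != 0 by move=> /Hr h; rewrite -normc_gt0; apply: le_lt_trans h; rewrite divr_ge0.
case: Hf => p [cp <- fE]. exists (fun w => if f w == 0 then - (f z)^-1 / (w - z) else - p w / (f w * f z)); split.
- apply: (@cts_near (fun w => - p w / (f w * f z)) _ _ r) => // [w /nf /negbTE ->//|].
  apply: ctsM (ctsN cp) (@ctsV (fun w => f w * f z) _ (mulf_neq0 fz fz) (ctsM cf (cts_cst _ z))).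
- by rewrite (negbTE fz). move=> w; case: eqP => [fw|/eqP fw]. have [wz|wz] := eqVneq w z; first by rewrite -wz fw eqxx in fz.
  by rewrite fw invr0 divfK ?subr_eq0 // subrr.
have -> : - p w / (f w * f z) * (w - z) = - (p w * (w - z)) / (f w * f z) by ring.
have -> : p w * (w - z) = f w - f z by rewrite [in RHS]fE; ring. by field; apply/andP.
Qed.
Lemma cd_sum (I : Type) (r : seq I) (F : I -> C -> C) (D : I -> C) z :
  (forall i, cd (F i) z (D i)) ->
  cd (fun w => \sum_(i <- r) F i w) z (\sum_(i <- r) D i).
move=> cF; elim: r => [|i r IH].
  by apply: cd_ext (cd_cst 0 z) => [w|]; rewrite big_nil.
by apply: cd_ext (cdD (cF i) IH) => [w|]; rewrite big_cons.
Qed.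
Lemma cdX f z d n : cd f z d -> cd (fun w => f w ^+ n) z (n%:R * f z ^+ n.-1 * d).
move=> cf; elim: n => [|n IH].
  by apply: cd_ext (cd_cst 1 z) => [w|]; rewrite ?expr0 ?mul0r.
apply: cd_ext (cdM cf IH) => [w|]; first by rewrite exprS. case: n {IH} => [|n] /=; first by rewrite expr0; ring.
by rewrite -[n.+2%:R]natr1 exprS; ring.
Qed.
End ComplexDerivative.

(** * Mean value inequalities along segments *)

Section MeanValue.
Context {R : realType}.
Local Notation C := R[i].
Implicit Types (f : C -> C) (h : R -> C) (a b z : C).
Definition in01 (s : R) := 0 <= s <= 1.
(** Derivative relative to [0, 1], hence one-sided at the end points. *)
Definition rd h (s : R) (d : C) := forall e : R, 0 < e -> somepos r, forall t, in01 t -> `|t - s| < r ->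
    nc (h t - h s - (t - s)%:C * d) <= e * `|t - s|.
Definition rcts h (s : R) := forall e : R, 0 < e -> somepos r, forall t, in01 t -> `|t - s| < r -> nc (h t - h s) < e.
Definition seg a b (s : R) : C := a + s%:C * (b - a).
Lemma seg0 a b : seg a b 0 = a. Proof. by rewrite /seg mul0r addr0. Qed.
Lemma seg1 a b : seg a b 1 = b. Proof. by rewrite /seg mul1r addrC subrK. Qed.
Lemma segB a b s t : seg a b t - seg a b s = (t - s)%:C * (b - a).
by rewrite /seg rmorphB /=; ring. Qed.
 Lemma in01_0 : in01 0. Proof. by rewrite /in01 lexx ler01. Qed.
Lemma in01_1 : in01 1. Proof. by rewrite /in01 lexx ler01. Qed.
 Lemma seg_near a b (s r : R) : 0 < r -> somepos d, forall t, `|t - s| < d -> nc (seg a b t - seg a b s) < r.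
move=> r0; have n0 := normc_ge0 (b - a). have k0 : 0 < nc (b - a) + 1 by lra. exists (r / (nc (b - a) + 1)); first exact: divr_gt0.
move=> t; rewrite ltr_pdivlMr // segB normcM normc_real => h. have := normr_ge0 (t - s); nra.
Qed.
Lemma rcts_seg f a b s : cts f (seg a b s) -> rcts (fun t => f (seg a b t)) s.
move=> cf e /cf[r r0 Hr]; have [d d0 Hd] := seg_near a b s r0. by exists d => // t _ /Hd /Hr.
Qed.
Lemma rd_seg f a b s d : cd f (seg a b s) d ->
  rd (fun t => f (seg a b t)) s (d * (b - a)).
move=> /cdP H e e0; have n0 := normc_ge0 (b - a). have k0 : 0 < nc (b - a) + 1 by lra. have [r r0 Hr] := H _ (divr_gt0 e0 k0).
have [q q0 Hq] := seg_near a b s r0; exists q => // t _ /Hq /Hr. rewrite segB normcM normc_real.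
rewrite (_ : d * ((t - s)%:C * (b - a)) = (t - s)%:C * (d * (b - a))); last by ring.
move=> h; apply: le_trans h _; rewrite mulrAC ler_pdivrMr // mulrA. have := normr_ge0 (t - s); have : 0 <= e * `|t - s| by pos. nra.
Qed.
Lemma rdD h k s d e : rd h s d -> rd k s e -> rd (fun t => h t + k t) s (d + e).
move=> H1 H2 x x0; have x2 : 0 < x / 2 by lra. have [r r0 Hr] := H1 _ x2; have [q q0 Hq] := H2 _ x2. exists (minr r q); first by pos.
move=> t t01 /lt_minP[/(Hr _ t01) h1 /(Hq _ t01) h2]. rewrite (_ : _ - _ = (h t - h s - (t - s)%:C * d) + (k t - k s - (t - s)%:C * e)).
  by have := ler_normcD (h t - h s - (t - s)%:C * d) (k t - k s - (t - s)%:C * e); lra.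
ring.
Qed.
Lemma rdZ h s d (c : C) : rd h s d -> rd (fun t => c * h t) s (c * d).
move=> H x x0; have n0 := normc_ge0 c; have k0 : 0 < nc c + 1 by lra.
have [r r0 Hr] := H _ (divr_gt0 x0 k0); exists r => // t t01 /(Hr _ t01). rewrite mulrAC ler_pdivlMr // => h1.
rewrite (_ : _ - _ = c * (h t - h s - (t - s)%:C * d)); last by ring. rewrite normcM; have := normc_ge0 (h t - h s - (t - s)%:C * d); nra.
Qed.
Lemma rd_ext h k s d : h =1 k -> rd h s d -> rd k s d.
move=> hk H e /H[r r0 Hr]; exists r => // t t01; rewrite -!hk; exact: Hr.
Qed.
(** With slack [e * (b - a)] the inequality is additive in the interval, and on a short interval it
    follows from differentiability at a point of it. A variable majorant [g'] is allowed so that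
    curves without a uniform bound on the speed can still be controlled by their total variation. *)
Lemma comparison h h' (g g' : R -> R) :
    (forall s, in01 s -> rd h s (h' s)) ->
    (forall s, in01 s -> forall e : R, 0 < e -> somepos r, forall t, in01 t -> `|t - s| < r ->
         `|g t - g s - (t - s) * g' s| <= e * `|t - s|) ->
    (forall s, in01 s -> nc (h' s) <= g' s) ->
  nc (h 1 - h 0) <= g 1 - g 0.
move=> dh dg hg; apply/ler_addgt0Pr => e e0. pose P (a b : R) : Prop := nc (h b - h a) <= g b - g a + e * (b - a).
suff : P 0 1 by rewrite /P subr0 mulr1. apply: cousin.
  rewrite /P => a b c _ _ _ _ h1 h2; have := ler_normc_dist (h c) (h b) (h a).
  rewrite (_ : e * (c - a) = e * (c - b) + e * (b - a)); last by ring. lra.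
move=> x x01; have e4 : 0 < e / 4 by lra. have [r r0 Hr] := dh _ x01 _ e4; have [q q0 Hq] := dg _ x01 _ e4. exists (minr r q); first by pos.
move=> a b a0 ax xb b1 /lt_minP[lr lq]. have a01 : in01 a by apply/andP; split; lra. have b01 : in01 b by apply/andP; split; lra.
have aE : `|a - x| = x - a by rewrite ler0_norm; nlra. have bE : `|b - x| = b - x by rewrite ger0_norm; nlra.
have := Hr _ a01; have := Hr _ b01; have := Hq _ a01; have := Hq _ b01.
rewrite aE bE => /(_ ltac:(nlra)) qb /(_ ltac:(nlra)) qa /(_ ltac:(nlra)) rb /(_ ltac:(nlra)) ra.
have hx := hg _ x01; have nb := normc_ge0 (h' x). have ub : nc (h b - h x) <= (b - x) * g' x + e / 4 * (b - x).
  have := ler_normcD (h b - h x - (b - x)%:C * h' x) ((b - x)%:C * h' x).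
  rewrite subrK normcM normc_real bE; move: rb hx xb; clear; move=> *; nra.
have ua : nc (h a - h x) <= (x - a) * g' x + e / 4 * (x - a).
  have := ler_normcD (h a - h x - (a - x)%:C * h' x) ((a - x)%:C * h' x).
  rewrite subrK normcM normc_real aE; move: ra hx ax; clear; move=> *; nra.
have := ler_normc_dist (h b) (h x) (h a); rewrite [nc (h x - _)]normc_distC.
move: qa qb; rewrite !ler_norml => /andP[qa1 qa2] /andP[qb1 qb2]. rewrite /P; have : 0 <= e * (b - a) by apply: mulr_ge0; nlra. nlra.
Qed.
Lemma rd_mvt h h' (K : R) : (forall s, in01 s -> rd h s (h' s)) ->
  (forall s, in01 s -> nc (h' s) <= K) -> nc (h 1 - h 0) <= K.
move=> dh hK. have := @comparison h h' (fun s => K * s) (fun=> K) dh _ hK.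
rewrite mulr1 mulr0 subr0; apply => s _ e e0; exists 1 => // t _ _. rewrite (_ : _ - _ = 0) ?normr0 ?mulr_ge0 ?normr_ge0 ?(ltW e0) //; ring.
Qed.
Lemma cd_mvt f f' a b (K : R) :
    (forall s, in01 s -> cd f (seg a b s) (f' (seg a b s))) ->
    (forall s, in01 s -> nc (f' (seg a b s)) <= K) ->
  nc (f b - f a) <= K * nc (b - a).
move=> df fK; have := @rd_mvt (fun t => f (seg a b t)) (fun t => f' (seg a b t) * (b - a)).
rewrite seg0 seg1; apply => s s01; first exact/rd_seg/df. by rewrite normcM ler_wpM2r // fK.
Qed.
Lemma rd_Re_ge h h' (m : R) : (forall s, in01 s -> rd h s (h' s)) ->
  (forall s, in01 s -> m <= Re (h' s)) -> m <= Re (h 1 - h 0).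
move=> dh hm; apply/ler_addgt0Pr => e e0. pose P (a b : R) : Prop := m * (b - a) <= Re (h b - h a) + e * (b - a).
suff : P 0 1 by rewrite /P !subr0 !mulr1. apply: cousin.
  rewrite /P => a b c _ _ _ _; rewrite !ReB; nra.
move=> x x01; have e4 : 0 < e by lra. have [r r0 Hr] := dh _ x01 _ e4. exists r => // a b a0 ax xb b1 lr.
have a01 : in01 a by apply/andP; split; lra. have b01 : in01 b by apply/andP; split; lra.
have aE : `|a - x| = x - a by rewrite ler0_norm; lra. have bE : `|b - x| = b - x by rewrite ger0_norm; lra.
have := Hr _ a01; have := Hr _ b01. rewrite aE bE => /(_ ltac:(lra)) rb /(_ ltac:(lra)) ra.
have := le_trans (ler_Re_normc _) rb; have := le_trans (ler_Re_normc _) ra. rewrite /P !ReB !Re_realM !ler_norml => /andP[? ?] /andP[? ?].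
have := hm _ x01; nra.
Qed.
End MeanValue.

(** * Antiderivatives of continuous functions on [0, 1] *)

Section Antiderivative.
Context {R : realType}.
Local Notation C := R[i].
Lemma real_antiderivative (g : R -> R) :
    (forall s, in01 s -> forall e : R, 0 < e -> somepos r, forall t, in01 t -> `|t - s| < r -> `|g t - g s| < e) ->
  exists G : R -> R, forall s, in01 s -> forall e : R, 0 < e ->
    somepos r, forall t, in01 t -> `|t - s| < r ->
      `|G t - G s - (t - s) * g s| <= e * `|t - s|.
(* [cl] is the 1-Lipschitz retraction of the line onto [0, 1]. Composing with it extends [g]
   continuously past both end points, so that the fundamental theorem applies at 0 and 1 too. *)
move=> cg; pose cl (x : R) := (1 + `|x| - `|1 - x|) / 2. have cl01 x : in01 (cl x).
  have := ler_normB 1 x; have := ler_normB 1 (1 - x). by rewrite subKr normr1 /in01 /cl => h1 h2; apply/andP; split; lra.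
have clE x : in01 x -> cl x = x.
  by move=> /andP[x0 x1]; rewrite /cl !ger0_norm ?subr_ge0 //; lra.
have cl_lip x y : `|cl x - cl y| <= `|x - y|.
  have := ler_dist_dist x y; have := ler_dist_dist (1 - x) (1 - y). rewrite (_ : 1 - x - (1 - y) = - (x - y)) ?normrN; last by ring.
  by rewrite /cl !ler_norml => /andP[a1 a2] /andP[b1 b2]; apply/andP; split; lra.
pose k x := g (cl x). have ck : continuous k.
  move=> x; apply/cvgrPdist_lt => e e0. have [r r0 Hr] := cg _ (cl01 x) _ e0. near=> t; rewrite distrC; apply: Hr => //.
  apply: le_lt_trans (cl_lip _ _) _; rewrite distrC. near: t; exact: cvgr_dist_lt.
have ki : (@lebesgue_measure R).-integrable [set` Interval (BLeft (-1)) (BRight (2:R))] (EFin \o k).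
  apply: continuous_compact_integrable; first exact: segment_compact. by apply: continuous_subspaceT => x; exact: ck.
pose F x := (\int[@lebesgue_measure R]_(t in [set` Interval (BLeft (-1)) (BRight x)]) (k t))%R. exists F => s s01 e e0.
have s2 : s < 2 by case/andP: s01; lra. have [|dF FE] := @continuous_FTC1 R k (BLeft (-1)) s 2 s2 ki _ (ck s).
  by case/andP: s01 => ? ?; rewrite /Order.lt /=; lra.
have kE : k s = g s by rewrite /k clE. have := dF; rewrite /derivable => /cvg_ex[l /= Hl]. have lE : l = g s.
  rewrite -kE -FE derive1E /derive; apply/esym/cvg_lim => //.
move: Hl; rewrite lE => /cvgrPdist_le /(_ _ e0). rewrite /dnbhs near_withinE => /nbhs_ballP[r /= r0 Hr]. exists r => // t _ tr.
have [->|ts] := eqVneq t s; first by rewrite !subrr mul0r subr0 normr0 mulr0. have ts0 : t - s != 0 by rewrite subr_eq0.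
have := Hr (t - s); rewrite /ball /= sub0r normrN => /(_ tr ts0). rewrite scaler1 subrK /= => h.
have -> : F t - F s - (t - s) * g s = - (t - s) * (g s - (t - s)^-1 * (F t - F s)).
  by field.
rewrite normrM normrN mulrC ler_pM2r ?normr_gt0 //. Unshelve. all: by end_near.
Qed.
Lemma antiderivative (h : R -> C) : (forall s, in01 s -> rcts h s) ->
  exists H : R -> C, forall s, in01 s -> rd H s (h s).
move=> ch. have [|A HA] := @real_antiderivative (fun s => Re (h s)).
  move=> s s01 e e0; have [r r0 Hr] := ch _ s01 _ e0; exists r => // t t01 tr.
  by rewrite -ReB; apply: le_lt_trans (ler_Re_normc _) _; exact: Hr.
have [|B HB] := @real_antiderivative (fun s => Im (h s)).
  move=> s s01 e e0; have [r r0 Hr] := ch _ s01 _ e0; exists r => // t t01 tr.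
  by rewrite -ImB; apply: le_lt_trans (ler_Im_normc _) _; exact: Hr.
exists (fun s => A s +i* B s) => s s01 e e0; have e2 : 0 < e / 2 by lra. have [r r0 Hr] := HA _ s01 _ e2; have [q q0 Hq] := HB _ s01 _ e2.
exists (minr r q); first by pos. move=> t t01 /lt_minP[/(Hr _ t01) h1 /(Hq _ t01) h2]. apply: le_trans (ler_normc_ReIm _) _.
rewrite !ReB !ImB Re_realM Im_realM /=; lra.
Qed.
End Antiderivative.

(** * Integrals along segments, Goursat's theorem, primitives *)

Section PathIntegral.
Context {R : realType}.
Local Notation C := R[i].
Implicit Types (f g F : C -> C) (a b c z w : C).
(** The integral over [0, 1], as the increment of a chosen antiderivative; [i01E] shows that the
    choice does not matter. The value 0 is a default for integrands without an antiderivative. *)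
Definition i01 (h : R -> C) : C :=
  if pselect (exists H : R -> C, forall s, in01 s -> rd H s (h s)) is left p
  then projT1 (cid p) 1 - projT1 (cid p) 0 else 0.
Lemma rdB (h k : R -> C) s d e : rd h s d -> rd k s e ->
  rd (fun t => h t - k t) s (d - e).
move=> H1 /(rdZ (-1)) H2; have := rdD H1 H2; rewrite mulN1r. by apply: rd_ext => t; rewrite mulN1r.
Qed.
Lemma i01E (h H : R -> C) : (forall s, in01 s -> rd H s (h s)) ->
  i01 h = H 1 - H 0.
move=> dH; rewrite /i01; case: pselect => [p|[]]; last by exists H. case: (cid p) => G dG /=; apply/eqP; rewrite -subr_eq0 -normc_eq0.
rewrite eq_le normc_ge0 andbT. have := @rd_mvt _ (fun t => G t - H t) (fun s => h s - h s) 0.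
rewrite (_ : G 1 - G 0 - (H 1 - H 0) = G 1 - H 1 - (G 0 - H 0)); last by ring.
by apply => s s01; [apply: rdB; [exact: dG|exact: dH]|rewrite subrr normc0].
Qed.
Definition cint f a b : C := (b - a) * i01 (fun s => f (seg a b s)).
Definition ctseg f a b := forall s, in01 s -> cts f (seg a b s).
Lemma cint_prim f a b : ctseg f a b -> exists2 H : R -> C,
  forall s, in01 s -> rd H s (f (seg a b s)) & cint f a b = (b - a) * (H 1 - H 0).
move=> cf; have [|H dH] := @antiderivative R (fun s => f (seg a b s)).
  by move=> s s01; exact/rcts_seg/cf.
by exists H => //; rewrite /cint (i01E dH).
Qed.
Lemma cintE f a b (H : R -> C) : (forall s, in01 s -> rd H s (f (seg a b s))) ->
  cint f a b = (b - a) * (H 1 - H 0).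
by move=> dH; rewrite /cint (i01E dH). Qed.
 Lemma cint_eq f g a b : ctseg f a b -> (forall s, in01 s -> f (seg a b s) = g (seg a b s)) -> cint f a b = cint g a b.
move=> /cint_prim[H dH ->] fg; apply/esym/cintE => s s01; rewrite -fg //; exact: dH.
Qed.
Lemma ctsegD f g a b : ctseg f a b -> ctseg g a b -> ctseg (fun w => f w + g w) a b.
by move=> cf cg s s01; apply: ctsD; [exact: cf|exact: cg]. Qed.
 Lemma ctsegM f g a b : ctseg f a b -> ctseg g a b -> ctseg (fun w => f w * g w) a b.
by move=> cf cg s s01; apply: ctsM; [exact: cf|exact: cg]. Qed.
 Lemma ctseg_cst (k : C) a b : ctseg (fun=> k) a b.
by move=> s _; exact: cts_cst. Qed.
 Lemma cintD f g a b : ctseg f a b -> ctseg g a b -> cint (fun w => f w + g w) a b = cint f a b + cint g a b.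
move=> /cint_prim[H dH ->] /cint_prim[G dG ->]. rewrite (@cintE _ a b (fun s => H s + G s)); first by ring.
by move=> s s01; apply: rdD; [exact: dH|exact: dG].
Qed.
Lemma cintZ f a b (k : C) : ctseg f a b -> cint (fun w => k * f w) a b = k * cint f a b.
move=> /cint_prim[H dH ->]; rewrite (@cintE _ a b (fun s => k * H s)); first by ring. by move=> s s01; apply: rdZ; exact: dH.
Qed.
Lemma cintB f g a b : ctseg f a b -> ctseg g a b ->
  cint (fun w => f w - g w) a b = cint f a b - cint g a b.
move=> /cint_prim[H dH ->] /cint_prim[G dG ->]. rewrite (@cintE _ a b (fun s => H s - G s)); first by ring.
by move=> s s01; apply: rdB; [exact: dH|exact: dG].
Qed.
Lemma cint_le f a b (K : R) : ctseg f a b ->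
  (forall s, in01 s -> nc (f (seg a b s)) <= K) ->
  nc (cint f a b) <= K * nc (b - a).
move=> /cint_prim[H dH ->] fK; rewrite normcM mulrC ler_wpM2r //. exact: rd_mvt dH fK.
Qed.
Lemma cint_FTC f F a b : (forall s, in01 s -> cd F (seg a b s) (f (seg a b s))) ->
  cint f a b = F b - F a.
move=> dF; have [->|ab] := eqVneq a b; first by rewrite /cint !subrr mul0r. have ba : b - a != 0 by rewrite subr_eq0 eq_sym.
rewrite (@cintE f a b (fun s => (b - a)^-1 * F (seg a b s))).
  by rewrite seg0 seg1; field.
move=> s s01; have := rdZ (b - a)^-1 (rd_seg (dF s s01)). by rewrite mulrCA mulVf // mulr1.
Qed.
Lemma rd_affine (H : R -> C) (c d : R) s v :
    (forall t, in01 t -> in01 (c * t + d)) -> rd H (c * s + d) v ->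
  rd (fun t => H (c * t + d)) s (c%:C * v).
move=> c01 dH e e0; have n0 := normr_ge0 c; have k0 : 0 < `|c| + 1 by lra. have [r r0 Hr] := dH _ (divr_gt0 e0 k0).
exists (r / (`|c| + 1)); first exact: divr_gt0. move=> t t01; rewrite ltr_pdivlMr // => tr.
have E : c * t + d - (c * s + d) = c * (t - s) by ring. have p0 := normr_ge0 (t - s).
have := Hr _ (c01 _ t01); rewrite E normrM => /(_ ltac:(nra)) h. rewrite rmorphM /= in h.
rewrite (_ : (t - s)%:C * (c%:C * v) = c%:C * (t - s)%:C * v); last by ring. apply: le_trans h _; rewrite mulrAC ler_pdivrMr //.
have := mulr_ge0 (ltW e0) p0; nra.
Qed.
Definition mid a b : C := (a + b) / 2.
Lemma cint_mid f a b : ctseg f a b ->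
  cint f a b = cint f a (mid a b) + cint f (mid a b) b.
move=> /cint_prim[H dH ->]. have h2 : (2^-1 : R)%:C = (2 : C)^-1 by rewrite fmorphV /= rmorph_nat.
have n2 : (2 : C) != 0 by rewrite pnatr_eq0. rewrite (@cintE f a _ (fun s => 2 * H (2^-1 * s + 0))).
  rewrite (@cintE f _ b (fun s => 2 * H (2^-1 * s + 2^-1))).
    rewrite !mulr1 !mulr0 !addr0 !add0r (_ : 2^-1 + 2^-1 = 1 :> R); last by lra. by rewrite /mid; field.
  move=> s /andP[s0 s1]; have := @rd_affine H 2^-1 2^-1 s (f (seg (mid a b) b s)).
  move=> /(_ _ _)/(rdZ 2); rewrite h2 mulrA divff // mul1r; apply.
    by move=> t /andP[t0 t1]; apply/andP; split; lra.
  have -> : seg (mid a b) b s = seg a b (2^-1 * s + 2^-1).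
    by rewrite /seg /mid rmorphD rmorphM /= h2; field.
  by apply: dH; apply/andP; split; lra.
move=> s /andP[s0 s1]; have := @rd_affine H 2^-1 0 s (f (seg a (mid a b) s)).
move=> /(_ _ _)/(rdZ 2); rewrite h2 mulrA divff // mul1r; apply.
  by move=> t /andP[t0 t1]; apply/andP; split; lra.
have -> : seg a (mid a b) s = seg a b (2^-1 * s + 0).
  by rewrite /seg /mid addr0 rmorphM /= h2; field.
by apply: dH; apply/andP; split; lra.
Qed.
Lemma cint_rev f a b : ctseg f a b -> cint f b a = - cint f a b.
move=> /cint_prim[H dH ->]. rewrite (@cintE f b a (fun s => (-1) * H ((-1) * s + 1))).
  by rewrite mulr0 mulr1 add0r addNr; ring.
move=> s /andP[s0 s1]; have := @rd_affine H (-1) 1 s (f (seg b a s)).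
move=> /(_ _ _)/(rdZ (-1)); rewrite rmorphN rmorph1 /= mulrA mulrNN !mul1r; apply.
  by move=> t /andP[t0 t1]; apply/andP; split; lra.
have -> : seg b a s = seg a b (-1 * s + 1).
  by rewrite /seg rmorphD rmorphM rmorphN rmorph1 /=; ring.
by apply: dH; apply/andP; split; lra.
Qed.
Definition cvx (D : C -> Prop) := forall a b s, D a -> D b -> in01 s -> D (seg a b s).
Definition op (D : C -> Prop) := forall z, D z -> somepos r, forall w, nc (w - z) < r -> D w.
Definition hol f (D : C -> Prop) := forall z, D z -> exists d, cd f z d.
Lemma hol_cts f D : hol f D -> forall z, D z -> cts f z.
by move=> hf z /hf[d /cd_cts]. Qed.
 Definition tri f a b c := cint f a b + cint f b c + cint f c a.
 Section Goursat.
Variables (D : C -> Prop) (f : C -> C). Hypotheses (cD : cvx D) (cf : forall z, D z -> cts f z).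
 Lemma ctsegD_ a b : D a -> D b -> ctseg f a b.
by move=> Da Db s s01; apply: cf; exact: cD. Qed.
 Lemma cvx_mid a b : D a -> D b -> D (mid a b).
move=> Da Db; have := cD Da Db (_ : in01 2^-1); rewrite /seg fmorphV rmorph_nat /=.
have -> : a + 2^-1 * (b - a) = mid a b by rewrite /mid; field. by apply; apply/andP; split; lra.
Qed.
Lemma tri_split a b c : D a -> D b -> D c ->
  tri f a b c = tri f a (mid a b) (mid c a) + tri f (mid a b) b (mid b c)
    + tri f (mid c a) (mid b c) c + tri f (mid b c) (mid c a) (mid a b).
move=> Da Db Dc; rewrite /tri. have Dab := cvx_mid Da Db; have Dbc := cvx_mid Db Dc; have Dca := cvx_mid Dc Da.
rewrite (cint_mid (ctsegD_ Da Db)) (cint_mid (ctsegD_ Db Dc)) (cint_mid (ctsegD_ Dc Da)).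
rewrite (cint_rev (ctsegD_ Dca Dab)) (cint_rev (ctsegD_ Dab Dbc)). rewrite (cint_rev (ctsegD_ Dbc Dca)) ; ring.
Qed.
End Goursat.
Lemma segB_le a b z s : in01 s ->
  nc (seg a b s - z) <= (1 - s) * nc (a - z) + s * nc (b - z).
move=> /andP[s0 s1]. have -> : seg a b s - z = (1 - s)%:C * (a - z) + s%:C * (b - z).
  by rewrite /seg rmorphB rmorph1; ring.
apply: le_trans (ler_normcD _ _) _; rewrite !normcM !normc_real !ger0_norm //. by rewrite subr_ge0.
Qed.
Lemma segB_lt a b z s (r : R) : in01 s -> nc (a - z) < r -> nc (b - z) < r ->
  nc (seg a b s - z) < r.
move=> s01 ha hb; apply: le_lt_trans (segB_le _ _ _ s01) _. move: s01 => /andP[s0 s1]; have [s1'|s1'] := ltrP s 1.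
  have : (1 - s) * nc (a - z) < (1 - s) * r by rewrite ltr_pM2l // subr_gt0. have : s * nc (b - z) <= s * r by rewrite ler_wpM2l // ltW.
  lra.
have -> : s = 1 by lra. by rewrite subrr mul0r add0r mul1r.
Qed.
(** Goursat's subdivision: one of the four medial triangles keeps a quarter of the integral while
    the sides are halved. Near the limit point [f] is affine up to a small multiple of the distance,
    and affine functions have primitives. *)
Lemma goursat_tri D f p u v : cvx D -> hol f D -> D p -> D (p + u) -> D (p + v) ->
  tri f p (p + u) (p + v) = 0.
move=> cD hf Dp Du Dv; have cf := hol_cts hf. have n2 : (2 : C) != 0 by rewrite pnatr_eq0.
have h2 : (2^-1 : R)%:C = (2 : C)^-1 by rewrite fmorphV /= rmorph_nat. pose pt (x : R * R) := p + x.1%:C * u + x.2%:C * v.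
pose sx (x : R * R) := [/\ 0 <= x.1, 0 <= x.2 & x.1 + x.2 <= 1]. have Dpt x : sx x -> D (pt x).
  case: x => a b [/= a0 b0 ab]; have [e0|ne0] := eqVneq (a + b) 0.
    have [-> ->] : a = 0 /\ b = 0 by split; lra. by rewrite /pt /= !mul0r !addr0.
  have s0 : 0 < a + b by rewrite lt_def ne0 addr_ge0. have b01 : in01 (b / (a + b)).
    by rewrite /in01 divr_ge0 ?(ltW s0) //= ler_pdivrMr // mul1r; lra.
  have := cD _ _ (a + b) Dp (cD _ _ _ Du Dv b01). have -> : seg p (seg (p + u) (p + v) (b / (a + b))) (a + b) = pt (a, b).
    have ne1 : a%:C + b%:C != 0 by rewrite -rmorphD /= fmorph_eq0. by rewrite /seg /pt /= rmorphM fmorphV /= rmorphD /=; field.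
  by apply; apply/andP; split; lra.
(* A state ((a, b), h) is the triangle with corner (a, b) and legs h in the affine coordinates of p
   + a u + b v; h becomes negative for the central triangle, which is turned upside down. Nested
   triangles thus become convergent real sequences. *)
pose st := ((R * R) * R)%type. pose tr (x : st) := tri f (pt x.1) (pt (x.1.1 + x.2, x.1.2)) (pt (x.1.1, x.1.2 + x.2)).
pose c1 (x : st) : st := (x.1, x.2 / 2). pose c2 (x : st) : st := ((x.1.1 + x.2 / 2, x.1.2), x.2 / 2).
pose c3 (x : st) : st := ((x.1.1, x.1.2 + x.2 / 2), x.2 / 2). pose c4 (x : st) : st := ((x.1.1 + x.2 / 2, x.1.2 + x.2 / 2), - (x.2 / 2)).
pose good (x : st) := [/\ sx x.1, sx (x.1.1 + x.2, x.1.2) & sx (x.1.1, x.1.2 + x.2)]. pose big (x y : st) := nc (tr x) <= 4 * nc (tr y).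
pose step x := if big x (c1 x) then c1 x else if big x (c2 x) then c2 x else if big x (c3 x) then c3 x else c4 x.
have trE x : good x -> tr x = tr (c1 x) + tr (c2 x) + tr (c3 x) + tr (c4 x).
  case: x => [[a b] h] [/Dpt g1 /Dpt g2 /Dpt g3]; rewrite /tr /= in g1 g2 g3 *. rewrite (tri_split cD cf g1 g2 g3).
  have E1 : mid (pt (a, b)) (pt (a + h, b)) = pt (a + h / 2, b).
    by rewrite /mid /pt /= !rmorphD rmorphM /= h2; field.
  have E2 : mid (pt (a, b + h)) (pt (a, b)) = pt (a, b + h / 2).
    by rewrite /mid /pt /= !rmorphD rmorphM /= h2; field.
  have E3 : mid (pt (a + h, b)) (pt (a, b + h)) = pt (a + h / 2, b + h / 2).
    by rewrite /mid /pt /= !rmorphD rmorphM /= h2; field.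
  have e : h / 2 + h / 2 = h by lra. by rewrite E1 E2 E3 -!addrA !subrr !addr0 e.
have stepP x : good x -> big x (step x).
  move=> gx; rewrite /step; case: ifPn => // /negP n1; case: ifPn => // /negP n2'.
  case: ifPn => // /negP n3; move: n1 n2' n3; rewrite /big => /negP; rewrite -ltNge => l1.
  move=> /negP; rewrite -ltNge => l2 /negP; rewrite -ltNge => l3. have := trE _ gx => E.
  have := ler_normcD (tr (c1 x) + tr (c2 x) + tr (c3 x)) (tr (c4 x)). have := ler_normcD (tr (c1 x) + tr (c2 x)) (tr (c3 x)).
  have := ler_normcD (tr (c1 x)) (tr (c2 x)). rewrite -E; nlra.
have stepG x : good x -> good (step x).
  case: x => [[a b] h] [[/= g1 g2 g3] [/= g4 g5 g6] [/= g7 g8 g9]].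
  by rewrite /step; do 3?case: ifPn => _; split; split; rewrite /=; move: g1 g2 g3 g4 g5 g6 g7 g8 g9; clear; lra.
have step2 x : `|(step x).2| = `|x.2| / 2.
  rewrite /step; do 3?case: ifPn => _; rewrite /= ?normrN normrM normfV; by rewrite [`|2|]ger0_norm.
have step1 x : `|(step x).1.1 - x.1.1| <= `|x.2| / 2 /\ `|(step x).1.2 - x.1.2| <= `|x.2| / 2.
  have E : `|x.2 / 2| = `|x.2| / 2 by rewrite normrM normfV [`|2|]ger0_norm. have z0 := normr_ge0 x.2.
  by rewrite /step; do 3?case: ifPn => _; split => /=; rewrite ?subrr ?normr0 1?addrAC ?subrr ?add0r ?E //; lra.
pose s n := iter n step ((0, 0), 1). have sG n : good (s n).
  elim: n => [|n IH]; last exact: stepG. by split; split => /=; lra.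
have sh n : `|(s n).2| = 1 / 2 ^+ n.
  elim: n => [|n IH]; first by rewrite /= expr0 divr1 normr1. by rewrite /= step2 IH exprSr invfM mulrA.
have sbig n : nc (tr (s 0%N)) <= 4 ^+ n * nc (tr (s n)).
  elim: n => [|n IH]; first by rewrite expr0 mul1r. apply: le_trans IH _; rewrite exprSr -mulrA ler_wpM2l ?exprn_ge0 //. exact: stepP.
have s0E : tr (s 0%N) = tri f p (p + u) (p + v).
  by rewrite /tr /pt /= !add0r !mul0r !mul1r !addr0.
have [A HA] := @geometric_limit R (fun n => (s n).1.1) 1 (fun n => ltac:(rewrite exprSr invfM mulrA -sh; exact: (step1 _).1)).
have [B HB] := @geometric_limit R (fun n => (s n).1.2) 1 (fun n => ltac:(rewrite exprSr invfM mulrA -sh; exact: (step1 _).2)).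
have lim0 (x : R) : (forall n : nat, - (4 / 2 ^+ n) <= x) -> 0 <= x.
  move=> hx; rewrite leNgt; apply/negP => x0. have [|n hn] := @half_pow_small R 4 (- x); first lra. by have := hx n; lra.
have zs : sx (A, B).
  have bnd n : [/\ - (4 / 2 ^+ n) <= A, - (4 / 2 ^+ n) <= B &
      - (4 / 2 ^+ n) <= 1 - (A + B)].
    have := HA n; have := HB n; have [[/= g1 g2 g3] _ _] := sG n. have q0 : 0 <= 1 / (2 : R) ^+ n by pos.
    rewrite !ler_norml !mulr1 => /andP[a1 a2] /andP[b1 b2]. have e4 : 4 / 2 ^+ n = 4 * (1 / 2 ^+ n) :> R by rewrite mul1r.
    have e2 : 2 / 2 ^+ n = 2 * (1 / 2 ^+ n) :> R by rewrite mul1r. by split; nlra.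
  split => /=; last (rewrite -subr_ge0); apply: lim0 => n; by have [] := bnd n.
pose z := pt (A, B); have Dz : D z := Dpt _ zs. have [d /cdP fd] := hf z Dz. apply/eqP; rewrite -normc_eq0 eq_le normc_ge0 andbT -s0E.
pose S := nc u + nc v. have u0 := normc_ge0 u; have v0 := normc_ge0 v; have S0 : 0 <= S by pos. apply/ler_addgt0Pr => e e0; rewrite add0r.
(* The 9 collects three sides of length at most S h, with points at distance at most 3 S h from z;
   the factor 4 ^ n h ^ 2 is 1. The added 1 covers degenerate triangles. *)
have k0 : 0 < 9 * (S * S) + 1 by nra. have [r r0 Hr] := fd _ (divr_gt0 e0 k0). have [n hn] := @half_pow_small R (3 * S) r r0.
apply: le_trans (sbig n) _. set h := 1 / (2 : R) ^+ n; have h0 : 0 <= h by pos. have hS : 3 * S * h < r by rewrite /h mul1r.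
have ptz (x : R * R) : `|x.1 - A| <= 3 * h -> `|x.2 - B| <= 3 * h -> nc (pt x - z) <= 3 * S * h.
  move=> h1 h2'; have -> : pt x - z = (x.1 - A)%:C * u + (x.2 - B)%:C * v.
    by rewrite /z /pt /= !rmorphB /=; ring.
  apply: le_trans (ler_normcD _ _) _; rewrite !normcM !normc_real /S; nra.
have hA' : `|(s n).1.1 - A| <= 2 * h by have := HA n; rewrite mulr1 /h mul1r.
have hB' : `|(s n).1.2 - B| <= 2 * h by have := HB n; rewrite mulr1 /h mul1r. have hh : `|(s n).2| = h by rewrite sh.
have [/Dpt D1 /Dpt D2 /Dpt D3] := sG n. set P1 := pt (s n).1 in D1; set P2 := pt _ in D2; set P3 := pt _ in D3.
have shift (x y k : R) : `|x - y| <= 2 * h -> `|k| = h -> `|x + k - y| <= 3 * h.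
  by move=> ? ?; rewrite addrAC; apply: le_trans (ler_normD _ _) _; lra.
have P1z : nc (P1 - z) <= 3 * S * h by apply: ptz; nlra. have P2z : nc (P2 - z) <= 3 * S * h by apply: ptz => /=; [exact: shift|nlra].
have P3z : nc (P3 - z) <= 3 * S * h by apply: ptz => /=; [nlra|exact: shift]. have side a b : D a -> D b -> nc (a - z) <= 3 * S * h ->
    nc (b - z) <= 3 * S * h -> nc (b - a) <= S * h -> exists2 E, cint f a b = (f z * b + d / 2 * (b - z) ^+ 2) -
      (f z * a + d / 2 * (a - z) ^+ 2) + E & nc E <= (e / (9 * (S * S) + 1)) * (3 * S * h) * (S * h).
  move=> Da Db az bz ab. pose g w := f w - (f z + d * (w - z)). have cl : forall w, cts (fun w => f z + d * (w - z)) w.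
    move=> w; apply: ctsD; first exact: cts_cst. by apply: ctsM; [exact: cts_cst|apply: ctsB; [exact: cts_id|exact: cts_cst]].
  have cfs := ctsegD_ cD cf Da Db. exists (cint g a b).
    rewrite /g cintB // (@cint_FTC (fun w => f z + d * (w - z)) (fun w => f z * w + d / 2 * (w - z) ^+ 2)); first by ring.
    move=> t _; set w := seg a b t. apply: cd_ext (cdD (cdZ (f z) (cd_id w)) (cdZ (d / 2) (cdX 2 (cdB (cd_id w) (cd_cst z w))))) => //.
    by rewrite subr0 !mulr1 /= expr1; field.
  have gK : forall t, in01 t -> nc (g (seg a b t)) <= e / (9 * (S * S) + 1) * (3 * S * h).
    move=> t t01; have lt1 : nc (seg a b t - z) <= 3 * S * h.
      apply: le_trans (segB_le _ _ _ t01) _; move: t01 => /andP[+ +]; move: az bz; clear; move=> *; nra.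
    have := Hr _ (le_lt_trans lt1 hS). rewrite (_ : f _ - f z - _ = g (seg a b t)); last by rewrite /g; ring.
    move=> h1; apply: le_trans h1 _. by rewrite ler_wpM2l // divr_ge0 ?ltW.
  apply: le_trans (cint_le (ctsegD cfs (fun t t01 => ctsN (cl _))) gK) _. rewrite ler_wpM2l // mulr_ge0 //; first by pos. by pos.
have d12 : nc (P2 - P1) <= S * h.
  have -> : P2 - P1 = (s n).2%:C * u by rewrite /P1 /P2 /pt /= rmorphD /=; ring.
  by rewrite normcM normc_real hh /S; move: u0 v0 h0; clear; move=> *; nra.
have d23 : nc (P3 - P2) <= S * h.
  have -> : P3 - P2 = (s n).2%:C * (v - u) by rewrite /P3 /P2 /pt /= !rmorphD /=; ring.
  by rewrite normcM normc_real hh /S mulrC ler_wpM2r // [leRHS]addrC; exact: ler_normcB.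
have d31 : nc (P1 - P3) <= S * h.
  have -> : P1 - P3 = (s n).2%:C * (- v) by rewrite /P1 /P3 /pt /= rmorphD /=; ring.
  by rewrite normcM normc_real hh normcN /S; move: u0 v0 h0; clear; move=> *; nra.
have [E1 e1 n1] := side _ _ D1 D2 P1z P2z d12. have [E2 e2 n2'] := side _ _ D2 D3 P2z P3z d23.
have [E3 e3 n3] := side _ _ D3 D1 P3z P1z d31. have trs : tr (s n) = E1 + E2 + E3.
  by rewrite /tr /tri -/P1 -/P2 -/P3 e1 e2 e3; ring.
have nt : nc (tr (s n)) <= 3 * ((e / (9 * (S * S) + 1)) * (3 * S * h) * (S * h)).
  rewrite trs; have := ler_normcD (E1 + E2) E3; have := ler_normcD E1 E2; lra.
have hh4 : 4 ^+ n * (h * h) = 1 :> R.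
  rewrite /h (_ : 4 = 2 * 2 :> R) ?exprMn; last by ring. by rewrite !mul1r mulrACA divff ?expf_neq0 ?pnatr_eq0 // mulr1.
apply: le_trans (ler_wpM2l (exprn_ge0 _ _) nt) _ => //. have -> : 4 ^+ n * (3 * (e / (9 * (S * S) + 1) * (3 * S * h) * (S * h))) =
  (e / (9 * (S * S) + 1)) * (9 * (S * S)) * (4 ^+ n * (h * h)) :> R by ring.
rewrite hh4 mulr1 mulrAC ler_pdivrMr //; move: e0; clear; move=> *; nra.
Qed.
Lemma goursat D f a b c : cvx D -> hol f D -> D a -> D b -> D c -> tri f a b c = 0.
move=> cD hf Da Db Dc. have := @goursat_tri D f a (b - a) (c - a) cD hf Da. by rewrite ![a + _]addrC !subrK; exact.
Qed.
(** By Goursat the increment of the integral between z and w is the integral over the short segment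
    from z to w, on which [f] is close to [f z]. *)
Lemma primitive_cint D f z0 : cvx D -> op D -> hol f D -> D z0 ->
  forall z, D z -> cd (cint f z0) z (f z).
move=> cD oD hf D0 z Dz; have cf := hol_cts hf; apply/cdP => e e0. have [r1 r10 H1] := cf _ Dz _ e0; have [r2 r20 H2] := oD _ Dz.
exists (minr r1 r2); first by pos. move=> w /lt_minP[w1 w2]; have Dw := H2 _ w2. have := goursat cD hf D0 Dz Dw; rewrite /tri.
rewrite (cint_rev (ctsegD_ cD cf D0 Dw)) => /eqP; rewrite subr_eq0 => /eqP <-. rewrite [cint f z0 z + _]addrC addrK.
have <- : cint (fun=> f z) z w = f z * (w - z).
  rewrite (@cint_FTC _ (fun w => f z * w)); first by ring. by move=> s _; apply: cd_ext (cdZ (f z) (cd_id _)) => //; rewrite mulr1.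
have cs := ctsegD_ cD cf Dz Dw. rewrite -cintB //; last exact: ctseg_cst.
apply: cint_le => [s s01|s s01]; first by apply: ctsB; [exact: cs|exact: cts_cst].
apply/ltW/H1; apply: segB_lt => //; by rewrite subrr normc0.
Qed.
Lemma primitive D f : cvx D -> op D -> hol f D ->
  exists F, forall z, D z -> cd F z (f z).
move=> cD oD hf; have [[z0 D0]|nD] := pselect (exists z, D z); last first.
  by exists id => z Dz; case: nD; exists z.
by exists (cint f z0); exact: primitive_cint.
Qed.
End PathIntegral.

(** * Cauchy's formula on a square and bounds for derivatives *)

Section Cauchy.
Context {R : realType}.
Local Notation C := R[i].
Implicit Types (f g F : C -> C) (a b z w zeta : C).
Lemma cts_unif f a b (e : R) : ctseg f a b -> 0 < e -> somepos r, forall s, in01 s -> forall w, nc (w - seg a b s) < r ->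
    nc (f w - f (seg a b s)) < e.
move=> cf e0; pose P (p q : R) : Prop := somepos r, forall s, in01 s -> p <= s <= q -> forall w, nc (w - seg a b s) < r ->
    nc (f w - f (seg a b s)) < e.
suff [r r0 Hr] : P 0 1 by exists r => // s s01; apply: Hr. apply: cousin => [p q t _ pq qt _ [r r0 Hr] [r' r'0 Hr']|x x01].
  exists (minr r r'); first by pos. move=> s s01 /andP[ps st] w; rewrite lt_min => /andP[wr wr'].
  by have [sq|qs] := leP s q; [apply: Hr => //; rewrite ps|apply: Hr' => //; rewrite st ltW].
have e2 : 0 < e / 2 by lra. have [d d0 Hd] := cf _ x01 _ e2; have d2 : 0 < d / 2 by lra. have [q q0 Hq] := seg_near a b x d2.
exists q => // p t p0 px xt t1 tp; exists (d / 2) => // s s01 /andP[ps st] w ws. have sx : nc (seg a b s - seg a b x) < d / 2.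
  by apply: Hq; rewrite ltr_norml; apply/andP; split; lra.
have h1 := Hd _ (_ : nc (seg a b s - seg a b x) < d). have h2 := Hd w; have := ler_normc_dist w (seg a b s) (seg a b x).
have := ler_normc_dist (f w) (f (seg a b x)) (f (seg a b s)). rewrite [nc (f (seg a b x) - _)]normc_distC => h3 h4.
have := h1 ltac:(lra); have := h2 ltac:(lra); lra.
Qed.
Lemma cts_bdd f a b : ctseg f a b -> exists K : R,
  forall s, in01 s -> nc (f (seg a b s)) <= K.
move=> cf; pose P (p q : R) : Prop := exists K : R, forall s, in01 s -> p <= s <= q -> nc (f (seg a b s)) <= K.
suff [K HK] : P 0 1 by exists K => s s01; apply: HK. apply: cousin => [p q t _ pq qt _ [K HK] [L HL]|x x01].
  exists (Num.max K L) => s s01 /andP[ps st]; rewrite le_max. by have [sq|qs] := leP s q; [rewrite HK ?ps|rewrite HL ?orbT // st ltW].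
have [d d0 Hd] := cf _ x01 _ ltr01; have [q q0 Hq] := seg_near a b x d0. exists q => // p t p0 px xt t1 tp; exists (nc (f (seg a b x)) + 1).
move=> s s01 /andP[ps st]; have := lerB_normc (f (seg a b s)) (f (seg a b x)).
have := Hd (seg a b s) (Hq s _); rewrite ltr_norml => /(_ ltac:(lra)); lra.
Qed.
Lemma cint_cd (f : C -> C -> C) f' a b z (r0 : R) : 0 < r0 ->
    (forall w, nc (w - z) < r0 -> ctseg (f w) a b) -> ctseg f' a b ->
    (forall e : R, 0 < e -> somepos r, forall w, nc (w - z) < r ->
       forall s, in01 s -> nc (f w (seg a b s) - f z (seg a b s)
         - (w - z) * f' (seg a b s)) <= e * nc (w - z)) ->
  cd (fun w => cint (f w) a b) z (cint f' a b).
move=> r00 cf cf' H; apply/cdP => e e0; have n0 := normc_ge0 (b - a). have k0 : 0 < nc (b - a) + 1 by lra.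
have [r rp Hr] := H _ (divr_gt0 e0 k0). exists (minr r r0); first by pos. move=> w /lt_minP[wr wr0].
have cz : ctseg (f z) a b by apply: cf; rewrite subrr normc0. have cw := cf _ wr0; have cc := @ctseg_cst R (w - z) a b.
have cwz : ctseg (fun x => f w x - f z x) a b by move=> s s01; apply: ctsB; [exact: cw|exact: cz]. have cm := ctsegM cc cf'.
rewrite [_ * (w - z)]mulrC -cintZ // -!cintB //. apply: le_trans (cint_le (K := e / (nc (b - a) + 1) * nc (w - z)) _ _) _.
- by move=> s s01; apply: ctsB; [exact: cwz|exact: cm].
- by move=> s s01; exact: Hr. rewrite (_ : e / _ * _ * _ = e * nc (w - z) * nc (b - a) / (nc (b - a) + 1)); last by ring.
rewrite ler_pdivrMr //. have := mulr_ge0 (ltW e0) (normc_ge0 (w - z)); nra.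
Qed.
(** Corners $\pm1\pm i$ of the contour that plays the part of a circle, counterclockwise from $1-i$;
    side $k$ is side 0 multiplied by $i^k$. *)
Definition vert (k : nat) : C := (1 - 'i) * 'i ^+ k.
Definition onsq zeta := exists k s, in01 s /\ zeta = seg (vert k) (vert k.+1) s.
Definition sq f := \sum_(k < 4) cint f (vert k) (vert k.+1).
Definition ctsq f := forall zeta, onsq zeta -> cts f zeta.
Lemma ctsq_seg f k : ctsq f -> ctseg f (vert k) (vert k.+1).
by move=> cf s s01; apply: cf; exists k, s. Qed.
 Lemma seg_vert k s : seg (vert k) (vert k.+1) s = 'i ^+ k * (1 +i* (2 * s - 1)).
rewrite /seg /vert exprS. rewrite (_ : 1 +i* (2 * s - 1) = (1 - 'i) + s%:C * (2 * 'i)); last first.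
  by apply/eqP; rewrite eq_complex /=; apply/andP; split; apply/eqP; ring.
have i2 : 'i * 'i = -1 :> C by rewrite -expr2 sqr_i. ring: i2.
Qed.
Lemma onsq_norm zeta : onsq zeta -> 1 <= nc zeta <= 2.
move=> [k [s [/andP[s0 s1] ->]]]; rewrite seg_vert normcM normcX normc_i expr1n mul1r. apply/andP; split.
  by apply: le_trans (ler_Re_normc _); rewrite /= normr1.
apply: le_trans (ler_normc_ReIm _) _; rewrite /= normr1. have : `|2 * s - 1| <= 1 by rewrite ler_norml; apply/andP; split; lra. lra.
Qed.
Lemma vert4 : vert 4 = vert 0.
by rewrite /vert expr0 -[4%N]/(2 * 2)%N exprM sqr_i expr2 mulrNN mulr1. Qed.
 Lemma sq_FTC f F : (forall zeta, onsq zeta -> cd F zeta (f zeta)) -> sq f = 0.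
move=> dF; rewrite /sq (eq_bigr (fun k : 'I_4 => F (vert k.+1) - F (vert k))).
  by rewrite -(big_mkord xpredT (fun k => F (vert k.+1) - F (vert k))) telescope_sumr // vert4 subrr.
by move=> k _; apply: cint_FTC => s s01; apply: dF; exists k, s.
Qed.
Lemma normc_side k : nc (vert k.+1 - vert k) <= 4.
rewrite /vert exprS. have -> : (1 - 'i) * ('i * 'i ^+ k) - (1 - 'i) * 'i ^+ k = (1 - 'i) * ('i - 1) * 'i ^+ k :> C by ring.
rewrite !normcM normcX normc_i expr1n mulr1. have := ler_normcB (1 : C) 'i; have := ler_normcB ('i : C) 1; rewrite normc1 normc_i.
have := normc_ge0 (1 - 'i : C); have := normc_ge0 ('i - 1 : C); nra.
Qed.
Lemma sq_le f (K : R) : ctsq f -> (forall zeta, onsq zeta -> nc (f zeta) <= K) ->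
  nc (sq f) <= 16 * K.
move=> cf fK; apply: le_trans (ler_normc_sum _ _ _) _. have K0 : 0 <= K.
  apply: le_trans (fK (vert 0) _); first exact: normc_ge0. by exists 0%N, 0; split; [exact: in01_0|rewrite seg0].
apply: le_trans (_ : _ <= \sum_(k < 4) (K * 4)) _.
  apply: ler_sum => k _; apply: le_trans (cint_le (K := K) _ _) _.
  - exact: ctsq_seg.
  - by move=> s s01; apply: fK; exists k, s.
  - by rewrite ler_wpM2l // normc_side.
rewrite sumr_const card_ord -mulr_natr; lra.
Qed.
Lemma sqD f g : ctsq f -> ctsq g -> sq (fun w => f w + g w) = sq f + sq g.
move=> cf cg; rewrite /sq -big_split; apply: eq_bigr => k _. by rewrite cintD //; exact: ctsq_seg.
Qed.
Lemma sqB f g : ctsq f -> ctsq g -> sq (fun w => f w - g w) = sq f - sq g.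
move=> cf cg; rewrite /sq -sumrB; apply: eq_bigr => k _. by rewrite cintB //; exact: ctsq_seg.
Qed.
Lemma sqZ c f : ctsq f -> sq (fun w => c * f w) = c * sq f.
move=> cf; rewrite /sq mulr_sumr; apply: eq_bigr => k _. by rewrite cintZ //; exact: ctsq_seg.
Qed.
Lemma sq_eq f g : ctsq f -> (forall zeta, onsq zeta -> f zeta = g zeta) -> sq f = sq g.
move=> cf fg; apply: eq_bigr => k _; apply: cint_eq; first exact: ctsq_seg. by move=> s s01; apply: fg; exists k, s.
Qed.
Lemma sq_cd (f : C -> C -> C) f' z (r0 : R) : 0 < r0 ->
    (forall w, nc (w - z) < r0 -> ctsq (f w)) -> ctsq f' ->
    (forall k (e : R), 0 < e -> somepos r, forall w, nc (w - z) < r ->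
       forall s zeta, in01 s -> zeta = seg (vert k) (vert k.+1) s ->
         nc (f w zeta - f z zeta - (w - z) * f' zeta) <= e * nc (w - z)) ->
  cd (fun w => sq (f w)) z (sq f').
move=> r00 cf cf' H; apply: cd_sum => k; apply: (cint_cd r00) => [w wr||e e0].
- exact/ctsq_seg/cf.
- exact: ctsq_seg.
- have [r r1 Hr] := H k e e0; exists r => // w wr s s01; exact: (Hr w wr s).
Qed.
(** Mathematically $2\pi i$; the estimates below only divide by it. *)
Definition c0 := sq (fun zeta => zeta^-1).
(** The form $d\zeta/\zeta$ is invariant under multiplication by $i$, so the four sides contribute
    equally. On the side $\mathrm{Re}\,\zeta=1$ the contribution is $2i$ times a mean of $1/(1+ix)$
    with $|x|\le1$, whose real part is at least 1/2. *)
Lemma c0_neq0 : c0 != 0.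
have ci : ctseg (fun zeta : C => zeta^-1) (vert 0) (vert 1).
  move=> s s01; apply: ctsV; last exact: cts_id.
  rewrite -normc_gt0; have /onsq_norm/andP[+ _] : onsq (seg (vert 0) (vert 1) s) by exists 0%N, s. by apply: lt_le_trans.
have [H dH _] := cint_prim ci. have E k : cint (fun zeta => zeta^-1) (vert k) (vert k.+1) = 2 * 'i * (H 1 - H 0).
  have ik : 'i ^+ k != 0 :> C by rewrite expf_neq0 // -normc_gt0 normc_i.
  rewrite (@cintE _ _ _ _ (fun s => ('i ^+ k)^-1 * H s)) => [|s s01].
    have i2 : 'i * 'i = -1 :> C by rewrite -expr2 sqr_i. have e1 : vert k.+1 - vert k = (2 * 'i) * 'i ^+ k.
      by rewrite /vert exprS; ring: i2.
    transitivity (2 * 'i * ('i ^+ k * ('i ^+ k)^-1) * (H 1 - H 0)).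
      by rewrite e1; ring.
    by rewrite divff // mulr1.
  have := rdZ ('i ^+ k)^-1 (dH s s01); congr (rd _ _ _). by rewrite !seg_vert expr0 mul1r invfM.
rewrite /c0 /sq (eq_bigr (fun=> 2 * 'i * (H 1 - H 0))) // sumr_const card_ord. rewrite mulrn_eq0 /= !mulf_eq0 pnatr_eq0 /=.
have -> : ('i : C) == 0 = false by apply/negbTE; rewrite -normc_gt0 normc_i. apply/negP => /eqP h. have : 2^-1 <= Re (H 1 - H 0).
  apply: rd_Re_ge dH _ => s /andP[s0 s1]; rewrite seg_vert expr0 mul1r. pose x := 2 * s - 1; have x1 : x ^+ 2 <= 1 by rewrite /x; nra.
  have x0 := sqr_ge0 x; have xp : 0 < 1 + x ^+ 2 by lra. have -> : (1 +i* x)^-1 = ((1 + x ^+ 2)^-1 +i* (- (x / (1 + x ^+ 2)))).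
    apply: mulr1_eq; apply/eqP; rewrite eq_complex /=; apply/andP; split; apply/eqP.
      by field; rewrite gt_eqF.
    by ring.
  by rewrite /= lef_pV2 ?posrE //; lra.
by rewrite h /=; lra.
Qed.
Lemma onsq_sub zeta z : onsq zeta -> nc z < 1 / 2 -> 1 / 2 <= nc (zeta - z).
by move=> /onsq_norm/andP[h _] hz; have := lerB_normc zeta z; lra. Qed.
 Lemma onsq_subn zeta z : onsq zeta -> nc z < 1 / 2 -> zeta - z != 0.
by move=> h /(onsq_sub h) l; rewrite -normc_gt0; lra. Qed.
 (** Shrinking to the centre: $G(\lambda)=\oint F(z+\lambda(\zeta-z))/(\zeta-z)\,d\zeta$ has
     derivative $\oint f(z+\lambda(\zeta-z))\,d\zeta=0$, so $G(1)=G(0)$. Differentiation under the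
     integral uses continuity of [f]; the lemma is later applied to a primitive [F] of the function
     of interest. *)
 Lemma cauchy_C1 F f : (forall z, nc z < 3 -> cd F z (f z)) -> (forall z, nc z < 3 -> cts f z) -> forall z, nc z < 1 / 2 ->
    F z * sq (fun zeta => (zeta - z)^-1) = sq (fun zeta => F zeta / (zeta - z)).
move=> dF cf z hz. have cinv : ctsq (fun zeta => (zeta - z)^-1).
  move=> x xs; apply: ctsV; first exact: onsq_subn. by apply: ctsB; [exact: cts_id|exact: cts_cst].
have cpt l x : cts (fun zeta => z + l * (zeta - z)) x.
  apply: ctsD; first exact: cts_cst. by apply: ctsM; [exact: cts_cst|apply: ctsB; [exact: cts_id|exact: cts_cst]].
have zl x : onsq x -> nc (x - z) <= 3.
  by move=> /onsq_norm/andP[_ h]; have := ler_normcB x z; lra.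
have inD x s l : onsq x -> in01 s -> nc (l - s%:C) < 1 / 10 -> nc (z + l * (x - z)) < 3.
  move=> xs s01 ls. have -> : z + l * (x - z) = seg z x s + (l - s%:C) * (x - z) by rewrite /seg; ring.
  have h1 := segB_le z x 0 s01; rewrite !subr0 in h1. have := ler_normcD (seg z x s) ((l - s%:C) * (x - z)).
  have := zl _ xs; have /andP[_ h2] := onsq_norm xs. rewrite normcM; have := normc_ge0 (l - s%:C); have := normc_ge0 (x - z).
  move: s01 => /andP[s0 s1]; nra.
pose G (l : C) := sq (fun x => F (z + l * (x - z)) / (x - z)). pose G' (l : C) := sq (fun x => f (z + l * (x - z))).
have G'0 l s : in01 s -> l = s%:C -> G' l = 0.
  move=> s01 ls; have [l0|l0] := eqVneq l 0.
    rewrite /G' l0; apply: (@sq_FTC _ (fun x => f z * x)) => x xs.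
    by rewrite mul0r addr0; apply: cd_ext (cdZ (f z) (cd_id x)) => //; rewrite mulr1.
  apply: (@sq_FTC _ (fun x => l^-1 * F (z + l * (x - z)))) => x xs. have hD : nc (z + l * (x - z)) < 3.
    by apply: (inD x s) => //; rewrite ls subrr normc0; lra.
  have dl : cd (fun x => z + l * (x - z)) x l.
    apply: cd_ext (cdD (cd_cst z x) (cdZ l (cdB (cd_id x) (cd_cst z x)))) => //. by rewrite subr0 mulr1 add0r.
  by apply: cd_ext (cdZ l^-1 (cd_comp dl (dF _ hD))) => //; field.
have dG s : in01 s -> cd G s%:C (G' s%:C).
  move=> s01; have p10 : 0 < 1 / 10 :> R by lra. apply: (sq_cd p10) => [w ws|x xs|k e e0].
  - move=> x xs; apply: ctsM (cinv _ xs). by apply: cts_comp (cpt _ _) _; apply: cd_cts (dF _ (inD _ _ _ xs s01 ws)).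
  - apply: cts_comp (cpt _ _) _; apply: cf; apply: (inD x s) => //. by rewrite subrr normc0; lra.
  - pose a := z + s%:C * (vert k - z); pose b := z + s%:C * (vert k.+1 - z).
    have ab t : seg a b t = z + s%:C * (seg (vert k) (vert k.+1) t - z).
      by rewrite /a /b /seg; ring.
    have cab : ctseg f a b.
      move=> t t01; rewrite ab; apply: cf; apply: (inD _ s) => //; first by exists k, t. by rewrite subrr normc0; lra.
    have [r r0 Hr] := cts_unif cab e0. exists (minr (r / 3) (1 / 10)); first by pos. move=> w /lt_minP[wr w10] t x t01 xE.
    have xs : onsq x by exists k, t. set A := z + s%:C * (x - z); set B := z + w * (x - z). have AE : A = seg a b t by rewrite ab -xE.
    have BA : B - A = (w - s%:C) * (x - z) by rewrite /A /B; ring. have nBA : nc (B - A) < r.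
      rewrite BA normcM; have := zl _ xs; have := normc_ge0 (w - s%:C). have := normc_ge0 (x - z); nra.
    have xz := onsq_subn xs hz. have -> : F B / (x - z) - F A / (x - z) - (w - s%:C) * f A = (F B - f A * B - (F A - f A * A)) / (x - z).
      have -> : w - s%:C = (B - A) / (x - z) by rewrite BA mulfK. by field.
    rewrite normcM normcV ler_pdivrMr ?normc_gt0 // -mulrA -normcM -BA.
    apply: (@cd_mvt _ (fun y => F y - f A * y) (fun y => f y - f A)) => q q01.
      have qD : nc (seg A B q) < 3.
        rewrite -[seg A B q]subr0; apply: segB_lt => //; rewrite subr0.
          by apply: (inD _ s) => //; rewrite subrr normc0; lra.
        by apply: (inD _ s).
      apply: cd_ext (cdB (dF _ qD) (cdZ (f A) (cd_id _))) => //. by rewrite mulr1.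
    apply/ltW; rewrite AE; apply: Hr => //; rewrite -AE. by apply: segB_lt => //; rewrite subrr normc0.
have : nc (G 1 - G 0) <= 0 * nc (1 - 0 : C).
  apply: (@cd_mvt _ G G') => s s01; rewrite /seg add0r subr0 mulr1; first exact: dG. by rewrite (G'0 _ s) // normc0.
rewrite mul0r => h; have /eqP : nc (G 1 - G 0) == 0 by rewrite eq_le h normc_ge0.
move=> /eqP; rewrite normc_eq0 subr_eq0 => /eqP; rewrite /G.
rewrite (@sq_eq (fun x => F (z + 1 * (x - z)) / (x - z)) (fun x => F x / (x - z))); last first.
- by move=> x _; rewrite mul1r addrC subrK.
- move=> x xs; apply: ctsM (cinv _ xs); apply: cts_comp (cpt _ _) _. apply: cd_cts (dF _ _); apply: (inD _ 1 1 xs (@in01_1 R)).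
  by rewrite subrr normc0; lra.
move=> ->; rewrite -sqZ //; apply: sq_eq => [x xs|x xs].
  by apply: ctsM (cinv _ xs); exact: cts_cst.
by rewrite mul0r addr0.
Qed.
Definition kern zeta (m : nat) z := ((zeta - z)^-1) ^+ m.
Lemma cd_kern zeta m z : zeta - z != 0 ->
  cd (kern zeta m) z (m%:R * kern zeta m.+1 z).
move=> n0. have d1 : cd (fun w => zeta - w) z (-1).
  by apply: cd_ext (cdB (cd_cst zeta z) (cd_id z)) => //; rewrite sub0r.
apply: cd_ext (cdX m (@cdV _ (fun w => zeta - w) z _ n0 d1)) => //. rewrite opprK /kern; case: m => [|m] /=; first by rewrite !mul0r.
by rewrite mul1r -exprVn -mulrA -exprD addn2.
Qed.
Lemma kern_le zeta m z : onsq zeta -> nc z < 1 / 2 ->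
  nc (kern zeta m z) <= 2 ^+ m.
move=> zs hz; rewrite /kern normcX normcV lerXn2r ?nnegrE ?invr_ge0 //. have h := onsq_sub zs hz.
rewrite -[leRHS]invrK lef_pV2 ?posrE ?invr_gt0 //; lra.
Qed.
Lemma cts_kern m z x : onsq x -> nc z < 1 / 2 -> cts (fun zeta => kern zeta m z) x.
move=> xs hz; apply: ctsX; apply: ctsV; first exact: onsq_subn. by apply: ctsB; [exact: cts_id|exact: cts_cst].
Qed.
Definition Kint (m : nat) F z := sq (fun zeta => F zeta * kern zeta m z).
Lemma cts_Kint m F z : ctsq F -> nc z < 1 / 2 ->
  ctsq (fun zeta => F zeta * kern zeta m z).
by move=> cF hz x xs; apply: ctsM; [exact: cF|exact: cts_kern]. Qed.
 Lemma Kint_le m F z (B : R) : ctsq F -> nc z < 1 / 2 -> (forall x, onsq x -> nc (F x) <= B) -> nc (Kint m F z) <= 16 * (B * 2 ^+ m).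
move=> cF hz FB; apply: sq_le => [|x xs]; first exact: cts_Kint. by rewrite normcM ler_pM ?FB ?kern_le.
Qed.
Lemma Kint_cd m F z : ctsq F -> nc z < 1 / 2 ->
  cd (Kint m F) z (Kint m.+1 (fun x => m%:R * F x) z).
move=> cF hz; have r0 : 0 < 1 / 2 - nc z by lra. have near w : nc (w - z) < 1 / 2 - nc z -> nc w < 1 / 2.
  by move=> h; have := ler_normcD (w - z) z; rewrite subrK; lra.
apply: (sq_cd r0) => [w /near hw||k e e0].
- exact: cts_Kint.
- by apply: cts_Kint => // x xs; apply: ctsM; [exact: cts_cst|exact: cF].
- have [B HB] := cts_bdd (ctsq_seg k cF). have B0 : 0 <= B by apply: le_trans (HB 0 (@in01_0 R)); exact: normc_ge0.
  pose L : R := m%:R * (m.+1%:R * 2 ^+ m.+2). have L0 : 0 <= L.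
    by rewrite /L; apply: mulr_ge0; rewrite ?ler0n //; apply: mulr_ge0; rewrite ?ler0n // exprn_ge0.
  have k0 : 0 < B * L + 1 by pos. exists (minr (e / (B * L + 1)) (1 / 2 - nc z)); first by pos.
  move=> w /lt_minP[w1 w2] s x s01 xE; have xs : onsq x by exists k, s. have hw := near _ w2.
  have hseg a b t : in01 t -> nc a < 1 / 2 -> nc b < 1 / 2 -> nc (seg a b t) < 1 / 2.
    by move=> t01 ha hb; rewrite -[seg _ _ _]subr0; apply: segB_lt => //; rewrite subr0.
  have -> : F x * kern x m w - F x * kern x m z - (w - z) * (m%:R * F x * kern x m.+1 z) =
      F x * ((kern x m w - (m%:R * kern x m.+1 z) * w) - (kern x m z - (m%:R * kern x m.+1 z) * z)).
    by ring.
  have step1 y : nc y < 1 / 2 -> nc (kern x m.+1 y - kern x m.+1 z) <= m.+1%:R * 2 ^+ m.+2 * nc (y - z).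
    move=> hy; apply: (@cd_mvt _ (kern x m.+1) (fun y => m.+1%:R * kern x m.+2 y)) => t t01.
      by apply: cd_kern; apply: onsq_subn => //; exact: hseg.
    by rewrite normcM normc_nat ler_wpM2l ?ler0n // kern_le //; exact: hseg.
  have step2 : nc (kern x m w - (m%:R * kern x m.+1 z) * w - (kern x m z - (m%:R * kern x m.+1 z) * z)) <= (L * nc (w - z)) * nc (w - z).
    apply: (@cd_mvt _ (fun y => kern x m y - (m%:R * kern x m.+1 z) * y) (fun y => m%:R * (kern x m.+1 y - kern x m.+1 z))) => t t01.
      have ht := hseg _ _ _ t01 hz hw. apply: cd_ext (cdB (cd_kern m (onsq_subn xs ht)) (cdZ _ (cd_id _))) => //. by ring.
    have ht := hseg _ _ _ t01 hz hw. rewrite normcM normc_nat /L -mulrA ler_wpM2l ?ler0n //.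
    apply: le_trans (step1 _ ht) _; apply: ler_wpM2l; first by pos.
    have := segB_le z w z t01; rewrite subrr normc0 mulr0 add0r => /le_trans; apply.
    by move: t01 => /andP[_ t1]; rewrite -[leRHS]mul1r ler_wpM2r.
  rewrite normcM; move: w1; rewrite ltr_pdivlMr // => w1. have n0 := normc_ge0 (w - z); have FB : nc (F x) <= B by rewrite xE HB.
  have := ler_pM (normc_ge0 _) (normc_ge0 _) FB step2 => /le_trans; apply.
  have -> : B * (L * nc (w - z) * nc (w - z)) = (B * L * nc (w - z)) * nc (w - z) by ring. rewrite ler_wpM2r //; nra.
Qed.
Lemma ctsq_cst c : ctsq (fun=> c).
by move=> x _; exact: cts_cst. Qed.
 Lemma sq_inv z : nc z < 1 / 2 -> sq (fun zeta => (zeta - z)^-1) = c0.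
move=> hz; pose g (y : C) := Kint 1 (fun=> 1) y. have gE y : nc y < 1 / 2 -> g y = sq (fun zeta => (zeta - y)^-1).
  by move=> hy; apply: sq_eq => [|x _]; [apply: cts_Kint => //; exact: ctsq_cst|rewrite mul1r /kern expr1].
have dg y : nc y < 1 / 2 -> cd g y 0.
  move=> hy; have <- : Kint 2 (fun x => 1%:R * (fun=> 1) x) y = 0; last exact: (Kint_cd 1 (ctsq_cst 1) hy).
  apply: (@sq_FTC _ (fun x => - (x - y)^-1)) => x xs. have n0 := onsq_subn xs hy.
  apply: cd_ext (cdN (@cdV _ (fun x => x - y) x _ n0 (cdB (cd_id x) (cd_cst y x)))) => //.
  by rewrite /kern subr0 !mul1r mulN1r opprK exprVn.
have : nc (g z - g 0) <= 0 * nc (z - 0).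
  apply: (@cd_mvt _ g (fun=> 0)) => s s01; last by rewrite normc0.
  apply: dg; rewrite -[seg _ _ _]subr0; apply: segB_lt => //; rewrite subr0 // normc0; lra.
rewrite mul0r => h; have /eqP : nc (g z - g 0) == 0 by rewrite eq_le h normc_ge0.
move=> /eqP; rewrite normc_eq0 subr_eq0 => /eqP; rewrite gE // => ->. rewrite gE ?normc0; last by lra.
apply: sq_eq => [x xs|x _]; last by rewrite subr0. apply: ctsV; first by apply: onsq_subn => //; rewrite normc0; lra.
by apply: ctsB; [exact: cts_id|exact: cts_cst].
Qed.
Lemma cauchy_deriv F f : (forall z, nc z < 3 -> cd F z (f z)) ->
    (forall z, nc z < 3 -> cts f z) ->
  forall z, nc z < 1 / 2 -> f z * c0 = Kint 2 F z.
move=> dF cf z hz. have onD x : onsq x -> nc x < 3 by move=> /onsq_norm/andP[_]; lra. have cF : ctsq F by move=> x /onD /dF /cd_cts.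
have h1 : cd (fun w => c0 * F w) z (c0 * f z) by apply/cdZ/dF; lra. have h2 := Kint_cd 1 cF hz.
have -> : Kint 2 F z = Kint 2 (fun x => 1%:R * F x) z.
  by apply: sq_eq => [|x _]; [exact: cts_Kint|rewrite mul1r].
rewrite mulrC; apply: cd_unique h1 _; have r0 : 0 < 1 / 2 - nc z by lra. apply: cd_near r0 _ h2 => w hw.
have hw' : nc w < 1 / 2 by have := ler_normcD (w - z) z; rewrite subrK; lra. rewrite mulrC -(sq_inv hw') (cauchy_C1 dF cf hw').
by apply: sq_eq => [|x _]; [exact: cts_Kint|rewrite /kern expr1].
Qed.
(** A function only known to be complex differentiable has a primitive, which is then continuously
    differentiable. Cauchy's formula for the primitive writes [f] and its derivatives as integrals
    against powers of the kernel. *)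
Lemma smooth_unit : exists2 A : R, 0 <= A & forall f (B : R),
    hol f (fun z => nc z < 3) -> (forall z, nc z < 3 -> nc (f z) <= B) ->
  exists f1 f2, forall z, nc z < 1 / 2 ->
    [/\ cd f z (f1 z), cd f1 z (f2 z), nc (f1 z) <= A * B & nc (f2 z) <= A * B].
pose k := nc (c0^-1); have k0 : 0 <= k := normc_ge0 _. exists (k * (16 * (6 * 2 * 2 ^+ 4))); first by pos. move=> f B hf fB.
have cvD : cvx (fun z : C => nc z < 3).
  by move=> a b s Da Db s01; rewrite -[seg _ _ _]subr0; apply: segB_lt => //; rewrite subr0.
have opD : op (fun z : C => nc z < 3).
  move=> z Dz; exists (3 - nc z) => [|w hw]; first lra. by have := ler_normcD (w - z) z; rewrite subrK; lra.
(* Normalising the primitive at 0 bounds it on the contour by a multiple of B. *)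
have [F0 dF0] := primitive cvD opD hf; pose F w := F0 w - F0 0. have dF z : nc z < 3 -> cd F z (f z).
  by move=> /dF0 h; apply: cd_ext (cdB h (cd_cst (F0 0) z)) => //; rewrite subr0.
have cf := hol_cts hf. have onD x : onsq x -> nc x < 3 by move=> /onsq_norm/andP[_]; lra. have cF : ctsq F by move=> x /onD /dF /cd_cts.
have B0 : 0 <= B by apply: le_trans (fB 0 _); rewrite // normc0; lra. have FB x : onsq x -> nc (F x) <= 2 * B.
  move=> xs; have h : nc (F0 x - F0 0) <= B * nc (x - 0).
    by apply: (@cd_mvt _ F0 f) => s s01; [apply: dF0|apply: fB]; apply: cvD => //; rewrite ?normc0 ?onD //; lra.
  move: h; rewrite subr0 -/(F x); have /andP[_] := onsq_norm xs; nra.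
have F2 : ctsq (fun x => 2 * F x) by move=> x xs; apply: ctsM; [exact: cts_cst|exact: cF]. have F6 : ctsq (fun x => 3 * (2 * F x)).
  by move=> x xs; apply: ctsM; [exact: cts_cst|exact: F2].
exists (fun z => c0^-1 * Kint 3 (fun x => 2 * F x) z), (fun z => c0^-1 * Kint 4 (fun x => 3 * (2 * F x)) z) => z hz.
have cn := c0_neq0; split.
- have r0 : 0 < 1 / 2 - nc z by lra. apply: cd_near r0 _ (cdZ c0^-1 (Kint_cd 2 cF hz)) => w hw.
  have hw' : nc w < 1 / 2 by have := ler_normcD (w - z) z; rewrite subrK; lra. by rewrite -(cauchy_deriv dF cf hw') mulrC mulfK.
- exact: cdZ (Kint_cd 3 F2 hz).
- rewrite normcM -/k (_ : k * _ * B = k * (16 * (6 * 2 * 2 ^+ 4) * B)); last by ring. rewrite ler_wpM2l //.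
  apply: le_trans (Kint_le 3 (B := 2 * (2 * B)) F2 hz _) _.
    by move=> x xs; rewrite normcM normc_nat ler_wpM2l ?FB.
  rewrite !exprS expr0; lra.
- rewrite normcM -/k (_ : k * _ * B = k * (16 * (6 * 2 * 2 ^+ 4) * B)); last by ring. rewrite ler_wpM2l //.
  apply: le_trans (Kint_le 4 (B := 3 * (2 * (2 * B))) F6 hz _) _.
    by move=> x xs; rewrite !normcM !normc_nat ler_wpM2l // ler_wpM2l ?FB.
  rewrite !exprS expr0; lra.
Qed.
Lemma smooth : exists2 A : R, 0 <= A & forall f z0 (rho B : R), 0 < rho ->
    hol f (fun z => nc (z - z0) < rho) ->
    (forall z, nc (z - z0) < rho -> nc (f z) <= B) ->
  exists f1 f2, forall z, nc (z - z0) < rho / 6 ->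
    [/\ cd f z (f1 z), cd f1 z (f2 z), nc (f1 z) <= A * B / rho
      & nc (f2 z) <= A * B / rho ^+ 2].
have [A A0 HA] := smooth_unit; exists (9 * A); first by pos. move=> f z0 rho B r0 hf fB. pose k : R := rho / 3; have k0 : 0 < k by pos.
have kC : k%:C != 0 by rewrite fmorph_eq0 gt_eqF. pose g s := f (z0 + k%:C * s). have inb s : nc s < 3 -> nc (z0 + k%:C * s - z0) < rho.
  by move=> hs; rewrite [z0 + _]addrC addrK normcM normc_real gtr0_norm //; rewrite /k in k0 *; nra.
have daff s : cd (fun s => z0 + k%:C * s) s k%:C.
  by apply: cd_ext (cdD (cd_cst z0 s) (cdZ k%:C (cd_id s))) => //; rewrite mulr1 add0r.
have hg : hol g (fun z => nc z < 3).
  by move=> s /inb /hf[d fd]; exists (d * k%:C); exact: cd_comp (daff s) fd.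
have gB s : nc s < 3 -> nc (g s) <= B by move=> /inb /fB. have B0 : 0 <= B by apply: le_trans (fB z0 _); rewrite // subrr normc0.
have [g1 [g2 Hg]] := HA g B hg gB. have dinv z : cd (fun z => (z - z0) / k%:C) z k%:C^-1.
  apply: cd_ext (cdZ (k%:C^-1) (cdB (cd_id z) (cd_cst z0 z))) => [w|]; first by rewrite mulrC. by rewrite subr0 mulr1.
exists (fun z => g1 ((z - z0) / k%:C) / k%:C), (fun z => g2 ((z - z0) / k%:C) / k%:C / k%:C) => z hz.
have hs : nc ((z - z0) / k%:C) < 1 / 2.
  by rewrite normcM normcV normc_real gtr0_norm // ltr_pdivrMr // /k; lra.
have [h1 h2 h3 h4] := Hg _ hs. have nk : nc (k%:C^-1) = k^-1 by rewrite normcV normc_real gtr0_norm.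
have kE : k^-1 = 3 / rho by rewrite /k invfM invrK mulrC. have rV : 0 < rho^-1 by pos. have AB : 0 <= A * B by pos. split.
- apply: cd_ext (cd_comp (dinv z) h1) => // w; rewrite /g; congr f. by field.
- have := cdZ (k%:C^-1) (cd_comp (dinv z) h2); apply: cd_ext => [w|]; rewrite mulrC //.
- rewrite normcM nk kE; apply: le_trans (ler_wpM2r _ h3) _; nra.
- rewrite !normcM nk kE -mulrA -expr2 exprMn exprVn. apply: le_trans (ler_wpM2r _ h4) _; first by pos. have : 0 <= (rho ^+ 2)^-1 by pos.
  have -> : (3 : R) ^+ 2 = 9 by rewrite expr2; ring. nra.
Qed.
Lemma taylor1 f f1 f2 z w (K : R) :
    (forall s, in01 s -> cd f (seg z w s) (f1 (seg z w s))) ->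
    (forall s, in01 s -> cd f1 (seg z w s) (f2 (seg z w s))) ->
    (forall s, in01 s -> nc (f2 (seg z w s)) <= K) ->
  nc (f w - f z - f1 z * (w - z)) <= K * nc (w - z) ^+ 2.
move=> d1 d2 f2K. have -> : f w - f z - f1 z * (w - z) = (f w - f1 z * w) - (f z - f1 z * z) by ring.
have K0 : 0 <= K by apply: le_trans (f2K 0 (@in01_0 R)); exact: normc_ge0. rewrite expr2 mulrA.
apply: (@cd_mvt _ (fun y => f y - f1 z * y) (fun y => f1 y - f1 z)) => s s01.
  by apply: cd_ext (cdB (d1 _ s01) (cdZ (f1 z) (cd_id _))) => //; rewrite mulr1.
have ss t : seg z (seg z w s) t = seg z w (t * s) by rewrite /seg rmorphM /=; ring. have ts t : in01 t -> in01 (t * s).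
  by move: s01 => /andP[s0 s1] /andP[t0 t1]; apply/andP; split; nra.
apply: le_trans (@cd_mvt _ f1 f2 z (seg z w s) K _ _) _.
- by move=> t t01; rewrite ss; exact/d2/ts.
- by move=> t t01; rewrite ss; exact/f2K/ts. rewrite ler_wpM2l //; have := segB_le z w z s01; rewrite subrr normc0 mulr0 add0r.
move=> /le_trans; apply; move: s01 => /andP[_ s1]. by rewrite -[leRHS]mul1r ler_wpM2r.
Qed.
End Cauchy.

(** * Several variables: gradients and their holomorphy *)

Section VectorNorm.
Context {R : realType}.
Local Notation C := R[i].
Definition vn m (x : 'rV[C]_m) : R := \sum_i nc (x 0 i).
Definition dot m (g h : 'rV[C]_m) : C := \sum_i g 0 i * h 0 i.

Section Fixed.
Variable m : nat.
Implicit Types (x y v h g : 'rV[C]_m).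
Lemma vn_ge0 x : 0 <= vn x.
by apply: sumr_ge0 => i _. Qed.
 Lemma vnD x y : vn (x + y) <= vn x + vn y.
by rewrite /vn -big_split; apply: ler_sum => i _; rewrite mxE; exact: ler_normcD.
Qed.
Lemma vnZ (a : C) x : vn (a *: x) = nc a * vn x.
by rewrite /vn mulr_sumr; apply: eq_bigr => i _; rewrite mxE normcM. Qed.
 Lemma vnN x : vn (- x) = vn x.
by rewrite -scaleN1r vnZ normcN normc1 mul1r. Qed.
 Lemma vnB x y : vn (x - y) <= vn x + vn y.
by apply: le_trans (vnD _ _) _; rewrite vnN. Qed.
 Lemma vn_distC x y : vn (x - y) = vn (y - x).
by rewrite -opprB vnN. Qed.
 Lemma vn_dist x y z : vn (x - z) <= vn (x - y) + vn (y - z).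
by have := vnD (x - y) (y - z); rewrite addrA subrK. Qed.
 Lemma vn0 : vn (0 : 'rV[C]_m) = 0.
by rewrite /vn big1 // => i _; rewrite mxE normc0. Qed.
 Lemma vn_coord x i : nc (x 0 i) <= vn x.
rewrite /vn (bigD1 i) //= lerDl; apply: sumr_ge0 => j _; exact: normc_ge0.
Qed.
Lemma vn_eq0 x : (vn x == 0) = (x == 0).
apply/eqP/eqP => [h|->]; last exact: vn0. apply/rowP => i; rewrite mxE; apply/eqP; rewrite -normc_eq0.
by rewrite eq_le normc_ge0 andbT -h vn_coord.
Qed.
Lemma vn_gt0 x : (0 < vn x) = (x != 0).
by rewrite lt_def vn_ge0 andbT vn_eq0. Qed.
 Lemma vn_delta (i : 'I_m) : vn (delta_mx 0 i) = 1.
rewrite /vn (bigD1 i) //= big1 => [|j /negbTE ji]; last by rewrite mxE ji andbF normc0. by rewrite mxE !eqxx normc1 addr0.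
Qed.
Lemma vn_le x (K : R) : (forall i, nc (x 0 i) <= K) -> vn x <= m%:R * K.
move=> xK; apply: le_trans (ler_sum _ (fun i _ => xK i)) _. by rewrite sumr_const card_ord mulr_natl.
Qed.
Lemma dotDr g x y : dot g (x + y) = dot g x + dot g y.
by rewrite /dot -big_split; apply: eq_bigr => i _; rewrite mxE mulrDr. Qed.
 Lemma dotZr g (a : C) x : dot g (a *: x) = a * dot g x.
by rewrite /dot mulr_sumr; apply: eq_bigr => i _; rewrite mxE mulrCA. Qed.
 Lemma dot_delta g i : dot g (delta_mx 0 i) = g 0 i.
rewrite /dot (bigD1 i) //= big1 => [|j /negbTE ji]; last by rewrite mxE ji andbF mulr0. by rewrite mxE !eqxx mulr1 addr0.
Qed.
Lemma dot_le g h : nc (dot g h) <= vn g * vn h.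
apply: le_trans (ler_normc_sum _ _ _) _; rewrite {1}/vn mulr_suml. by apply: ler_sum => i _; rewrite normcM ler_wpM2l ?vn_coord.
Qed.
Lemma dot0r g : dot g 0 = 0.
by rewrite /dot big1 // => i _; rewrite mxE mulr0. Qed.
 Definition fd (f : 'rV[C]_m -> C) x g := forall e : R, 0 < e -> somepos r, forall h, vn h < r ->
    nc (f (x + h) - f x - dot g h) <= e * vn h.
 Lemma fd_line f x v (s : C) g : fd f (x + s *: v) g -> cd (fun t => f (x + t *: v)) s (dot g v).
move=> H; apply/cdP => e e0; have v0 := vn_ge0 v. have k0 : 0 < vn v + 1 by lra. have [r r0 Hr] := H _ (divr_gt0 e0 k0).
exists (r / (vn v + 1)); first exact: divr_gt0. move=> w; rewrite ltr_pdivlMr // => hw; have w0 := normc_ge0 (w - s).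
have := Hr ((w - s) *: v); rewrite vnZ => /(_ ltac:(nra)). have -> : x + s *: v + (w - s) *: v = x + w *: v.
  by rewrite -addrA -scalerDl [s + _]addrC subrK.
rewrite dotZr [dot _ _ * _]mulrC => h; apply: le_trans h _. rewrite mulrAC ler_pdivrMr //; have := mulr_ge0 (ltW e0) w0; nra.
Qed.
Lemma fd_unique f x g g' : fd f x g -> fd f x g' -> g = g'.
move=> h1 h2; apply/rowP => i; rewrite -!dot_delta. apply: (@cd_unique _ (fun t => f (x + t *: delta_mx 0 i)) 0).
  by apply: fd_line; rewrite scale0r addr0.
by apply: fd_line; rewrite scale0r addr0.
Qed.
Lemma fd_cts f x g : fd f x g -> forall e : R, 0 < e -> somepos r, forall y, vn (y - x) < r -> nc (f y - f x) < e.
move=> H e e0; have [r r0 Hr] := H _ ltr01; have g0 := vn_ge0 g. have k0 : 0 < vn g + 2 by lra.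
exists (minr r (e / (vn g + 2))); first by pos. move=> y; rewrite lt_min ltr_pdivlMr // => /andP[/Hr h1 h2].
move: h1; rewrite [x + _]addrC subrK mul1r => h1. have := ler_normcD (f y - f x - dot g (y - x)) (dot g (y - x)); rewrite subrK.
have := dot_le g (y - x); have := vn_ge0 (y - x); nra.
Qed.
Definition grads (f : 'rV[C]_m -> C) G x0 (rho : R) :=
  forall x, vn (x - x0) < rho -> fd f x (G x).
End Fixed.

#[local] Hint Extern 0 (is_true (@Order.le _ _ _ (vn _))) => exact: vn_ge0 : core.
(** One-variable bounds on the complex lines through x: $s\mapsto f(x+sv)$ is holomorphic and
    bounded on a disc of radius $\rho/(2|v|)$. *)
Lemma second_order : exists2 A : R, 0 <= A &
  forall m (f : 'rV[C]_m -> C) G x0 (rho B : R), 0 < rho -> grads f G x0 rho ->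
    (forall x, vn (x - x0) < rho -> nc (f x) <= B) ->
  forall x, vn (x - x0) < rho / 2 ->
    (forall v, nc (dot (G x) v) <= A * B / rho * vn v) /\
    (forall h, vn h < rho / 12 ->
       nc (f (x + h) - f x - dot (G x) h) <= A * B / rho ^+ 2 * vn h ^+ 2).
have [A A0 HA] := @smooth R; exists (4 * A); first by pos. move=> m f G x0 rho B r0 fG fB x hx.
have B0 : 0 <= B by apply: le_trans (fB x0 _); rewrite // subrr vn0. have AB : 0 <= A * B by pos.
have main v : v != 0 -> exists f1 f2, forall s, nc s < rho / (2 * vn v) / 6 -> [/\ cd (fun t => f (x + t *: v)) s (f1 s), cd f1 s (f2 s),
      nc (f1 s) <= 2 * (A * B / rho) * vn v & nc (f2 s) <= 4 * (A * B / rho ^+ 2) * vn v ^+ 2].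
  rewrite -vn_gt0 => v0; have p0 : 0 < rho / (2 * vn v) by pos. have inb s : nc (s - 0) < rho / (2 * vn v) -> vn (x + s *: v - x0) < rho.
    rewrite subr0 ltr_pdivlMr ?mulr_gt0 // => hs. rewrite addrAC; apply: le_lt_trans (vnD _ _) _; rewrite vnZ; lra.
  have [||f1 [f2 H]] := HA (fun t => f (x + t *: v)) 0 _ B p0.
  - by move=> s /inb /fG /fd_line; exists (dot (G (x + s *: v)) v).
  - by move=> s /inb /fB. exists f1, f2 => s hs; have [|h1 h2 h3 h4] := H s; first by rewrite subr0. split=> //.
    apply: le_trans h3 _; rewrite invfM invrK; have := ltW v0; nra.
  apply: le_trans h4 _; rewrite -exprVn invfM invrK exprMn exprMn -exprVn. by rewrite (_ : 2 ^+ 2 = 4 :> R); [lra|rewrite expr2; ring].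
split=> [v|h hh].
  have [->|v0] := eqVneq v 0; first by rewrite dot0r normc0 vn0 mulr0. have [f1 [f2 H]] := main v v0; have vp := v0; rewrite -vn_gt0 in vp.
  have [|h1 _ h3 _] := H 0.
    by rewrite normc0 !divr_gt0 // mulr_gt0.
  have e : dot (G x) v = f1 0.
    apply: cd_unique h1; apply: fd_line; rewrite scale0r addr0; apply: fG; lra.
  rewrite e; apply: le_trans h3 _. have : 0 <= A * B / rho * vn v by pos. lra.
have [->|h0] := eqVneq h 0.
  by rewrite addr0 subrr dot0r subrr normc0 vn0 expr0n /= mulr0.
have [f1 [f2 H]] := main h h0; have hp := h0; rewrite -vn_gt0 in hp. have l1 : 1 < rho / (2 * vn h) / 6.
  by rewrite ltr_pdivlMr // ltr_pdivlMr ?mulr_gt0 //; lra.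
have inn s : in01 s -> nc (seg (0 : C) 1 s) < rho / (2 * vn h) / 6.
  move=> s01; have := segB_le 0 1 0 s01; rewrite !subr0 normc0 normc1. by move: s01 => /andP[_ s1] h'; lra.
have := @taylor1 _ (fun t => f (x + t *: h)) f1 f2 0 1 (4 * (A * B / rho ^+ 2) * vn h ^+ 2).
move=> /(_ (fun s s01 => let: And4 h1 _ _ _ := H _ (inn s s01) in h1) (fun s s01 => let: And4 _ h1 _ _ := H _ (inn s s01) in h1)
           (fun s s01 => let: And4 _ _ _ h1 := H _ (inn s s01) in h1)).
rewrite subr0 normc1 expr1n !mulr1 scale1r scale0r addr0. have [|h1 _ _ _] := H 0; first by rewrite normc0 !divr_gt0 // mulr_gt0.
have -> : f1 0 = dot (G x) h.
  apply: cd_unique h1 _; apply: fd_line; rewrite scale0r addr0; apply: fG; lra.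
by move=> h2; apply: le_trans h2 _; rewrite !mulrA.
Qed.
Lemma sq_sum (I : Type) (s : seq I) (F : I -> C -> C) : (forall l, ctsq (F l)) ->
  sq (fun z => \sum_(l <- s) F l z) = \sum_(l <- s) sq (F l).
move=> cF; elim: s => [|l s IH].
  rewrite big_nil (_ : (fun z => _) = fun=> 0); last by apply/funext => z; rewrite big_nil.
  by apply: (@sq_FTC _ _ (fun=> 0)) => z _; exact: cd_cst.
rewrite big_cons -IH -sqD //; last by move=> z zs; apply: cts_sum => j; exact: cF. by congr sq; apply/funext => z; rewrite big_cons.
Qed.
(** By Cauchy's formula in the direction $e_i$, the partial derivative is an average of f over a
    small square. Increments of f at the points of the square are linear up to a uniform quadratic
    error, and this survives the averaging; the new gradient is the same average of the old one. *)
Lemma partial_holomorphic : exists2 A : R, 0 <= A &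
  forall m (f : 'rV[C]_m -> C) G x0 (rho B : R), 0 < rho -> grads f G x0 rho ->
    (forall x, vn (x - x0) < rho -> nc (f x) <= B) ->
  forall i, exists2 G', grads (fun x => G x 0 i) G' x0 (rho / 4) &
    forall x, vn (x - x0) < rho / 4 -> nc (G x 0 i) <= A * B / rho.
have [A A0 HA] := second_order; exists A => // m f G x0 rho B r0 fG fB i.
have B0 : 0 <= B by apply: le_trans (fB x0 _); rewrite // subrr vn0. have H x := HA m f G x0 rho B r0 fG fB x.
(* The disc of radius 3 r around a point at distance less than rho / 4 from x0 stays within rho / 2,
   where [second_order] applies. *)
pose r := rho / 24; have rp : 0 < r by pos. have rC : r%:C != 0 by rewrite fmorph_eq0 gt_eqF. pose ei : 'rV[C]_m := delta_mx 0 i.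
pose K : R := A * B / rho ^+ 2. have K0 : 0 <= K by pos. have inb x s (k : R) : vn (x - x0) < rho / 4 -> nc s < k ->
    vn (x + (r%:C * s) *: ei - x0) < rho / 4 + r * k.
  move=> hx hs; rewrite addrAC; apply: le_lt_trans (vnD _ _) _. rewrite vnZ vn_delta mulr1 normcM normc_real gtr0_norm //; nra.
have in3 x s : vn (x - x0) < rho / 4 -> nc s < 3 -> vn (x + (r%:C * s) *: ei - x0) < rho / 2.
  by move=> hx hs; have := inb _ _ _ hx hs; rewrite /r; lra.
have onD (x : C) : onsq x -> nc x < 3 by move=> /onsq_norm/andP[_]; lra. have caff s : cd (fun s => r%:C * s) s r%:C.
  by apply: cd_ext (cdZ r%:C (cd_id s)) => //; rewrite mulr1.
(* Entries of the gradient are continuous along the line because they are uniformly approximated by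
   difference quotients of f with a fixed step d. *)
have cG x l s : vn (x - x0) < rho / 4 -> nc s < 3 -> cts (fun s => G (x + (r%:C * s) *: ei) 0 l) s.
  move=> hx hs e e0. pose d := minr (rho / 24) (e / (4 * (K + 1))). have K1 : 0 < 4 * (K + 1) by lra.
  have dp : 0 < d by rewrite lt_min; apply/andP; split; [lra|exact: divr_gt0]. have d1 : d <= rho / 24 by rewrite ge_min lexx.
  have d2 : d * (4 * (K + 1)) <= e by rewrite -ler_pdivlMr // ge_min lexx orbT. pose el : 'rV[C]_m := delta_mx 0 l. have q t : nc t < 3 ->
      nc (f (x + (r%:C * t) *: ei + d%:C *: el) - f (x + (r%:C * t) *: ei)
        - d%:C * G (x + (r%:C * t) *: ei) 0 l) <= d * (e / 4).
    move=> ht; have [_ /(_ (d%:C *: el))] := H _ (in3 _ _ hx ht). rewrite vnZ vn_delta mulr1 normc_real gtr0_norm // dotZr dot_delta.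
    move=> /(_ ltac:(lra)) h; apply: le_trans h _; rewrite -/K; nra.
  have dC : d%:C != 0 by rewrite fmorph_eq0 gt_eqF. have de : 0 < d * (e / 8) by pos. have c1 : cts (fun t => f (x + (r%:C * t) *: ei)) s.
    apply: (@cts_comp _ (fun t => r%:C * t) (fun t => f (x + t *: ei))).
      exact: cd_cts (caff s).
    by apply: cd_cts (fd_line (fG _ _)); have := in3 _ _ hx hs; lra.
  have c2 : cts (fun t => f (x + (r%:C * t) *: ei + d%:C *: el)) s.
    apply: cts_ext (_ : cts (fun t => f (x + d%:C *: el + (r%:C * t) *: ei)) s).
      by move=> t; rewrite addrAC.
    apply: (@cts_comp _ (fun t => r%:C * t) (fun t => f (x + d%:C *: el + t *: ei))).
      exact: cd_cts (caff s).
    apply: cd_cts (fd_line (fG _ _)). rewrite [x + d%:C *: el + _]addrAC [_ + d%:C *: el - _]addrAC.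
    apply: le_lt_trans (vnD _ _) _; rewrite vnZ vn_delta mulr1 normc_real gtr0_norm //. have := in3 _ _ hx hs; lra.
  have [r1 r10 h1] := c1 _ de; have [r2 r20 h2] := c2 _ de.
  exists (minr (minr r1 r2) (3 - nc s)); first by rewrite !lt_min r10 r20 subr_gt0.
  move=> t; rewrite !lt_min => /andP[/andP[/h1 k1 /h2 k2] k3]. have ht : nc t < 3 by have := ler_normcD (t - s) s; rewrite subrK; lra.
  have := q _ ht; have := q _ hs; move: k1 k2.
  set a1 := f _; set a2 := f _; set b1 := f _; set b2 := f _; set g2 := G _ 0 l; set g1 := G _ 0 l. move=> k1 k2 k4 k5.
  have : nc (d%:C * (g1 - g2)) < d * e.
    have -> : d%:C * (g1 - g2) = ((b1 - b2) - (a1 - a2)) - (b1 - a1 - d%:C * g1) + (b2 - a2 - d%:C * g2).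
      ring.
    have := ler_normcD ((b1 - b2) - (a1 - a2) - (b1 - a1 - d%:C * g1)) (b2 - a2 - d%:C * g2).
    have := ler_normcB ((b1 - b2) - (a1 - a2)) (b1 - a1 - d%:C * g1). have := ler_normcB (b1 - b2) (a1 - a2). have : 0 < d * e by pos. nlra.
  by rewrite normcM normc_real gtr0_norm // ltr_pM2l.
pose S x (z : C) := x + (r%:C * z) *: ei; pose k (z : C) := kern z 2 0.
have cker : ctsq k by move=> z zs; apply: cts_kern => //; rewrite normc0; lra. have kle (z : C) : onsq z -> nc (k z) <= 4.
  move=> zs; have := kern_le 2 zs (_ : nc 0 < 1 / 2). by rewrite normc0 (_ : 2 ^+ 2 = 4 :> R); [apply; lra|rewrite expr2; ring].
have repr x : vn (x - x0) < rho / 4 -> r%:C * G x 0 i * c0 = sq (fun z => f (S x z) * k z).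
  move=> hx; have := @cauchy_deriv _ (fun s => f (S x s)) (fun s => r%:C * G (S x s) 0 i) _ _ 0.
  rewrite /S mulr0 scale0r addr0 normc0; apply=> [s hs|s hs|]; last by lra.
    have h : cd (fun t => f (x + t *: ei)) (r%:C * s) (G (S x s) 0 i).
      by rewrite -dot_delta; apply: fd_line; apply: fG; have := in3 _ _ hx hs; rewrite /S; lra.
    by apply: cd_ext (cd_comp (caff s) h) => //; exact: mulrC.
  by apply: ctsM; [exact: cts_cst|exact: cG].
have cff x : vn (x - x0) < rho / 4 -> ctsq (fun z => f (S x z) * k z).
  move=> hx z zs; apply: ctsM (cker _ zs); apply: (@cts_comp _ (fun t => r%:C * t) (fun t => f (x + t *: ei))).
    exact: cd_cts (caff z).
  by apply: cd_cts (fd_line (fG _ _)); have := in3 _ _ hx (onD _ zs); lra.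
pose g' x : 'rV[C]_m := \row_l ((r%:C * c0)^-1 * sq (fun z => G (S x z) 0 l * k z)). have cn := @c0_neq0 R.
exists g' => [x hx e e0|x hx]; last first.
  have [/(_ (delta_mx 0 i))] := H x ltac:(lra); by rewrite dot_delta vn_delta mulr1.
pose L : R := nc ((r%:C * c0)^-1) * (16 * (K * 4)). have L0 : 0 <= L by pos. have L1 : 0 < L + 1 by lra.
exists (minr (e / (L + 1)) (minr (rho / 12) (rho / 4 - vn (x - x0)))).
  by rewrite !lt_min divr_gt0 //= subr_gt0 hx andbT; lra.
move=> h; rewrite !lt_min ltr_pdivlMr // => /andP[he /andP[h12 hr]]. have hxh : vn (x + h - x0) < rho / 4.
  by rewrite addrAC; apply: le_lt_trans (vnD _ _) _; lra.
have cGk l : ctsq (fun z => G (S x z) 0 l * k z).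
  by move=> z zs; apply: ctsM (cker _ zs); exact: cG (onD _ zs).
have cS l : ctsq (fun z => h 0 l * (G (S x z) 0 l * k z)).
  by move=> z zs; apply: ctsM (cGk l z zs); exact: cts_cst.
have dE : (fun z => dot (G (S x z)) h * k z) = fun z => \sum_l h 0 l * (G (S x z) 0 l * k z).
  by apply/funext => z; rewrite mulr_suml; apply: eq_bigr => l _; ring.
have cD : ctsq (fun z => dot (G (S x z)) h * k z).
  by rewrite dE => z zs; apply: cts_sum => l; exact: cS.
have c2 : ctsq (fun z => f (S (x + h) z) * k z - f (S x z) * k z).
  by move=> z zs; apply: ctsB; apply: cff zs.
pose I z := (f (S (x + h) z) - f (S x z) - dot (G (S x z)) h) * k z.
have dI : I = fun z => f (S (x + h) z) * k z - f (S x z) * k z - dot (G (S x z)) h * k z.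
  by apply/funext => z; rewrite /I; ring.
have -> : G (x + h) 0 i - G x 0 i - dot (g' x) h = (r%:C * c0)^-1 * sq I.
  have -> : dot (g' x) h = (r%:C * c0)^-1 * sq (fun z => dot (G (S x z)) h * k z).
    by rewrite dE sq_sum // mulr_sumr; apply: eq_bigr => l _; rewrite mxE sqZ //; ring.
  rewrite dI (sqB c2 cD) sqB; [|exact: cff..]. by rewrite -!repr //; field; apply/andP.
rewrite normcM. have bnd : nc (sq I) <= 16 * (K * vn h ^+ 2 * 4).
  apply: sq_le => [z zs|z zs]; first by rewrite dI; exact: ctsB (c2 z zs) (cD z zs). rewrite normcM; apply: ler_pM; rewrite ?kle //.
  have [_ /(_ h h12)] := H _ (in3 _ _ hx (onD _ zs)). by rewrite /S [x + h + _]addrAC.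
apply: le_trans (ler_wpM2l (normc_ge0 _) bnd) _. have -> : nc ((r%:C * c0)^-1) * (16 * (K * vn h ^+ 2 * 4)) = L * vn h * vn h.
  by rewrite /L expr2; ring.
rewrite ler_wpM2r //; have := vn_ge0 h; nra.
Qed.
End VectorNorm.
#[local] Hint Extern 0 (is_true (@Order.le _ _ _ (vn _))) => exact: vn_ge0 : core.

(** * Polynomials and Taylor expansion in several variables *)

Section Polynomials.
Context {R : realType}.
Local Notation C := R[i].
Variable m : nat.
Implicit Types (x y v h g : 'rV[C]_m) (K : {ffun 'I_m -> nat}).
Implicit Types (f : 'rV[C]_m -> C) (G : 'rV[C]_m -> 'rV[C]_m).
Definition mon K x : C := \prod_i x 0 i ^+ K i.
Definition mdg K := (\sum_i K i)%N.
(** Lists of coefficients with exponents, repetitions allowed, so that derivation, integration and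
    truncation are operations on lists. *)
Definition polyf := seq (C * {ffun 'I_m -> nat}).
Definition peval (p : polyf) x : C := \sum_(u <- p) u.1 * mon u.2 x.
Definition raise (i : 'I_m) K : {ffun 'I_m -> nat} := [ffun j => (K j + (j == i))%N].
Definition lower (i : 'I_m) K : {ffun 'I_m -> nat} := [ffun j => (K j - (j == i))%N].
Lemma mon_scale K (s : C) x : mon K (s *: x) = s ^+ mdg K * mon K x.
rewrite /mon /mdg expr_sum -big_split; apply: eq_bigr => i _ /=. by rewrite mxE exprMn.
Qed.
Lemma mon_raise i K x : mon (raise i K) x = x 0 i * mon K x.
rewrite /mon (bigD1 i) //= [in RHS](bigD1 i) //= ffunE eqxx addn1 exprS mulrA.
by congr (_ * _); apply: eq_bigr => j /negbTE ji; rewrite ffunE ji addn0.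
Qed.
Lemma mdg_raise i K : mdg (raise i K) = (mdg K).+1.
rewrite /mdg (bigD1 i) //= [in RHS](bigD1 i) //= ffunE eqxx addn1 addSn.
by congr (_ + _).+1; apply: eq_bigr => j /negbTE ji; rewrite ffunE ji addn0.
Qed.
Lemma peval_cons u p x : peval (u :: p) x = u.1 * mon u.2 x + peval p x.
by rewrite /peval big_cons. Qed.
 Lemma fd_add f1 f2 x g1 g2 : fd f1 x g1 -> fd f2 x g2 -> fd (fun y => f1 y + f2 y) x (g1 + g2).
move=> H1 H2 e e0; have e2 : 0 < e / 2 by lra. have [r r0 Hr] := H1 _ e2; have [q q0 Hq] := H2 _ e2. exists (minr r q); first by pos.
move=> h /lt_minP[/Hr h1 /Hq h2]. have -> : dot (g1 + g2) h = dot g1 h + dot g2 h.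
  by rewrite /dot -big_split; apply: eq_bigr => i _; rewrite mxE mulrDl.
rewrite (_ : _ - _ = (f1 (x + h) - f1 x - dot g1 h) + (f2 (x + h) - f2 x - dot g2 h)); last by ring.
by apply: le_trans (ler_normcD _ _) _; lra.
Qed.
Lemma fd_mul f1 f2 x g1 g2 : fd f1 x g1 -> fd f2 x g2 ->
  fd (fun y => f1 y * f2 y) x (f2 x *: g1 + f1 x *: g2).
move=> H1 H2 e e0. pose a := nc (f1 x) + 1; pose b := nc (f2 x) + 1; pose c := vn g1 + 1.
have a0 := normc_ge0 (f1 x); have b0 := normc_ge0 (f2 x); have c0 := vn_ge0 g1. have s0 : 0 < a + b + c by pos.
have es : 0 < e / (a + b + c) by pos. have [r r0 Hr] := H1 _ (ltr01). have [r1 r10 Hr1] := H1 _ es. have [q q0 Hq] := H2 _ es.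
have [q1 q10 Hq1] := fd_cts H2 es. have [q2 q20 Hq2] := fd_cts H2 (ltr01). exists (minr (minr r1 q) (minr q1 q2)); first by pos.
move=> h; rewrite !lt_min => /andP[/andP[/Hr1 h1 /Hq h2] /andP[hq1 hq2]].
have h3 : nc (f2 (x + h) - f2 x) < e / (a + b + c) by apply: Hq1; rewrite addrAC subrr add0r.
have h4 : nc (f2 (x + h) - f2 x) < 1 by apply: Hq2; rewrite addrAC subrr add0r.
have -> : dot (f2 x *: g1 + f1 x *: g2) h = f2 x * dot g1 h + f1 x * dot g2 h.
  by rewrite /dot 2!mulr_sumr -big_split /=; apply: eq_bigr => i _; rewrite !mxE; ring.
rewrite (_ : _ - _ = (f1 (x + h) - f1 x - dot g1 h) * f2 (x + h)
  + dot g1 h * (f2 (x + h) - f2 x) + f1 x * (f2 (x + h) - f2 x - dot g2 h)); last by ring.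
set k := e / (a + b + c) in es h1 h2 h3. have v0 := vn_ge0 h.
have f2b : nc (f2 (x + h)) <= b by have := lerB_normc (f2 (x + h)) (f2 x); rewrite /b; lra.
have t1 : nc ((f1 (x + h) - f1 x - dot g1 h) * f2 (x + h)) <= k * vn h * b.
  by rewrite normcM ler_pM.
have t2 : nc (dot g1 h * (f2 (x + h) - f2 x)) <= c * vn h * k.
  rewrite normcM ler_pM //; last exact: ltW. by apply: le_trans (dot_le _ _) _; rewrite ler_wpM2r // /c; lra.
have t3 : nc (f1 x * (f2 (x + h) - f2 x - dot g2 h)) <= a * (k * vn h).
  by rewrite normcM ler_pM // /a; lra.
apply: le_trans (ler_normcD _ _) _. have : e * vn h = k * vn h * b + c * vn h * k + a * (k * vn h).
  by rewrite /k; field; rewrite gt_eqF.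
have := ler_normcD ((f1 (x + h) - f1 x - dot g1 h) * f2 (x + h)) (dot g1 h * (f2 (x + h) - f2 x)). lra.
Qed.
Lemma fd_ext f1 f2 x g : f1 =1 f2 -> fd f1 x g -> fd f2 x g.
by move=> /boolp.funext ->. Qed.
 Lemma fd_cst (a : C) x : fd (fun=> a) x 0.
move=> e e0; exists 1 => // h _; rewrite subrr /dot big1 ?subr0 ?normc0.
  by pos.
by move=> i _; rewrite mxE mul0r.
Qed.
Lemma fd_coord i x : fd (fun y => y 0 i) x (delta_mx 0 i).
move=> e e0; exists 1 => // h _. have -> : dot (delta_mx 0 i) h = h 0 i.
  rewrite /dot (bigD1 i) //= big1 => [|j /negbTE ji]; last by rewrite mxE ji andbF mul0r. by rewrite mxE !eqxx mul1r addr0.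
by rewrite mxE [_ + h 0 i]addrC addrK subrr normc0 mulr_ge0 // ltW.
Qed.
Lemma fd_mon K x : exists g, fd (mon K) x g.
have pw i k : exists g, fd (fun y : 'rV[C]_m => y 0 i ^+ k) x g.
  elim: k => [|k [g IH]]; first by exists 0; exact: fd_cst. exists (x 0 i ^+ k *: delta_mx 0 i + x 0 i *: g).
  by apply: fd_ext (fd_mul (fd_coord i x) IH) => y; rewrite exprS.
have : exists g, fd (fun y => \prod_(i <- index_enum 'I_m) y 0 i ^+ K i) x g; last by []. elim: (index_enum _) => [|i s [g IH]].
  by exists 0; apply: fd_ext (fd_cst 1 x) => y; rewrite big_nil.
have [g' hg'] := pw i (K i). exists ((\prod_(i <- s) x 0 i ^+ K i) *: g' + (x 0 i ^+ K i) *: g).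
by apply: fd_ext (fd_mul hg' IH) => y; rewrite big_cons.
Qed.
Lemma cd_coord x v i s : cd (fun t => (x + t *: v) 0 i) s (v 0 i).
have := fd_line (fd_coord i (x + s *: v)); congr (cd _ _ _).
rewrite /dot (bigD1 i) //= big1 => [|j /negbTE ji]; last by rewrite mxE ji andbF mul0r. by rewrite mxE !eqxx mul1r addr0.
Qed.
Definition pder (i : 'I_m) (p : polyf) : polyf :=
  [seq (u.1 * (u.2 i)%:R, lower i u.2) | u : C * {ffun 'I_m -> nat} <- p].
Lemma mon_partial K x i g : fd (mon K) x g -> g 0 i = (K i)%:R * mon (lower i K) x.
move=> hg; rewrite -dot_delta. apply: (@cd_unique _ (fun t => mon K (x + t *: delta_mx 0 i)) 0).
  by apply: fd_line; rewrite scale0r addr0.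
pose c := \prod_(j | j != i) x 0 j ^+ K j. have := cdX (K i) (cd_coord x (delta_mx 0 i) i 0) => /(cdZ c).
rewrite !mxE !eqxx mulr1 mul0r addr0; apply: cd_ext => [t|].
  rewrite /mon [in RHS](bigD1 i) //= mulrC; congr (_ * _). by apply: eq_bigr => j /negbTE ji; rewrite !mxE ji andbF mulr0 addr0.
rewrite /mon [in RHS](bigD1 i) //= ffunE eqxx subn1 /c mulrC mulrA; congr (_ * _).
by apply: eq_bigr => j /negbTE ji; rewrite ffunE ji subn0.
Qed.
Definition pgrad (p : polyf) x : 'rV[C]_m := \row_i peval (pder i p) x.
Lemma fd_peval p x : fd (peval p) x (pgrad p x).
elim: p => [|u p IH].
  have -> : pgrad [::] x = 0 by apply/rowP => i; rewrite !mxE /peval big_nil. by apply: fd_ext (fd_cst 0 x) => y; rewrite /peval big_nil.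
have [g hg] := fd_mon u.2 x. have := fd_add (fd_mul (fd_cst u.1 x) hg) IH.
have -> : mon u.2 x *: (0 : 'rV[C]_m) + u.1 *: g + pgrad p x = pgrad (u :: p) x.
  apply/rowP => i; rewrite !mxE mulr0 add0r /pder /= peval_cons /=; congr (_ + _). by rewrite (mon_partial i hg) mulrA.
by apply: fd_ext => y; rewrite peval_cons.
Qed.
(** The radial integral $\int_0^1 x_i\,p(sx)\,ds$, monomial by monomial. *)
Definition intp (i : 'I_m) (p : polyf) : polyf :=
  [seq (u.1 / (mdg u.2).+1%:R, raise i u.2) | u : C * {ffun 'I_m -> nat} <- p].
Lemma cd_intp i p x s :
  cd (fun t => peval (intp i p) (t *: x)) s (x 0 i * peval p (s *: x)).
elim: p => [|u p IH].
  apply: cd_ext (cd_cst 0 s) => [t|]; rewrite /peval big_nil //. by rewrite mulr0.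
have n0 : (mdg u.2).+1%:R != 0 :> C by rewrite pnatr_eq0.
apply: cd_ext (cdD (cdZ (u.1 / (mdg u.2).+1%:R * (x 0 i * mon u.2 x)) (cdX (mdg u.2).+1 (cd_id s))) IH).
  move=> t; rewrite /intp /= peval_cons /=; congr (_ + _). by rewrite mon_scale mon_raise mdg_raise; ring.
rewrite peval_cons mon_scale mulr1 mulrDr /=; congr (_ + _).
transitivity ((mdg u.2).+1%:R / (mdg u.2).+1%:R * (x 0 i * (u.1 * (s ^+ mdg u.2 * mon u.2 x)))).
  by ring.
by rewrite divff // mul1r.
Qed.
Lemma lipschitz : exists2 A : R, 0 <= A & forall f G x0 (rho B : R), 0 < rho ->
    grads f G x0 rho -> (forall x, vn (x - x0) < rho -> nc (f x) <= B) ->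
  forall x y, vn (x - x0) < rho / 2 -> vn (y - x0) < rho / 2 ->
    nc (f x - f y) <= A * B / rho * vn (x - y).
have [A A0 HA] := @second_order R; exists A => // f G x0 rho B r0 fG fB x y hx hy.
have inb s : in01 s -> vn (y + s%:C *: (x - y) - x0) < rho / 2.
  move=> /andP[s0 s1]. have -> : y + s%:C *: (x - y) - x0 = (1 - s)%:C *: (y - x0) + s%:C *: (x - x0).
    by apply/rowP => i; rewrite !mxE rmorphB rmorph1 /=; ring.
  apply: le_lt_trans (vnD _ _) _; rewrite !vnZ !normc_real !ger0_norm ?subr_ge0 //. have [s1'|s1'] := ltrP s 1.
    have : (1 - s) * vn (y - x0) < (1 - s) * (rho / 2) by rewrite ltr_pM2l // subr_gt0.
    have : s * vn (x - x0) <= s * (rho / 2) by rewrite ler_wpM2l // ltW. lra.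
  have -> : s = 1 by lra. by rewrite subrr mul0r add0r mul1r.
have := @cd_mvt _ (fun t => f (y + t *: (x - y))) (fun t => dot (G (y + t *: (x - y))) (x - y)) 0 1 (A * B / rho * vn (x - y)).
rewrite scale1r scale0r addr0 [y + _]addrC subrK subr0 normc1 mulr1; apply => s s01.
  rewrite /seg add0r subr0 mulr1; apply: fd_line; apply: fG; have := inb _ s01; lra.
rewrite /seg add0r subr0 mulr1; have [h _] := HA _ f G x0 rho B r0 fG fB _ (inb _ s01). exact: h.
Qed.
(** Induction on the order by integration along rays, $f(x)-f(0)=\int_0^1\sum_i
    x_i\,\partial_if(sx)\,ds$: each partial derivative is again holomorphic and bounded on a smaller
    ball. *)
Lemma taylor_poly k f G (rho B : R) : 0 < rho -> grads f G 0 rho ->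
    (forall x, vn x < rho -> nc (f x) <= B) ->
  exists p : polyf, exists D r : R, [/\ 0 <= D, 0 < r &
    forall x, vn x < r -> nc (f x - peval p x) <= D * vn x ^+ k].
elim: k f G rho B => [|k IH] f G rho B r0 fG fB.
  exists [::], B, rho; split=> //.
    by apply: le_trans (fB 0 _); rewrite // vn0.
  by move=> x /fB; rewrite /peval big_nil subr0 expr0 mulr1.
have fB' x : vn (x - 0) < rho -> nc (f x) <= B by rewrite subr0; exact: fB. have [A A0 HA] := @partial_holomorphic R.
have /boolp.choice[p Hp] i : exists p : polyf, exists D r : R, [/\ 0 <= D, 0 < r &
    forall x, vn x < r -> nc (G x 0 i - peval p x) <= D * vn x ^+ k].
  have [G' h1 h2] := HA _ f G 0 rho B r0 fG fB' i. apply: (IH _ G' (rho / 4) (A * B / rho)) => // [|x hx]; first by lra.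
  by apply: h2; rewrite subr0.
have /boolp.choice[D /boolp.choice[r Hr]] := Hp.
pose p' : polyf := (f 0, [ffun=> 0%N]) :: flatten [seq intp i (p i) | i <- index_enum 'I_m]. pose r' := \big[minr/rho]_i r i.
have r'0 : 0 < r'.
  rewrite /r'; elim/big_ind: _ => // [x y x0 y0|i _]; first by pos. by have [] := Hr i.
have r'le i : r' <= r i by rewrite /r' (bigD1 i) //= ge_min lexx. have r'rho : r' <= rho.
  rewrite /r'; elim: (index_enum _) => [|i s IHs]; first by rewrite big_nil. by rewrite big_cons ge_min IHs orbT.
exists p', (\sum_i D i), r'; split=> //; first by apply: sumr_ge0 => i _; have [] := Hr i. move=> x hx.
have p'E y : peval p' y = f 0 + \sum_i peval (intp i (p i)) y.
  rewrite peval_cons /= /mon big1 ?mulr1 => [|i _]; last by rewrite ffunE expr0. by congr (_ + _); rewrite /peval big_flatten big_map.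
have inb s : in01 s -> vn (s%:C *: x) < r'.
  move=> /andP[s0 s1]; rewrite vnZ normc_real ger0_norm //. apply: le_lt_trans hx; rewrite -[leRHS]mul1r ler_wpM2r //.
pose F t := f (t *: x) - peval p' (t *: x). pose F' t := \sum_i x 0 i * (G (t *: x) 0 i - peval (p i) (t *: x)).
have := @cd_mvt _ F F' 0 1 ((\sum_i D i) * vn x ^+ k.+1). rewrite /F subr0 normc1 mulr1 scale1r scale0r !p'E.
have -> : f 0 - (f 0 + \sum_i peval (intp i (p i)) 0) = 0.
  rewrite opprD addrA subrr sub0r big1 ?oppr0 // => i _. rewrite /peval big_map big1 // => u _ /=; rewrite mon_raise mxE mul0r mulr0 //.
rewrite subr0; apply => s s01.
  rewrite /seg add0r subr0 mulr1. have h1 : cd (fun t => f (0 + t *: x)) s%:C (dot (G (0 + s%:C *: x)) x).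
    by apply: fd_line; apply: fG; rewrite add0r subr0; have := inb _ s01; lra.
  have h2 : cd (fun t => f 0 + \sum_i peval (intp i (p i)) (t *: x)) s%:C (0 + \sum_i x 0 i * peval (p i) (s%:C *: x)).
    by apply: cdD; [exact: cd_cst|apply: cd_sum => i; exact: cd_intp].
  apply: cd_ext (cdB h1 h2) => [t|]; first by rewrite add0r p'E. rewrite add0r add0r /dot /F' -sumrB; apply: eq_bigr => i _; ring.
rewrite /seg add0r subr0 mulr1 /F'; apply: le_trans (ler_normc_sum _ _ _) _.
rewrite mulr_suml; apply: ler_sum => i _; rewrite normcM exprS mulrCA.
have [D0 _ /(_ (s%:C *: x))] := Hr i; move=> /(_ (lt_le_trans (inb _ s01) (r'le i))) h. apply: ler_pM; rewrite ?vn_coord //.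
apply: le_trans h _; rewrite ler_wpM2l //. rewrite lerXn2r ?nnegrE // vnZ normc_real; move: s01 => /andP[s0 s1].
by rewrite ger0_norm // -[leRHS]mul1r ler_wpM2r.
Qed.
(** Cauchy's estimate on the ball of radius |x| around x, where f is bounded by $D(2|x|)^{k+1}$; the
    point 0 has no such ball and is treated apart. *)
Lemma vanish_partial k f G (rho B D r : R) : 0 < rho -> grads f G 0 rho ->
    (forall x, vn x < rho -> nc (f x) <= B) -> 0 < r -> 0 <= D ->
    (forall x, vn x < r -> nc (f x) <= D * vn x ^+ k.+1) ->
  exists D' r' : R, [/\ 0 <= D', 0 < r' &
    forall i x, vn x < r' -> nc (G x 0 i) <= D' * vn x ^+ k].
move=> r0 fG fB rr0 D0 fD; have [A A0 HA] := @second_order R. have B0 : 0 <= B by apply: le_trans (fB 0 _); rewrite // vn0.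
pose q := minr rho r / 2; have m0 : 0 < minr rho r by pos. have q0 : 0 < q by pos. have qrho : 2 * q <= rho.
  have : minr rho r <= rho by rewrite ge_min lexx. by rewrite /q; lra.
have qr : 2 * q <= r.
  have : minr rho r <= r by rewrite ge_min lexx orbT. by rewrite /q; lra.
pose D' := A * B / rho + A * D * 2 ^+ k.+1. have p2 n : 0 <= (2 : R) ^+ n by pos. have D'0 : 0 <= A * D * 2 ^+ k.+1 by pos.
have AB : 0 <= A * B / rho by pos. exists D', q; split=> //; first by rewrite /D'; lra. move=> i x hx; have [->|x0] := eqVneq x 0.
  have f00 : f 0 = 0.
    apply/eqP; rewrite -normc_eq0 eq_le normc_ge0 andbT. by apply: le_trans (fD 0 _) _; rewrite vn0 // expr0n mulr0.
  have [k0|k0] := eqVneq k 0%N.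
    rewrite k0 expr0 mulr1. have h1 y : vn (y - 0) < rho -> nc (f y) <= B by rewrite subr0; exact: fB.
    have h2 : vn (0 - 0 : 'rV[C]_m) < rho / 2 by rewrite subr0 vn0; lra. have [h _] := HA _ f G 0 rho B r0 fG h1 0 h2.
    have := h (delta_mx 0 i); rewrite dot_delta vn_delta mulr1 => /le_trans; apply. by rewrite /D'; lra.
  have G0 : G 0 = 0.
    apply: (@fd_unique _ _ f 0); first by apply: fG; rewrite subr0 vn0. move=> e e0; have D1 : 0 < D + 1 by lra.
    exists (minr r (minr 1 (e / (D + 1)))); first by pos. move=> h; rewrite !lt_min ltr_pdivlMr // => /andP[h1 /andP[h2 h3]].
    rewrite add0r f00 subr0 (_ : dot 0 h = 0) ?subr0; last first.
      by rewrite /dot big1 // => j _; rewrite mxE mul0r.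
    apply: le_trans (fD _ h1) _; have v0 := vn_ge0 h. have : vn h ^+ k.+1 <= vn h * vn h.
      case: k {fD D' D'0} k0 => // k _; rewrite !exprS mulrA -[leRHS]mulr1. by rewrite ler_wpM2l ?mulr_ge0 // exprn_ile1 // ltW.
    nra.
  by rewrite G0 mxE normc0 vn0 expr0n (negbTE k0) mulr0.
have xp := x0; rewrite -vn_gt0 in xp. have inb y : vn (y - x) < vn x -> vn y < 2 * vn x.
  by move=> h; have := vnD (y - x) x; rewrite subrK; lra.
have h1 : grads f G x (vn x) by move=> y /inb hy; apply: fG; rewrite subr0; lra.
have h2 y : vn (y - x) < vn x -> nc (f y) <= D * (2 * vn x) ^+ k.+1.
  move=> /inb hy; apply: le_trans (fD _ _) _; first by lra. by rewrite ler_wpM2l // lerXn2r ?nnegrE // ltW // mulr_gt0.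
have h3 : vn (x - x) < vn x / 2 by rewrite subrr vn0; lra. have [h _] := HA _ f G x (vn x) _ xp h1 h2 x h3.
have := h (delta_mx 0 i); rewrite dot_delta vn_delta mulr1 => /le_trans; apply.
rewrite exprMn [vn x ^+ k.+1]exprS (_ : _ / vn x = A * D * 2 ^+ k.+1 * vn x ^+ k); last first.
  by set a := 2 ^+ k.+1; field; rewrite gt_eqF.
by rewrite ler_wpM2r ?exprn_ge0 // /D'; lra.
Qed.
End Polynomials.

(** * The complex exponential and the density of $\mathbb Z+\mathbb Z\sqrt2$ *)

Section Exponential.
Context {R : realType}.
Local Notation C := R[i].
Lemma is_derive_le (f : R -> R) x d : is_derive x (1 : R) f d -> forall e : R, 0 < e ->
  somepos r, forall t, `|t - x| < r -> `|f t - f x - (t - x) * d| <= e * `|t - x|.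
move=> [df Df] e e0; have := df; rewrite /derivable => /cvg_ex[l /= Hl]. have lE : l = d.
  by rewrite -Df /derive; apply/esym/cvg_lim.
move: Hl; rewrite lE => /cvgrPdist_le /(_ _ e0). rewrite /dnbhs near_withinE => /nbhs_ballP[r /= r0 Hr]. exists r => // t tr.
have [->|ts] := eqVneq t x; first by rewrite !subrr mul0r subr0 normr0 mulr0. have ts0 : t - x != 0 by rewrite subr_eq0.
have := Hr (t - x); rewrite /ball /= sub0r normrN => /(_ tr ts0). rewrite scaler1 subrK /= => h.
have -> : f t - f x - (t - x) * d = - (t - x) * (d - (t - x)^-1 * (f t - f x)) by field. by rewrite normrM normrN mulrC ler_pM2r ?normr_gt0.
Qed.
Definition cexp (z : C) : C := (expR (Re z))%:C * (cos (Im z) +i* sin (Im z)).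
Lemma cexpD z w : cexp (z + w) = cexp z * cexp w.
rewrite /cexp ReD ImD expRD cosD sinD rmorphM /=.
rewrite (_ : (_ +i* _) = (cos (Im z) +i* sin (Im z)) * (cos (Im w) +i* sin (Im w))); first by ring.
by apply/eqP; rewrite eq_complex /=; apply/andP; split; apply/eqP; ring.
Qed.
Lemma cexp0 : cexp 0 = 1.
by rewrite /cexp /= expR0 cos0 sin0 mul1r. Qed.
 Lemma normc_cexp z : nc (cexp z) = expR (Re z).
by rewrite /cexp normcM normc_real ger0_norm ?expR_ge0 // /nc cos2Dsin2 sqrtr1 mulr1.
Qed.
Lemma cexp_neq0 z : cexp z != 0.
by rewrite -normc_gt0 normc_cexp expR_gt0. Qed.
 Lemma cexpN z : cexp (- z) = (cexp z)^-1.
have h : cexp z * cexp (- z) = 1 by rewrite -cexpD subrr cexp0. by rewrite (mulr1_eq h).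
Qed.
Lemma cexpB z w : cexp (z - w) = cexp z / cexp w.
by rewrite cexpD cexpN. Qed.
 Lemma cexp_nat z n : cexp (n%:R * z) = cexp z ^+ n.
elim: n => [|n IH]; first by rewrite mul0r cexp0. by rewrite -natr1 mulrDl mul1r cexpD IH exprSr.
Qed.
Lemma cexp_sum (I : Type) (r : seq I) (F : I -> C) :
  cexp (\sum_(i <- r) F i) = \prod_(i <- r) cexp (F i).
by elim: r => [|i r IH]; rewrite ?big_nil ?cexp0 // !big_cons cexpD IH.
Qed.
Definition pii : C := 0 +i* (pi *+ 2).
Lemma cexp_2pi : cexp pii = 1.
by rewrite /cexp /= expR0 cos2pi sin2pi mul1r. Qed.
 Lemma cexp_real (x : R) : cexp x%:C = (expR x)%:C.
by rewrite /cexp /= cos0 sin0 mulr1. Qed.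
 Lemma cd_cexp z : cd cexp z (cexp z).
suff h : cd cexp 0 1.
  have ds : cd (fun w => w - z) z 1.
    by apply: cd_ext (cdB (cd_id z) (cd_cst z z)) => //; rewrite subr0.
  rewrite -(subrr z) in h; apply: cd_ext (cdZ (cexp z) (cd_comp ds h)) => [w|].
    by rewrite -cexpD addrC subrK.
  by rewrite !mulr1.
apply/cdP => e e0; pose d := minr (e / 16) 1. have d0 : 0 < d by pos. have d1 : d <= 1 by rewrite ge_min lexx orbT.
have de : d <= e / 16 by rewrite ge_min lexx. clearbody d. have [r1 r10 H1] := is_derive_le (is_derive_expR (0 : R)) d0.
have [r2 r20 H2] := is_derive_le (is_derive_cos (0 : R)) d0. have [r3 r30 H3] := is_derive_le (is_derive_sin (0 : R)) d0.
exists (minr (minr r1 d) (minr r2 r3)); first by pos. case=> x y; rewrite !subr0 mul1r !lt_min => /andP[/andP[n1 nd] /andP[n2 n3]].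
have nx := ler_Re_normc (x +i* y); have ny := ler_Im_normc (x +i* y).
rewrite /= -/(nc (x +i* y)) in nx ny; set nn := nc (x +i* y) in n1 nd n2 n3 nx ny *. have {}H1 := H1 x; rewrite subr0 expR0 mulr1 in H1.
have {}H2 := H2 y; rewrite subr0 cos0 sin0 oppr0 mulr0 subr0 in H2. have {}H3 := H3 y; rewrite subr0 sin0 cos0 mulr1 subr0 in H3.
have h1 := H1 (le_lt_trans nx n1); have h2 := H2 (le_lt_trans ny n2). have h3 := H3 (le_lt_trans ny n3).
have x0 := normr_ge0 x; have y0 := normr_ge0 y. have E1 : `|expR x - 1| <= 2 * `|x|.
  have -> : expR x - 1 = (expR x - 1 - x) + x by ring. by apply: le_trans (ler_normD _ _) _; nra.
have E2 : `|expR x| <= 3.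
  have -> : expR x = (expR x - 1) + 1 by ring. by apply: le_trans (ler_normD _ _) _; rewrite normr1; lra.
rewrite cexp0; apply: le_trans (ler_normc_ReIm _) _. rewrite /cexp !ReB !ImB Re_realM Im_realM /= subr0.
have A : `|expR x * cos y - 1 - x| <= 4 * d * nn.
  have -> : expR x * cos y - 1 - x = expR x * (cos y - 1) + (expR x - 1 - x) by ring. apply: le_trans (ler_normD _ _) _; rewrite normrM.
  have : `|expR x| * `|cos y - 1| <= 3 * (d * `|y|) by rewrite ler_pM. have : d * `|y| <= d * nn by rewrite ler_wpM2l // ltW.
  have : d * `|x| <= d * nn by rewrite ler_wpM2l // ltW. lra.
have B : `|expR x * sin y - y| <= 5 * d * nn.
  have -> : expR x * sin y - y = expR x * (sin y - y) + (expR x - 1) * y by ring. apply: le_trans (ler_normD _ _) _; rewrite !normrM.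
  have : `|expR x| * `|sin y - y| <= 3 * (d * `|y|) by rewrite ler_pM.
  have : `|expR x - 1| * `|y| <= (2 * `|x|) * `|y| by rewrite ler_wpM2r. have : d * `|y| <= d * nn by rewrite ler_wpM2l // ltW.
  have : `|x| * `|y| <= d * nn by rewrite ler_pM //; lra. lra.
have : 0 <= e * nn by rewrite mulr_ge0 ?(ltW e0) ?normc_ge0. have : d * nn <= e / 16 * nn by rewrite ler_wpM2r // normc_ge0. lra.
Qed.
Lemma cexp_surj z : z != 0 -> exists w, cexp w = z.
move=> z0; have n0 := z0; rewrite -normc_gt0 in n0. pose u := Re z / nc z; pose v := Im z / nc z. have uv : u ^+ 2 + v ^+ 2 = 1.
  have h : Re z ^+ 2 + Im z ^+ 2 = nc z ^+ 2.
    by case: {u v n0} z z0 => a b _ /=; rewrite sqr_sqrtr // addr_ge0 ?sqr_ge0.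
  rewrite /u /v !expr_div_n -mulrDl h divff // expf_neq0 // gt_eqF //.
have u1 : -1 <= u <= 1.
  by have := sqr_ge0 v => v2; apply/andP; split; nra.
have zE : z = (nc z)%:C * (u +i* v).
  apply/eqP; rewrite eq_complex Re_realM Im_realM /= /u /v. by apply/andP; split; apply/eqP; field; rewrite gt_eqF.
have ca : cos (acos u) = u by apply: acosK; rewrite in_itv. have sa : sin (acos u) = `|v|.
  rewrite sin_acos // (_ : 1 - u ^+ 2 = v ^+ 2) ?sqrtr_sqr //; lra.
exists (ln (nc z) +i* (if 0 <= v then acos u else - acos u)). rewrite [RHS]zE /cexp /= lnK ?posrE //; congr (_ * _); congr Complex.
  by case: ifP => _; rewrite ?cosN.
case: ifPn => [v0|]; first by rewrite sa ger0_norm. by rewrite -ltNge => v0; rewrite sinN sa ltr0_norm // opprK.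
Qed.
(** The powers of $\sqrt2-1$ lie in $\mathbb Z+\mathbb Z\sqrt2$ and tend to 0; an integer multiple
    of a small one falls near x. *)
Lemma kronecker (s x e : R) : 0 < s -> 0 < e ->
  exists a b : int, `|s * (a%:~R + b%:~R * Num.sqrt 2) - x| < e.
move=> s0 e0; have q2 : (Num.sqrt 2 : R) ^+ 2 = 2 by rewrite sqr_sqrtr // ler0n. have q0 : 0 <= (Num.sqrt 2 : R) by pos.
pose u : R := Num.sqrt 2 - 1. have u0 : 0 < u by rewrite /u; nra. have u2 : u <= 1 / 2 by rewrite /u; nra.
have uk k : exists a b : int, u ^+ k = a%:~R + b%:~R * Num.sqrt 2.
  elim: k => [|k [a [b IH]]]; first by exists 1, 0; rewrite expr0 mul0r addr0.
  exists (2 * b - a), (a - b); rewrite exprS IH !rmorphB rmorphM /= rmorph_nat /u.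
  have q2' : Num.sqrt 2 * Num.sqrt 2 = 2 :> R by rewrite -expr2. ring: q2'.
have [k hk] := half_pow_small s e0. have uke : u ^+ k <= 1 / 2 ^+ k.
  rewrite (_ : 1 / 2 ^+ k = (1 / 2) ^+ k :> R); last by rewrite expr_div_n expr1n. have u0' := ltW u0; have h2 : (0 : R) <= 1 / 2 by lra.
  by rewrite lerXn2r.
have p0 : 0 < s * u ^+ k by pos. have pe : s * u ^+ k < e.
  by apply: le_lt_trans hk; rewrite ler_wpM2l ?(ltW s0) //; move: uke; rewrite mul1r.
have [a [b ab]] := uk k. pose m := Num.floor (x / (s * u ^+ k)). exists (m * a), (m * b).
have -> : s * ((m * a)%:~R + (m * b)%:~R * Num.sqrt 2) = m%:~R * (s * u ^+ k).
  by rewrite ab !rmorphM /=; ring.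
have h1 : m%:~R <= x / (s * u ^+ k) by apply: floor_le.
have h2 : x / (s * u ^+ k) < m%:~R + 1 by have := floorD1_gt (x / (s * u ^+ k)); rewrite rmorphD /=.
rewrite ler_pdivlMr // in h1; rewrite ltr_pdivrMr // in h2. rewrite ltr_norml; apply/andP; split; lra.
Qed.
End Exponential.

(** * Convex neighbourhoods of segments; the chain rule along curves *)

Section Tubes.
Context {R : realType}.
Local Notation C := R[i].
Definition cdv m (G : C -> 'rV[C]_m) s (d : 'rV[C]_m) := forall i, cd (fun u => G u 0 i) s (d 0 i).
Definition tube (a b : C) (d : R) (u : C) := exists s, in01 s /\ nc (u - seg a b s) < d.
Lemma tube_cvx a b d : cvx (tube a b d).
move=> u v s [s1 [h1 n1]] [s2 [h2 n2]] h; exists ((1 - s) * s1 + s * s2); split.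
  by move: h h1 h2 => /andP[? ?] /andP[? ?] /andP[? ?]; apply/andP; split; nra.
have -> : seg u v s - seg a b ((1 - s) * s1 + s * s2) = seg (u - seg a b s1) (v - seg a b s2) s.
  by rewrite /seg !rmorphD !rmorphM /= rmorphB rmorph1; ring.
by rewrite -[seg (_ - _) _ _]subr0; apply: segB_lt; rewrite ?subr0.
Qed.
Lemma tube_op a b d : op (tube a b d).
move=> u [s [hs n]]; exists (d - nc (u - seg a b s)); first by rewrite subr_gt0. move=> w nw; exists s; split=> //.
by have := ler_normc_dist w u (seg a b s); lra.
Qed.
Lemma tube_seg a b d s : 0 < d -> in01 s -> tube a b d (seg a b s).
by move=> d0 hs; exists s; rewrite subrr normc0. Qed.
 Lemma tube_in (P : C -> Prop) a b : (forall s, in01 s -> somepos r, forall u, nc (u - seg a b s) < r -> P u) ->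
  somepos d, forall u, tube a b d u -> P u.
move=> H. pose Q (x y : R) : Prop := somepos d, forall s u, x <= s <= y -> nc (u - seg a b s) < d -> P u.
have [d d0 Hd] : Q 0 1; last by exists d => // u [s [hs n]]; exact: Hd n. apply: cousin => [x y z _ xy yz _ [d1 d10 H1] [d2 d20 H2]|x hx].
  exists (minr d1 d2); first by pos. move=> s u /andP[h1 h2]; rewrite lt_min => /andP[n1 n2].
  by have [sy|ys] := leP s y; [apply: H1 n1; rewrite h1|apply: H2 n2; rewrite h2 ltW].
have [r r0 Hr] := H _ hx. have [d d0 Hd] := @seg_near _ a b x (r / 2) (ltac:(lra)).
exists d => // y z y0 yx xz z1 yz; exists (r / 2); first by lra. move=> s u /andP[h1 h2] nu; apply: Hr.
have : `|s - x| < d by rewrite ltr_norml; apply/andP; split; lra. by move=> /Hd; have := ler_normc_dist u (seg a b s) (seg a b x); lra.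
Qed.
Lemma seg_gap (f : R -> R) (r : R) :
  (forall s, in01 s -> forall e : R, 0 < e -> somepos d, forall t, in01 t -> `|t - s| < d -> `|f t - f s| < e) ->
  (forall s, in01 s -> f s < r) -> somepos g, forall s, in01 s -> f s + g <= r.
move=> cf H. pose Q (x y : R) : Prop := somepos g, forall s, x <= s <= y -> f s + g <= r. apply: (_ : Q 0 1).
apply: cousin => [x y z _ xy yz _ [d1 d10 H1] [d2 d20 H2]|x hx].
  exists (minr d1 d2); first by pos. move=> s /andP[h1 h2]; have [sy|ys] := leP s y.
    have := H1 s; rewrite h1 sy => /(_ isT). have : minr d1 d2 <= d1 by rewrite ge_min lexx. lra.
  have := H2 s; rewrite h2 ltW // => /(_ isT). have : minr d1 d2 <= d2 by rewrite ge_min lexx orbT. lra.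
have hr := H _ hx. have [d d0 Hd] := cf _ hx ((r - f x) / 2) (ltac:(lra)).
exists d => // y z y0 yx xz z1 yz; exists ((r - f x) / 2); first by lra. move=> s /andP[h1 h2].
have : `|s - x| < d by rewrite ltr_norml; apply/andP; split; lra. move=> /Hd; rewrite /in01 => /(_ (ltac:(apply/andP; split; lra))).
by rewrite ltr_norml => /andP[]; lra.
Qed.
Lemma seg_seg a b s t : seg a (seg a b s) t = seg a b (t * s) :> C.
by rewrite /seg rmorphM /=; ring. Qed.
 Lemma in01M (s t : R) : in01 s -> in01 t -> in01 (s * t).
by move=> /andP[? ?] /andP[? ?]; apply/andP; split; nra. Qed.
 Lemma vn_le_scale m (x y : 'rV[C]_m) (K : R) : (forall i, nc (x 0 i) <= K * nc (y 0 i)) -> vn x <= K * vn y.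
by move=> H; rewrite /vn mulr_sumr; apply: ler_sum. Qed.
 Lemma vn_cts m (G : C -> 'rV[C]_m) s : (forall i, cts (fun u => G u 0 i) s) ->
  forall e : R, 0 < e -> somepos d, forall u, nc (u - s) < d -> vn (G u - G s) < e.
move=> H e e0. have [d d0 Hd] : somepos d, forall i u, nc (u - s) < d -> nc (G u 0 i - G s 0 i) < e / m.+1%:R.
  suff : forall r : seq 'I_m, somepos d, forall i u, i \in r -> nc (u - s) < d -> nc (G u 0 i - G s 0 i) < e / m.+1%:R.
    by move=> /(_ (index_enum _))[d d0 Hd]; exists d => // i u; apply: Hd; rewrite mem_index_enum.
  elim=> [|j r [d d0 Hd]]; first by exists 1. have [d' d'0 Hd'] := H j (e / m.+1%:R) (divr_gt0 e0 (ltr0Sn _ _)).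
  exists (minr d d'); first by pos. by move=> i u; rewrite inE lt_min => /orP[/eqP->|ir] /andP[n1 n2]; [exact: Hd'|exact: Hd].
exists d => // u nu; apply: (@le_lt_trans _ _ (m%:R * (e / m.+1%:R))).
  by apply: vn_le => i; rewrite !mxE ltW // Hd.
rewrite mulrA ltr_pdivrMr ?ltr0Sn // mulrC ltr_pM2l // ltr_nat //.
Qed.
Lemma cts_bdd_fin (I : finType) (f : I -> C -> C) a b : (forall i, ctseg (f i) a b) ->
  exists2 K : R, 0 <= K & forall i s, in01 s -> nc (f i (seg a b s)) <= K.
move=> H; suff : forall r : seq I, exists2 K : R, 0 <= K & forall i s, i \in r -> in01 s -> nc (f i (seg a b s)) <= K.
  by move=> /(_ (index_enum _))[K K0 HK]; exists K => // i s; apply: HK; rewrite mem_index_enum.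
elim=> [|j r [K K0 HK]]; first by exists 0. have [K' HK'] := cts_bdd (H j). exists (K + `|K'|); first by pos.
move=> i s; rewrite inE => /orP[/eqP->|ir] hs.
  by have := HK' _ hs; have := ler_norm K'; lra.
by have := HK _ _ ir hs; have := normr_ge0 K'; lra.
Qed.
Lemma fd_cd m (f : 'rV[C]_m -> C) (G : C -> 'rV[C]_m) s g d :
  fd f (G s) g -> cdv G s d -> cd (fun u => f (G u)) s (dot g d).
move=> ff cG; apply/cdP => e e0. pose D := vn d + 1; have D0 : 0 < D by pos.
have g0 := vn_ge0 g; pose e1 := e / (2 * D); have e10 : 0 < e1 by pos. pose e2 := minr 1 (e / (2 * (vn g + 1))). have e20 : 0 < e2.
  rewrite lt_min ltr01 /= divr_gt0 //; lra.
have e21 : e2 <= 1 by rewrite ge_min lexx. have e22 : vn g * e2 <= e / 2.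
  have h : e2 <= e / (2 * (vn g + 1)) by rewrite ge_min lexx orbT. rewrite ler_pdivlMr in h; last lra. by nra.
have [r r0 Hr] := ff e1 e10. have H : somepos r1, forall u, nc (u - s) < r1 -> vn (G u - G s - (u - s) *: d) <= e2 * nc (u - s).
  pose e3 := e2 / m.+1%:R; have e30 : 0 < e3 by pos. suff : forall q : seq 'I_m, somepos r1, forall i u, i \in q -> nc (u - s) < r1 ->
      nc (G u 0 i - G s 0 i - d 0 i * (u - s)) <= e3 * nc (u - s).
    move=> /(_ (index_enum _))[r1 r10 H1]; exists r1 => // u nu. apply: (@le_trans _ _ (m%:R * (e3 * nc (u - s)))).
      by apply: vn_le => i; rewrite !mxE (mulrC (u - s)) H1 ?mem_index_enum.
    rewrite mulrA ler_wpM2r // /e3 mulrA ler_pdivrMr ?ltr0Sn // mulrC. by rewrite ler_wpM2l ?(ltW e20) // ler_nat.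
  elim=> [|j q [r1 r10 H1]]; first by exists 1. have [r2 r20 H2] := (cdP _ _ _).1 (cG j) e3 e30. exists (minr r1 r2); first by pos.
  by move=> i u; rewrite inE lt_min => /orP[/eqP->|ir] /andP[n1 n2]; [exact: H2|exact: H1].
have [r1 r10 H1] := H; exists (minr r1 (r / D)); first by pos. move=> u /lt_minP[n1 n2]; rewrite ltr_pdivlMr // in n2.
have h1 := H1 _ n1; have n0 := normc_ge0 (u - s). have hd : vn (G u - G s) <= D * nc (u - s).
  have -> : G u - G s = (G u - G s - (u - s) *: d) + (u - s) *: d by rewrite subrK.
  apply: le_trans (vnD _ _) _; rewrite vnZ /D mulrDl mul1r. have : e2 * nc (u - s) <= 1 * nc (u - s) by rewrite ler_wpM2r. lra.
rewrite mulrC in n2; have h2 := Hr (G u - G s) (le_lt_trans hd n2). rewrite (addrC (G s)) subrK in h2.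
have -> : f (G u) - f (G s) - dot g d * (u - s) = (f (G u) - f (G s) - dot g (G u - G s)) + dot g (G u - G s - (u - s) *: d).
  by rewrite -[- ((u - s) *: d)]scaleN1r !dotDr !dotZr; ring.
apply: le_trans (ler_normcD _ _) _. have h3 := dot_le g (G u - G s - (u - s) *: d). have h4 : e1 * vn (G u - G s) <= e / 2 * nc (u - s).
  apply: le_trans (_ : e1 * (D * nc (u - s)) <= _); first by rewrite ler_wpM2l // ltW.
  by rewrite /e1 mulrA (_ : e / (2 * D) * D = e / 2) //; field; rewrite gt_eqF.
have h5 : vn g * vn (G u - G s - (u - s) *: d) <= e / 2 * nc (u - s).
  apply: le_trans (_ : vn g * (e2 * nc (u - s)) <= _); first by rewrite ler_wpM2l. by rewrite mulrA ler_wpM2r.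
lra.
Qed.
End Tubes.

(** * The vector field and its orbits in the coordinates t, eta *)

Section Curves.
Context {R : realType}.
Local Notation C := R[i].
Variables (n N : nat) (B : finType) (tb : B -> C) (ex : B -> 'I_n.+1 -> C).
Implicit Types (t s u : C) (eta mu : 'rV[C]_n.+1) (x : 'rV[C]_n.+2) (z : 'rV[C]_N).
(** Index of the entry of eta that drives the coordinate: $x_0=\eta_0$ and $x_1=t\eta_0$ share index
    0, and $x_i=\eta_{i-1}$ from $i=2$ on. *)
Definition sg (i : 'I_n.+2) : 'I_n.+1 := inord i.-1.
Definition i0 : 'I_n.+2 := ord0.
Definition i1 : 'I_n.+2 := lift ord0 ord0.
Definition th (i : 'I_n.+2) t : C := if i == i1 then t else 1.
Definition thd (i : 'I_n.+2) : C := if i == i1 then 1 else 0.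
Definition act mu eta : 'rV[C]_n.+1 := (\row_j (mu 0 j * eta 0 j)).
Definition pt t eta : 'rV[C]_n.+2 := (\row_i (th i t * eta 0 (sg i))).
Definition nz eta := forall j, eta 0 j != 0.
Definition LL b x : C := x 0 i1 - tb b * x 0 i0.
Definition PI x : C := \prod_b LL b x.
Definition qq j x : C := \sum_b ex b j * \prod_(b' | b' != b) LL b' x.
(** With $t=x_1/x_0$ the field reads $\dot t=\Pi/x_0$, $\dot\eta_j=q_j\eta_j$, that is
    $d\log\eta_j/dt=\sum_b e_{bj}/(t-t_b)$ up to a change of time. Clearing the denominators makes
    it polynomial, homogeneous of degree the number of poles. *)
Definition FF x : 'rV[C]_n.+2 := (\row_i (x 0 i * qq (sg i) x + thd i * PI x)).
Lemma sg_surj j : exists i, sg i = j /\ i != i1.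
case: (unliftP ord0 j) => [k ->|->].
  exists (lift ord0 (lift ord0 k)); split; last by []. by apply: val_inj; rewrite /sg /= inordK //; exact: (ltn_ord (lift ord0 k)).
by exists ord0; split; [apply: val_inj; rewrite /sg /= inordK|].
Qed.
Lemma sg0 : sg i0 = ord0. Proof. by apply: val_inj; rewrite /sg /= inordK. Qed.
Lemma sg1 : sg i1 = ord0. Proof. by apply: val_inj; rewrite /sg /= inordK. Qed.
Lemma th_i0 t : th i0 t = 1. Proof. by []. Qed.
Lemma th_i1 t : th i1 t = t. Proof. by rewrite /th eqxx. Qed.
Lemma thd_i0 : thd i0 = 0. Proof. by []. Qed.
Lemma LL_pt b t eta : LL b (pt t eta) = (t - tb b) * eta 0 ord0.
by rewrite /LL !mxE sg0 sg1 th_i0 th_i1; ring. Qed.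
 Lemma act1 eta : act (const_mx 1) eta = eta.
by apply/rowP => j; rewrite !mxE mul1r. Qed.
 Lemma actA mu nu eta : act mu (act nu eta) = act (act mu nu) eta.
by apply/rowP => j; rewrite !mxE mulrA. Qed.
 Lemma nz_act mu eta : nz mu -> nz eta -> nz (act mu eta).
by move=> h1 h2 j; rewrite !mxE mulf_neq0. Qed.
 (** A parametrised path in the t-plane over a convex domain, carrying for every pole a branch
     [lam b] of the logarithm of [tau - tb b], so that complex powers are single-valued along it. *)
 Record piece := Piece { tau : C -> C; dtau : C -> C; lam : B -> C -> C; dm : C -> Prop }.
 Definition piece_ok p := [/\ op (dm p), cvx (dm p) &
  forall s, dm p s -> [/\ cd (tau p) s (dtau p s), exists d, cd (dtau p) s d, dtau p s != 0 &
    forall b, tau p s != tb b /\ cd (lam p b) s (dtau p s / (tau p s - tb b))]].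
 (** The multiplier $\prod_b\big((\tau(s)-t_b)/(\tau(s_0)-t_b)\big)^{e_{bj}}$, continued along the
     path. *)
 Definition nu p s0 j s : C := cexp (\sum_b ex b j * (lam p b s - lam p b s0)).
Definition nuv p s0 s : 'rV[C]_n.+1 := (\row_j nu p s0 j s). Definition dlog p j s : C := \sum_b ex b j * (dtau p s / (tau p s - tb b)).
Definition cA p s0 (i : 'I_n.+2) s := th i (tau p s) * nu p s0 (sg i) s. Definition cA' p s0 (i : 'I_n.+2) s :=
  (thd i * dtau p s + th i (tau p s) * dlog p (sg i) s) * nu p s0 (sg i) s.
Definition xl p s0 eta s : 'rV[C]_n.+2 := (\row_i (cA p s0 i s * eta 0 (sg i))).
Definition xd p s0 eta s : 'rV[C]_n.+2 := (\row_i (cA' p s0 i s * eta 0 (sg i))).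
 Lemma xlE p s0 eta s : xl p s0 eta s = pt (tau p s) (act (nuv p s0 s) eta).
by apply/rowP => i; rewrite !mxE /cA mulrA. Qed.
 Lemma nu_cocycle p s0 s1 j s : nu p s1 j s * nu p s0 j s1 = nu p s0 j s.
rewrite /nu -cexpD -big_split /=; congr cexp; apply: eq_bigr => b _. by rewrite -mulrDr; congr (_ * _); ring.
Qed.
Lemma nu_refl p s j : nu p s j s = 1.
by rewrite /nu big1 ?cexp0 // => b _; rewrite subrr mulr0. Qed.
 Lemma nu_neq0 p s0 j s : nu p s0 j s != 0. Proof. exact: cexp_neq0. Qed.
 Lemma nz_nuv p s0 s : nz (nuv p s0 s).
by move=> j; rewrite mxE nu_neq0. Qed.
 Lemma act_nuv_refl p s eta : act (nuv p s s) eta = eta.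
by apply/rowP => j; rewrite !mxE nu_refl mul1r. Qed.
 Lemma act_nuv p s0 s1 s eta : act (nuv p s1 s) (act (nuv p s0 s1) eta) = act (nuv p s0 s) eta.
by apply/rowP => j; rewrite !mxE mulrA nu_cocycle. Qed.
 Lemma xl_shift p s0 s1 eta s : xl p s1 (act (nuv p s0 s1) eta) s = xl p s0 eta s.
by rewrite !xlE act_nuv. Qed.
 Lemma xd_shift p s0 s1 eta s : xd p s1 (act (nuv p s0 s1) eta) s = xd p s0 eta s.
by apply/rowP => i; rewrite !mxE /cA' -(nu_cocycle p s0 s1 _ s); ring. Qed.
 Lemma xl0 p s0 eta : xl p s0 eta s0 = pt (tau p s0) eta.
by rewrite xlE act_nuv_refl. Qed.
 Section Piece.
Variable p : piece. Hypothesis pok : piece_ok p.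
 Lemma cd_tau s : dm p s -> cd (tau p) s (dtau p s). Proof. by case: pok => _ _ h /h[]. Qed.
Lemma cd_dtau s : dm p s -> exists d, cd (dtau p) s d. Proof. by case: pok => _ _ h /h[]. Qed.
Lemma dtau_neq0 s : dm p s -> dtau p s != 0. Proof. by case: pok => _ _ h /h[]. Qed. Lemma tau_neq b s : dm p s -> tau p s - tb b != 0.
by case: pok => _ _ h /h[_ _ _ /(_ b)[]]; rewrite subr_eq0. Qed.
Lemma cd_lam b s : dm p s -> cd (lam p b) s (dtau p s / (tau p s - tb b)).
by case: pok => _ _ h /h[_ _ _ /(_ b)[]]. Qed.
 Lemma cd_nu s0 j s : dm p s -> cd (nu p s0 j) s (dlog p j s * nu p s0 j s).
move=> hs; have h : cd (fun u => \sum_b ex b j * (lam p b u - lam p b s0)) s (dlog p j s).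
  apply: cd_sum => b; apply: cdZ; rewrite -[_ / _]subr0. by apply: cdB; [exact: cd_lam|exact: cd_cst].
by apply: cd_ext (cd_comp h (cd_cexp _)) => //; rewrite mulrC.
Qed.
Lemma cd_th i s : dm p s -> cd (fun u => th i (tau p u)) s (thd i * dtau p s).
move=> hs; rewrite /th /thd; case: eqP => _; rewrite ?mul1r ?mul0r; first exact: cd_tau. exact: cd_cst.
Qed.
Lemma cd_cA s0 i s : dm p s -> cd (cA p s0 i) s (cA' p s0 i s).
move=> hs; apply: cd_ext (cdM (cd_th i hs) (cd_nu s0 (sg i) hs)) => //. by rewrite /cA' mulrDl mulrA.
Qed.
Lemma hol_dlog j s : dm p s -> exists d, cd (dlog p j) s d.
move=> hs; have [d hd] := cd_dtau hs; eexists; apply: cd_sum => b; apply: cdZ.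
apply: cdM hd _; apply: (@cdV _ (fun u => tau p u - tb b) _ (dtau p s - 0)); first exact: tau_neq.
by apply: cdB; [exact: cd_tau|exact: cd_cst].
Qed.
Lemma hol_cA' s0 i s : dm p s -> exists d, cd (cA' p s0 i) s d.
move=> hs; have [d1 h1] := cd_dtau hs; have [d2 h2] := hol_dlog (sg i) hs. eexists; apply: cdM (cd_nu s0 (sg i) hs).
by apply: cdD (cdZ _ h1) (cdM (cd_th i hs) h2).
Qed.
Lemma cdv_xl s0 eta s : dm p s -> cdv (xl p s0 eta) s (xd p s0 eta s).
move=> hs i; rewrite mxE mulrC; apply: cd_ext (cdZ (eta 0 (sg i)) (cd_cA s0 i hs)) => // u. by rewrite mxE mulrC.
Qed.
(** The nowhere vanishing factor between the parameter of the path and the time of the field; it is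
    undone by a local inverse when integral arcs are built. *)
Definition kap s0 eta s : C := dtau p s * (xl p s0 eta s 0 i0 / PI (xl p s0 eta s)).
Lemma PI_neq0 s0 eta s : nz eta -> dm p s -> PI (xl p s0 eta s) != 0.
move=> h hs; apply/prodf_neq0 => b _; rewrite xlE LL_pt mulf_neq0 ?tau_neq //. by apply: nz_act => //; apply: nz_nuv.
Qed.
Lemma xl_i0_neq0 s0 eta s : nz eta -> xl p s0 eta s 0 i0 != 0.
by move=> h; rewrite xlE mxE th_i0 mul1r; apply: nz_act => //; apply: nz_nuv. Qed.
 Lemma xdE s0 eta s : nz eta -> dm p s -> xd p s0 eta s = kap s0 eta s *: FF (xl p s0 eta s).
move=> h hs; have P0 := PI_neq0 s0 h hs; have X0 := xl_i0_neq0 s0 s h. set x := xl _ _ _ _ in P0 X0 *.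
have qE j : qq j x = \sum_b ex b j * (PI x / LL b x).
  apply: eq_bigr => b _; congr (_ * _); rewrite [PI x](bigD1 b) //= mulrAC divff ?mul1r //.
  by move: P0; rewrite /PI => /prodf_neq0/(_ b isT).
have LE b : LL b x = (tau p s - tb b) * x 0 i0.
  by rewrite /x xlE LL_pt [in RHS]mxE th_i0 mul1r sg0.
have dE j : dlog p j s = dtau p s * (x 0 i0 / PI x) * qq j x.
  rewrite qE mulr_sumr; apply: eq_bigr => b _; rewrite LE.
  have := tau_neq b hs; move: P0 X0; set P := PI x; set X := x 0 i0; set T := _ - _ => P0 X0 T0. by field; rewrite T0 X0 P0.
apply/rowP => i; rewrite !mxE /cA' -/x mulrDr dE /kap -/x. rewrite /cA. rewrite !mulrDl; rewrite [RHS]addrC; congr (_ + _); last by ring.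
have [i1E|ni] := eqVneq i i1; last by rewrite /thd (negbTE ni) !mul0r mulr0. rewrite /thd i1E eqxx !mul1r.
have -> : x 0 i0 = nu p s0 (sg i1) s * eta 0 (sg i1).
  by rewrite /x xlE mxE th_i0 mul1r !mxE sg0 sg1.
by field.
Qed.
Lemma kap_neq0 s0 eta s : nz eta -> dm p s -> kap s0 eta s != 0.
move=> h hs; rewrite /kap mulf_neq0 ?dtau_neq0 // mulf_neq0 ?xl_i0_neq0 // invr_neq0 //. exact: PI_neq0.
Qed.
Lemma hol_kap s0 eta s : nz eta -> dm p s -> exists d, cd (kap s0 eta) s d.
move=> h hs; have [d1 h1] := cd_dtau hs. have [d2 h2] : exists d, cd (fun u => PI (xl p s0 eta u)) s d.
  rewrite /PI; elim: (index_enum B) => [|b r [d IH]].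
    by exists 0; apply: cd_ext (cd_cst 1 s) => // u; rewrite big_nil.
  have hb : cd (fun u => LL b (xl p s0 eta u)) s (xd p s0 eta s 0 i1 - tb b * xd p s0 eta s 0 i0).
    by apply: cdB; [|apply: cdZ]; exact: cdv_xl.
  by eexists; apply: cd_ext (cdM hb IH) => // u; rewrite big_cons.
eexists; apply: cdM h1 _; apply: cdM (cdv_xl s0 eta hs i0) _. exact: (@cdV _ (fun u => PI (xl p s0 eta u)) _ _ (PI_neq0 s0 h hs) h2).
Qed.
End Piece.

Section Steps.
Variable w : 'rV[C]_n.+2 -> 'M[C]_(n.+2, N).
Definition zd p s0 eta s : 'rV[C]_N := xd p s0 eta s *m w (xl p s0 eta s).
Definition state := (C * 'rV[C]_n.+1 * 'rV[C]_N)%type.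
(** [D] cuts the domain of the piece down to a convex part on which the lifted curve exists and
    stays in [Om]; the step itself only joins two of its points. *)
Definition step (Om : 'rV[C]_n.+2 -> 'rV[C]_N -> Prop) (a b : state) : Prop :=
  exists p (D : C -> Prop) (zc : C -> 'rV[C]_N) s0 s1,
  [/\ piece_ok p, [/\ op D, cvx D, D s0, D s1 & forall s, D s -> dm p s], nz a.1.2 &
  [/\ a = (tau p s0, a.1.2, zc s0), b = (tau p s1, act (nuv p s0 s1) a.1.2, zc s1) &
     forall s, D s -> cdv zc s (zd p s0 a.1.2 s) /\ Om (xl p s0 a.1.2 s) (zc s)]].
Lemma step_sym Om a b : step Om a b -> step Om b a.
case=> p [D [zc [s0 [s1 [pok [oD cD D0 D1 sD] h [aE bE H]]]]]].
exists p, D, zc, s1, s0; rewrite bE /=; split=> //; first by apply: nz_act => //; apply: nz_nuv.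
split=> //; first by rewrite act_nuv act_nuv_refl. by move=> s Ds; rewrite xl_shift /zd xd_shift xl_shift; apply: H.
Qed.
Definition reach Om := clos_refl_trans _ (step Om).
Lemma reach_sym Om a b : reach Om a b -> reach Om b a.
elim=> [x y h|x|x y z _ IH1 _ IH2]; first by apply: rt_step; apply: step_sym.
  exact: rt_refl.
exact: rt_trans IH2 IH1.
Qed.
Lemma reach_trans Om a b c : reach Om a b -> reach Om b c -> reach Om a c.
exact: rt_trans. Qed.
 Lemma step_nz Om a b : step Om a b -> nz a.1.2 /\ nz b.1.2.
by move=> h; split; [case: h|have := step_sym h; case]=> p [D [zc [s0 [s1 []]]]]. Qed.
 Lemma reach_nz Om a b : reach Om a b -> nz a.1.2 -> nz b.1.2.
by elim=> [x y /step_nz[]//|//|x y z _ IH1 _ IH2 /IH1/IH2]. Qed.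
 End Steps.
End Curves.

 (** * Dependence of lifted paths on their starting point *)

 Section Transport.
Context {R : realType}. Local Notation C := R[i]. Variables (n N : nat) (B : finType) (tb : B -> C) (ex : B -> 'I_n.+1 -> C).
Variables (w : 'rV[C]_n.+2 -> 'M[C]_(n.+2, N)) (r1 Bw Lw : R). Hypotheses (r10 : 0 < r1) (Bw0 : 0 <= Bw) (Lw0 : 0 <= Lw).
Hypothesis wfd : forall x, vn x < r1 -> forall i c, exists g, fd (fun y => w y i c) x g.
Hypothesis wB : forall x, vn x < r1 -> forall i c, nc (w x i c) <= Bw. Hypothesis wL : forall x y, vn x < r1 -> vn y < r1 -> forall i c,
  nc (w x i c - w y i c) <= Lw * vn (x - y).
Implicit Types (eta mu : 'rV[C]_n.+1) (x : 'rV[C]_n.+2) (z : 'rV[C]_N).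
 Local Notation piece_ok := (piece_ok tb).
Local Notation nuv := (nuv ex). Local Notation xl := (xl ex). Local Notation xd := (xd tb ex). Local Notation zd := (zd tb ex w).
Local Notation cA := (cA ex). Local Notation cA' := (cA' tb ex).
 Lemma vn_lt m (x y : 'rV[C]_m) (r : R) : vn (x - y) < r - vn y -> vn x < r.
by have := vn_dist x y 0; rewrite !subr0; lra. Qed.
 Definition Om x z := vn x < r1 /\ vn z < r1.
Local Notation step := (step tb ex w Om).
 (** Increment of z along the path. It depends on eta but not on z, as the forms involve x only. *)
 Definition inc p s0 eta s : 'rV[C]_N := (\row_c cint (fun u => zd p s0 eta u 0 c) s0 s).
 Lemma seg_in (D : C -> Prop) (a b : C) (s : R) : cvx D -> D a -> D b -> in01 s -> D (seg a b s).
by move=> cD; exact: cD. Qed.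
 Section Piece.
Variable p : @piece R B. Hypothesis pok : piece_ok p.
 Lemma cts_xl s0 eta s i : dm p s -> cts (fun u => xl p s0 eta u 0 i) s.
by move=> hs; exact: cd_cts (cdv_xl ex pok s0 eta hs i). Qed.
 Lemma hol_zd s0 eta s c : dm p s -> vn (xl p s0 eta s) < r1 -> exists d, cd (fun u => zd p s0 eta u 0 c) s d.
move=> hs hx. have H i : exists d, cd (fun u => xd p s0 eta u 0 i * w (xl p s0 eta u) i c) s d.
  have [d hd] := hol_cA' ex pok s0 i hs; have [g hg] := wfd hx i c. eexists; apply: cdM; last exact: fd_cd hg (cdv_xl ex pok s0 eta hs).
  by apply: cd_ext (cdZ (eta 0 (sg i)) hd) => // u; rewrite mxE mulrC.
have [d hd] := choice H. by eexists; apply: cd_ext (cd_sum (index_enum _) hd) => // u; rewrite mxE.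
Qed.
Lemma cA_bdd s0 s1 : dm p s0 -> dm p s1 -> exists2 K : R, 0 <= K & forall a i, in01 a ->
  nc (cA p s0 i (seg s0 s1 a)) <= K /\ nc (cA' p s0 i (seg s0 s1 a)) <= K.
move=> h0 h1; have [_ cD _] := pok. have [K1 K10 H1] : exists2 K : R, 0 <= K & forall i s, in01 s -> nc (cA p s0 i (seg s0 s1 s)) <= K.
  by apply: cts_bdd_fin => i s hs; apply: cd_cts (cd_cA ex pok s0 i _); apply: seg_in.
have [K2 K20 H2] : exists2 K : R, 0 <= K & forall i s, in01 s -> nc (cA' p s0 i (seg s0 s1 s)) <= K.
  apply: cts_bdd_fin => i s hs. by have [d hd] := hol_cA' ex pok s0 i (seg_in cD h0 h1 hs); exact: cd_cts hd.
exists (K1 + K2); first by pos. by move=> a i ha; split; [have := H1 i _ ha|have := H2 i _ ha]; lra.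
Qed.
Lemma xl_le s0 eta eta' s (K : R) : (forall i, nc (cA p s0 i s) <= K) ->
  vn (xl p s0 eta s - xl p s0 eta' s) <= n.+2%:R * (K * vn (eta - eta')).
move=> H; apply: vn_le => i; rewrite !mxE -mulrBr normcM. have h := vn_coord (eta - eta') (sg i); rewrite !mxE in h.
by apply: ler_pM => //; exact: normc_ge0.
Qed.
Lemma xl_0 s0 s : xl p s0 0 s = 0.
by apply/rowP => i; rewrite !mxE mulr0. Qed.
 Lemma xd_0 s0 s : xd p s0 0 s = 0.
by apply/rowP => i; rewrite !mxE mulr0. Qed.
 Lemma zd_0 s0 s : zd p s0 0 s = 0.
by rewrite /zd xd_0 mul0mx. Qed.
 Lemma eta_le s0 eta : vn eta <= n.+1%:R * vn (xl p s0 eta s0).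
apply: vn_le => j; have [i [<- ni]] := sg_surj j. apply: le_trans (vn_coord _ i); rewrite xl0 mxE /th (negbTE ni) mul1r //.
Qed.
Lemma zd_lip s0 eta eta' s (K : R) : 0 <= K -> vn eta' <= n.+1%:R * r1 ->
  (forall i, nc (cA p s0 i s) <= K /\ nc (cA' p s0 i s) <= K) ->
  vn (xl p s0 eta s) < r1 -> vn (xl p s0 eta' s) < r1 -> forall c,
  nc (zd p s0 eta s 0 c - zd p s0 eta' s 0 c) <=
   (n.+2%:R * (K * Bw + K * (n.+1%:R * r1) * (Lw * (n.+2%:R * K)))) * vn (eta - eta').
move=> K0 he' HK h1 h2 c; rewrite !mxE -sumrB; apply: le_trans (ler_normc_sum _ _ _) _. set a := vn (eta - eta').
apply: (@le_trans _ _ (\sum_(i < n.+2) (K * Bw + K * (n.+1%:R * r1) * (Lw * (n.+2%:R * K))) * a)); last first.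
  by rewrite sumr_const card_ord -[leLHS]mulr_natl mulrA.
apply: ler_sum => i _; set W := w _; set W' := w _. have a0 : 0 <= a by pos. have hW : nc (W i c) <= Bw by apply: wB.
have hWW : nc (W i c - W' i c) <= Lw * (n.+2%:R * (K * a)).
  apply: le_trans (wL h1 h2 i c) _; apply: ler_wpM2l => //; apply: xl_le => j; exact: (HK j).1.
have -> : xd p s0 eta s 0 i * W i c - xd p s0 eta' s 0 i * W' i c =
  (xd p s0 eta s 0 i - xd p s0 eta' s 0 i) * W i c + xd p s0 eta' s 0 i * (W i c - W' i c) by ring.
apply: le_trans (ler_normcD _ _) _; rewrite !normcM mulrDl. have e1 : nc (xd p s0 eta s 0 i - xd p s0 eta' s 0 i) <= K * a.
  rewrite !mxE -mulrBr normcM; apply: ler_pM; rewrite //; first exact: (HK i).2. by have := vn_coord (eta - eta') (sg i); rewrite !mxE.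
have e2 : nc (xd p s0 eta' s 0 i) <= K * (n.+1%:R * r1).
  rewrite !mxE normcM; apply: ler_pM; rewrite //; first exact: (HK i).2. exact: le_trans (vn_coord _ _) he'.
apply: lerD.
  by rewrite (mulrAC K); apply: ler_pM.
rewrite -mulrA -(mulrA Lw) -(mulrA n.+2%:R). by apply: ler_pM.
Qed.
Lemma ctseg_zd s0 s1 eta c : dm p s0 -> dm p s1 ->
  (forall a, in01 a -> vn (xl p s0 eta (seg s0 s1 a)) < r1) ->
  ctseg (fun u => zd p s0 eta u 0 c) s0 s1.
move=> h0 h1 H a ha; have [_ cD _] := pok. by have [d hd] := hol_zd c (seg_in cD h0 h1 ha) (H _ ha); exact: cd_cts hd.
Qed.
Lemma inc_lip s0 s1 : dm p s0 -> dm p s1 -> exists2 K : R, 0 <= K & forall eta eta' b, in01 b ->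
  (forall a, in01 a -> vn (xl p s0 eta (seg s0 s1 a)) < r1) ->
  (forall a, in01 a -> vn (xl p s0 eta' (seg s0 s1 a)) < r1) ->
  vn (inc p s0 eta (seg s0 s1 b) - inc p s0 eta' (seg s0 s1 b)) <= K * vn (eta - eta') /\
  vn (xl p s0 eta (seg s0 s1 b) - xl p s0 eta' (seg s0 s1 b)) <= K * vn (eta - eta').
move=> h0 h1; have [_ cD _] := pok; have [K K0 HK] := cA_bdd h0 h1.
pose K1 : R := (n.+2%:R * (K * Bw + K * (n.+1%:R * r1) * (Lw * (n.+2%:R * K)))). have K10 : 0 <= K1.
  have r0 := ltW r10; apply: mulr_ge0 => //; apply: addr_ge0; apply: mulr_ge0 => //.
    by apply: mulr_ge0 => //; apply: mulr_ge0.
  by apply: mulr_ge0 => //; apply: mulr_ge0.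
pose K2 : R := N%:R * (K1 * nc (s1 - s0)). have K20 : 0 <= K2 by pos. have K30 : 0 <= n.+2%:R * K by pos.
exists (K2 + n.+2%:R * K); first by pos. move=> eta eta' b hb H H'; have a0 := vn_ge0 (eta - eta').
have hsb : dm p (seg s0 s1 b) by apply: seg_in. have sub e : (forall a, in01 a -> vn (xl p s0 e (seg s0 s1 a)) < r1) ->
  forall a, in01 a -> vn (xl p s0 e (seg s0 (seg s0 s1 b) a)) < r1. by move=> He a ha; rewrite seg_seg; apply/He/in01M.
split; last first.
  apply: le_trans (_ : n.+2%:R * (K * vn (eta - eta')) <= _).
    by apply: xl_le => i; exact: (HK b i hb).1.
  by rewrite mulrA ler_wpM2r //; lra.
apply: (@le_trans _ _ (K2 * vn (eta - eta'))); last by rewrite ler_wpM2r //; lra.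
rewrite /K2 -mulrA; apply: vn_le => c; rewrite !mxE -cintB; [|exact: ctseg_zd (sub _ _)..]. have he' : vn eta' <= n.+1%:R * r1.
  apply: le_trans (eta_le s0 eta') _; rewrite ler_wpM2l // ltW //. by have := H' 0 in01_0; rewrite seg0.
apply: le_trans (_ : (K1 * vn (eta - eta')) * nc (seg s0 s1 b - s0) <= _).
  apply: cint_le; first by apply: ctsegD; [|move=> a ha; apply: ctsN; move: a ha]; apply: ctseg_zd => //; exact: sub.
  move=> a ha; apply: zd_lip => //; [|exact: sub H _ ha|exact: sub H' _ ha]. by rewrite seg_seg => i; apply: HK; apply: in01M.
rewrite mulrAC; apply: ler_wpM2r => //; apply: ler_wpM2l => //. have := segB s0 s1 0 b; rewrite seg0 subr0 => ->; rewrite normcM normc_real.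
by move: hb => /andP[b0 b1]; rewrite ger0_norm // ler_piMl // normc_ge0.
Qed.
Lemma inc_0 s0 s : inc p s0 0 s = 0.
apply/rowP => c; rewrite !mxE (@cint_FTC _ _ (fun=> 0)) ?subrr // => a _. by rewrite zd_0 mxE; exact: cd_cst.
Qed.
(** Bounds on the segment are enough: by openness they extend to a tube around it, and the tube is
    convex, so Goursat's theorem makes [inc] a holomorphic lift there. *)
Lemma step_seg s0 s1 eta z : dm p s0 -> dm p s1 -> nz eta ->
  (forall a, in01 a -> vn (xl p s0 eta (seg s0 s1 a)) < r1) ->
  (forall a, in01 a -> vn (z + inc p s0 eta (seg s0 s1 a)) < r1) ->
  step (tau p s0, eta, z) (tau p s1, act (nuv p s0 s1) eta, z + inc p s0 eta s1).
move=> h0 h1 he Hx Hz; have [oD cD _] := pok. pose P u := dm p u /\ vn (xl p s0 eta u) < r1.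
have [d1 d10 H1] : somepos d, forall u, tube s0 s1 d u -> P u.
  apply: tube_in => a ha; have ds := seg_in cD h0 h1 ha; have [r r0 Hr] := oD _ ds.
  have hx := Hx _ ha; pose g := r1 - vn (xl p s0 eta (seg s0 s1 a)). have g0 : 0 < g by rewrite subr_gt0.
  have [d d0 Hd] := vn_cts (fun i => cts_xl s0 eta i ds) g0. exists (minr r d); first by pos.
  move=> u /lt_minP[n1 n2]; split; first exact: Hr. exact: vn_lt (Hd _ n2).
pose D1 := tube s0 s1 d1. have D10 : D1 s0 by rewrite -(seg0 s0 s1); apply: tube_seg => //; exact: in01_0.
have zcd u : D1 u -> cdv (fun v => z + inc p s0 eta v) u (zd p s0 eta u).
  move=> Du c; have hol1 : hol (fun v => zd p s0 eta v 0 c) D1.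
    by move=> v /H1[hv hxv]; exact: hol_zd.
  have h := primitive_cint (@tube_cvx _ _ _ _) (@tube_op _ _ _ _) hol1 D10 Du.
  by apply: cd_ext (cdD (cd_cst (z 0 c) u) h) => [v|]; rewrite ?mxE ?add0r.
have [d2 d20 H2] : somepos d, forall u, tube s0 s1 d u -> D1 u /\ vn (z + inc p s0 eta u) < r1.
  apply: tube_in => a ha; have Da : D1 (seg s0 s1 a) by apply: tube_seg. have [r r0 Hr] := tube_op Da.
  have hz := Hz _ ha; pose g := r1 - vn (z + inc p s0 eta (seg s0 s1 a)). have g0 : 0 < g by rewrite subr_gt0.
  have [d d0 Hd] := @vn_cts _ _ (fun v => z + inc p s0 eta v) _ (fun i => cd_cts (zcd _ Da i)) _ g0. exists (minr r d); first by pos.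
  move=> u /lt_minP[n1 n2]; split; first exact: Hr. exact: vn_lt (Hd _ n2).
exists p, (tube s0 s1 d2), (fun u => z + inc p s0 eta u), s0, s1; split=> //.
- split; [exact: tube_op|exact: tube_cvx| | |by move=> s /H2[/H1[]]].
    by rewrite -{2}(seg0 s0 s1); apply: tube_seg => //; exact: in01_0.
  by rewrite -{2}(seg1 s0 s1); apply: tube_seg => //; exact: in01_1.
split=> //=.
  rewrite (_ : inc p s0 eta s0 = 0) ?addr0 //; apply/rowP => c; rewrite !mxE. by rewrite /cint subrr mul0r.
by move=> s /H2[D1s hz]; split; [exact: zcd|split=> //; have [] := H1 _ D1s].
Qed.
End Piece.
Lemma vn_gap m (G : C -> 'rV[C]_m) s0 s1 (r : R) :
  (forall s, in01 s -> forall i, cts (fun u => G u 0 i) (seg s0 s1 s)) ->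
  (forall s, in01 s -> vn (G (seg s0 s1 s)) < r) ->
  somepos g, forall s, in01 s -> vn (G (seg s0 s1 s)) + g <= r.
move=> cG; apply: seg_gap => s hs e e0. have [d d0 Hd] := vn_cts (cG _ hs) e0. have [d' d'0 Hd'] := @seg_near _ s0 s1 s _ d0.
exists d' => // t ht /Hd'/Hd; set x := G _; set y := G _ => hxy.
have := vn_dist x y 0; have := vn_dist y x 0; rewrite !subr0 (vn_distC y x). by rewrite ltr_norml => h1 h2; apply/andP; split; lra.
Qed.
(** The path is kept and the start moved. Nearby curves stay uniformly close by the Lipschitz
    bounds, and the original one keeps a positive gap to the boundary of [Om] along the segment. *)
Lemma step_transport a b : step a b -> forall e : R, 0 < e -> somepos d, forall eta z, nz eta -> vn (eta - a.1.2) < d -> vn (z - a.2) < d ->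
  exists eta' z', [/\ step (a.1.1, eta, z) (b.1.1, eta', z'), vn (eta' - b.1.2) < e & vn (z' - b.2) < e].
case=> p [D [zc [s0 [s1 [pok [oD cD D0 D1 sD] h [aE bE H]]]]]] e e0.
have E c : in01 c -> a.2 + inc p s0 a.1.2 (seg s0 s1 c) = zc (seg s0 s1 c).
  move=> hc; rewrite {1}aE /=; apply/rowP => k; rewrite !mxE. rewrite (@cint_FTC _ _ (fun u => zc u 0 k)) ?subrKC // => d hd.
  by have [h1 _] := H _ (seg_in cD D0 (seg_in cD D0 D1 hc) hd); exact: h1.
have dD s : in01 s -> D (seg s0 s1 s) by exact: seg_in.
have [g1 g10 G1] : somepos g, forall s, in01 s -> vn (xl p s0 a.1.2 (seg s0 s1 s)) + g <= r1.
  apply: vn_gap => s hs; first by move=> i; apply: cts_xl => //; exact/sD/dD. by have [_ []] := H _ (dD _ hs).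
have [g2 g20 G2] : somepos g, forall s, in01 s -> vn (zc (seg s0 s1 s)) + g <= r1.
  apply: vn_gap => s hs; last by have [_ []] := H _ (dD _ hs). by move=> i; have [h1 _] := H _ (dD _ hs); exact: cd_cts (h1 i).
have [K K0 HK] := inc_lip pok (sD _ D0) (sD _ D1); have [KA KA0 HA] := cA_bdd pok (sD _ D0) (sD _ D1).
have n2 : (0 : R) < n.+2%:R by rewrite ltr0Sn. have n1 : (0 : R) < n.+1%:R by rewrite ltr0Sn.
have [L LE] : exists L : R, L = n.+1%:R * K + (n.+2%:R * KA + K + 1) by eexists. have n1K : 0 <= n.+1%:R * K by pos.
have n2K : 0 <= n.+2%:R * KA by pos. have L0 : 0 < L by lra. have [m m0 [m1 m2 m3]] : somepos m, [/\ m <= e, m <= g1 & m <= g2].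
  exists (minr e (minr g1 g2)); first by pos. by rewrite !ge_min !lexx !orbT.
have d0 : 0 < m / (2 * L) by pos. have dL : L * (m / (2 * L)) = m / 2 by field; rewrite gt_eqF. exists (minr (m / (2 * L)) (m / 2)).
  by rewrite lt_min d0 /=; lra.
move=> eta z hn; rewrite !lt_min => /andP[l1 _] /andP[_ l2]. set a' := vn (eta - a.1.2) in l1 *; have a0 : 0 <= a' by pos.
have La : L * a' < m / 2 by rewrite -dL ltr_pM2l.
have hx b' : in01 b' -> vn (xl p s0 eta (seg s0 s1 b') - xl p s0 a.1.2 (seg s0 s1 b')) < m / 2.
  move=> hb; apply: le_lt_trans La; apply: le_trans (xl_le _ _ (fun i => (HA b' i hb).1)) _. by rewrite -/a' mulrA ler_wpM2r //; lra.
have Hx b' : in01 b' -> vn (xl p s0 eta (seg s0 s1 b')) < r1.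
  by move=> hb; apply: vn_lt (lt_le_trans (hx _ hb) _); have := G1 _ hb; lra.
have Hx0 b' : in01 b' -> vn (xl p s0 a.1.2 (seg s0 s1 b')) < r1.
  by move=> hb; have := G1 _ hb; lra.
have hi b' : in01 b' -> vn (z + inc p s0 eta (seg s0 s1 b') - zc (seg s0 s1 b')) < m.
  move=> hb; rewrite -E // opprD addrACA; apply: le_lt_trans (vnD _ _) _. have [k1 _] := HK eta a.1.2 b' hb Hx Hx0; rewrite -/a' in k1.
  by have : K * a' <= L * a' by [rewrite ler_wpM2r //; lra]; lra.
have Hz b' : in01 b' -> vn (z + inc p s0 eta (seg s0 s1 b')) < r1.
  by move=> hb; apply: vn_lt (lt_le_trans (hi _ hb) _); have := G2 _ hb; lra.
exists (act (nuv p s0 s1) eta), (z + inc p s0 eta s1); split.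
- rewrite aE bE /=; apply: step_seg => //; exact: sD.
- rewrite bE /=; apply: le_lt_trans (_ : L * a' < e); last by lra.
  apply: le_trans (_ : n.+1%:R * K * a' <= _); last by rewrite ler_wpM2r //; lra.
  rewrite -mulrA; apply: vn_le => j; have [i [<- ni]] := sg_surj j.
  have := (HK eta a.1.2 1 in01_1 Hx Hx0).2; apply: le_trans; apply: le_trans (vn_coord _ i).
  rewrite seg1 !xlE !mxE /th (negbTE ni) !mul1r //.
by rewrite bE /= -[in zc _](seg1 s0 s1) -[in inc _ _ _ _](seg1 s0 s1); apply: lt_le_trans m1; apply: hi; exact: in01_1.
Qed.
Lemma reach_transport a b : reach tb ex w Om a b -> nz a.1.2 -> forall e : R, 0 < e -> somepos d, forall eta z, nz eta -> vn (eta - a.1.2) < d -> vn (z - a.2) < d ->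
  exists eta' z', [/\ reach tb ex w Om (a.1.1, eta, z) (b.1.1, eta', z'), vn (eta' - b.1.2) < e & vn (z' - b.2) < e].
elim=> [x y xy|x|x y z xy IH1 yz IH2] hn e e0.
- have [d d0 Hd] := step_transport xy e0; exists d => // eta z h1 h2 h3. have [eta' [z' [k1 k2 k3]]] := Hd _ _ h1 h2 h3.
  by exists eta', z'; split=> //; exact: rt_step.
- by exists e => // eta z h1 h2 h3; exists eta, z; split=> //; exact: rt_refl.
have [d2 d20 H2] := IH2 (reach_nz xy hn) e e0; have [d1 d10 H1] := IH1 hn d2 d20.
exists d1 => // eta u h1 h2 h3; have [eta' [z' [k1 k2 k3]]] := H1 _ _ h1 h2 h3.
have [eta'' [z'' [l1 l2 l3]]] := H2 _ _ (reach_nz k1 h1) k2 k3. by exists eta'', z''; split=> //; exact: reach_trans k1 l1.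
Qed.
End Transport.

Ltac vgen := repeat match goal with
    | h : is_true (Order.le _ _) |- _ => revert h
    | h : is_true (Order.lt _ _) |- _ => revert h
  end;
  repeat match goal with |- context [@vn ?R ?m ?x] => generalize (@vn R m x) end.
Ltac vlra := vgen; intros; lra.
Lemma common_bound (a b c d e : nat) : exists J, [/\ (a <= J)%N, (b <= J)%N, (c <= J)%N, (d <= J)%N & (e <= J)%N].
by exists (maxn a (maxn b (maxn c (maxn d e)))); rewrite !leq_max !leqnn !orbT. Qed.
 Lemma near_one {R : realType} (x y q : R) : x <= 1 -> 1 < x + y -> y <= q -> 0 <= q -> `|x - 1| <= q.
by move=> *; rewrite ler_norml; apply/andP; split; lra. Qed.
 Lemma nat_approx {R : realType} (x : R) : 0 < x -> exists k : nat, k%:R * x <= 1 /\ 1 < k%:R * x + x.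
move=> x0; have /andP[] := truncn_itv (ltW (divr_gt0 ltr01 x0)).
move: (Num.Def.trunc _) => k; rewrite ler_pdivlMr // ltr_pdivrMr // -natr1 mulrDl mul1r => t1 t2. by exists k.
Qed.

(** * From dense multipliers and periods to dense orbits in a level *)

Section Density.
Context {R : realType}.
Local Notation C := R[i].
Variables (n N : nat).
Local Notation H := 'rV[C]_n.+1.
Local Notation Z := 'rV[C]_N.
Variables (rch : H -> Z -> H -> Z -> Prop) (r1 : R).
Hypothesis r10 : 0 < r1.
Hypothesis rch_refl : forall a z, rch a z a z.
Hypothesis rch_sym : forall a z b u, rch a z b u -> rch b u a z.
Hypothesis rch_trans : forall a z b u c v, rch a z b u -> rch b u c v -> rch a z c v.
Hypothesis rch_nz : forall a z b u, rch a z b u -> nz a -> nz b.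
Hypothesis rch_transport : forall a z b u, rch a z b u -> nz a -> forall e : R, 0 < e ->
  somepos d, forall a' z', nz a' -> vn (a' - a) < d -> vn (z' - z) < d ->
  exists b' u', [/\ rch a' z' b' u', vn (b' - b) < e & vn (u' - u) < e].
(** Holonomy over the base point: a multiplier on eta and a translation of z depending on eta alone.
    The single constant [K] bounds the translation linearly and delimits the domain. *)
Definition germ (mu : H) (F : H -> Z) (K : R) := [/\ nz mu, 0 < K &
  forall a, nz a -> K * vn a < r1 -> vn (F a) <= K * vn a /\
    forall z, vn z + K * vn a < r1 -> rch a z (act mu a) (z + F a)].
Definition hgerm mu F := exists K, germ mu F K.
Lemma act_le mu (a : H) : vn (act mu a) <= vn mu * vn a.
by apply: vn_le_scale => j; rewrite mxE normcM ler_wpM2r // vn_coord. Qed.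
 Lemma nz_inv mu : nz mu -> nz (\row_j (mu 0 j)^-1 : H).
by move=> h j; rewrite mxE invr_neq0. Qed.
 Lemma act_inv mu (a : H) : nz mu -> act mu (act (\row_j (mu 0 j)^-1 : H) a) = a.
by move=> h; apply/rowP => j; rewrite !mxE mulrA divff ?mul1r. Qed.
 Lemma nz1 : nz (const_mx 1 : H). Proof. by move=> j; rewrite mxE oner_neq0. Qed.
 Lemma germ_comp mu F mu' F' : hgerm mu F -> hgerm mu' F' -> hgerm (act mu' mu) (fun a => F a + F' (act mu a)).
move=> [K [h0 K0 h]] [K' [h0' K'0 h']]; exists (K + K' * vn mu). have m0 := vn_ge0 mu; have Km : 0 <= K' * vn mu by pos.
split; [exact: nz_act|lra|] => a na Ka. have a0 := vn_ge0 a; have q1 : K * vn a < r1.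
  by apply: le_lt_trans Ka; rewrite ler_wpM2r //; lra.
have q2 : K' * vn (act mu a) <= K' * vn mu * vn a.
  by rewrite -mulrA ler_wpM2l ?act_le // ltW.
have q3 : K' * vn (act mu a) < r1.
  by apply: le_lt_trans q2 _; apply: le_lt_trans Ka; rewrite ler_wpM2r //; lra.
have [f1 f2] := h _ na q1; have [f1' f2'] := h' _ (nz_act h0 na) q3. split; first by apply: le_trans (vnD _ _) _; rewrite mulrDl; lra.
move=> z; rewrite mulrDl => hz; have K2 : 0 <= K' * vn mu * vn a by pos.
rewrite -actA addrA; apply: rch_trans (f2 z _) (f2' _ _); first by lra. by have := vnD z (F a); lra.
Qed.
Lemma germ_inv mu F : hgerm mu F ->
  hgerm (\row_j (mu 0 j)^-1) (fun a => - F (act (\row_j (mu 0 j)^-1) a)).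
move=> [K [h0 K0 h]]; set m' : H := \row_j _; exists (2 * (K * vn m')). have m'n : nz m' by exact: nz_inv.
have m0 : 0 < vn m' by rewrite vn_gt0; apply: contra_neq (m'n ord0) => ->; rewrite mxE. have Km : 0 < K * vn m' by pos.
split=> //; first by lra. move=> a na Ka; have a0 := vn_ge0 a. have q2 : K * vn (act m' a) <= K * vn m' * vn a.
  by rewrite -mulrA ler_wpM2l ?act_le // ltW.
have q4 : 0 <= K * vn m' * vn a by pos. have q3 : K * vn (act m' a) < r1 by lra.
have [f1 f2] := h _ (nz_act m'n na) q3; rewrite vnN; split; first by lra. move=> z hz; apply: rch_sym; have := f2 (z - F (act m' a)).
rewrite subrK act_inv //; apply; have := vnB z (F (act m' a)); lra.
Qed.
Lemma germ_id : hgerm (const_mx 1) (fun=> 0).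
exists 1; split=> [||a na]; [exact: nz1|exact: ltr01|].
move=> _; rewrite vn0 mul1r vn_ge0; split=> // z _; rewrite act1 addr0; exact: rch_refl.
Qed.
Lemma germ_ext mu F mu' F' : mu = mu' -> F =1 F' -> hgerm mu F -> hgerm mu' F'.
by move=> <- FF [K [h0 K0 h]]; exists K; split=> // a na /(h _ na); rewrite FF. Qed.
 Variables (de : R) (Fd : H -> Z).
Hypothesis de01 : 0 < de < 1. Hypothesis hde : hgerm (const_mx de%:C) Fd. Hypothesis dense_mult : forall (nu : H) (e : R), nz nu -> 0 < e ->
  exists mu F, hgerm mu F /\ vn (mu - nu) < e.
 Lemma act_const (c : C) (a : H) : act (const_mx c) a = c *: a.
by apply/rowP => j; rewrite !mxE. Qed.
 Lemma nz_scale (c : C) (a : H) : c != 0 -> nz a -> nz (c *: a).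
by move=> c0 ha j; rewrite mxE mulf_neq0. Qed.
 Lemma deJ_neq0 J : (de ^+ J)%:C != 0 :> C.
by have /andP[d0 _] := de01; rewrite -normc_gt0 normc_real normr_gt0 expf_neq0 // gt_eqF.
Qed.
Lemma vn_deJ J (a : H) : vn ((de ^+ J)%:C *: a) = de ^+ J * vn a.
by have /andP[d0 _] := de01; rewrite vnZ normc_real ger0_norm // exprn_ge0 // ltW.
Qed.
(** The translations of successive contractions are bounded by a geometric series, so that any
    number of them costs a fixed multiple of |a|: eta can be brought as close to 0 as wanted without
    leaving the domain. *)
Lemma contract : somepos C0, forall J a, nz a -> exists2 f, vn f <= C0 * vn a &
  forall z, vn z + C0 * vn a < r1 -> rch a z ((de ^+ J)%:C *: a) (z + f).
have /andP[d0 d1] := de01; have [K [_ K0 h]] := hde. have e0 : 0 < 1 - de by lra. exists (K / (1 - de)); first by pos.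
move=> J a na; have a0 := vn_ge0 a. have [ca|nca] := ltP (K / (1 - de) * vn a) r1; last first.
  exists 0; first by rewrite vn0 mulr_ge0 // ltW // divr_gt0. by move=> z; have := vn_ge0 z; lra.
have [f hf Hf] : exists2 f, vn f <= K * ((1 - de ^+ J) / (1 - de)) * vn a &
    forall z, vn z + K / (1 - de) * vn a < r1 -> rch a z ((de ^+ J)%:C *: a) (z + f).
  elim: J => [|J [f hf Hf]].
    exists 0; first by rewrite vn0 expr0 subrr mul0r mulr0 mul0r. by move=> z _; rewrite expr0 scale1r addr0; exact: rch_refl.
  set a' := _ *: a in Hf; have na' : nz a' by apply: nz_scale => //; exact: deJ_neq0. have dJ : 0 <= de ^+ J by pos.
  have dJ1 : de ^+ J <= 1 by rewrite exprn_ile1 // ltW.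
  have E : K * ((1 - de ^+ J) / (1 - de)) * vn a + K * vn a' = K * ((1 - de ^+ J.+1) / (1 - de)) * vn a.
    by rewrite /a' vn_deJ exprS; field; rewrite gt_eqF.
  have L j : K * ((1 - de ^+ j) / (1 - de)) * vn a <= K / (1 - de) * vn a.
    rewrite ler_wpM2r // ler_wpM2l ?(ltW K0) // ler_piMl ?invr_ge0 ?(ltW e0) //. have : 0 <= de ^+ j by pos. by lra.
  have p0 : 0 <= K * ((1 - de ^+ J) / (1 - de)) * vn a.
    apply: mulr_ge0 => //; apply: mulr_ge0; first exact: ltW. by apply: divr_ge0; lra.
  have LJ := L J.+1. have [f1 f2] := h a' na' (ltac:(lra)). exists (f + Fd a'); first by apply: le_trans (vnD _ _) _; lra.
  move=> z hz; have := f2 (z + f) (ltac:(have := vnD z f; lra)).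
  rewrite act_const /a' scalerA -rmorphM -exprS addrA; apply: rch_trans; exact: Hf.
exists f => //; apply: le_trans hf _; rewrite ler_wpM2r // ler_wpM2l ?(ltW K0) //. rewrite ler_piMl ?invr_ge0 ?(ltW e0) //.
have : 0 <= de ^+ J by pos. by lra.
Qed.
Lemma de_pow_small (c e : R) : 0 < e -> exists J, forall j, (J <= j)%N -> de ^+ j * c < e.
move=> e0; have /andP[d0 d1] := de01. have c10 : 0 < `|c| + 1 by pos. have : `|de| < 1 by rewrite ger0_norm // ltW.
move=> /cvg_expr/cvgrPdist_lt/(_ _ (divr_gt0 e0 c10))[J _ HJ].
exists J => j Jj; have := HJ _ Jj; rewrite sub0r normrN ger0_norm; last by pos. have p0 : 0 < de ^+ j by pos.
rewrite ltr_pdivlMr //; have := ler_norm c; nra.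
Qed.
Variables (a0 : H) (z0 : Z).
Hypothesis na0 : nz a0.
(** The closure of what is reachable from [(a0, z0)], over the [a] without zero entry. *)
Definition Q a z := nz a /\ forall e : R, 0 < e ->
  exists a' z', [/\ rch a0 z0 a' z', vn (a' - a) < e & vn (z' - z) < e].
Lemma Q_rch a z b u : Q a z -> rch a z b u -> Q b u.
move=> [na h] r; split; first exact: rch_nz r na. move=> e e0; have [d d0 Hd] := rch_transport r na e0. have [a' [z' [h1 h2 h3]]] := h d d0.
have [b' [u' [k1 k2 k3]]] := Hd a' z' (rch_nz h1 na0) h2 h3. by exists b', u'; split=> //; exact: rch_trans h1 k1.
Qed.
Lemma Q_closed a z : nz a -> (forall e : R, 0 < e -> exists2 z', Q a z' & vn (z' - z) < e) -> Q a z.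
move=> na h; split=> // e e0; have [z' [_ hz] nz'] := h (e / 2) (ltac:(lra)). have [a1 [z1 [h1 h2 h3]]] := hz (e / 2) (ltac:(lra)).
exists a1, z1; split=> //; first by lra. by have := vn_dist z1 z' z; lra.
Qed.
Variable C0 : R.
Hypothesis C00 : 0 < C0.
Hypothesis contr : forall J a, nz a -> exists2 f, vn f <= C0 * vn a &
  forall z, vn z + C0 * vn a < r1 -> rch a z ((de ^+ J)%:C *: a) (z + f).
Definition Dom (a : H) (z : Z) := vn z + C0 * vn a < r1.
(** Directions of the fibre along which the closure [Q] is saturated inside [Dom]; they form a
    vector space by [V_scale] and [V_add]. *)
Definition V (v : Z) := forall (c : C) a z, Q a z -> Dom a z -> Dom a (z + c *: v) -> Q a (z + c *: v).
Lemma V_scale c v : V v -> V (c *: v).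
by move=> h d a z; rewrite scalerA; exact: h. Qed.
 Lemma V_0 : V 0.
by move=> c a z; rewrite scaler0 addr0. Qed.
 Lemma vn_convex m (z y : 'rV[C]_m) s : in01 s -> vn (z + s%:C *: y) <= (1 - s) * vn z + s * vn (z + y).
move=> /andP[s0 s1]; have -> : z + s%:C *: y = (1 - s)%:C *: z + s%:C *: (z + y).
  by rewrite scalerDr addrA -scalerDl -rmorphD subrK scale1r.
by apply: le_trans (vnD _ _) _; rewrite !vnZ !normc_real !ger0_norm // subr_ge0.
Qed.
Lemma vn_convex_lt m (z y : 'rV[C]_m) s (r : R) : in01 s -> vn z < r -> vn (z + y) < r ->
  vn (z + s%:C *: y) < r.
move=> hs h1 h2; apply: le_lt_trans (vn_convex z y hs) _; move: hs => /andP[s0 s1].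
have [M [M1 M2 M3]] : exists M, [/\ vn z <= M, vn (z + y) <= M & M < r].
  exists (Num.max (vn z) (vn (z + y))). by rewrite gt_max h1 h2; split=> //; rewrite le_max lexx ?orbT.
have : (1 - s) * vn z <= (1 - s) * M by rewrite ler_wpM2l // subr_ge0. have : s * vn (z + y) <= s * M by rewrite ler_wpM2l. lra.
Qed.
Lemma Dom_convex a z y s : in01 s -> Dom a z -> Dom a (z + y) -> Dom a (z + s%:C *: y).
by move=> hs; rewrite /Dom -!ltrBrDr; exact: vn_convex_lt.
Qed.
Lemma gap (x y : R) : x < r1 -> y < r1 -> somepos g, x + g < r1 /\ y + g < r1.
move=> hx hy; have [xy|yx] := leP x y; first by exists ((r1 - y) / 2); [lra|split; lra]. by exists ((r1 - x) / 2); [lra|split; lra].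
Qed.
(** The segment from z to z + y is followed by a zigzag of 2 ^ k small moves along v1 and v2, fine
    enough to stay within the gap between the segment and the boundary of [Dom]. *)
Lemma V_add v1 v2 : V v1 -> V v2 -> V (v1 + v2).
move=> h1 h2 c a z hQ hD hD'; set y := c *: (v1 + v2) in hD' *.
have [g g0 [gz gy]] : somepos g, vn z + C0 * vn a + g < r1 /\ vn (z + y) + C0 * vn a + g < r1.
  by exact: gap.
have [k hk] := half_pow_small (vn (c *: v1)) g0. have p0 : 0 < (2 : R) ^+ k by pos.
have e2 : (2 ^ k)%:R / 2 ^+ k = 1 :> R by rewrite natrX divff // gt_eqF.
have /(_ (2 ^ k)%N (leqnn _)) : forall i, (i <= 2 ^ k)%N -> Q a (z + (i%:R / 2 ^+ k : R)%:C *: y).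
  elim=> [|i IH] ik; first by rewrite mul0r scale0r addr0. have i01 j : (j <= 2 ^ k)%N -> in01 (j%:R / 2 ^+ k : R).
    move=> jk; apply/andP; split; first by pos. by rewrite ler_pdivrMr // mul1r -natrX ler_nat.
  have hs := i01 i (ltnW ik); have hs' := i01 i.+1 ik. set s := i%:R / 2 ^+ k in hs IH *.
  have Ds : Dom a (z + s%:C *: y) by exact: Dom_convex. have sE : i.+1%:R / 2 ^+ k = s + 1 / 2 ^+ k :> R by rewrite -natr1 mulrDl.
  pose c' := (1 / 2 ^+ k : R)%:C * c. have vnc : vn (c' *: v1) = vn (c *: v1) / 2 ^+ k.
    have e0 : (0 : R) <= 1 / 2 ^+ k by apply: divr_ge0; rewrite ?ler01 // ltW.
    by rewrite /c' -scalerA vnZ normc_real ger0_norm // div1r mulrC.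
  have Q1 : Q a (z + s%:C *: y + c' *: v1).
    apply: h1 => //; first by apply: IH; exact: ltnW. rewrite /Dom; have := vnD (z + s%:C *: y) (c' *: v1). rewrite vnc.
    by have : vn (z + s%:C *: y) < r1 - C0 * vn a - g; [apply: vn_convex_lt => //; lra|lra].
  have := h2 c' a _ Q1; rewrite (_ : _ + c' *: v2 = z + (i.+1%:R / 2 ^+ k : R)%:C *: y).
    apply; last exact: Dom_convex. rewrite /Dom; have := vnD (z + s%:C *: y) (c' *: v1). rewrite vnc.
    by have : vn (z + s%:C *: y) < r1 - C0 * vn a - g; [apply: vn_convex_lt => //; lra|lra].
  by rewrite sE rmorphD scalerDl -!addrA; congr (_ + (_ + _)); rewrite /y /c' scalerA -scalerDr.
by rewrite e2 scale1r; apply.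
Qed.
Lemma V_sum (I : Type) (r : seq I) (P : pred I) (f : I -> Z) :
  (forall i, P i -> V (f i)) -> V (\sum_(i <- r | P i) f i).
by move=> h; apply: big_ind => //; [exact: V_0|exact: V_add]. Qed.
 (** Alternating the germ [F] with a correction [u] from [V] lets only the sum [F a + u]
     accumulate. *)
 Lemma iterate F a z u k (bd : R) : germ (const_mx 1) F bd -> V u -> Q a z ->
  (forall i, (i <= k)%N -> vn (z + i%:R *: (F a + u)) + 2 * bd * vn a + C0 * vn a + vn u < r1) -> Q a (z + k%:R *: (F a + u)).
move=> [_ bd0 hF] Vu hQ; elim: k => [|k IH] hn; first by rewrite scale0r addr0. have {}IH := IH (fun i h => hn i (leqW h)).
have na := hQ.1; have v0 := vn_ge0 a; have u0 := vn_ge0 u; have c0 : 0 <= C0 * vn a by pos. have b0 : 0 <= bd * vn a by pos.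
have h1 := hn k (leqnSn k); have h2 := hn k.+1 (leqnn _). set z1 := z + k%:R *: (F a + u) in IH h1 *; have z10 := vn_ge0 z1.
have [f1 /(_ z1) f2] := hF a na (ltac:(lra)). have := Q_rch IH (f2 (ltac:(lra))); rewrite act1 => Q1.
have E : z1 + F a + 1 *: u = z + k.+1%:R *: (F a + u).
  by rewrite scale1r -natr1 scalerDl scale1r /z1 !addrA.
rewrite -E; apply: Vu => //; rewrite /Dom ?E; last by lra. by have := vnD z1 (F a); lra.
Qed.

Section Periods.
Variables (F : H -> Z) (P : nat -> H -> Z) (D : nat) (CE rE : R).
Hypothesis hF : hgerm (const_mx 1) F.
Hypothesis hP : forall m c a, P m (c *: a) = c ^+ m *: P m a.
Hypothesis cP : forall m a (e : R), 0 < e -> somepos d, forall a', vn (a' - a) < d -> vn (P m a' - P m a) < e.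
Hypothesis rE0 : 0 < rE.
Hypothesis hE : forall a, vn a < rE ->
  vn (F a - \sum_(1 <= k < D.+1) P k a) <= CE * vn a ^+ D.+1.
Lemma remainder m a : (0 < m <= D)%N -> exists2 CC : R, 0 <= CC & exists J0, forall J, (J0 <= J)%N ->
  vn (F ((de ^+ J)%:C *: a) - \sum_(1 <= k < m) P k ((de ^+ J)%:C *: a) - (de ^+ (J * m))%:C *: P m a)
    <= CC * de ^+ (J * m.+1).
move=> /andP[m0 mD]; have /andP[d0 d1] := de01. have [J0 HJ] := de_pow_small (vn a) rE0. pose S := \sum_(m.+1 <= k < D.+1) vn (P k a).
have S0 : 0 <= S by pos. have A0 : 0 <= vn a ^+ D.+1 by pos. exists (S + `|CE| * vn a ^+ D.+1); first by pos.
exists J0 => J JJ; set a' := _ *: a. have va : vn a' = de ^+ J * vn a by exact: vn_deJ.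
have Pk k : P k a' = (de ^+ (J * k))%:C *: P k a by rewrite hP -rmorphXn -exprM.
have -> : F a' - \sum_(1 <= k < m) P k a' - (de ^+ (J * m))%:C *: P m a =
  (F a' - \sum_(1 <= k < D.+1) P k a') + \sum_(m.+1 <= k < D.+1) P k a'. rewrite (@big_cat_nat _ _ _ m 1 D.+1) //=; last exact: leqW.
  rewrite (@big_ltn _ _ _ m D.+1) // -Pk !opprD !addrA subrK //.
apply: le_trans (vnD _ _) _; rewrite addrC mulrDl; apply: lerD.
  apply: (@le_trans _ _ (\sum_(m.+1 <= k < D.+1) vn (P k a'))).
    elim/big_ind2: _ => [|x1 x2 y1 y2 h1 h2|//]; first by rewrite vn0. by apply: le_trans (vnD _ _) _; exact: lerD.
  rewrite /S mulr_suml big_nat_cond [leRHS]big_nat_cond; apply: ler_sum => k /andP[/andP[mk _] _].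
  rewrite Pk vnZ normc_real ger0_norm ?exprn_ge0 ?(ltW d0) // mulrC ler_wpM2l //.
  by rewrite ler_wiXn2l ?(ltW d0) ?(ltW d1) // leq_mul2l mk orbT.
apply: le_trans (hE _) _; first by rewrite va HJ. rewrite va exprMn -exprM (mulrC (_ ^+ (J * _)%N)) mulrA.
have dm : de ^+ (J * D.+1) <= de ^+ (J * m.+1).
  by rewrite ler_wiXn2l ?(ltW d0) ?(ltW d1) // leq_mul2l ltnS mD orbT.
have p1 : 0 <= de ^+ (J * D.+1) by pos. have c1 : CE * vn a ^+ D.+1 <= `|CE| * vn a ^+ D.+1 by rewrite ler_wpM2r // ler_norm.
have c2 : 0 <= `|CE| * vn a ^+ D.+1 by pos. apply: le_trans (_ : `|CE| * vn a ^+ D.+1 * de ^+ (J * D.+1) <= _).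
  by rewrite ler_wpM2r.
by rewrite ler_wpM2l.
Qed.

Ltac plra := vgen; clear - rch_refl rch_sym rch_trans rch_nz rch_transport de01 hde dense_mult na0
  z0 contr hF hP cP hE; intros; lra.
(** At a point contracted by $q=\delta^J$ the germ is $q^mP_m$ up to order $q^{m+1}$, once the terms
    of degree below m, already in [V], are subtracted. About $q^{-m}$ repetitions produce $P_m$ with
    an error of order q. *)
Lemma V_P1 m : (0 < m <= D)%N -> (forall k, (0 < k < m)%N -> forall b, nz b -> V (P k b)) ->
  forall b, nz b -> forall a z, Q a z -> Dom a z -> Dom a (z + P m b) -> Q a (z + P m b).
move=> /andP[m0 mD] IH b nb a z hQ hD hD'; set v := P m b in hD' *; have na := hQ.1. have /andP[d0 d1] := de01; apply: Q_closed => // e e0.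
have [g g0 [gz gy]] := gap hD hD'. have gz' : vn z < r1 - C0 * vn a - g by plra.
have gy' : vn (z + v) < r1 - C0 * vn a - g by move: gy; plra. have [ee ee0 [eee eeg]] : somepos ee, 16 * ee <= e /\ 16 * ee <= g.
  by have [eg|ge] := leP e g; [exists (e / 16); [plra|split; plra]|exists (g / 16); [plra|split; plra]].
(* Only a dense set of multipliers is available, so b is replaced by a nearby b' = act mu a;
   continuity of P m absorbs the change. *)
have va0 := vn_ge0 a; have vb0 := vn_ge0 b. have [d dd0 Hd] := cP m b ee0. pose nu : H := (\row_j (b 0 j / a 0 j)).
have nnu : nz nu by move=> j; rewrite mxE mulf_neq0 ?invr_neq0. have nuE : act nu a = b by apply/rowP => j; rewrite !mxE divfK.
have ea : 0 < d / (vn a + 1) by rewrite divr_gt0 //; plra. have [mu [F' [[K' [nmu K'0 hF']] hmu]]] := dense_mult nnu ea.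
set b' := act mu a; have nb' : nz b' by exact: nz_act. have hb' : vn (P m b' - v) < ee.
  apply: Hd; rewrite -nuE (_ : b' - act nu a = act (mu - nu) a); last first.
    by apply/rowP => j; rewrite !mxE mulrBl.
  apply: le_lt_trans (act_le _ _) _; rewrite ltr_pdivlMr in hmu; last by plra. by have := vn_ge0 (mu - nu); nra.
have vb'0 := vn_ge0 b'. have [bd gF] := hF; have [_ bd0 _] := gF. have [CC CC0 [J0 HR]] := @remainder m b' (ltac:(by rewrite m0)).
pose S1 := \sum_(1 <= k < m) vn (P k b'). have S10 : 0 <= S1 by apply: sumr_ge0 => k _; exact: vn_ge0.
have [J1 H1] := de_pow_small (K' * vn a) ee0. have [J2 H2] := de_pow_small ((2 * bd + C0) * vn b' + S1) ee0.
have [J3 H3] := de_pow_small CC ee0. have [J4 H4] := de_pow_small (vn v) ee0. have [J [K0 K1 K2 K3 K4]] := common_bound J0 J1 J2 J3 J4.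
have {}HR := HR _ K0; have {}H1 := H1 _ K1; have {}H2 := H2 _ K2; have {}H3 := H3 _ K3. have {}H4 := H4 _ K4; clear K0 K1 K2 K3 K4.
set q := de ^+ J in H1 H2 H3 H4; have q0 : 0 < q by rewrite exprn_gt0. have q1 : q <= 1 by rewrite exprn_ile1 // ltW.
have qm : de ^+ (J * m) = q ^+ m by rewrite exprM. have qm1 : de ^+ (J * m.+1) = q ^+ m * q by rewrite exprM exprSr.
set bJ := (de ^+ J)%:C *: b' in HR; have vbJ : vn bJ = q * vn b' by exact: vn_deJ.
have nbJ : nz bJ by apply: nz_scale => //; exact: deJ_neq0. set u := - \sum_(1 <= k < m) P k bJ. have Vu : V u.
  rewrite /u -scaleN1r; apply: V_scale; rewrite big_nat; apply: V_sum => k hk; exact: IH.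
have hu : vn u <= q * S1.
  rewrite vnN /S1 mulr_sumr; apply: (@le_trans _ _ (\sum_(1 <= k < m) vn (P k bJ))).
    elim/big_ind2: _ => [|x1 x2 y1 y2 h1 h2|//]; first by rewrite vn0. by apply: le_trans (vnD _ _) _; exact: lerD.
  rewrite big_nat_cond [leRHS]big_nat_cond; apply: ler_sum => k /andP[/andP[k0 _] _].
  rewrite hP -rmorphXn vnZ normc_real ger0_norm; last by rewrite exprn_ge0 // ltW.
  by rewrite ler_wpM2r // -/q -{2}(expr1 q) ler_wiXn2l // ltW.
set G := F bJ + u. pose qmr := q ^+ m; have qmr0 : 0 < qmr by rewrite exprn_gt0.
have hqm : qmr <= q by rewrite /qmr -{2}(expr1 q) ler_wiXn2l // ltW. have hG : vn (G - qmr%:C *: P m b') <= CC * (qmr * q).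
  by move: HR; rewrite qm qm1.
(* The number of repetitions: k times q ^ m is at most 1 and within q ^ m of it. *)
have [k [k1 k2]] := nat_approx qmr0. clearbody qmr.
have est i : (i <= k)%N -> in01 (i%:R * qmr) /\ vn (i%:R *: G - (i%:R * qmr)%:C *: v) < 2 * ee.
  move=> ik; have i0 : (0 : R) <= i%:R by []. have ikR : (i%:R : R) <= k%:R by rewrite ler_nat.
  have s1 : i%:R * qmr <= 1 by apply: le_trans k1; rewrite ler_wpM2r // ltW.
  split; first by apply/andP; split=> //; rewrite mulr_ge0 // ltW. have -> : i%:R *: G - (i%:R * qmr)%:C *: v =
      i%:R *: (G - qmr%:C *: P m b') + (i%:R * qmr)%:C *: (P m b' - v).
    by rewrite !scalerBr addrA; congr (_ - _); rewrite rmorphM rmorph_nat scalerA subrK.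
  apply: le_lt_trans (vnD _ _) _; rewrite !vnZ normc_nat normc_real ger0_norm; last by rewrite mulr_ge0 // ltW.
  have w0 := vn_ge0 (P m b' - v). have : i%:R * qmr * vn (P m b' - v) <= 1 * vn (P m b' - v) by rewrite ler_wpM2r.
  have : i%:R * vn (G - qmr%:C *: P m b') <= i%:R * (CC * (qmr * q)) by rewrite ler_wpM2l.
  have : i%:R * qmr * (q * CC) <= 1 * (q * CC) by rewrite ler_wpM2r // mulr_ge0 // ltW. plra.
have [f hf Hf] := contr J na. set aJ := (de ^+ J)%:C *: a in Hf; have vaJ : vn aJ = q * vn a by exact: vn_deJ.
have naJ : nz aJ by apply: nz_scale => //; exact: deJ_neq0. have c0 : 0 <= C0 * vn a by rewrite mulr_ge0 // ltW.
have aJb : act mu aJ = bJ by apply/rowP => j; rewrite !mxE; ring. have vz0 := vn_ge0 z.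
(* [go] is the outward trip, a contraction followed by the germ of mu. Its translation is the same
   for all z1, so the trip back cancels it. *)
have [hF1 hF2] := hF' aJ naJ (ltac:(rewrite vaJ; plra)). have go z1 : vn z1 + C0 * vn a + 2 * ee < r1 -> rch a z1 bJ (z1 + f + F' aJ).
  move=> h; apply: rch_trans (Hf _ _) _; first by plra. rewrite -aJb; apply: hF2; rewrite vaJ; have := vnD z1 f; plra.
have Q1 : Q bJ (z + f + F' aJ) by apply: Q_rch hQ _; apply: go; plra.
have zi i : (i <= k)%N -> vn (z + i%:R *: G) < r1 - C0 * vn a - g + 2 * ee.
  move=> ik; have [hs hi] := est i ik. have hc : vn (z + (i%:R * qmr)%:C *: v) < r1 - C0 * vn a - g by exact: vn_convex_lt hs gz' gy'.
  have -> : z + i%:R *: G = (z + (i%:R * qmr)%:C *: v) + (i%:R *: G - (i%:R * qmr)%:C *: v).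
    by rewrite -addrA subrKC.
  by apply: le_lt_trans (vnD _ _) _; exact: ltrD hc hi.
have Q2 : Q bJ (z + f + F' aJ + k%:R *: G).
  apply: (iterate gF Vu Q1) => i ik; rewrite -/G.
  have -> : z + f + F' aJ + i%:R *: G = (z + i%:R *: G) + (f + F' aJ) by rewrite -!addrA; congr (_ + _); rewrite [RHS]addrC addrA.
  have w1 := zi i ik. have w2 : vn (z + i%:R *: G + (f + F' aJ)) <= vn (z + i%:R *: G) + (vn f + vn (F' aJ)).
    by apply: le_trans (vnD _ _) _; rewrite lerD2l vnD.
  rewrite vaJ vbJ in hF1 *; have : 2 * bd * (q * vn b') + C0 * (q * vn b') + q * S1 = q * ((2 * bd + C0) * vn b' + S1) by ring. plra.
exists (z + k%:R *: G).
  apply: Q_rch Q2 _; apply: rch_sym.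
  have -> : z + f + F' aJ + k%:R *: G = (z + k%:R *: G) + f + F' aJ by rewrite -!addrA; congr (_ + _); rewrite [RHS]addrC addrA.
  by apply: go; have := zi k (leqnn _); plra.
have [/andP[s0 s1] hk] := est k (leqnn _).
have -> : z + k%:R *: G - (z + v) = (k%:R *: G - (k%:R * qmr)%:C *: v) + (k%:R * qmr - 1)%:C *: v.
  by rewrite opprD addrACA subrr add0r rmorphB rmorph1 scalerBl scale1r addrA subrK.
apply: le_lt_trans (vnD _ _) _; rewrite vnZ normc_real. have kq : `|k%:R * qmr - 1| <= q by exact: near_one k1 k2 hqm (ltW q0).
have : `|k%:R * qmr - 1| * vn v <= q * vn v by rewrite ler_wpM2r // vn_ge0. plra.
Qed.
(** Scalars are absorbed by homogeneity: $c\,P_m(b)=P_m(c^{1/m}b)$, and the induction hypothesis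
    covers all b. *)
Lemma V_P m : (0 < m <= D)%N -> forall b, nz b -> V (P m b).
elim/ltn_ind: m => m IH hm b nb c a z hQ hD. have [->|c0] := eqVneq c 0; first by rewrite scale0r addr0. have [w wE] := cexp_surj c0.
have -> : c *: P m b = P m (cexp (w / m%:R) *: b).
  rewrite hP -cexp_nat mulrC divfK ?wE // pnatr_eq0 -lt0n; by move/andP: hm => [].
apply: V_P1 => //; last by apply: nz_scale => //; exact: cexp_neq0. move=> k hk; apply: IH; first by move/andP: hk => [].
by move/andP: hk => [-> /ltnW/leq_trans]; apply; move/andP: hm => [].
Qed.
End Periods.

Section Fill.
Variables (l : nat) (T : 'M[C]_(N, l)) (g : H -> 'rV[C]_l) (a1 : H) (z1 : Z).
Hypothesis hT : forall v : Z, v *m T = 0 -> V v.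
Hypothesis invT : forall a z b u, nz a -> rch a z b u -> z *m T - g a = u *m T - g b.
Hypothesis na1 : nz a1.
Hypothesis cg : forall e : R, 0 < e -> somepos d, forall b, vn (b - a1) < d -> vn (g b - g a1) < e.
Hypothesis eqT : z0 *m T - g a0 = z1 *m T - g a1.
Hypothesis small0 : vn z0 < r1 / 8 /\ C0 * vn a0 < r1 / 8.
Hypothesis small1 : vn z1 < r1 / 8 /\ C0 * vn a1 < r1 / 8.
Lemma vn_mulmx p q (y : 'rV[C]_p) (A : 'M[C]_(p, q)) : exists2 K : R, 0 <= K &
  forall y : 'rV[C]_p, vn (y *m A) <= K * vn y.
exists (\sum_j \sum_i nc (A i j)).
  by apply: sumr_ge0 => j _; apply: sumr_ge0 => i _; exact: normc_ge0.
move=> x; rewrite mulr_suml; apply: ler_sum => j _; rewrite mxE mulr_suml. apply: le_trans (ler_normc_sum _ _ _) _; apply: ler_sum => i _.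
by rewrite normcM mulrC ler_wpM2l // vn_coord.
Qed.

Ltac flra := vgen; clear - rch_refl rch_sym rch_trans rch_nz rch_transport de01 hde dense_mult na0
  contr hT invT na1 cg eqT small0 small1; intros; lra.
(** A dense multiplier carries a0 near a1, over some z2. Invariance of $Tz-g$ puts z1 - z2 in the
    kernel of T up to a correction as small as the variation of g, and the kernel lies in [V]. *)
Lemma fill : Q a1 z1.
move: small0 small1 => [s1 s2] [s3 s4]; have /andP[d0 d1] := de01. split=> // e e0; have [KT KT0 HT] := vn_mulmx 0 (pinvmx T).
pose ee := minr (e / 2) (r1 / 8). have e20 : 0 < e / 2 by lra. have r8 : 0 < r1 / 8 by apply: divr_gt0.
have ee0 : 0 < ee by rewrite lt_min e20 r8. have ee1 : ee <= e / 2 by rewrite ge_min lexx.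
have ee2 : ee <= r1 / 8 by rewrite ge_min lexx orbT. have k0 : 0 < ee / (KT + 1) by rewrite divr_gt0 //; lra. have [dg dg0 Hg] := cg k0.
pose d := minr dg (minr (e / 2) (r1 / 8 / C0)). have dd0 : 0 < d by rewrite !lt_min dg0 e20 /= divr_gt0.
have [dd1 dd2 dd3] : [/\ d <= dg, d <= e / 2 & d * C0 <= r1 / 8].
  rewrite -ler_pdivlMr //; split; first by rewrite ge_min lexx.
    by rewrite !ge_min lexx orbT.
  by rewrite /d !ge_min lexx !orbT.
clearbody d ee. have va0 := vn_ge0 a0. pose nu : H := (\row_j (a1 0 j / a0 0 j)).
have nnu : nz nu by move=> j; rewrite mxE mulf_neq0 ?invr_neq0. have nuE : act nu a0 = a1 by apply/rowP => j; rewrite !mxE divfK.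
have ea : 0 < d / (vn a0 + 1) by rewrite divr_gt0 //; lra. have [mu [F' [[K' [nmu K'0 hF']] hmu]]] := dense_mult nnu ea.
set b := act mu a0; have nb : nz b by exact: nz_act. have hb : vn (b - a1) < d.
  rewrite -nuE (_ : b - act nu a0 = act (mu - nu) a0); last first.
    by apply/rowP => j; rewrite !mxE mulrBl.
  apply: le_lt_trans (act_le _ _) _; rewrite ltr_pdivlMr in hmu; last by lra. by have := vn_ge0 (mu - nu); nra.
(* The germ of mu is defined only near 0: both ends a0 and b are contracted by the same power, where
   mu acts. *)
have [J HJ] := de_pow_small (K' * vn a0) r8; have {}HJ := HJ _ (leqnn _). have [f hf Hf] := contr J na0; have [f' hf' Hf'] := contr J nb.
set aJ := (de ^+ J)%:C *: a0 in Hf; have vaJ : vn aJ = de ^+ J * vn a0 by exact: vn_deJ.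
have naJ : nz aJ by apply: nz_scale => //; exact: deJ_neq0. have aJb : act mu aJ = (de ^+ J)%:C *: b by apply/rowP => j; rewrite !mxE; ring.
have [hF1 hF2] := hF' aJ naJ (ltac:(rewrite vaJ; flra)). have vb : vn b < d + vn a1.
  by have := vnD (b - a1) a1; rewrite subrK; flra.
have cb : C0 * vn b < r1 / 4.
  have : C0 * vn b <= C0 * (d + vn a1) by rewrite ler_wpM2l // ltW. by rewrite mulrDr mulrC; flra.
pose z2 := z0 + f + F' aJ - f'. have vz2 : vn z2 <= vn z0 + vn f + vn (F' aJ) + vn f'.
  apply: le_trans (vnB _ _) _; rewrite lerD2r; apply: le_trans (vnD _ _) _. by rewrite lerD2r vnD.
have r2 : rch a0 z0 b z2.
  apply: rch_trans (Hf z0 _) _; first by flra. apply: rch_trans (hF2 _ _) _; first by rewrite vaJ; have := vnD z0 f; flra.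
  rewrite aJb; apply: rch_sym; have := Hf' z2; rewrite /z2 subrK; apply; rewrite -/z2. by rewrite vaJ in hF1; flra.
have Q2 : Q b z2.
  apply: Q_rch r2; split=> // e' e'0; exists a0, z0; rewrite !subrr !vn0; split=> //; exact: rch_refl.
have E2 : (z1 - z2) *m T = g a1 - g b.
  have h := invT na0 r2; rewrite eqT in h; rewrite mulmxBl. have -> : z1 *m T = z2 *m T - g b + g a1 by rewrite -h subrK.
  by rewrite [LHS]addrC !addrA addNr add0r addrC.
(* A small preimage of g a1 - g b under T; by E2 this vector is in the image. *)
pose s := (g a1 - g b) *m pinvmx T. have sT : s *m T = g a1 - g b by rewrite /s -E2 mulmxKpV // submxMl. have vs : vn s < ee.
  apply: le_lt_trans (HT _) _; rewrite vn_distC. have := Hg b (lt_le_trans hb dd1); rewrite ltr_pdivlMr; last by lra.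
  by have := vn_ge0 (g b - g a1); nra.
have Q3 : Q b (z1 - s).
  have Vx : V (z1 - z2 - s) by apply: hT; rewrite mulmxBl E2 sT subrr.
  have E3 : z2 + 1 *: (z1 - z2 - s) = z1 - s by rewrite scale1r addrA subrKC.
  rewrite -E3; apply: Vx => //; rewrite ?E3 /Dom; first by rewrite vaJ in hF1; flra.
  by apply: (@le_lt_trans _ _ (vn z1 + vn s + C0 * vn b)); [rewrite lerD2r vnB|flra].
have [_ /(_ (e / 2) (ltac:(lra)))[a' [z' [h1 h2 h3]]]] := Q3. exists a', z'; split=> //.
  by have := vn_dist a' b a1; flra.
have := vn_dist z' (z1 - s) z1; rewrite (_ : z1 - s - z1 = - s); last by rewrite addrAC subrr add0r. by rewrite vnN; flra.
Qed.
End Fill.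
End Density.

(** * Loops around single poles *)

Section Loops.
Context {R : realType}.
Local Notation C := R[i].
Variables (B : finType) (nb : B -> nat).
Hypotheses (nb_inj : injective nb) (nb_gt0 : forall b, (0 < nb b)%N).
Definition tbn (b : B) : C := (nb b)%:R.
Lemma prim_diff (D : C -> Prop) (F G f : C -> C) a b : cvx D -> D a -> D b ->
  (forall z, D z -> cd F z (f z)) -> (forall z, D z -> cd G z (f z)) -> F b - F a = G b - G a.
move=> cD Da Db hF hG. rewrite -(@cint_FTC _ f F a b) -?(@cint_FTC _ f G a b) // => s hs; [apply: hG|apply: hF]; exact: cD.
Qed.
Lemma mk_piece (tb : B -> C) (tau dtau : C -> C) (D : C -> Prop) : op D -> cvx D ->
  (forall s, D s -> [/\ cd tau s (dtau s), exists d, cd dtau s d, dtau s != 0 & forall b, tau s != tb b]) ->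
  exists lam, piece_ok tb (Piece tau dtau lam D).
move=> oD cD H. have /choice[lam Hl] : forall b, exists l, forall s, D s -> cd l s (dtau s / (tau s - tb b)).
  move=> b; apply: primitive => // s /H[h1 [d h2] h3 /(_ b) h4]. have h5 : tau s - tb b != 0 by rewrite subr_eq0.
  eexists; apply: cdM h2 _; apply: (@cdV _ (fun u => tau u - tb b) _ (dtau s - 0)) => //. by apply: cdB h1 _; exact: cd_cst.
exists lam; split=> // s Ds; have [h1 h2 h3 h4] := H _ Ds; split=> // b; split; [exact: h4|exact: Hl].
Qed.
Lemma convex_bounds (x y s lo hi : R) : 0 <= s <= 1 -> lo < x < hi -> lo < y < hi ->
  lo < x + s * (y - x) < hi.
move=> /andP[s0 s1] /andP[h1 h2] /andP[h3 h4]; apply/andP. by have [xy|yx] := leP x y; split; nra.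
Qed.
Lemma log_primitive : exists P : C -> C, forall u, nc u < 1 -> cd P u (1 + u)^-1.
apply: (@primitive _ (fun u => nc u < 1)).
- move=> a b s h1 h2 hs; rewrite -[seg a b s]subr0; apply: segB_lt => //; by rewrite subr0.
- move=> z hz; exists (1 - nc z); first by rewrite subr_gt0. by move=> w hw; have := ler_normcD (w - z) z; rewrite subrK; lra.
move=> z hz; have h : 1 + z != 0.
  by apply: contraTneq hz => /eqP; rewrite addrC addr_eq0 => /eqP->; rewrite normcN normc1 ltxx.
eexists; apply: (@cdV _ (fun u => 1 + u) _ (0 + 1)) => //. by apply: cdD; [exact: cd_cst|exact: cd_id].
Qed.
Lemma cexpNii : cexp (- pii) = 1 :> C.
by rewrite cexpN cexp_2pi invr1. Qed.
 (** A circle through i centred at c = m + i y above the pole m. Its squared radius y ^ 2 + 1/4 lies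
     between y ^ 2, the squared distance from c to m, and y ^ 2 + 1, a lower bound for the other
     poles. It is run through by c + k exp s, with s from 0 to $2\pi i$ inside a vertical strip. *)
 Lemma loop b : exists p : @piece R B, [/\ piece_ok tbn p, dm p 0 /\ dm p pii,
  tau p 0 = 'i, tau p pii = 'i & forall b', lam p b' pii - lam p b' 0 = if b' == b then pii else 0].
have [LP HLP] := log_primitive. pose m : R := (nb b)%:R; have m1 : 1 <= m by rewrite /m ler1n.
(* Solution of $m^2+(1-y)^2=y^2+1/4$. *)
pose y : R := (m ^+ 2 + 3 / 4) / 2; have y0 : 0 < y by pos. pose c : C := m +i* y; pose k : C := 'i - c. pose rho := nc k.
have rho2 : rho ^+ 2 = y ^+ 2 + 1 / 4.
  rewrite /rho /k /c /nc /= sqr_sqrtr; last by rewrite addr_ge0 // sqr_ge0. by rewrite /y; field.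
have rho0 : 0 < rho.
  by rewrite lt_neqAle normc_ge0 andbT; apply: contraTneq isT => /esym h; move: rho2; rewrite h; nra.
have k0 : k != 0 by rewrite -normc_gt0. have yrho : y < rho by nra. pose sig := Num.sqrt (1 + y ^+ 2).
have sig2 : sig ^+ 2 = 1 + y ^+ 2 by rewrite sqr_sqrtr //; nra. have sig0 : 0 <= sig by exact: sqrtr_ge0. have rhosig : rho < sig by nra.
have sigp : 0 < sig by lra. have kb : nc (c - tbn b) = y.
  rewrite /c /tbn -[(nb b)%:R](rmorph_nat (real_complex R)) /nc /= subrr expr0n add0r oppr0 addr0. by rewrite sqrtr_sqr gtr0_norm.
have kb' b' : b' != b -> sig <= nc (c - tbn b').
  move=> bb; rewrite /c /tbn -[(nb b')%:R](rmorph_nat (real_complex R)) /nc /= oppr0 addr0.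
  rewrite ler_sqrt; last by rewrite addr_ge0 // sqr_ge0. rewrite lerD2r /m; have [lt|gt|e] := ltngtP (nb b) (nb b').
  - have : (nb b).+1%:R <= (nb b')%:R :> R by rewrite ler_nat. by rewrite -natr1; nra.
  - have : (nb b').+1%:R <= (nb b)%:R :> R by rewrite ler_nat. by rewrite -natr1; nra. by move: bb; rewrite (nb_inj e) eqxx.
pose tau s := c + k * cexp s; pose dtau s := k * cexp s. pose D (s : C) := ln (y / rho) < Re s < ln (sig / rho).
have yr0 : 0 < y / rho by pos. have sr0 : 0 < sig / rho by pos. have De s : D s -> y < rho * expR (Re s) < sig.
  move=> /andP[h1 h2]; rewrite -ltr_expR lnK ?posrE // in h1. rewrite -ltr_expR lnK ?posrE // in h2.
  rewrite ltr_pdivrMr // in h1; rewrite ltr_pdivlMr // in h2. by rewrite mulrC h1.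
have D0 s : Re s = 0 -> D s.
  move=> h; rewrite /D h; apply/andP; split.
    by rewrite ln_lt0 // yr0 ltr_pdivrMr // mul1r.
  by rewrite ln_gt0 // ltr_pdivlMr // mul1r.
(* Logarithms of tau - tb up to constants: the factor $ke^s$ is taken out for the enclosed pole,
   $c-t_{b'}$ for the others, and what is left has the form 1 + u with |u| < 1 on the strip. *)
pose lm b' s := if b' == b then s + LP ((c - tbn b) / k * cexp (- s)) else LP (k / (c - tbn b') * cexp s). have cde s : cd tau s (dtau s).
  by apply: cd_ext (cdD (cd_cst c s) (cdZ k (cd_cexp s))) => //; rewrite add0r.
have nk s : nc (k * cexp s) = rho * expR (Re s) by rewrite normcM normc_cexp. have tb0 b' s : D s -> tau s - tbn b' != 0.
  move=> /De/andP[h1 h2]; rewrite /tau addrAC addrC -(opprK (c - tbn b')) subr_eq0. apply/eqP => h; have := nk s; rewrite h normcN.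
  by have [->|/kb'] := eqVneq b' b; [rewrite kb|]; lra.
exists (Piece tau dtau lm D); split=> /=.
- split=> /=.
  + move=> s /andP[h1 h2]; exists (minr (Re s - ln (y / rho)) (ln (sig / rho) - Re s)).
      by rewrite lt_min !subr_gt0 h1.
    move=> w /lt_minP[n1 n2]; have := ler_Re_normc (w - s); rewrite ReB. by rewrite ler_norml => /andP[g1 g2]; apply/andP; split; lra.
  + by move=> a a' s h1 h2 hs; rewrite /D /seg ReD Re_realM ReB; exact: convex_bounds.
  move=> s Ds; split=> //; first by eexists; apply: cdZ; exact: cd_cexp.
    by rewrite /dtau mulf_neq0 // cexp_neq0.
  move=> b'; split; first by rewrite -subr_eq0 tb0. rewrite /lm; have := tb0 b' s Ds; have /andP[h1 h2] := De s Ds.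
  case: (eqVneq b' b) => [->|bb] t0.
    have u1 : nc ((c - tbn b) / k * cexp (- s)) < 1.
      rewrite normcM normcM kb normcV normc_cexp -/rho (_ : Re (- s) = - Re s); last by case: (s).
      by rewrite expRN -mulrA -invfM ltr_pdivrMr ?mulr_gt0 ?expR_gt0 // mul1r.
    have dN : cd (fun v => cexp (- v)) s (- cexp (- s)).
      by apply: cd_ext (cd_comp (cdN (cd_id s)) (cd_cexp _)) => //; rewrite mulrN1.
    apply: cd_ext (cdD (cd_id s) (cd_comp (cdZ ((c - tbn b) / k) dN) (HLP _ u1))) => //.
    rewrite cexpN; have e0 := cexp_neq0 s; move: t0; rewrite /tau /dtau addrAC => t0; field. by rewrite e0 k0 t0.
  have c0 : c - tbn b' != 0 by rewrite -normc_gt0; have := kb' _ bb; lra. have u1 : nc (k / (c - tbn b') * cexp s) < 1.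
    rewrite mulrAC normcM nk normcV ltr_pdivrMr ?normc_gt0 // mul1r. by apply: lt_le_trans (kb' _ bb).
  apply: cd_ext (cd_comp (cdZ (k / (c - tbn b')) (cd_cexp s)) (HLP _ u1)) => //. move: t0; rewrite /tau /dtau addrAC => t0; field.
  by rewrite c0 t0.
- by split; apply: D0.
- by rewrite /tau cexp0 mulr1 /k addrC subrK.
- by rewrite /tau cexp_2pi mulr1 /k addrC subrK.
move=> b'; rewrite /lm; case: eqVneq => _; rewrite ?oppr0 cexp0 ?cexpNii ?cexp_2pi ?subrr //. by rewrite add0r addrK.
Qed.
End Loops.

Arguments pii {R}.

(** * The poles and exponents of the field; its multipliers *)

Section Config.
Context {R : realType}.
Local Notation C := R[i].
Variables (n L p : nat) (eps : R).
Hypothesis eps0 : 0 < eps.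
(** [inl (j, l)] is a pole acting on the entry j of eta with a small exponent; [inr (k, e)] is one
    of p poles acting on the entry k + 1 with exponent 1. *)
Definition idx : finType := (('I_n.+1 * 'I_(4 + L)) + ('I_n * 'I_p))%type.
Definition nidx (b : idx) : nat := (enum_rank b).+1.
Definition tb : idx -> C := tbn nidx.
(** Times $-2\pi i\varepsilon$, the first four values generate a dense subgroup of C. The later ones
    repeat the fourth, so that their loops have its multiplier. *)
Definition beta (l : 'I_(4 + L)) : C :=
  if l == 0 :> nat then (Num.sqrt 2)%:C else if l == 1 :> nat then 1 +i* 1 else
  if l == 2 :> nat then (Num.sqrt 2)%:C * (1 +i* 1) else 1.
Definition ex (b : idx) (j : 'I_n.+1) : C := match b with
  | inl jl => if j == jl.1 then - eps%:C * beta jl.2 else 0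
  | inr ke => if j == lift ord0 ke.1 then 1 else 0 end.
Lemma nidx_inj : injective nidx.
by move=> a b []/val_inj/enum_rank_inj. Qed. Lemma nidx_gt0 b : (0 < nidx b)%N. Proof. by []. Qed.
 Definition lp (b : idx) := projT1 (cid (loop (R:=R) nidx_inj nidx_gt0 b)).
Lemma lpP b : [/\ piece_ok tb (lp b), dm (lp b) 0 /\ dm (lp b) pii, tau (lp b) 0 = 'i, tau (lp b) pii = 'i &
  forall b', lam (lp b) b' pii - lam (lp b) b' 0 = if b' == b then pii else 0].
exact: projT2 (cid (loop nidx_inj nidx_gt0 b)). Qed.
 Definition mult (b : idx) : 'rV[C]_n.+1 := (\row_j cexp (ex b j * pii)).
 Lemma nuv_lp b : nuv ex (lp b) 0 pii = mult b.
have [_ _ _ _ H] := lpP b; apply/rowP => j; rewrite !mxE /nu (bigD1 b) //= big1 ?addr0 ?H ?eqxx //.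
by move=> b' bb; rewrite H (negbTE bb) mulr0.
Qed.
Variables (N : nat) (w : 'rV[C]_n.+2 -> 'M[C]_(n.+2, N)) (r1 Bw Lw : R).
Hypotheses (r10 : 0 < r1) (Bw0 : 0 <= Bw) (Lw0 : 0 <= Lw).
Hypothesis wfd : forall x, vn x < r1 -> forall i c, exists g, fd (fun y => w y i c) x g.
Hypothesis wB : forall x, vn x < r1 -> forall i c, nc (w x i c) <= Bw.
Hypothesis wL : forall x y, vn x < r1 -> vn y < r1 -> forall i c,
  nc (w x i c - w y i c) <= Lw * vn (x - y).
Local Notation H := 'rV[C]_n.+1.
Local Notation Z := 'rV[C]_N.
Local Notation inc := (inc tb ex w).
Definition rch (a : H) (z : Z) (b : H) (u : Z) := reach tb ex w (Om r1) ('i : C, a, z) ('i : C, b, u).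
Local Notation hgerm := (hgerm rch r1).
(** Along a fixed path everything is Lipschitz in eta and vanishes at eta = 0, so one linear bound
    controls both the curve and the increment of z. *)
Lemma small_step q s0 s1 : piece_ok tb q -> dm q s0 -> dm q s1 -> somepos K, forall a : H, K * vn a < r1 ->
  [/\ (forall c, in01 c -> vn (xl ex q s0 a (seg s0 s1 c)) < r1), vn (inc q s0 a s1) <= K * vn a &
   nz a -> forall z, vn z + K * vn a < r1 ->
   step tb ex w (Om r1) (tau q s0, a, z) (tau q s1, act (nuv ex q s0 s1) a, z + inc q s0 a s1)].
move=> ok d0 d1; have [K1 K10 H1] := cA_bdd ex ok d0 d1. have [K2 K20 H2] := inc_lip ex r10 Bw0 Lw0 wfd wB wL ok d0 d1.
exists (n.+2%:R * K1 + K2 + 1); first by have : 0 <= n.+2%:R * K1 by [apply: mulr_ge0]; lra. move=> a hK; have a0 := vn_ge0 a.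
have p1 : 0 <= n.+2%:R * K1 * vn a by pos. have p2 : 0 <= K2 * vn a by pos.
have hK' : n.+2%:R * K1 * vn a + K2 * vn a + vn a < r1 by move: hK; rewrite (mulrDl _ 1) (mulrDl (_ * _) K2) mul1r.
rewrite (mulrDl _ 1) (mulrDl (_ * _) K2) mul1r. move: hK' p1; set c2 := n.+2%:R * K1 => hK' p1.
have hx c : in01 c -> vn (xl ex q s0 a (seg s0 s1 c)) < r1.
  move=> hc; have := xl_le (ex := ex) (p := q) (s0 := s0) a 0 (fun i => (H1 c i hc).1). by rewrite xl_0 !subr0 mulrA -/c2; vlra.
have hx0 c : in01 c -> vn (xl ex q s0 0 (seg s0 s1 c)) < r1 by rewrite xl_0 vn0.
have hi c : in01 c -> vn (inc q s0 a (seg s0 s1 c)) <= K2 * vn a.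
  by move=> hc; have [] := H2 a 0 c hc hx hx0; rewrite inc_0 !subr0.
split=> //; first by have := hi 1 in01_1; rewrite seg1; vlra. move=> na z hz; apply: (step_seg wfd) => // c hc.
by apply: le_lt_trans (vnD _ _) _; have := hi _ hc; vlra.
Qed.
Definition Fl b (a : H) : Z := inc (lp b) 0 a pii.
Lemma hgerm_loop b : hgerm (mult b) (Fl b).
have [ok [d0 d1] t0 t1 _] := lpP b; have [K K0 HK] := small_step ok d0 d1. exists K; split=> //; first by move=> j; rewrite mxE cexp_neq0.
move=> a na /HK[_ h1 h2]; split=> // z hz; have := h2 na z hz. by rewrite t0 t1 nuv_lp; exact: rt_step.
Qed.
Lemma rch_refl a z : rch a z a z. Proof. exact: rt_refl. Qed.
Lemma rch_sym a z b u : rch a z b u -> rch b u a z. Proof. exact: reach_sym. Qed.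
Lemma rch_trans a z b u c v : rch a z b u -> rch b u c v -> rch a z c v.
exact: reach_trans. Qed. Lemma rch_nz a z b u : rch a z b u -> nz a -> nz b.
by move=> h ha; apply: (reach_nz h). Qed. Lemma rch_transport a z b u : rch a z b u -> nz a -> forall e : R, 0 < e ->
  somepos d, forall a' z', nz a' -> vn (a' - a) < d -> vn (z' - z) < d ->
  exists b' u', [/\ rch a' z' b' u', vn (b' - b) < e & vn (u' - u) < e].
move=> h na e e0; have [d d0 Hd] := reach_transport r10 Bw0 Lw0 wfd wB wL h na e0. by exists d => // a' z' k1 k2 k3; exact: Hd.
Qed.
(** The multipliers realised by holonomy, a group under [act]. *)
Definition Gm mu := exists F, hgerm mu F.
Lemma Gm_act mu nu : Gm mu -> Gm nu -> Gm (act mu nu).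
by move=> [F h] [F' h']; eexists; apply: (germ_comp rch_trans h' h). Qed.
 Lemma Gm_inv mu : Gm mu -> Gm (\row_j (mu 0 j)^-1).
by move=> [F h]; eexists; apply: (germ_inv rch_sym h). Qed.
 Lemma Gm1 : Gm (const_mx 1).
by eexists; exact: (germ_id r1 rch_refl). Qed.
 Definition single (j : 'I_n.+1) (x : C) : H := (\row_i (if i == j then x else 1)).
 Lemma act_single j x y : act (single j x) (single j y) = single j (x * y).
by apply/rowP => i; rewrite !mxE; case: eqP => //; rewrite mulr1. Qed.
 Lemma single1 j : single j 1 = const_mx 1.
by apply/rowP => i; rewrite !mxE; case: eqP. Qed.
 Lemma single_inv j x : single j x^-1 = (\row_i (single j x 0 i)^-1).
by apply/rowP => i; rewrite !mxE; case: eqP; rewrite ?invr1. Qed.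
 Lemma mult_single j l : mult (inl (j, l)) = single j (cexp (- eps%:C * beta l * pii)).
by apply/rowP => i; rewrite !mxE /=; case: eqP => // _; rewrite mul0r cexp0.
Qed.
Lemma Gm_nat j v (k : nat) : Gm (single j (cexp v)) -> Gm (single j (cexp (k%:R * v))).
move=> h; elim: k => [|k IH]; first by rewrite mul0r cexp0 single1; exact: Gm1.
by rewrite -natr1 mulrDl mul1r cexpD -act_single; exact: Gm_act.
Qed.
Lemma Gm_int j v (k : int) : Gm (single j (cexp v)) -> Gm (single j (cexp (k%:~R * v))).
move=> h; case: k => k; first exact: Gm_nat. rewrite NegzE rmorphN /= mulNr cexpN single_inv; apply: Gm_inv; exact: Gm_nat.
Qed.
(** The loops have logarithms $-2\pi i\varepsilon\beta$: the values 1 and $\sqrt2$ of $\beta$ give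
    the imaginary part, and $1+i$, $\sqrt2(1+i)$, after the previous ones are taken off, the real
    part. *)
Lemma Gm_lattice j (a b c d : int) :
  Gm (single j (cexp ((2 * pi * eps * (c%:~R + d%:~R * Num.sqrt 2)) +i*
                      (2 * pi * eps * (a%:~R + b%:~R * Num.sqrt 2))))).
have G l : Gm (single j (cexp (- eps%:C * beta l * pii))).
  by rewrite -mult_single; exists (Fl (inl (j, l))); exact: hgerm_loop.
pose l0 : 'I_(4 + L) := Ordinal (isT : (0 < 4 + L)%N). pose l1 : 'I_(4 + L) := Ordinal (isT : (1 < 4 + L)%N).
pose l2 : 'I_(4 + L) := Ordinal (isT : (2 < 4 + L)%N). pose l3 : 'I_(4 + L) := Ordinal (isT : (3 < 4 + L)%N).
have := Gm_act (Gm_act (Gm_int (- b - d) (G l0)) (Gm_int (- a - c) (G l3))) (Gm_act (Gm_int c (G l1)) (Gm_int d (G l2))).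
rewrite !act_single -!cexpD /beta /=; set u := cexp _; set v := cexp _; rewrite (_ : u = v) //.
rewrite /u /v; congr cexp; rewrite /pii -!(rmorph_int (real_complex R)).
by apply/eqP; rewrite eq_complex /=; apply/andP; split; apply/eqP; rewrite !rmorphB !rmorphN /= -mulr_natr; ring.
Qed.
Lemma cexp_cts z (e : R) : 0 < e -> somepos d, forall w, nc (w - z) < d -> nc (cexp w - cexp z) < e.
exact: cd_cts (cd_cexp z) e. Qed.
 Lemma Gm_dense1 j (x : C) (e : R) : x != 0 -> 0 < e -> exists2 y, Gm (single j y) & nc (y - x) < e.
move=> x0 e0; have [v vE] := cexp_surj x0. have [d d0 Hd] := cexp_cts v e0. have s0 : 0 < 2 * pi * eps by rewrite !mulr_gt0 // pi_gt0.
have d2 : 0 < d / 2 by lra. have [c [d' h1]] := kronecker (Re v) s0 d2. have [a [b h2]] := kronecker (Im v) s0 d2.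
eexists; first exact: (Gm_lattice j a b c d'). rewrite -vE; apply: Hd; apply: le_lt_trans (ler_normc_ReIm _) _; rewrite ReB ImB /=; lra.
Qed.
Lemma dense_mult (nu : H) (e : R) : nz nu -> 0 < e -> exists mu F, hgerm mu F /\ vn (mu - nu) < e.
move=> nn e0. have e1 : 0 < e / n.+2%:R by pos.
have /choice[y Hy] : forall j, exists y : C, Gm (single j y) /\ nc (y - nu 0 j) < e / n.+2%:R.
  by move=> j; have [y h1 h2] := Gm_dense1 j (nn j) e1; exists y.
have : Gm (\big[(@act R n)/const_mx 1]_j single j (y j)).
  by apply: big_ind => [|a b|j _]; [exact: Gm1|exact: Gm_act|exact: (Hy j).1].
have E (r : seq 'I_n.+1) : uniq r -> forall i, (\big[(@act R n)/const_mx 1]_(j <- r) single j (y j)) 0 i = if i \in r then y i else 1.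
  elim: r => [_ i|j r IH /= /andP[jr ur] i]; first by rewrite big_nil mxE.
  rewrite big_cons !mxE IH // inE; case: eqP => [->|_] /=; first by rewrite (negbTE jr) mulr1. by rewrite mul1r.
move=> [F hF]; eexists; exists F; split; first exact: hF. apply: le_lt_trans (_ : n.+1%:R * (e / n.+2%:R) < e).
  apply: vn_le => i; rewrite !mxE E ?index_enum_uniq // mem_index_enum ltW //; exact: (Hy i).2.
by rewrite mulrA ltr_pdivrMr ?ltr0Sn // mulrC ltr_pM2l // ltr_nat.
Qed.
Definition de : R := expR (- (2 * pi * eps)).
Lemma de01 : 0 < de < 1.
by rewrite expR_gt0 /= -expR0 ltr_expR oppr_lt0 !mulr_gt0 // pi_gt0.
Qed.
Lemma hgerm_de : exists F, hgerm (const_mx de%:C) F.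
have G j : Gm (single j de%:C).
  have := Gm_lattice j 0 0 (-1) 0; rewrite !mul0r !addr0 mulr0 /de -cexp_real. by rewrite rmorphN rmorph1 mulrN1.
have -> : const_mx de%:C = \big[(@act R n)/const_mx 1]_j single j de%:C.
  have E (r : seq 'I_n.+1) : uniq r -> forall i, (\big[(@act R n)/const_mx 1]_(j <- r) single j de%:C) 0 i = if i \in r then de%:C else 1.
    elim: r => [_ i|j r IH /= /andP[jr ur] i]; first by rewrite big_nil mxE.
    rewrite big_cons !mxE IH // inE; case: eqP => [->|_] /=; first by rewrite (negbTE jr) mulr1. by rewrite mul1r.
  by apply/rowP => i; rewrite E ?index_enum_uniq // mem_index_enum mxE.
by apply: (big_ind (fun m => Gm m)) => [|a b|j _]; [exact: Gm1|exact: Gm_act|exact: G].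
Qed.

(* Two loops with the same multiplier differ by a germ fixing eta. *)
Lemma hgerm_diff j (l l' : 'I_(4 + L)) : (3 <= l)%N -> (3 <= l')%N ->
  hgerm (const_mx 1) (fun a => Fl (inl (j, l)) a - Fl (inl (j, l')) a).
move=> hl hl'; have b1 (k : 'I_(4 + L)) : (3 <= k)%N -> beta k = 1.
  by rewrite /beta; case: (nat_of_ord k) => [|[|[|k']]].
have E : mult (inl (j, l')) = mult (inl (j, l)) by rewrite !mult_single !b1.
have h1 := hgerm_loop (inl (j, l)); have h2 := germ_inv rch_sym (hgerm_loop (inl (j, l'))).
have n1 : nz (mult (inl (j, l))) by move=> i; rewrite mxE cexp_neq0. apply: germ_ext (germ_comp rch_trans h1 h2).
  by apply/rowP => i; rewrite E !mxE mulVf // cexp_neq0.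
move=> a /=; congr (_ - Fl _ _); rewrite E. by apply/rowP => i; rewrite !mxE mulKf // cexp_neq0.
Qed.
End Config.

(** * Residues and polynomial primitives *)

Section PolyCalculus.
Context {R : realType}.
Local Notation C := R[i].
Lemma cd_horner (q : {poly C}) s : cd (fun t => q.[t]) s (q^`()).[s].
elim/poly_ind: q => [|q c IH].
  by apply: cd_ext (cd_cst 0 s) => [t|]; rewrite ?derivC ?horner0.
apply: cd_ext (cdD (cdM IH (cd_id s)) (cd_cst c s)) => [t|].
  by rewrite !hornerE.
by rewrite derivMXaddC !hornerE; ring.
Qed.
Definition pprim (q : {poly C}) : {poly C} := \poly_(i < (size q).+1) (q`_i.-1 / i%:R).
Lemma deriv_pprim q : (pprim q)^`() = q.
apply/polyP => i; rewrite coef_deriv coef_poly ltnS /=. have [iq|qi] := ltnP i (size q); last by rewrite mul0rn nth_default.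
by rewrite -[_ *+ _]mulr_natr divfK // pnatr_eq0.
Qed.
Lemma size_pprim q : (size (pprim q) <= (size q).+1)%N. Proof. exact: size_poly. Qed.
Definition pprim0 (q : {poly C}) c := pprim q - (pprim q).[c]%:P.
Lemma deriv_pprim0 q c : (pprim0 q c)^`() = q.
by rewrite /pprim0 derivB derivC subr0 deriv_pprim. Qed. Lemma pprim0_root q c : (pprim0 q c).[c] = 0.
by rewrite /pprim0 !hornerE subrr. Qed. Lemma size_pprim0 q c : (size (pprim0 q c) <= (size q).+1)%N.
apply: leq_trans (size_polyD _ _) _; rewrite size_polyN geq_max size_pprim. by apply: leq_trans (size_polyC_leq1 _) _.
Qed.
(** Division of Q by X - c leaves a polynomial in tau, exact on a path whose ends have the same tau,
    and the constant Q(c), which [lam] integrates. *)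
Lemma cint_residue (Q : {poly C}) (tau dtau lam : C -> C) (c s0 s1 : C) (D : C -> Prop) :
  cvx D -> D s0 -> D s1 -> tau s0 = tau s1 ->
  (forall s, D s -> [/\ cd tau s (dtau s), tau s - c != 0 & cd lam s (dtau s / (tau s - c))]) ->
  cint (fun s => Q.[tau s] * (dtau s / (tau s - c))) s0 s1 = Q.[c] * (lam s1 - lam s0).
move=> cD D0 D1 tt H. have /factor_theorem[q qE] : root (Q - Q.[c]%:P) c by rewrite rootE !hornerE subrr.
rewrite (@cint_FTC _ _ (fun s => (pprim q).[tau s] + Q.[c] * lam s)).
  by rewrite tt; ring.
move=> a ha; have [h1 h2 h3] := H _ (cD _ _ _ D0 D1 ha). apply: cd_ext (cdD (cd_comp h1 (cd_horner _ _)) (cdZ Q.[c] h3)) => //.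
rewrite deriv_pprim; have -> : Q.[tau (seg s0 s1 a)] = q.[tau (seg s0 s1 a)] * (tau (seg s0 s1 a) - c) + Q.[c].
  by rewrite -[Q in LHS](subrK Q.[c]%:P) qE !hornerE.
by field.
Qed.
Lemma cts_sum_seg (I : Type) (r : seq I) (F : I -> C -> C) a b : (forall i, ctseg (F i) a b) ->
  ctseg (fun w => \sum_(i <- r) F i w) a b.
by move=> h s hs; apply: cts_sum => i; exact: h. Qed.
 Lemma cint_sum (I : Type) (r : seq I) (F : I -> C -> C) a b : (forall i, ctseg (F i) a b) ->
  cint (fun w => \sum_(i <- r) F i w) a b = \sum_(i <- r) cint (F i) a b.
move=> h; elim: r => [|i r IH].
  rewrite big_nil (@cint_FTC _ _ (fun=> 0)) ?subrr // => s _. by apply: cd_ext (cd_cst 0 _) => //; rewrite big_nil.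
rewrite big_cons -IH -cintD //; last exact: cts_sum_seg. by apply: cint_eq => [|s _]; [apply: cts_sum_seg|rewrite big_cons].
Qed.

(* The dependence on e of an integral with an exponential factor. *)
Lemma cint_exp_limit (G X : C -> C) a b : ctseg G a b -> ctseg X a b -> forall d : R, 0 < d ->
  somepos e0, forall e : R, 0 < e < e0 ->
  nc (cint (fun s => cexp (- e%:C * G s) * X s) a b - cint X a b) < d.
move=> hG hX d d0; have [KG HG] := cts_bdd hG; have [KX HX] := cts_bdd hX.
have kx : 0 <= KX by apply: le_trans (HX _ in01_0); exact: normc_ge0. have kg : 0 <= KG by apply: le_trans (HG _ in01_0); exact: normc_ge0.
have nb := normc_ge0 (b - a). pose d1 := d / (2 * (KX * nc (b - a) + 1)). have p0 : 0 <= KX * nc (b - a) by pos. have d10 : 0 < d1 by pos.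
have [r r0 Hr] := cd_cts (cd_cexp (0 : C)) d10. exists (r / (KG + 1)); first by pos.
move=> e /andP[e0 er]; rewrite ltr_pdivlMr in er; last by lra. have cE : ctseg (fun s => cexp (- e%:C * G s)) a b.
  move=> s hs; apply: (@cts_comp _ (fun s => - e%:C * G s) cexp); last exact: cd_cts (cd_cexp _).
  by apply: ctsM; [exact: cts_cst|exact: hG].
rewrite -cintB //; last exact: ctsegM. apply: le_lt_trans (_ : d1 * KX * nc (b - a) < d); last first.
  by rewrite /d1 -mulrA mulrAC ltr_pdivrMr ?mulr_gt0 //; [nra|lra].
apply: cint_le => [|s hs].
  by apply: ctsegD; [exact: ctsegM|move=> s hs; apply: ctsN; exact: hX].
have -> : cexp (- e%:C * G (seg a b s)) * X (seg a b s) - X (seg a b s) =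
  (cexp (- e%:C * G (seg a b s)) - cexp 0) * X (seg a b s) by rewrite cexp0; ring.
rewrite normcM; apply: ler_pM; rewrite //; last exact: HX. apply/ltW/Hr; rewrite subr0 normcM normcN normc_real gtr0_norm //.
have := HG _ hs; have := normc_ge0 (G (seg a b s)); nra.
Qed.
End PolyCalculus.

(** * Integrals of $x^K\,dx_i$ over the loops, to first order in eps *)

Section LoopIntegral.
Context {R : realType}.
Local Notation C := R[i].
Variables (n L p : nat).
Local Notation idx := (idx n L p).
Local Notation tb := (@tb R n L p).
Local Notation lp := (@lp R n L p).
Definition bt (b : idx) (j : 'I_n.+1) : C := if b is inl jl then (if j == jl.1 then beta jl.2 else 0) else 0.
Definition xt (b : idx) (j : 'I_n.+1) : bool := if b is inr ke then j == lift ord0 ke.1 else false.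
Lemma exE eps b j : ex eps b j = - eps%:C * bt b j + (xt b j)%:R.
by case: b => [[j' l]|[k e]] /=; case: eqP; rewrite ?mulr0 ?addr0 ?add0r. Qed.
 (** At eps = 0 only the exponents 1 remain, and the orbit through eta = 1 over t = i is the
     polynomial curve [xh], built from [wj] with value 1 at i. On it [Um] is $x^K$ and [Uh] the
     primitive of $x^K\,dx_i$ vanishing at i. *)
 Definition wj (j : 'I_n.+1) : {poly C} := \prod_(b | xt b j) (('i%C - tb b)^-1 *: ('X - (tb b)%:P)).
Definition xh (i : 'I_n.+2) : {poly C} := (if i == i1 n then 'X else 1) * wj (sg i).
Definition Um (K : {ffun 'I_n.+2 -> nat}) : {poly C} := \prod_l xh l ^+ K l. Definition Uh K i := pprim0 (Um K * (xh i)^`()) 'i%C.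
Definition kq (K : {ffun 'I_n.+2 -> nat}) i b : C := \sum_l (K l)%:R * bt b (sg l) + bt b (sg i).
(** The numerator over t - tb b in the first-order term of $x^K\,dx_i$, as left by the integration
    by parts in [integrandE]. *)
Definition Qb K i b : {poly C} := kq K i b *: Uh K i - bt b (sg i) *: (Um K * xh i).
 Section OneLoop.
Variable b0 : idx. Local Notation q := (lp b0). Local Notation D := (dm q).
 Definition La j s : C := \sum_b bt b j * (lam q b s - lam q b 0).
Definition dLa j s : C := \sum_b bt b j * (dtau q s / (tau q s - tb b)).
 Lemma q_ok : piece_ok tb q. Proof. by case: (@lpP R n L p b0). Qed.
Lemma q_cvx : cvx D. Proof. by case: q_ok. Qed. Lemma q_0 : D 0. Proof. by case: (@lpP R n L p b0) => _ []. Qed.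
Lemma q_pii : D pii. Proof. by case: (@lpP R n L p b0) => _ []. Qed.
Lemma q_seg s : in01 s -> D (seg 0 pii s). Proof. exact: q_cvx q_0 q_pii. Qed.
Lemma tau_0 : tau q 0 = 'i%C. Proof. by case: (@lpP R n L p b0). Qed.
Lemma tau_pii : tau q pii = 'i%C. Proof. by case: (@lpP R n L p b0). Qed.
 Lemma cd_La j s : D s -> cd (La j) s (dLa j s).
move=> hs; apply: cd_sum => b; apply: cdZ; rewrite -[_ / _]subr0. by apply: cdB; [exact: (cd_lam q_ok)|exact: cd_cst].
Qed.
Lemma exp_lam b s : D s -> cexp (lam q b s - lam q b 0) = (tau q s - tb b) / ('i%C - tb b).
move=> hs. pose f u := (tau q u - tb b) * cexp (- (lam q b u - lam q b 0)). have df u : D u -> cd f u 0.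
  move=> hu; have t0 := tau_neq q_ok b hu.
  have h1 : cd (fun v => tau q v - tb b) u (dtau q u - 0) by apply: cdB (cd_tau q_ok hu) (cd_cst _ _).
  have h2 : cd (fun v => - (lam q b v - lam q b 0)) u (- (dtau q u / (tau q u - tb b) - 0)).
    by apply/cdN/cdB; [exact: (cd_lam q_ok)|exact: cd_cst].
  by apply: cd_ext (cdM h1 (cd_comp h2 (cd_cexp _))) => //; field.
have := prim_diff q_cvx q_0 hs df (fun z _ => cd_cst 0 z).
rewrite subrr /f subrr oppr0 cexp0 mulr1 tau_0 cexpN => /eqP; rewrite subr_eq0 => /eqP h.
have t0 : 'i%C - tb b != 0 by rewrite -tau_0; apply: (tau_neq q_ok b q_0). have e0 := cexp_neq0 (lam q b s - lam q b 0).
by rewrite -h invf_div mulrC divfK // (tau_neq q_ok b hs).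
Qed.
(** The exponent is the sum of a 0-1 part and a part proportional to eps; the former gives the
    polynomial [wj], so eps occurs only in the exponential factor. *)
Lemma nuE eps j s : D s -> nu (ex eps) q 0 j s = (wj j).[tau q s] * cexp (- eps%:C * La j s).
move=> hs; rewrite /nu. under eq_bigr do rewrite exE mulrDl. rewrite big_split cexpD mulrC; congr (_ * _); last first.
  by rewrite /La mulr_sumr; congr cexp; apply: eq_bigr => b _; rewrite mulrA.
rewrite cexp_sum /wj horner_prod [RHS]big_mkcond; apply: eq_bigr => b _. case: (xt b j); last by rewrite mul0r cexp0.
by rewrite mul1r exp_lam // !hornerE mulrC.
Qed.
Local Notation one := (const_mx 1 : 'rV[C]_n.+1).
Lemma xlhE eps i s : D s -> xl (ex eps) q 0 one s 0 i = (xh i).[tau q s] * cexp (- eps%:C * La (sg i) s).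
move=> hs; rewrite !mxE mulr1 /cA nuE // mulrA; congr (_ * _). by rewrite /th /xh; case: eqP => _; rewrite !hornerE.
Qed.
Lemma monlhE eps K s : D s -> mon K (xl (ex eps) q 0 one s) =
  (Um K).[tau q s] * cexp (- eps%:C * \sum_l (K l)%:R * La (sg l) s).
move=> hs; rewrite /mon /Um horner_prod mulr_sumr cexp_sum -big_split; apply: eq_bigr => l _ /=.
by rewrite xlhE // exprMn horner_exp -cexp_nat; congr (_ * cexp _); ring.
Qed.
Definition Gs (K : {ffun 'I_n.+2 -> nat}) i s := \sum_l (K l)%:R * La (sg l) s + La (sg i) s.
Definition Xi K i s := \sum_b (Qb K i b).[tau q s] * (dtau q s / (tau q s - tb b)).
Lemma xdhE eps i s : D s -> xd tb (ex eps) q 0 one s 0 i =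
  cexp (- eps%:C * La (sg i) s) *
  ((xh i)^`().[tau q s] * dtau q s - eps%:C * ((xh i).[tau q s] * dLa (sg i) s)).
move=> hs; apply: cd_unique (cdv_xl (ex eps) q_ok 0 one hs i) _. have h := cdM (cd_comp (cd_tau q_ok hs) (cd_horner (xh i) _))
  (cd_comp (cdZ (- eps%:C) (cd_La (sg i) hs)) (cd_cexp _)).
have [oD _ _] := q_ok; have [r r0 Hr] := oD _ hs. apply: (@cd_near _ _ _ _ _ r r0 (fun u hu => esym (xlhE eps i (Hr u hu)))).
by apply: cd_ext h => //; ring.
Qed.
Lemma sum_dLa (K : {ffun 'I_n.+2 -> nat}) i s : \sum_l (K l)%:R * dLa (sg l) s + dLa (sg i) s =
  \sum_b kq K i b * (dtau q s / (tau q s - tb b)).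
rewrite /dLa; under eq_bigr do rewrite mulr_sumr. rewrite exchange_big -big_split; apply: eq_bigr => b _ /=.
by rewrite /kq mulrDl mulr_suml; congr (_ + _); apply: eq_bigr => l _; rewrite mulrA.
Qed.
(** Integration by parts: at eps = 0 the integrand has the primitive [Uh], so along the perturbed
    curve it is exact up to eps times an exponential factor times [Xi], a form with simple poles. *)
Lemma integrandE eps K i s : D s -> cd (fun u => cexp (- eps%:C * Gs K i u) * (Uh K i).[tau q u]) s
  (mon K (xl (ex eps) q 0 one s) * xd tb (ex eps) q 0 one s 0 i
   - eps%:C * (cexp (- eps%:C * Gs K i s) * Xi K i s)).
move=> hs. have hG : cd (Gs K i) s (\sum_b kq K i b * (dtau q s / (tau q s - tb b))).
  rewrite -sum_dLa; apply: cdD (cd_La _ hs); apply: cd_sum => l; apply: cdZ; exact: cd_La.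
have h := cdM (cd_comp (cdZ (- eps%:C) hG) (cd_cexp _)) (cd_comp (cd_tau q_ok hs) (cd_horner (Uh K i) _)).
apply: cd_ext h => //; rewrite monlhE // xdhE // /Uh deriv_pprim0 -/(Uh K i) (hornerM (Um K)). have -> : cexp (- eps%:C * Gs K i s) =
  cexp (- eps%:C * \sum_l (K l)%:R * La (sg l) s) * cexp (- eps%:C * La (sg i) s). by rewrite -cexpD -mulrDr.
have -> : Xi K i s = (\sum_b kq K i b * (dtau q s / (tau q s - tb b))) * (Uh K i).[tau q s]
   - (Um K).[tau q s] * (xh i).[tau q s] * dLa (sg i) s.
  rewrite /Xi /dLa mulr_suml mulr_sumr -sumrB; apply: eq_bigr => b _. by rewrite /Qb hornerD hornerN !hornerZ hornerM; ring.
by ring.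
Qed.
Lemma cts_Xi K i : ctseg (Xi K i) 0 pii.
move=> s hs; have hD := q_seg hs; apply: cts_sum => b; apply: ctsM.
  exact: cd_cts (cd_comp (cd_tau q_ok hD) (cd_horner _ _)).
have [d hd] := cd_dtau q_ok hD; apply: ctsM (cd_cts hd) _. apply: (@ctsV _ (fun u => tau q u - tb b)); first exact: (tau_neq q_ok).
by apply: ctsB (cts_cst _ _); exact: cd_cts (cd_tau q_ok hD).
Qed.
Lemma cts_Gs K i : ctseg (Gs K i) 0 pii.
move=> s hs; have hD := q_seg hs; apply: ctsD; last exact: cd_cts (cd_La _ hD).
by apply: cts_sum => l; apply: ctsM (cts_cst _ _) _; exact: cd_cts (cd_La _ hD).
Qed.
Definition Jb eps K i := cint (fun s => mon K (xl (ex eps) q 0 one s) * xd tb (ex eps) q 0 one s 0 i) 0 pii.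
Lemma ctseg_integrand eps K i : ctseg (fun s => mon K (xl (ex eps) q 0 one s) * xd tb (ex eps) q 0 one s 0 i) 0 pii.
move=> s hs; have hD := q_seg hs; apply: ctsM.
  by have [g hg] := fd_mon K (xl (ex eps) q 0 one (seg 0 pii s)); exact: cd_cts (fd_cd hg (cdv_xl _ q_ok _ _ hD)).
have [d hd] := hol_cA' (ex eps) q_ok 0 i hD. by apply: cts_ext (cd_cts hd) => u; rewrite mxE mxE mulr1.
Qed.
(** Boundary terms vanish, as [Uh] is 0 at t = i where the loop closes. What remains is eps times
    the integral of [Xi] with a factor tending to 1, and only the enclosed pole contributes a
    residue. *)
Lemma Jb_limit K i (d : R) : 0 < d -> somepos e0, forall eps : R, 0 < eps < e0 ->
  nc (Jb eps K i / eps%:C - (Qb K i b0).[tb b0] * pii) < d.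
move=> d0; have [e0 e00 He] := cint_exp_limit (cts_Gs K i) (cts_Xi K i) d0. exists e0 => // eps he; have /andP[eps0 _] := he.
have ee0 : eps%:C != 0 :> C by rewrite -normc_gt0 normc_real normr_gt0 gt_eqF.
have cE : ctseg (fun s => cexp (- eps%:C * Gs K i s) * Xi K i s) 0 pii.
  apply: ctsegM (cts_Xi _ _) => s hs; apply: (@cts_comp _ (fun s => - eps%:C * Gs K i s) cexp).
    by apply: ctsM (cts_cst _ _) _; exact: cts_Gs.
  exact: cd_cts (cd_cexp _).
have EX : cint (Xi K i) 0 pii = (Qb K i b0).[tb b0] * pii.
  rewrite /Xi cint_sum; last first.
    move=> b s hs; have hD := q_seg hs; apply: ctsM.
      exact: cd_cts (cd_comp (cd_tau q_ok hD) (cd_horner _ _)).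
    have [d' hd] := cd_dtau q_ok hD; apply: ctsM (cd_cts hd) _. apply: (@ctsV _ (fun u => tau q u - tb b)); first exact: (tau_neq q_ok).
    by apply: ctsB (cts_cst _ _); exact: cd_cts (cd_tau q_ok hD).
  have Hl : forall b, lam q b pii - lam q b 0 = if b == b0 then pii else 0 by case: (@lpP R n L p b0).
  have E b : cint (fun w => (Qb K i b).[tau q w] * (dtau q w / (tau q w - tb b))) 0 pii = (Qb K i b).[tb b] * (lam q b pii - lam q b 0).
    apply: (@cint_residue R (Qb K i b) (tau q) (dtau q) (lam q b) (tb b) 0 pii D q_cvx q_0 q_pii); first by rewrite tau_0 tau_pii.
    by move=> s hs; split; [exact: (cd_tau q_ok)|exact: (tau_neq q_ok)|exact: (cd_lam q_ok)].
  rewrite (bigD1 b0) //= big1 ?addr0 ?E ?Hl ?eqxx // => b bb. by rewrite E Hl (negbTE bb) mulr0.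
have JE : Jb eps K i = eps%:C * cint (fun s => cexp (- eps%:C * Gs K i s) * Xi K i s) 0 pii.
  have h := @cint_FTC R (fun s => mon K (xl (ex eps) q 0 (const_mx 1) s) * xd tb (ex eps) q 0 (const_mx 1) s 0 i
   - eps%:C * (cexp (- eps%:C * Gs K i s) * Xi K i s))
   (fun u => cexp (- eps%:C * Gs K i u) * (Uh K i).[tau q u]) 0 pii (fun s hs => integrandE eps K i (q_seg hs)).
  rewrite tau_0 tau_pii /Uh pprim0_root !mulr0 subrr in h. have e := cintB (@ctseg_integrand eps K i) (ctsegM (ctseg_cst eps%:C 0 pii) cE).
  by move: h; rewrite e cintZ // => /eqP; rewrite subr_eq0 => /eqP.
by rewrite JE mulrC mulKf // -EX; exact: He.
Qed.
End OneLoop.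
End LoopIntegral.

(** * A polynomial form with vanishing first-order periods is closed *)

Section Algebra.
Context {R : realType}.
Local Notation C := R[i].
Variables (n D p L : nat).
Hypotheses (pD : (D <= p)%N) (LD : (D * p.+1 < L)%N).
Local Notation idx := (idx n L p).
Local Notation tb := (@tb R n L p).
Local Notation xh := (@xh R n L p).
Local Notation wj := (@wj R n L p).
Local Notation Um := (@Um R n L p).
Local Notation Uh := (@Uh R n L p).
Local Notation Qb := (@Qb R n L p).
Local Notation i1 := (i1 n).
Local Notation i0 := (i0 n).
Implicit Types (K : {ffun 'I_n.+2 -> nat}) (i l : 'I_n.+2) (j : 'I_n.+1).
Lemma tb_inj : injective tb.
move=> a b /eqP; rewrite /tb /tbn eqr_nat => /eqP; exact: nidx_inj.
Qed.
Lemma card_xt j : (#|[pred b : idx | xt b j]| <= p)%N.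
case: (unliftP ord0 j) => [k ->|->]; last first.
  by rewrite (eq_card (B := pred0)) ?card0 // => -[[]|[k e]].
apply: leq_trans (_ : #|[seq (inr (k, e) : idx) | e in 'I_p]| <= p)%N; last first.
  by apply: leq_trans (leq_image_card _ _) _; rewrite card_ord.
apply: subset_leq_card; apply/fintype.subsetP => -[[]//|[k' e]].
by rewrite inE /= (inj_eq (@lift_inj _ _)) => /eqP->; apply/fintype.imageP; exists e.
Qed.
Lemma size_wj j : (size (wj j) <= p.+1)%N.
apply: leq_trans (size_prod_leq _ _) _; rewrite leq_subLR. apply: (@leq_trans (#|[pred b : idx | xt b j]| * 2).+1).
  rewrite ltnS -sum_nat_const; apply: leq_sum => b _. by apply: leq_trans (size_scale_leq _ _) _; rewrite size_XsubC.
by rewrite mulnC mul2n -addnn -addnS leq_add2l ltnS card_xt.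
Qed.
Lemma size_xh i : (size (xh i) <= p.+2)%N.
apply: leq_trans (size_polyMleq _ _) _; rewrite -subn1 leq_subLR add1n. have h := size_wj (sg i).
apply: (@leq_trans (2 + p.+1)); last by []. apply: leq_add h; case: ifP => _; rewrite ?size_polyX ?size_poly1 //.
Qed.
Lemma size_expn (q : {poly C}) k m : (size q <= k.+1)%N -> (size (q ^+ m) <= (m * k).+1)%N.
move=> h; elim: m => [|m IH]; first by rewrite expr0 size_poly1.
rewrite exprS; apply: leq_trans (size_polyMleq _ _) _; rewrite -subn1 leq_subLR add1n. by rewrite mulSn -addnS -addSn; apply: leq_add.
Qed.
Lemma size_Um K : (size (Um K) <= (mdg K * p.+1).+1)%N.
rewrite /Um /mdg big_distrl /=. elim/big_ind2: _ => [|q1 k1 q2 k2 h1 h2|l _]; first by rewrite size_poly1.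
  apply: leq_trans (size_polyMleq _ _) _; rewrite -subn1 leq_subLR add1n -addnS -addSn. exact: leq_add.
by apply: size_expn; exact: size_xh.
Qed.
(** Each coordinate of the curve has degree at most p + 1 in t, and $x^Kx_i$ has at most D factors;
    [Uh] obeys the same bound because derivation and integration compensate. *)
Lemma size_Q K i b : (mdg K < D)%N -> (size (Qb K i b) <= (D * p.+1).+1)%N.
move=> KD; have hU := size_Um K; have hx := size_xh i. have le : ((mdg K * p.+1).+1 + p.+2 <= (D * p.+1).+2)%N.
  by rewrite addSn ltnS addnC addSn ltnS -mulSn leq_mul2r KD orbT.
apply: leq_trans (size_polyD _ _) _; rewrite size_polyN geq_max; apply/andP; split.
  apply: leq_trans (size_scale_leq _ _) _; apply: leq_trans (size_pprim0 _ _) _; rewrite ltnS.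
  apply: leq_trans (size_polyMleq _ _) _; rewrite -subn1 leq_subLR add1n.
  rewrite -ltnS; apply: leq_trans le; rewrite -addnS; apply: leq_add hU _.
  apply: leq_trans (_ : (size (xh i)).-1.+1 <= _)%N; last by case: (size _) hx. by rewrite ltnS /deriv; apply: leq_trans (size_poly _ _) _.
apply: leq_trans (size_scale_leq _ _) _; apply: leq_trans (size_polyMleq _ _) _.
by rewrite -subn1 leq_subLR add1n; apply: leq_trans (leq_add hU hx) _.
Qed.
Variable th : 'I_n.+2 -> polyf (R := R) n.+2.
Hypothesis thD : forall i u, u \in th i -> (mdg u.2 < D)%N.
(** Scaling factors of the coordinates of x when eta is scaled by a; those of $x_0$ and $x_1$
    agree. *)
Definition Sa (a : 'rV[C]_n.+1) : 'rV[C]_n.+2 := (\row_i a 0 (sg i)).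
(** Up to $2\pi i$, the limiting period differences of $\theta=\sum_i\theta_i\,dx_i$ for the curves
    scaled by a. The aim is $d\theta=0$. *)
Hypothesis ker : forall j (l l' : 'I_(4 + L)) (a : 'rV[C]_n.+1), (3 <= l)%N -> (3 <= l')%N -> nz a ->
  \sum_i \sum_(u <- th i) u.1 * mon (raise i u.2) (Sa a) *
    ((Qb u.2 i (inl (j, l))).[tb (inl (j, l))] - (Qb u.2 i (inl (j, l'))).[tb (inl (j, l'))]) = 0.
Definition l3 : 'I_(4 + L) := Ordinal (isT : (3 < 4 + L)%N).
Definition Aj j a : {poly C} := \sum_i \sum_(u <- th i) (u.1 * mon (raise i u.2) (Sa a)) *: Qb u.2 i (inl (j, l3)).
Lemma bt3 j (l : 'I_(4 + L)) j' : (3 <= l)%N -> bt (R := R) (inl (j, l) : idx) j' = bt (inl (j, l3) : idx) j'.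
by rewrite /bt /= /beta; case: (nat_of_ord l) => [|[|[|k]]]. Qed.
 Lemma Qb3 K i j (l : 'I_(4 + L)) : (3 <= l)%N -> Qb K i (inl (j, l)) = Qb K i (inl (j, l3)).
move=> h; rewrite /Submission.Qb /kq bt3 //; congr (_ *: _ - _); congr (_ + _). by apply: eq_bigr => l' _; rewrite bt3.
Qed.
Lemma size_Aj j a : (size (Aj j a) <= (D * p.+1).+1)%N.
apply: leq_trans (size_sum _ _ _) _; apply/bigmax_leqP => i _.
rewrite big_seq; apply: (big_ind (fun q : {poly C} => (size q <= (D * p.+1).+1)%N)) => [|q1 q2 h1 h2|u hu].
- by rewrite size_poly0.
- by apply: leq_trans (size_polyD _ _) _; rewrite geq_max h1. by apply: leq_trans (size_scale_leq _ _) _; apply: size_Q; exact: thD hu.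
Qed.
(** All poles (j, l) with l at least 3 share the polynomial [Aj]. The hypothesis gives it the same
    value at the L poles of index 4 and above as at index 3, which is more than a nonconstant
    polynomial of degree at most D (p + 1) < L permits. *)
Lemma Aj_const j a : nz a -> (Aj j a)^`() = 0.
move=> na; pose t3 := tb (inl (j, l3)). suff -> : Aj j a = (Aj j a).[t3]%:P by rewrite derivC.
apply/eqP; rewrite -subr_eq0; apply/negPn/negP => h0. pose rs := [seq tb (inl (j, rshift 4 e)) | e <- enum 'I_L]. have urs : uniq rs.
  rewrite map_inj_uniq ?enum_uniq // => e e' /tb_inj [] /eqP; by rewrite eqn_add2l => /eqP/val_inj.
have : all (root (Aj j a - (Aj j a).[t3]%:P)) rs.
  apply/allP => t /mapP[e _ ->]; rewrite rootE !hornerE. have := @ker j (rshift 4 e) l3 a isT isT na.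
  rewrite /Aj !horner_sum -sumrB => h; apply/eqP; rewrite -[RHS]h; apply: eq_bigr => i _.
  rewrite !horner_sum -sumrB; apply: eq_bigr => u _; rewrite !hornerZ Qb3 //. by rewrite -mulrBr.
move=> /(max_poly_roots h0)/(_ urs); rewrite size_map size_enum_ord ltnNge => /negP; apply.
apply: leq_trans (size_polyD _ _) _; rewrite size_polyN geq_max; apply/andP; split.
  by apply: leq_trans (size_Aj _ _) _.
by apply: leq_trans (size_polyC_leq1 _) _; apply: leq_trans LD.
Qed.
Definition Xt a t : 'rV[C]_n.+2 := (\row_i ((xh i).[t] * Sa a 0 i)).
Definition Xt' a t : 'rV[C]_n.+2 := (\row_i ((xh i)^`().[t] * Sa a 0 i)).
Lemma cdv_Xt a t : cdv (Xt a) t (Xt' a t).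
move=> i; rewrite mxE mulrC; apply: cd_ext (cdZ (Sa a 0 i) (cd_horner (xh i) t)) => // u. by rewrite [Xt _ _ _ _]mxE mulrC.
Qed.
Lemma mon_Xt K a t : mon K (Xt a t) = (Um K).[t] * mon K (Sa a).
rewrite /mon /Um horner_prod -big_split; apply: eq_bigr => l _ /=. by rewrite mxE exprMn horner_exp.
Qed.
Lemma mon_lower K i (x : 'rV[C]_n.+2) : (K i)%:R * mon K x = x 0 i * ((K i)%:R * mon (lower i K) x).
case E: (K i) => [|k]; first by rewrite !mul0r mulr0. rewrite mulrCA -mon_raise; congr (_ * mon _ _); apply/ffunP => l; rewrite !ffunE.
by case: eqP => [->|_]; rewrite ?E ?subn0 ?addn0 //= subn1 addn1.
Qed.
(** The coefficient of $dx_l\wedge dx_i$ in $d\theta$. *)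
Definition Th l i x := peval (pder l (th i)) x - peval (pder i (th l)) x.
Lemma peval_pder l i x : peval (pder l (th i)) x = \sum_(u <- th i) u.1 * ((u.2 l)%:R * mon (lower l u.2) x).
by rewrite /peval /pder big_map; apply: eq_bigr => u _; rewrite mulrA. Qed.
 Lemma cd_mon_curve K (G : C -> 'rV[C]_n.+2) t d : cdv G t d ->
  cd (fun s => mon K (G s)) t (\sum_l (K l)%:R * mon (lower l K) (G t) * d 0 l).
move=> hG; have [g hg] := fd_mon K (G t). apply: cd_ext (fd_cd hg hG) => //; rewrite /dot; apply: eq_bigr => l _.
by rewrite (mon_partial l hg).
Qed.
(** Cartan's formula. With $E_j=\sum_{sg(l)=j}x_l\partial_l$, the polynomial [Aj] is $\int\mathcal
    L_{E_j}\theta-\theta(E_j)$ along the curve, since [kq] is the weight of $x^K\,dx_i$ under $E_j$.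
    Its derivative, known to be 0, is therefore $d\theta(E_j,X')$. *)
Lemma contraction j a t : nz a ->
  \sum_l \sum_i (sg l == j)%:R * (Xt a t 0 l * Xt' a t 0 i * Th l i (Xt a t)) = 0.
move=> na; set X := Xt a t; set X' := Xt' a t.
have h0 : cd (fun s => (Aj j a).[s]) t 0 by have := cd_horner (Aj j a) t; rewrite Aj_const // horner0.
pose dl i := bt (R := R) (inl (j, l3) : idx) (sg i). have dlE i : dl i = (sg i == j)%:R by rewrite /dl /bt /=; case: eqP.
have h1 : cd (fun s => (Aj j a).[s]) t (\sum_i \sum_(u <- th i) u.1 * (kq u.2 i (inl (j, l3) : idx) * (mon u.2 X * X' 0 i) - dl i *
    (X' 0 i * mon u.2 X + X 0 i * (\sum_l (u.2 l)%:R * mon (lower l u.2) X * X' 0 l)))).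
  have hs i (u : C * {ffun 'I_n.+2 -> nat}) : cd (fun s => u.1 *
    (kq u.2 i (inl (j, l3) : idx) * (mon (raise i u.2) (Sa a) * (Uh u.2 i).[s]) - dl i * (Xt a s 0 i * mon u.2 (Xt a s)))) t
    (u.1 * (kq u.2 i (inl (j, l3) : idx) * (mon u.2 X * X' 0 i) - dl i *
    (X' 0 i * mon u.2 X + X 0 i * (\sum_l (u.2 l)%:R * mon (lower l u.2) X * X' 0 l)))). apply: cdZ; apply: cdB; apply: cdZ.
      apply: cd_ext (cdZ _ (cd_horner (Uh u.2 i) t)) => //. rewrite /Uh deriv_pprim0 hornerM mon_raise /X mon_Xt [Xt' _ _ _ _]mxE; ring.
    exact: (cdM (cdv_Xt a t i) (cd_mon_curve u.2 (cdv_Xt a t))).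
  apply: cd_ext (cd_sum (index_enum _) (fun i => cd_sum (th i) (hs i))) => // s.
  rewrite /Aj horner_sum; apply: eq_bigr => i _; rewrite horner_sum; apply: eq_bigr => u _.
  rewrite [RHS]hornerZ /Submission.Qb [in RHS]hornerD hornerN !hornerZ hornerM mon_raise mon_Xt [Xt _ _ _ _]mxE /dl; ring.
have := cd_unique h1 h0 => h; rewrite -[RHS]h. transitivity (\sum_l \sum_i (sg l == j)%:R * (X 0 l * X' 0 i * peval (pder l (th i)) X) -
  \sum_i \sum_l (sg i == j)%:R * (X 0 i * X' 0 l * peval (pder l (th i)) X)).
  rewrite -sumrB; apply: eq_bigr => l _; rewrite -sumrB; apply: eq_bigr => i _. by rewrite -mulrBr -mulrBr.
rewrite exchange_big -sumrB; apply: eq_bigr => i _ /=. under eq_bigr do rewrite peval_pder mulr_sumr mulr_sumr. rewrite exchange_big /=.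
under [X in _ - X]eq_bigr do rewrite peval_pder mulr_sumr mulr_sumr. rewrite [X in _ - X]exchange_big /= -sumrB; apply: eq_bigr => u _.
have -> : kq u.2 i (inl (j, l3) : idx) = (\sum_l (u.2 l)%:R * dl l) + dl i by [].
set A := \sum_l (u.2 l)%:R * dl l; set S := \sum_l _ * X' 0 l.
transitivity (u.1 * (A * (mon u.2 X * X' 0 i)) - u.1 * (dl i * (X 0 i * S))); last by ring. congr (_ - _).
  rewrite mulr_suml mulr_sumr; apply: eq_bigr => l _; rewrite -dlE. have e := mon_lower u.2 l X.
  transitivity (dl l * X' 0 i * u.1 * ((u.2 l)%:R * mon u.2 X)); last by ring. by rewrite e; ring.
rewrite -dlE !mulr_sumr; apply: eq_bigr => l _; ring.
Qed.
Lemma i_tb (b : idx) : 'i%C - tb b != 0.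
by have := tau_neq (q_ok (R := R) b) b (q_0 (R := R) b); rewrite tau_0. Qed.
 Lemma wj_log j t : (forall b : idx, xt b j -> t != tb b) -> (wj j)^`().[t] = (wj j).[t] * \sum_(b | xt b j) (t - tb b)^-1.
rewrite /Submission.wj; elim: (index_enum idx) => [|b r IH] h.
  by rewrite !big_nil derivC horner0 mulr0.
rewrite !big_cons; case: ifP => [hb|_]; last exact: IH. have t0 : t - tb b != 0 by rewrite subr_eq0; exact: h.
rewrite derivM hornerD !hornerM IH // derivZ derivB derivX derivC subr0 !hornerZ hornerXsubC hornerC.
have i0' := i_tb b; set G := _.[t]; set S := \sum_(j0 <- r | _) _; move: t0 i0'; set u := t - _; set v := 'i%C - _ => u0 v0.
by field; rewrite u0 v0.
Qed.
(** The velocity dx/dt at x of the curve of the case eps = 0 through x. *)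
Definition vf (x : 'rV[C]_n.+2) i : C :=
  (i == i1)%:R * x 0 i0 + \sum_(b : idx | xt b (sg i)) x 0 i / (x 0 i1 / x 0 i0 - tb b).
Definition generic (x : 'rV[C]_n.+2) := x 0 i0 != 0 /\ forall i, i != i1 -> x 0 i != 0.
Definition offT (x : 'rV[C]_n.+2) := forall (b : idx) j, xt b j -> x 0 i1 / x 0 i0 != tb b.
Lemma sgP i : i = i0 \/ i = i1 \/ exists k, i = lift ord0 (lift ord0 k) /\ sg i = lift ord0 k.
case: (unliftP ord0 i) => [k ->|->]; last by left. case: (unliftP ord0 k) => [k' ->|->]; last by right; left.
right; right; exists k'; split=> //; apply: val_inj; rewrite /sg /= inordK //; exact: (ltn_ord (lift ord0 k')).
Qed.
Lemma xt0 (b : idx) : xt b ord0 = false. Proof. by case: b => [[]|[]]. Qed.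
(** Every generic point off the poles lies on one of the scaled curves [Xt a], since the weights do
    not vanish there. *)
Lemma contraction_at x j : generic x -> offT x ->
  \sum_l \sum_i (sg l == j)%:R * (x 0 l * vf x i * Th l i x) = 0.
move=> [x0 gx] ox; pose t := x 0 i1 / x 0 i0. have w0 k : (wj k).[t] != 0.
  rewrite /Submission.wj horner_prod; apply/prodf_neq0 => b hb; rewrite !hornerE mulf_neq0 //.
    by rewrite invr_neq0 // i_tb.
  by rewrite subr_eq0; exact: ox hb.
have wj0 : wj ord0 = 1 by rewrite /Submission.wj big_pred0 // => b; exact: xt0. have [a [na aE]] : exists a, nz a /\ Xt a t = x.
  pose r j' : 'I_n.+2 := if unlift ord0 j' is Some k then lift ord0 (lift ord0 k) else i0.
  exists (\row_j' (x 0 (r j') / (wj j').[t])); split.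
    move=> j'; rewrite mxE mulf_neq0 ?invr_eq0 // gx // /r. by case: (unliftP ord0 j').
  apply/rowP => i; rewrite !mxE; have [->|[->|[k [-> ->]]]] := sgP i.
  - by rewrite sg0 /r unlift_none /Submission.xh sg0 wj0 /= mul1r hornerC divr1 mul1r.
  - rewrite sg1 /r unlift_none /Submission.xh sg1 wj0 eqxx mulr1 hornerX hornerC divr1 /t divfK //.
  rewrite /r liftK /Submission.xh; have -> : sg (lift ord0 (lift ord0 k)) = lift ord0 k.
    by apply: val_inj; rewrite /sg /= inordK //; exact: (ltn_ord (lift ord0 k)).
  by rewrite (_ : _ == i1 = false) // mul1r mulrC divfK.
have vE i : Xt' a t 0 i = vf x i.
  have ai : Sa a 0 i * (wj (sg i)).[t] = if i == i1 then x 0 i0 else x 0 i.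
    case: eqP => [->|/eqP ni]; rewrite -aE [in RHS]mxE /Submission.xh.
      by rewrite !mxE sg1 sg0 wj0 (_ : (i0 == i1) = false) // mulr1 hornerC mulr1 mul1r.
    by rewrite (negbTE ni) mul1r mulrC.
  rewrite mxE /Submission.xh derivM hornerD !hornerM (wj_log (j := sg i)); last by move=> b; exact: ox.
  rewrite /vf -/t; case: eqP ai => [->|ni] ai.
    rewrite sg1 in ai *; rewrite !(big_pred0 _ _ _ _ xt0). by rewrite derivX hornerC mulr0 !mulr0 !addr0 !mul1r -ai mulrC.
  rewrite -polyC1 derivC horner0 hornerC !mul0r !add0r mul1r -ai mulr_sumr mulr_suml. by apply: eq_bigr => b _; ring.
have := contraction j t na; rewrite aE => h; rewrite -[RHS]h. by apply: eq_bigr => l _; apply: eq_bigr => i _; rewrite vE.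
Qed.
Lemma poly_inf (q : {poly C}) (k0 : nat) : (forall k : nat, (k0 <= k)%N -> q.[k%:R] = 0) -> q = 0.
move=> h; apply/eqP/negPn/negP => q0. pose rs : seq C := [seq (k0 + k)%:R | k <- iota 0 (size q)]. have urs : uniq rs.
  by rewrite map_inj_uniq ?iota_uniq // => e e' /eqP; rewrite eqr_nat eqn_add2l => /eqP.
have ars : all (root q) rs.
  by apply/allP => t /mapP[e _ ->]; rewrite rootE h // leq_addr.
by have := max_poly_roots q0 ars urs; rewrite size_map size_iota ltnn.
Qed.
(** A line on which only the ratio $t=x_1/x_0$ varies. *)
Definition ray (x : 'rV[C]_n.+2) t : 'rV[C]_n.+2 := (\row_i (if i == i1 then t * x 0 i0 else x 0 i)).
Lemma peval_ray (q : polyf (R := R) n.+2) x : (forall u, u \in q -> (mdg u.2 < D)%N) ->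
  exists2 f : {poly C}, (size f <= D)%N & forall t, f.[t] = peval q (ray x t).
elim: q => [|u q IH] h; first by exists 0; [rewrite size_poly0|move=> t; rewrite horner0 /peval big_nil].
have [f sf fE] := IH (fun v hv => h v (mem_behead (s := u :: q) hv)).
pose g i : {poly C} := if i == i1 then (x 0 i0)%:P * 'X else (x 0 i)%:P. have sg_ i : (size (g i) <= 2)%N.
  rewrite /g; case: ifP => _; last by apply: leq_trans (size_polyC_leq1 _) _.
  by rewrite mul_polyC; apply: leq_trans (size_scale_leq _ _) _; rewrite size_polyX.
have sG : (size (\prod_i g i ^+ u.2 i)%R <= (mdg u.2).+1)%N.
  rewrite /mdg; elim/big_ind2: _ => [|q1 k1 q2 k2 h1 h2|i _]; first by rewrite size_poly1.
    apply: leq_trans (size_polyMleq _ _) _; rewrite -subn1 leq_subLR add1n -addnS -addSn. exact: leq_add.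
  by apply: leq_trans (size_expn (u.2 i) (sg_ i)) _; rewrite muln1.
exists (u.1 *: (\prod_i g i ^+ u.2 i) + f) => [|t].
  apply: leq_trans (size_polyD _ _) _; rewrite geq_max sf andbT.
  apply: leq_trans (size_scale_leq _ _) _; apply: leq_trans sG _; apply: h; exact: mem_head.
rewrite hornerD hornerZ fE peval_cons horner_prod; congr (_ * _ + _).
apply: eq_bigr => i _; rewrite horner_exp; congr (_ ^+ _); rewrite mxE /g. by case: ifP => _; rewrite !hornerE // mulrC.
Qed.
Lemma Th_ray l i x : exists2 f : {poly C}, (size f <= D)%N & forall t, f.[t] = Th l i (ray x t).
have hp l' i' u : u \in pder l' (th i') -> (mdg u.2 < D)%N.
  move=> /mapP[v hv ->] /=; apply: leq_ltn_trans (thD hv). by rewrite /mdg; apply: leq_sum => k _; rewrite ffunE leq_subr.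
have [f1 s1 e1] := peval_ray x (@hp l i); have [f2 s2 e2] := peval_ray x (@hp i l).
exists (f1 - f2) => [|t]; last by rewrite hornerD hornerN e1 e2. by apply: leq_trans (size_polyD _ _) _; rewrite size_polyN geq_max s1.
Qed.
Definition isx (b : idx) : bool := if b is inr _ then true else false.
Lemma xt_isx b j : xt b j -> isx b. Proof. by case: b. Qed.
Lemma ray_generic x t : generic x -> generic (ray x t).
move=> [x0 gx]; split=> [|i ni]; first by rewrite mxE. by rewrite mxE (negbTE ni) gx.
Qed.
Lemma ray_div x t : generic x -> ray x t 0 i1 / ray x t 0 i0 = t.
by move=> [x0 _]; rewrite !mxE eqxx (_ : (i0 == i1) = false) // mulfK. Qed.
 Lemma ray_self x : generic x -> ray x (x 0 i1 / x 0 i0) = x.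
by move=> [x0 _]; apply/rowP => i; rewrite mxE; case: eqP => // ->; rewrite divfK. Qed.

(* Clearing denominators, the relation becomes a polynomial identity in the
   ratio t = x_1 / x_0; evaluating at the p poles of one weight isolates one coefficient, whose degree in t is less than p. *)
Lemma eliminate l : (forall x, generic x -> offT x -> \sum_i vf x i * Th l i x = 0) -> forall x i, generic x -> i != i0 -> Th l i x = 0.
move=> H x i gx ni0; have x0 := gx.1.
have /choice[f hf] : forall i, exists f : {poly C}, (size f <= D)%N /\ forall t, f.[t] = Th l i (ray x t).
  by move=> i'; have [f h1 h2] := Th_ray l i' x; exists f.
pose Z : {poly C} := \prod_(b : idx | isx b) ('X - (tb b)%:P).
pose Zb b : {poly C} := \prod_(b' : idx | isx b' && (b' != b)) ('X - (tb b')%:P).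
pose S : {poly C} := x 0 i0 *: (Z * f i1) + \sum_i' \sum_(b : idx | xt b (sg i')) x 0 i' *: (Zb b * f i').
have xray i' t (b : idx) : xt b (sg i') -> ray x t 0 i' = x 0 i'.
  by move=> hb; rewrite mxE; case: eqP hb => // ->; rewrite sg1 xt0.
have SE t : (forall b, isx b -> t != tb b) -> S.[t] = 0.
  move=> ht; have ZE b : isx b -> Z.[t] / (t - tb b) = (Zb b).[t].
    move=> hb; rewrite /Z (bigD1 b) //= hornerM hornerXsubC mulrAC divff ?mul1r //. by rewrite subr_eq0; exact: ht.
  have g' := ray_generic t gx. have o' : offT (ray x t) by move=> b j /xt_isx/ht; rewrite ray_div.
  have := H _ g' o' => h; rewrite -[RHS](mulr0 Z.[t]) -h. rewrite /S hornerD hornerZ hornerM (hf i1).2 horner_sum mulr_sumr.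
  have -> : \sum_i' Z.[t] * (vf (ray x t) i' * Th l i' (ray x t)) = \sum_i' Z.[t] * ((i' == i1)%:R * x 0 i0 * Th l i' (ray x t)) +
    \sum_i' Z.[t] * ((\sum_(b : idx | xt b (sg i')) x 0 i' / (t - tb b)) * Th l i' (ray x t)).
    rewrite -big_split; apply: eq_bigr => i' _ /=; rewrite -mulrDr -mulrDl; congr (_ * (_ * _)).
    rewrite /vf ray_div //; congr (_ * _ + _); first by rewrite mxE. by apply: eq_bigr => b hb; rewrite (xray _ _ _ hb).
  congr (_ + _).
    rewrite (bigD1 i1) //= big1 ?addr0 => [|i' ni]; last by rewrite (negbTE ni) !mul0r mulr0. by rewrite mul1r mulrCA.
  apply: eq_bigr => i' _; rewrite horner_sum mulr_suml mulr_sumr; apply: eq_bigr => b hb.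
  by rewrite hornerZ hornerM (hf i').2 -ZE ?(xt_isx hb) //; ring.
have S0 : S = 0.
  apply: (@poly_inf S (\sum_(b : idx) (nidx b).+1)%N) => k hk; apply: SE => b _.
  rewrite /Submission.tb /tbn eqr_nat gtn_eqF //; apply: leq_trans hk. by rewrite (bigD1 b) //= leq_addr.
have fx i' : i' != i0 -> i' != i1 -> f i' = 0.
  move=> n0 n1; have [h|[h|[k [iE sE]]]] := sgP i'; [by rewrite h eqxx in n0|by rewrite h eqxx in n1|]. apply/eqP/negPn/negP => fn0.
  pose rs := [seq tb (inr (k, e)) | e <- enum 'I_p]. have urs : uniq rs by rewrite map_inj_uniq ?enum_uniq // => e e' /tb_inj [].
  have ars : all (root (f i')) rs.
    apply/allP => _ /mapP[e _ ->]; set b0 : idx := inr (k, e). have xb0 : xt b0 (sg i') by rewrite sE /= eqxx.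
    have Zb0 b : isx b -> b != b0 -> (Zb b).[tb b0] = 0.
      move=> hb nb; rewrite /Zb (bigD1 b0) /=; last by rewrite eq_sym nb. by rewrite hornerM hornerXsubC subrr mul0r.
    have := congr1 (fun q => q.[tb b0]) S0; rewrite /S hornerD hornerZ hornerM horner0.
    have -> : Z.[tb b0] = 0 by rewrite /Z (bigD1 b0) //= hornerM hornerXsubC subrr mul0r.
    rewrite mul0r mulr0 add0r horner_sum (bigD1 i') //= [X in _ + X]big1 ?addr0; last first.
      move=> i2 ni2; rewrite horner_sum big1 // => b hb; rewrite hornerZ hornerM.
      have [bE|nb] := eqVneq b b0; last by rewrite Zb0 ?(xt_isx hb) // mul0r mulr0.
      move: hb; rewrite bE /= => /eqP s2; have [h|[h|[k2 [i2E s2E]]]] := sgP i2.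
      - by move: s2; rewrite h sg0.
      - by move: s2; rewrite h sg1. by move: s2 ni2; rewrite s2E i2E iE => /lift_inj->; rewrite eqxx.
    rewrite horner_sum (bigD1 b0) //= [X in _ + X]big1 ?addr0; last first.
      by move=> b /andP[hb nb]; rewrite hornerZ hornerM Zb0 ?(xt_isx hb) // mul0r mulr0.
    rewrite hornerZ hornerM => /eqP; rewrite !mulf_eq0 (negbTE (gx.2 i' n1)) /=.
    case/orP => [|//]; rewrite /Zb horner_prod => /prodf_eq0[b' /andP[_ nb]].
    by rewrite hornerXsubC subr_eq0 (inj_eq tb_inj) eq_sym (negbTE nb).
  have := max_poly_roots fn0 ars urs; rewrite size_map size_enum_ord ltnNge => /negP; apply. exact: leq_trans (hf i').1 pD.
have f1 : f i1 = 0.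
  move: S0; rewrite /S big1 ?addr0; last first.
    move=> i' _; apply: big1 => b hb; rewrite fx ?mulr0 ?scaler0 //.
      by apply: contraTneq hb => ->; rewrite sg0 xt0.
    by apply: contraTneq hb => ->; rewrite sg1 xt0.
  move/eqP; rewrite scaler_eq0 (negbTE x0) /= mulf_eq0 => /orP[|/eqP//].
  by rewrite prodf_seq_eq0 => /hasP[b _ /andP[_]]; rewrite polyXsubC_eq0.
rewrite -(ray_self gx) -(hf i).2; have [->|ni1] := eqVneq i i1; first by rewrite f1 horner0. by rewrite fx // horner0.
Qed.
Lemma Th_anti l i x : Th i l x = - Th l i x. Proof. by rewrite /Th opprB. Qed.
(** Each coordinate of index at least 2 has a field $E_j$ of its own, which settles its row of
    $d\theta$. The field $E_0$ mixes $x_0$ and $x_1$, but the part from $x_1$ then vanishes by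
    antisymmetry. As [vf] has no component along $x_0$, the column of [i0] is obtained by
    antisymmetry only. *)
Lemma Th_eq0 l i x : generic x -> Th l i x = 0.
have hk k : forall x i, generic x -> i != i0 -> Th (lift ord0 (lift ord0 k)) i x = 0.
  apply: eliminate => y gy oy; have := contraction_at (lift ord0 k) gy oy. set lk : 'I_n.+2 := lift ord0 (lift ord0 k).
  have slk : sg lk = lift ord0 k.
    by apply: val_inj; rewrite /sg /= inordK //; exact: (ltn_ord (lift ord0 k)).
  rewrite (bigD1 lk) //= [X in _ + X]big1 ?addr0; last first.
    move=> l' nl; apply: big1 => i' _; have [h|[h|[k2 [lE sE]]]] := sgP l'.
    - by rewrite h sg0 mul0r.
    - by rewrite h sg1 mul0r. have [kk|nk] := eqVneq k2 k; first by move: nl; rewrite lE kk eqxx.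
    by rewrite sE (inj_eq (@lift_inj _ _)) (negbTE nk) mul0r.
  under eq_bigr do rewrite slk eqxx mul1r -mulrA. rewrite -mulr_sumr => /eqP; rewrite mulf_eq0 (negbTE (gy.2 lk _)) //= => /eqP; exact.
have v0 y : vf y i0 = 0 by rewrite /vf (_ : (i0 == i1) = false) // mul0r add0r sg0 big_pred0 // => b; exact: xt0.
have Tii l' y : Th l' l' y = 0 by rewrite /Th subrr. have h0 : forall x i, generic x -> i != i0 -> Th i0 i x = 0.
  apply: eliminate => y gy oy; have := contraction_at ord0 gy oy. have H1 : \sum_i' vf y i' * Th i1 i' y = 0.
    apply: big1 => i' _; have [->|[->|[k [-> _]]]] := sgP i'; first by rewrite v0 mul0r.
      by rewrite Tii mulr0.
    by rewrite Th_anti hk ?oppr0 ?mulr0.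
  rewrite (bigD1 i0) // (bigD1 i1) //= [X in _ + (_ + X)]big1; last first.
    move=> l' /andP[nl0 nl1]; apply: big1 => i' _; have [h|[h|[k2 [lE sE]]]] := sgP l'.
    - by rewrite h eqxx in nl0.
    - by rewrite h eqxx in nl1. by rewrite sE mul0r.
  under eq_bigr do rewrite sg0 eqxx mul1r -mulrA. under [X in _ + (X + _)]eq_bigr do rewrite sg1 eqxx mul1r -mulrA.
  rewrite -!mulr_sumr H1 mulr0 !addr0 => /eqP; rewrite mulf_eq0 (negbTE gy.1) /= => /eqP; exact.
move=> gx; have [->|[->|[k [-> _]]]] := sgP l.
- by have [->|n0] := eqVneq i i0; [exact: Tii|exact: h0].
- have [->|[->|[k [-> _]]]] := sgP i; first by rewrite Th_anti h0 ?oppr0.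
    exact: Tii.
  by rewrite Th_anti hk ?oppr0.
have [->|n0] := eqVneq i i0; last exact: hk. by rewrite Th_anti h0 ?oppr0.
Qed.
End Algebra.

(** * Stability of a spanning family under small perturbation *)

Section SpanStability.
Context {R : realType}.
Local Notation C := R[i].
Variables (N k : nat) (I : Type) (Lv : I -> 'rV[C]_N) (Pv : R -> I -> 'rV[C]_N) (T : 'M[C]_(N, k)).
Hypothesis PT : forall e f, 0 < e -> Pv e f *m T = 0.
Hypothesis lim : forall f (d : R), 0 < d -> somepos e0, forall e : R, 0 < e < e0 ->
  vn (e%:C^-1 *: Pv e f - Lv f) < d.
Hypothesis full : forall l : 'cV[C]_N, (forall f, Lv f *m l = 0) -> forall v : 'rV[C]_N, v *m T = 0 -> v *m l = 0.
(** A maximal independent family of limits spans at least the kernel of T, by [full]. Its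
    perturbation stays independent and lies in that kernel, so it spans it for reasons of dimension.
    Dividing by e does not change the span. *)
Lemma span_stable : somepos e0, forall e : R, 0 < e < e0 -> forall v : 'rV[C]_N, v *m T = 0 ->
  exists r (f : 'I_r -> I) (c : 'I_r -> C), v = \sum_i c i *: Pv e (f i).
pose P r := `[< exists f : 'I_r -> I, row_free (\matrix_i Lv (f i)) >]. have P0 : exists r, P r.
  exists 0%N; apply/asboolP; have f0 : 'I_0 -> I by case. by exists f0; rewrite /row_free flatmx0 mxrank0.
have PN r : P r -> (r <= N)%N.
  by move=> /asboolP[f]; rewrite /row_free => /eqP <-; exact: rank_leq_col.
have := ex_maxnP P0 PN; case=> r /asboolP[f ff] rmax {P0 PN}. set A := \matrix_i Lv (f i) in ff. have LA g : (Lv g <= A)%MS.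
  apply: contraT => ng; suff /rmax : P r.+1 by rewrite ltnn. apply/asboolP; exists (fun i => if unlift ord0 i is Some j then f j else g).
  have -> : \matrix_i Lv (if unlift ord0 i is Some j then f j else g) = col_mx (Lv g) A.
    apply/row_matrixP => i; rewrite rowK. case: (unliftP ord0 i) => [j ->|->].
      have -> : lift ord0 j = rshift 1 j :> 'I_(1 + r) by exact: val_inj. by rewrite -[RHS]/(row (rshift 1 j) (col_mx (Lv g) A)) rowKd rowK.
    have -> : ord0 = lshift r ord0 :> 'I_(1 + r) by exact: val_inj.
    by rewrite -[RHS]/(row (lshift r ord0) (col_mx (Lv g) A)) rowKu; apply/rowP => c; rewrite !mxE.
  rewrite -row_leq_rank; have nz0 : Lv g != 0 by apply: contraNneq ng => ->; exact: sub0mx. have rA : \rank A = r by exact/eqP.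
  suff : (r < \rank (Lv g + A)%MS)%N by rewrite addsmxE. have d0 : (Lv g :&: A)%MS = 0.
    apply/eqP; rewrite -mxrank_eq0 -leqn0 -ltnS; have := mxrankS (capmxSl (Lv g) A). rewrite rank_rV nz0 leq_eqVlt => /orP[|//] /eqP e1.
    case/negP: ng; have := mxrank_leqif_sup (capmxSl (Lv g) A) => -[_].
    by rewrite rank_rV nz0 e1 eqxx => /esym/submx_trans; apply; exact: capmxSr.
  by have := mxrank_sum_cap (Lv g) A; rewrite d0 mxrank0 addn0 rank_rV nz0 rA add1n => ->.
have kerA : (kermx T <= A)%MS.
  apply/row_subP => i; rewrite submxE; apply/eqP/matrixP => a c; rewrite ord1. have : row i (kermx T) *m col c (cokermx A) = 0.
    apply: full => [g|]; last by rewrite -row_mul mulmx_ker row0.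
    by rewrite colE mulmxA; have := LA g; rewrite submxE => /eqP->; rewrite mul0mx.
  by rewrite colE mulmxA -colE => /colP/(_ 0) h; rewrite !mxE in h *; exact: h.
(* The tolerance is set against the norm K of the right inverse Bm of A: a relation x between the
   perturbed rows satisfies |x| <= |x| / 2. *)
have [Bm AB] := row_freeP ff. have [K K0 HK] := vn_mulmx 0 Bm. have d0 : 0 < (2 * (K + 1))^-1 by pos.
have [e0 e00 He] : somepos e0, forall e : R, 0 < e < e0 -> forall i, vn (e%:C^-1 *: Pv e (f i) - Lv (f i)) < (2 * (K + 1))^-1.
  suff : forall s : seq 'I_r, somepos e0, forall e : R, 0 < e < e0 -> forall i, i \in s ->
    vn (e%:C^-1 *: Pv e (f i) - Lv (f i)) < (2 * (K + 1))^-1.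
    move=> /(_ (enum 'I_r))[e0 e00 H]; exists e0 => // e he i; apply: H => //; exact: mem_enum.
  elim=> [|j s [e1 e10 H1]]; first by exists 1. have [e2 e20 H2] := lim (f j) d0. exists (minr e1 e2); first by pos.
  move=> e /andP[h1]; rewrite lt_min => /andP[h2 h3] i; rewrite inE => /orP[/eqP->|hi].
    by apply: H2; rewrite h1.
  by apply: H1 => //; rewrite h1.
exists e0 => // e he v vT; have /andP[ep _] := he. have ee0 : e%:C != 0 :> C by rewrite -normc_gt0 normc_real normr_gt0 gt_eqF.
pose Ae := \matrix_i Pv e (f i). have fe : row_free Ae.
  rewrite -kermx_eq0; apply/eqP/row_matrixP => i; rewrite row0; set x := row i _.
  have xA : x *m Ae = 0 by rewrite /x -row_mul mulmx_ker row0. apply/eqP; rewrite -vn_eq0; apply/eqP. pose E := e%:C^-1 *: Ae - A.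
  have xE : - (x *m E *m Bm) = x.
    rewrite /E mulmxBr -scalemxAr xA scaler0 sub0r mulNmx opprK -mulmxA AB mulmx1 //.
  have h1 : vn (x *m E) <= (2 * (K + 1))^-1 * vn x.
    rewrite mulmx_sum_row /vn mulr_sumr -/(vn _). apply: (@le_trans _ _ (\sum_j vn (x 0 j *: row j E))).
      elim/big_rec2: _ => [|j y1 y2 _ h]; first by rewrite vn0. by apply: le_trans (vnD _ _) _; rewrite lerD2l.
    apply: ler_sum => j _; rewrite vnZ mulrC ler_wpM2r // ltW //.
    have -> : row j E = e%:C^-1 *: Pv e (f j) - Lv (f j) by apply/rowP => c; rewrite !mxE. exact: He.
  have h2 : vn x <= K * vn (x *m E) by rewrite -[in leLHS]xE vnN. have x0 := vn_ge0 x; apply/eqP; rewrite eq_le x0 andbT.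
  have h3 : K * vn (x *m E) <= K * ((2 * (K + 1))^-1 * vn x) by rewrite ler_wpM2l. have h4 : K * (2 * (K + 1))^-1 <= 1 / 2.
    by rewrite -[leLHS]/(K / _) ler_pdivrMr ?mulr_gt0 //; lra.
  have h5 : K * (2 * (K + 1))^-1 * vn x <= 1 / 2 * vn x by rewrite ler_wpM2r. by rewrite mulrA in h3; lra.
have AeT : (Ae <= kermx T)%MS.
  apply/row_subP => i; rewrite rowK; apply/sub_kermxP; exact: PT.
have eqr : (kermx T <= Ae)%MS.
  have [_ <-] := mxrank_leqif_sup AeT; rewrite eqn_leq mxrankS //=. by rewrite (eqP fe) -(eqP ff) mxrankS.
have /submxP[c ->] : (v <= Ae)%MS by apply: submx_trans eqr; apply/sub_kermxP.
exists r, f, (fun i => c 0 i); rewrite mulmx_sum_row; apply: eq_bigr => i _; by rewrite rowK.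
Qed.
End SpanStability.

(** * Comparison of powers, finite bounds, truncated Taylor expansion *)

Section SmallPowers.
Context {R : realType}.
Local Notation C := R[i].
(** The lowest coefficient not yet known to vanish is isolated on division by [s ^+ m] as s tends to
    0. *)
Lemma small_powers (D : nat) (c : nat -> C) (s0 K : R) : 0 < s0 ->
  (forall s : R, 0 < s < s0 -> nc (\sum_(1 <= m < D.+1) (s ^+ m)%:C * c m) <= K * s ^+ D.+1) ->
  forall m, (0 < m <= D)%N -> c m = 0.
move=> s00 H; elim/ltn_ind => m IH /andP[m0 mD].
apply/eqP; rewrite -normc_eq0 eq_le normc_ge0 andbT; apply/ler_addgt0Pr => e e0; rewrite add0r. pose S := \sum_(m.+1 <= k < D.+1) nc (c k).
have S0 : 0 <= S by pos. have SK : 0 < S + `|K| + 1 by pos. pose s := minr (s0 / 2) (minr 1 (e / (S + `|K| + 1))). have sp : 0 < s by pos.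
have s1 : s <= 1 by rewrite !ge_min lexx orbT. have ss0 : s < s0 by apply: le_lt_trans (_ : s0 / 2 < s0); [rewrite ge_min lexx|lra].
have se : s * (S + `|K| + 1) <= e.
  by rewrite -ler_pdivlMr // /s !ge_min lexx !orbT.
have hs : 0 < s < s0 by rewrite sp. have sm0 : 0 < s ^+ m by pos. have := H s hs; rewrite (@big_cat_nat _ _ _ m) //=; last exact: leqW.
rewrite big_nat big1 ?add0r; last first.
  by move=> k /andP[k0 km]; rewrite IH ?mulr0 // k0 (leq_trans (ltnW km)).
rewrite big_ltn //; set X := \sum_(m.+1 <= k < D.+1) _ => hX. have X1 : nc X <= s ^+ m.+1 * S.
  apply: le_trans (ler_normc_sum _ _ _) _; rewrite /S mulr_sumr big_nat_cond [leRHS]big_nat_cond.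
  apply: ler_sum => k /andP[/andP[mk _] _]; rewrite normcM normc_real ger0_norm ?exprn_ge0 ?(ltW sp) //.
  by rewrite ler_wpM2r // ler_wiXn2l // ltW.
have D1 : s ^+ D.+1 <= s ^+ m.+1 by rewrite ler_wiXn2l // ltW. have h : s ^+ m * nc (c m) <= s ^+ m * (s * (S + `|K|)).
  have -> : s ^+ m * nc (c m) = nc ((s ^+ m)%:C * c m).
    by rewrite normcM normc_real ger0_norm // ltW.
  have -> : (s ^+ m)%:C * c m = ((s ^+ m)%:C * c m + X) - X by rewrite addrK.
  apply: le_trans (ler_normcB _ _) _; rewrite mulrA -exprSr mulrDr addrC; apply: lerD => //.
  apply: le_trans hX _; apply: le_trans (_ : `|K| * s ^+ D.+1 <= _).
    by rewrite ler_wpM2r ?ler_norm // exprn_ge0 // ltW.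
  by rewrite mulrC ler_wpM2r.
rewrite ler_pM2l // in h; apply: le_trans h _; nra.
Qed.
End SmallPowers.

Section FiniteBounds.
Context {R : realType}.
Local Notation C := R[i].
Lemma pos_min (I : finType) (f : I -> R) : (forall i, 0 < f i) -> somepos r, forall i, r <= f i.
move=> h; suff : forall s : seq I, somepos r, forall i, i \in s -> r <= f i.
  by move=> /(_ (enum I))[r r0 H]; exists r => // i; apply: H; rewrite mem_enum.
elim=> [|j s [r r0 H]]; first by exists 1. exists (minr r (f j)); first by pos.
by move=> i; rewrite inE => /orP[/eqP->|/H hi]; rewrite ge_min ?lexx ?orbT // hi.
Qed.
Lemma pos_max (I : finType) (f : I -> R) : exists2 K : R, 0 <= K & forall i, f i <= K.
exists (\sum_i `|f i|); first by pos. move=> i; apply: le_trans (ler_norm _) _; rewrite (bigD1 i) //= lerDl; exact: sumr_ge0.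
Qed.
Lemma mon_le m (K : {ffun 'I_m -> nat}) (x : 'rV[C]_m) : nc (mon K x) <= vn x ^+ mdg K.
rewrite /mon normc_prod /mdg -prodrXr; apply: ler_prod => i _; rewrite normc_ge0 normcX /=. by rewrite lerXn2r ?nnegrE // vn_coord.
Qed.
Lemma taylor_trunc m D (f : 'rV[C]_m -> C) G (rho B : R) : 0 < rho -> grads f G 0 rho ->
  (forall x, vn x < rho -> nc (f x) <= B) ->
  exists p : polyf (R := R) m, exists K r : R, [/\ forall u, u \in p -> (mdg u.2 < D)%N, 0 <= K, 0 < r &
    forall x, vn x < r -> nc (f x - peval p x) <= K * vn x ^+ D].
move=> rho0 hG hB; have [q [K [r [K0 r0 H]]]] := taylor_poly D rho0 hG hB. pose S := \sum_(u <- q) nc u.1; have S0 : 0 <= S by pos.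
exists [seq u <- q | (mdg u.2 < D)%N], (K + S), (minr r 1); split.
- by move=> u; rewrite mem_filter => /andP[].
- exact: addr_ge0.
- by rewrite lt_min r0 ltr01. move=> x /lt_minP[xr x1]; have x0 := vn_ge0 x.
have -> : f x - peval [seq u <- q | (mdg u.2 < D)%N] x = (f x - peval q x) + \sum_(u <- q | ~~ (mdg u.2 < D)%N) u.1 * mon u.2 x.
  by rewrite /peval big_filter [in RHS](bigID (fun u => (mdg u.2 < D)%N)) /=; ring.
apply: le_trans (ler_normcD _ _) _; rewrite mulrDl; apply: lerD; first exact: H.
apply: le_trans (ler_normc_sum _ _ _) _; rewrite /S mulr_suml [leRHS](bigID (fun u => (mdg u.2 < D)%N)) /=.
rewrite -[leLHS]add0r; apply: lerD.
  by apply: sumr_ge0 => u _; rewrite mulr_ge0 ?exprn_ge0.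
apply: ler_sum => u; rewrite -leqNgt => hu; rewrite normcM ler_wpM2l //. by apply: le_trans (mon_le _ _) _; rewrite ler_wiXn2l // ltW.
Qed.
End FiniteBounds.

(** * Periods of the forms and density over the base point *)

Section Assembly.
Context {R : realType}.
Local Notation C := R[i].
Variables (n N k D p L : nat).
Hypotheses (D0 : (0 < D)%N) (pD : (D <= p)%N) (LD : (D * p.+1 < L)%N).
Variables (w : 'rV[C]_n.+2 -> 'M[C]_(n.+2, N)) (Gw : 'I_n.+2 -> 'I_N -> 'rV[C]_n.+2 -> 'rV[C]_n.+2).
Variables (r0 Bw Lw r1 : R).
Hypotheses (r10 : 0 < r1) (Bw0 : 0 <= Bw) (Lw0 : 0 <= Lw) (r1r0 : r1 <= r0).
Hypothesis hGw : forall i c, grads (fun y => w y i c) (Gw i c) 0 r0.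
Hypothesis wB0 : forall x, vn x < r0 -> forall i c, nc (w x i c) <= Bw.
Hypothesis wL : forall x y, vn x < r1 -> vn y < r1 -> forall i c,
  nc (w x i c - w y i c) <= Lw * vn (x - y).
Variables (T : 'M[C]_(N, k)) (g0 : 'rV[C]_n.+2 -> 'rV[C]_k).
Hypothesis hg0 : forall x, vn x < r1 -> forall c, fd (fun y => g0 y 0 c) x (\row_i ((w x *m T) i c)).
(* The closed combinations of the forms are those annihilated by ker T: it is
   enough that d(omega) vanishes to order D - 1 at 0. *)
Hypothesis closed_kernel : forall l : 'cV[C]_N, (exists K r : R, 0 < r /\ forall x, vn x < r ->
  forall i j, nc (\sum_c (Gw i c x 0 j - Gw j c x 0 i) * l c 0) <= K * vn x ^+ D.-1) ->
  forall v : 'rV[C]_N, v *m T = 0 -> v *m l = 0.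
Local Notation idx := (idx n L p).
Local Notation tb := (@tb R n L p).
Local Notation lp := (@lp R n L p).
Local Notation H := 'rV[C]_n.+1.
Local Notation Z := 'rV[C]_N.
Local Notation one := (const_mx 1 : H).
Local Notation sa := (@Sa R n).
Local Notation ex := (@ex R n L p).
Lemma r00 : 0 < r0. Proof. exact: lt_le_trans r1r0. Qed.
Lemma wfd x : vn x < r1 -> forall i c, exists g, fd (fun y => w y i c) x g.
by move=> hx i c; exists (Gw i c x); apply: hGw; rewrite subr0 (lt_le_trans hx). Qed.
 Lemma wB x : vn x < r1 -> forall i c, nc (w x i c) <= Bw.
by move=> hx; apply: wB0; exact: lt_le_trans r1r0. Qed.
 Section Invariance.
Variable e : R.
 (** The z-velocity is the x-velocity applied to the forms, and T of the forms is the differential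
     of g, so $Tz-g(x)$ has derivative 0 along the lift. *)
 Lemma step_HD a b : step tb (ex e) w (Om r1) a b -> a.2 *m T - g0 (pt a.1.1 a.1.2) = b.2 *m T - g0 (pt b.1.1 b.1.2).
case=> q [Ds [zc [s0 [s1 [ok [oD cD Ds0 Ds1 sD] na [aE bE hs]]]]]]. have xE0 := xl0 (ex e) q s0 a.1.2; have xE1 := xlE (ex e) q s0 a.1.2 s1.
rewrite aE bE /= -xE0 -xE1; apply/rowP => c; rewrite !mxE. pose h s := (\sum_j zc s 0 j * T j c) - g0 (xl (ex e) q s0 a.1.2 s) 0 c.
have dh s : Ds s -> cd h s 0.
  move=> Dss; have [hz [hx _]] := hs _ Dss.
  have h1 : cd (fun u => \sum_j zc u 0 j * T j c) s (\sum_j zd tb (ex e) w q s0 a.1.2 s 0 j * T j c).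
    apply: cd_sum => j; rewrite mulrC; apply: cd_ext (cdZ (T j c) (hz j)) => // u; exact: mulrC.
  have h2 := fd_cd (hg0 hx c) (cdv_xl (ex e) ok s0 a.1.2 (sD _ Dss)). apply: cd_ext (cdB h1 h2) => //.
  have -> : \sum_j zd tb (ex e) w q s0 a.1.2 s 0 j * T j c = (zd tb (ex e) w q s0 a.1.2 s *m T) 0 c by rewrite mxE.
  rewrite /zd -mulmxA mxE /dot; apply/eqP; rewrite subr_eq0; apply/eqP/eq_bigr => i _. by rewrite [in RHS]mxE mulrC.
have := prim_diff cD Ds0 Ds1 dh (fun z _ => cd_cst 0 z). by rewrite subrr => /eqP; rewrite subr_eq0 => /eqP/esym.
Qed.
Lemma reach_HD a b : reach tb (ex e) w (Om r1) a b ->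
  a.2 *m T - g0 (pt a.1.1 a.1.2) = b.2 *m T - g0 (pt b.1.1 b.1.2).
by elim=> [x y /step_HD|//|x y z _ -> _ ->]. Qed.
 End Invariance.
 Lemma jets : exists pw : 'I_n.+2 -> 'I_N -> polyf (R := R) n.+2, exists K r : R,
  [/\ forall i c u, u \in pw i c -> (mdg u.2 < D)%N, 0 <= K, 0 < r & forall x, vn x < r -> forall i c,
    nc (w x i c - peval (pw i c) x) <= K * vn x ^+ D].
have h (ic : 'I_n.+2 * 'I_N) := taylor_trunc D r00 (hGw ic.1 ic.2) (fun x hx => wB0 hx ic.1 ic.2).
have /choice[pw /choice[Kf /choice[rf hf]]] := h.
have [K K0 HK] := pos_max Kf; have [r rp Hr] := pos_min (fun ic => let: And4 _ _ h _ := hf ic in h).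
exists (fun i c => pw (i, c)), K, r; split=> //; first by move=> i c; have [] := hf (i, c).
move=> x hx i c; have [_ _ _ H] := hf (i, c); apply: le_trans (H x (lt_le_trans hx (Hr _))) _. by rewrite ler_wpM2r ?exprn_ge0.
Qed.
Variables (pw : 'I_n.+2 -> 'I_N -> polyf (R := R) n.+2) (KT rT : R).
Hypothesis pwD : forall i c u, u \in pw i c -> (mdg u.2 < D)%N.
Hypotheses (KT0 : 0 <= KT) (rT0 : 0 < rT).
Hypothesis pwE : forall x, vn x < rT -> forall i c, nc (w x i c - peval (pw i c) x) <= KT * vn x ^+ D.
(** The part of degree m in eta of the increment of z computed from the jet: [Y K i] stands for
    $\int x^K\,dx_i$ along the path started at eta = 1. *)
Definition Pgen (Y : {ffun 'I_n.+2 -> nat} -> 'I_n.+2 -> C) (m : nat) (a : H) : Z :=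
  (\row_c \sum_i \sum_(u <- pw i c | (mdg u.2).+1 == m) u.1 * mon (raise i u.2) (sa a) * Y u.2 i).
Lemma PgenZ Y m (c : C) a : Pgen Y m (c *: a) = c ^+ m *: Pgen Y m a.
apply/rowP => j; rewrite !mxE mulr_sumr; apply: eq_bigr => i _; rewrite mulr_sumr.
apply: eq_bigr => u /eqP <-; have -> : sa (c *: a) = c *: sa a by apply/rowP => l; rewrite !mxE. by rewrite mon_scale mdg_raise; ring.
Qed.
Lemma Pgen_sum Y a c : (\sum_(1 <= m < D.+1) Pgen Y m a) 0 c =
  \sum_i \sum_(u <- pw i c) u.1 * mon (raise i u.2) (sa a) * Y u.2 i.
rewrite summxE; under eq_bigr do rewrite mxE. rewrite exchange_big /=; apply: eq_bigr => i _. under eq_bigr do rewrite big_mkcond.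
rewrite exchange_big big_seq [RHS]big_seq; apply: eq_bigr => u hu /=.
rewrite -big_mkcond big_nat_cond (eq_bigl (fun m => m == (mdg u.2).+1)).
  by rewrite big_nat1_eq /= ltnS (pwD hu).
move=> m; rewrite [RHS]eq_sym; case: eqP => [<-|]; last by rewrite andbF. by rewrite andbT ltnS /= ltnS (pwD hu).
Qed.
Lemma fd_vn_cts m (f : 'rV[C]_m -> C) x : (exists g, fd f x g) -> forall e : R, 0 < e -> somepos d, forall y, vn (y - x) < d -> nc (f y - f x) < e.
by move=> [g /fd_cts]. Qed.
 Lemma sa_le a b : vn (sa a - sa b) <= n.+2%:R * vn (a - b).
apply: vn_le => i; have -> : (sa a - sa b) 0 i = (a - b) 0 (sg i) by rewrite !mxE. exact: vn_coord.
Qed.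
Lemma Pgen_cts Y m a (e : R) : 0 < e -> somepos d, forall a', vn (a' - a) < d -> vn (Pgen Y m a' - Pgen Y m a) < e.
move=> e0; pose f c (x : 'rV[C]_n.+2) := \sum_i \sum_(u <- pw i c | (mdg u.2).+1 == m) u.1 * mon (raise i u.2) x * Y u.2 i.
have Hf c : exists g, fd (f c) (sa a) g.
  have hs (I : Type) (r : seq I) (P : pred I) (F : I -> 'rV[C]_n.+2 -> C) :
     (forall i, exists g, fd (F i) (sa a) g) -> exists g, fd (fun x => \sum_(i <- r | P i) F i x) (sa a) g.
    move=> hF; elim: r => [|i r [g hg]].
      by exists 0; apply: fd_ext (fd_cst 0 _) => x; rewrite big_nil.
    have [g' hg'] := hF i. case Pi : (P i); last by exists g; apply: fd_ext hg => x; rewrite big_cons Pi.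
    by exists (g' + g); apply: fd_ext (fd_add hg' hg) => x; rewrite big_cons Pi.
  rewrite /f; apply: (hs _ _ _ _) => i; apply: (hs _ _ _ _) => u; have [g hg] := fd_mon (raise i u.2) (sa a).
  eexists; apply: fd_mul (fd_mul (fd_cst u.1 _) hg) (fd_cst _ _).
have e1 : 0 < e / N.+1%:R by pos.
have /choice[d Hd] : forall c, exists d : R, 0 < d /\ forall y, vn (y - sa a) < d -> nc (f c y - f c (sa a)) < e / N.+1%:R.
  by move=> c; have [d d0 h] := fd_vn_cts (Hf c) e1; exists d.
have [d' d'0 hd] := pos_min (fun c => (Hd c).1). exists (d' / n.+2%:R); first by pos. move=> a'; rewrite ltr_pdivlMr ?ltr0Sn // => ha.
apply: (@le_lt_trans _ _ (N%:R * (e / N.+1%:R))).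
  apply: vn_le => c; rewrite !mxE; apply/ltW/(Hd c).2. by apply: le_lt_trans (sa_le _ _) _; apply: lt_le_trans (hd c); rewrite mulrC.
by rewrite mulrA ltr_pdivrMr ?ltr0Sn // mulrC ltr_pM2l // ltr_nat.
Qed.
Local Notation Fl e := (@Fl R n L p e N w).

(* Integrals along the loops of the forms replaced by their jets are exact
   homogeneous polynomials in the initial point. *)
Lemma Fl_expand e b : exists K r : R, [/\ 0 <= K, 0 < r & forall a, vn a < r ->
  vn (Fl e b a - \sum_(1 <= m < D.+1) Pgen (Jb b e) m a) <= K * vn a ^+ D.+1].
have [ok [d0 d1] _ _ _] := @lpP R n L p b. have [K K0 HK] := cA_bdd (ex e) ok d0 d1. pose K2 := n.+2%:R * K; have K20 : 0 <= K2 by pos.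
pose rr := minr r1 rT; have rr0 : 0 < rr by pos. pose Kc : R := n.+2%:R * (K * (KT * K2 ^+ D)) * nc (pii - 0 : C). have Kc0 : 0 <= Kc.
  by rewrite /Kc; apply: mulr_ge0 (normc_ge0 _); apply: mulr_ge0 => //; apply: mulr_ge0 => //; apply: mulr_ge0 => //; exact: exprn_ge0.
exists (N%:R * Kc), (rr / (K2 + 1)); split; [exact: mulr_ge0|by pos|]. move=> a; rewrite ltr_pdivlMr; last by lra.
move=> ha; have va := vn_ge0 a. have hx s : in01 s -> vn (xl (ex e) (lp b) 0 a (seg 0 pii s)) <= K2 * vn a.
  move=> hs; have := xl_le (ex := ex e) (p := lp b) (s0 := 0) a 0 (fun i => (HK s i hs).1). by rewrite xl_0 !subr0 mulrA.
have hxr s : in01 s -> vn (xl (ex e) (lp b) 0 a (seg 0 pii s)) < rr.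
  by move=> hs; apply: le_lt_trans (hx _ hs) _; nra.
have hr1 s : in01 s -> vn (xl (ex e) (lp b) 0 a (seg 0 pii s)) < r1.
  by move=> hs; have := hxr _ hs; rewrite lt_min => /andP[].
have hrT s : in01 s -> vn (xl (ex e) (lp b) 0 a (seg 0 pii s)) < rT.
  by move=> hs; have := hxr _ hs; rewrite lt_min => /andP[].
rewrite -mulrA; apply: vn_le => c.
have xlE1 s i : xl (ex e) (lp b) 0 a s 0 i = xl (ex e) (lp b) 0 one s 0 i * sa a 0 i by rewrite !mxE mulr1.
have xdE1 s i : xd tb (ex e) (lp b) 0 a s 0 i = xd tb (ex e) (lp b) 0 one s 0 i * sa a 0 i by rewrite !mxE mulr1.
have monE K' s : mon K' (xl (ex e) (lp b) 0 a s) = mon K' (xl (ex e) (lp b) 0 one s) * mon K' (sa a).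
  by rewrite /mon -big_split; apply: eq_bigr => i _; rewrite xlE1 exprMn.
pose fi i (u : C * {ffun 'I_n.+2 -> nat}) s := (u.1 * mon (raise i u.2) (sa a)) *
   (mon u.2 (xl (ex e) (lp b) 0 one s) * xd tb (ex e) (lp b) 0 one s 0 i).
have cfi i u : ctseg (fi i u) 0 pii by apply: ctsegM (ctseg_cst _ _ _) (@ctseg_integrand R n L p b e u.2 i).
have cF : ctseg (fun s => \sum_i \sum_(u <- pw i c) fi i u s) 0 pii.
  by apply: cts_sum_seg => i; apply: cts_sum_seg => u; exact: cfi.
have E0 : cint (fun s => \sum_i \sum_(u <- pw i c) fi i u s) 0 pii = (\sum_(1 <= m < D.+1) Pgen (Jb b e) m a) 0 c.
  rewrite Pgen_sum cint_sum; last by move=> i; apply: cts_sum_seg => u; exact: cfi.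
  apply: eq_bigr => i _; rewrite cint_sum; last by move=> u; exact: cfi. by apply: eq_bigr => u _; rewrite cintZ //; exact: ctseg_integrand.
have cz : ctseg (fun u => zd tb (ex e) w (lp b) 0 a u 0 c) 0 pii by apply: (ctseg_zd wfd ok).
have FE : Fl e b a 0 c = cint (fun u => zd tb (ex e) w (lp b) 0 a u 0 c) 0 pii by rewrite mxE.
have -> : (Fl e b a - \sum_(1 <= m < D.+1) Pgen (Jb b e) m a) 0 c = Fl e b a 0 c - (\sum_(1 <= m < D.+1) Pgen (Jb b e) m a) 0 c by rewrite [LHS]mxE [X in _ + X]mxE.
rewrite FE -E0 -cintB //. apply: le_trans (_ : (n.+2%:R * (K * vn a * (KT * (K2 * vn a) ^+ D))) * nc (pii - 0 : C) <= _); last first.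
  by rewrite /Kc exprMn exprS; apply: eq_ler; ring.
apply: cint_le => [|s hs]; first by apply: ctsegD => // s hs; apply: ctsN; exact: cF. set S := seg 0 pii s.
have -> : \sum_i \sum_(u <- pw i c) fi i u S = \sum_i xd tb (ex e) (lp b) 0 a S 0 i * peval (pw i c) (xl (ex e) (lp b) 0 a S).
  apply: eq_bigr => i _; rewrite /peval mulr_sumr; apply: eq_bigr => u _. by rewrite /fi monE xdE1 mon_raise; ring.
rewrite /zd mxE -sumrB; apply: le_trans (ler_normc_sum _ _ _) _.
apply: (@le_trans _ _ (\sum_(i < n.+2) (K * vn a * (KT * (K2 * vn a) ^+ D)))); last first.
  by rewrite sumr_const card_ord -[leLHS]mulr_natl.
apply: ler_sum => i _; rewrite -mulrBr normcM; apply: ler_pM => //.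
  rewrite mxE normcM; apply: ler_pM; rewrite //; first exact: (HK s i hs).2. exact: vn_coord.
apply: le_trans (pwE (hrT _ hs) i c) _; rewrite ler_wpM2l //. by rewrite lerXn2r ?nnegrE ?hx // mulr_ge0.
Qed.
(** Labels of the periods: an entry j of eta, two loops around its poles with equal multiplier, a
    degree and a starting point. *)
Definition fam : Type := {f : 'I_n.+1 * ('I_(4 + L) * 'I_(4 + L)) * (nat * H) |
  [/\ (3 <= f.1.2.1)%N, (3 <= f.1.2.2)%N, (0 < f.2.1 <= D)%N & nz f.2.2]}.
Definition fj (f : fam) := (sval f).1.1.
Definition fl (f : fam) := (sval f).1.2.1.
Definition fl' (f : fam) := (sval f).1.2.2.
Definition fm (f : fam) := (sval f).2.1.
Definition fa (f : fam) := (sval f).2.2.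
Definition Ydiff e (f : fam) K i : C := Jb (inl (fj f, fl f) : idx) e K i - Jb (inl (fj f, fl' f) : idx) e K i.
Local Notation Qb := (@Qb R n L p).
Definition Ylim (f : fam) K i : C :=
  (Qb K i (inl (fj f, fl f))).[tb (inl (fj f, fl f))] * pii -
  (Qb K i (inl (fj f, fl' f))).[tb (inl (fj f, fl' f))] * pii.
Definition Pv e f := Pgen (Ydiff e f) (fm f) (fa f).
Definition Lv f := Pgen (Ylim f) (fm f) (fa f).
Lemma PgenB Y Y' m a : Pgen (fun K i => Y K i - Y' K i) m a = Pgen Y m a - Pgen Y' m a.
apply/rowP => c; rewrite !mxE -sumrB; apply: eq_bigr => i _; rewrite -sumrB. by apply: eq_bigr => u _; rewrite mulrBr.
Qed.
Definition Fd e j l l' a := Fl e (inl (j, l)) a - Fl e (inl (j, l')) a.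
Lemma Fd_expand e j l l' : exists K r : R, [/\ 0 <= K, 0 < r & forall a, vn a < r ->
  vn (Fd e j l l' a - \sum_(1 <= m < D.+1)
    Pgen (fun K i => Jb (inl (j, l) : idx) e K i - Jb (inl (j, l') : idx) e K i) m a) <= K * vn a ^+ D.+1].
have [K1 [s1 [K10 s10 H1]]] := Fl_expand e (inl (j, l)). have [K2 [s2 [K20 s20 H2]]] := Fl_expand e (inl (j, l')).
exists (K1 + K2), (minr s1 s2); split; [exact: addr_ge0|by pos|]. move=> a /lt_minP[/H1 h1 /H2 h2]. under eq_bigr do rewrite PgenB.
rewrite sumrB /Fd mulrDl; set A := Fl _ _ _ in h1 *; set A' := Fl _ _ _ in h2 *.
set X := \sum_(1 <= m < _) _ in h1 *; set X' := \sum_(1 <= m < _) _ in h2 *.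
have -> : A - A' - (X - X') = (A - X) - (A' - X') by rewrite !opprD !opprK addrACA. by apply: le_trans (vnB _ _) _; exact: lerD.
Qed.

Section PositiveParameter.
Variable e : R.
Hypothesis e0 : 0 < e.
Local Notation rch := (@rch R n L p e N w r1).
Lemma germ_diff j (l l' : 'I_(4 + L)) : (3 <= l)%N -> (3 <= l')%N -> hgerm rch r1 (const_mx 1) (Fd e j l l').
by move=> h h'; exact: (hgerm_diff p e0 r10 Bw0 Lw0 (@wfd) (@wB) wL). Qed.
 Lemma rch_HD a z b u : rch a z b u -> z *m T - g0 (pt 'i%C a) = u *m T - g0 (pt 'i%C b).
exact: reach_HD. Qed.
 Lemma Fd_T j (l l' : 'I_(4 + L)) : (3 <= l)%N -> (3 <= l')%N -> somepos r, forall a, nz a -> vn a < r -> Fd e j l l' a *m T = 0.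
move=> h h'; have [K [_ K0 H]] := germ_diff j h h'. exists (r1 / K); first exact: divr_gt0.
move=> a na; rewrite ltr_pdivlMr // mulrC => ha; have [_ H2] := H a na ha. have := rch_HD (H2 0 (ltac:(by rewrite vn0 add0r))).
by rewrite act1 add0r mul0mx => /addIr.
Qed.
(** The difference of the two loops fixes eta and preserves the first integral, so its translation
    is killed by T. Comparing powers of the scaling factor passes this on to each homogeneous part,
    although the expansion is only known to order D. *)
Lemma Pv_T f : Pv e f *m T = 0.
have [h1 h2 hm na] := svalP f; rewrite -/(fl f) -/(fl' f) -/(fm f) -/(fa f) in h1 h2 hm na.
have [r r0' Hr] := Fd_T (fj f) h1 h2; have [K [s [K0 s0 HK]]] := Fd_expand e (fj f) (fl f) (fl' f). apply/rowP => c; rewrite [RHS]mxE.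
have [KT' KT'0 HT] := vn_mulmx 0 T. have va := vn_ge0 (fa f); have va1 : 0 < vn (fa f) + 1 by lra.
apply: (@small_powers R D (fun m => (Pgen (Ydiff e f) m (fa f) *m T) 0 c) (minr r s / (vn (fa f) + 1)) (KT' * K * vn (fa f) ^+ D.+1)) => //.
  by pos.
move=> t /andP[t0]; rewrite ltr_pdivlMr // lt_min => /andP[t1 t2].
have vt : vn (t%:C *: fa f) = t * vn (fa f) by rewrite vnZ normc_real ger0_norm // ltW.
have nt : nz (t%:C *: fa f) by apply: nz_scale => //; rewrite -normc_gt0 normc_real normr_gt0 gt_eqF.
have {}Hr := Hr _ nt (ltac:(rewrite vt; nra)). have {}HK := HK (t%:C *: fa f) (ltac:(rewrite vt; nra)).
have -> : \sum_(1 <= m < D.+1) (t ^+ m)%:C * (Pgen (Ydiff e f) m (fa f) *m T) 0 c =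
   ((\sum_(1 <= m < D.+1) Pgen (Ydiff e f) m (t%:C *: fa f)) *m T) 0 c.
  rewrite mulmx_suml summxE; apply: eq_bigr => m _. by rewrite PgenZ -scalemxAl [in RHS]mxE rmorphXn.
apply: le_trans (vn_coord _ c) _. have -> : (\sum_(1 <= m < D.+1) Pgen (Ydiff e f) m (t%:C *: fa f)) *m T =
  - ((Fd e (fj f) (fl f) (fl' f) (t%:C *: fa f) - \sum_(1 <= m < D.+1) Pgen (Ydiff e f) m (t%:C *: fa f)) *m T).
  by rewrite mulmxBl Hr sub0r opprK.
rewrite vnN; apply: le_trans (HT _) _; rewrite -!mulrA ler_wpM2l //; apply: le_trans HK _. by rewrite vt exprMn [X in _ * X]mulrC.
Qed.
End PositiveParameter.
Lemma Pgen_lip m a : exists2 K : R, 0 <= K & forall Y Y' (d : R), 0 <= d ->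
  (forall i c u, u \in pw i c -> nc (Y u.2 i - Y' u.2 i) <= d) ->
  vn (Pgen Y m a - Pgen Y' m a) <= K * d.
have [K K0 HK] := pos_max (fun c => \sum_i \sum_(u <- pw i c | (mdg u.2).+1 == m) nc (u.1 * mon (raise i u.2) (sa a))).
exists (N%:R * K) => [|Y Y' d d0 h]; first exact: mulr_ge0. rewrite -PgenB -mulrA; apply: vn_le => c; rewrite mxE.
apply: le_trans (_ : (\sum_i \sum_(u <- pw i c | (mdg u.2).+1 == m) nc (u.1 * mon (raise i u.2) (sa a))) * d <= _).
  apply: le_trans (ler_normc_sum _ _ _) _; rewrite mulr_suml; apply: ler_sum => i _.
  apply: le_trans (ler_normc_sum _ _ _) _; rewrite mulr_suml big_seq_cond [leRHS]big_seq_cond.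
  apply: ler_sum => u /andP[hu _]; rewrite normcM ler_wpM2l //; exact: h hu.
by rewrite ler_wpM2r.
Qed.
Lemma Pv_lim f (d : R) : 0 < d -> somepos e0, forall e : R, 0 < e < e0 ->
  vn (e%:C^-1 *: Pv e f - Lv f) < d.
move=> d0; have [K K0 HK] := Pgen_lip (fm f) (fa f). pose d1 := d / (2 * (K + 1)); have d10 : 0 < d1 by pos.
have dK : K * d1 < d by rewrite /d1 mulrA ltr_pdivrMr ?mulr_gt0 //; [nra|lra].
pose b := inl (fj f, fl f) : idx; pose b' := inl (fj f, fl' f) : idx.
have lim2 b0 (s : seq ({ffun 'I_n.+2 -> nat} * 'I_n.+2)) : somepos e0, forall e : R, 0 < e < e0 ->
   forall q, q \in s -> nc (Jb b0 e q.1 q.2 / e%:C - (Qb q.1 q.2 b0).[tb b0] * pii) < d1 / 2.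
  elim: s => [|q s [e1 e10 H1]]; first by exists 1. have [e2 e20 H2] := @Jb_limit R n L p b0 q.1 q.2 (d1 / 2) (ltac:(by rewrite divr_gt0)).
  exists (minr e1 e2); first by pos. move=> e /andP[h0]; rewrite lt_min => /andP[h1 h2] q'; rewrite inE => /orP[/eqP->|hq].
    by apply: H2; rewrite h0.
  by apply: H1 => //; rewrite h0.
pose s := flatten [seq [seq (u.2, ic.1) | u <- pw ic.1 ic.2] | ic <- enum (('I_n.+2 * 'I_N)%type : finType)].
have hs i c u : u \in pw i c -> (u.2, i) \in s.
  move=> hu; apply/flattenP; exists [seq (v.2, i) | v <- pw i c]; last exact: map_f. by apply/mapP; exists (i, c); rewrite ?mem_enum.
have [e1 e10 H1] := lim2 b s; have [e2 e20 H2] := lim2 b' s. exists (minr e1 e2); first by pos.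
move=> e /andP[h0]; rewrite lt_min => /andP[h1 h2]. have ee0 : e%:C != 0 :> C by rewrite -normc_gt0 normc_real normr_gt0 gt_eqF.
have -> : e%:C^-1 *: Pv e f = Pgen (fun K i => Ydiff e f K i / e%:C) (fm f) (fa f).
  apply/rowP => c; rewrite !mxE mulr_sumr; apply: eq_bigr => i _; rewrite mulr_sumr. by apply: eq_bigr => u _; rewrite mulrC mulrA.
apply: le_lt_trans (HK _ _ d1 (ltW d10) _) dK => i c u hu. have k1 := H1 e (ltac:(by rewrite h0)) _ (hs i c u hu).
have k2 := H2 e (ltac:(by rewrite h0)) _ (hs i c u hu).
rewrite /Ydiff /Ylim -/b -/b' (_ : _ - _ = (Jb b e u.2 i / e%:C - (Qb u.2 i b).[tb b] * pii) -
  (Jb b' e u.2 i / e%:C - (Qb u.2 i b').[tb b'] * pii)); last by ring.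
apply: le_trans (ler_normcB _ _) _; move: k1 k2 => /=; lra.
Qed.
(** A covector l killing all limits makes the jet of $\omega\cdot l$ closed, by [Th_eq0]. The rest
    of $\omega\cdot l$ is of order D, hence $d(\omega\cdot l)$ is of order D - 1 and [closed_kernel]
    applies. *)
Lemma Lv_full (l : 'cV[C]_N) : (forall f, Lv f *m l = 0) -> forall v : 'rV[C]_N, v *m T = 0 -> v *m l = 0.
move=> hl; apply: closed_kernel.
pose th i : polyf (R := R) n.+2 := flatten [seq [seq (l c 0 * u.1, u.2) | u : C * {ffun 'I_n.+2 -> nat} <- pw i c] | c <- enum 'I_N].
have thS i (F : C * {ffun 'I_n.+2 -> nat} -> C) : \sum_(u <- th i) F u = \sum_c \sum_(u <- pw i c) F (l c 0 * u.1, u.2).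
  by rewrite /th big_flatten big_map big_enum /=; apply: eq_bigr => c _; rewrite big_map.
have thD i u : u \in th i -> (mdg u.2 < D)%N.
  by move=> /flattenP[_ /mapP[c _ ->] /mapP[v hv ->]] /=; exact: pwD hv.
have pii0 : pii != 0 :> C.
  by rewrite /pii eq_complex /= eqxx /= mulrn_eq0 /= gt_eqF ?pi_gt0.
have ker j (l1 l2 : 'I_(4 + L)) a : (3 <= l1)%N -> (3 <= l2)%N -> nz a -> \sum_i \sum_(u <- th i) u.1 * mon (raise i u.2) (sa a) *
    ((Qb u.2 i (inl (j, l1))).[tb (inl (j, l1))] - (Qb u.2 i (inl (j, l2))).[tb (inl (j, l2))]) = 0.
  move=> h1 h2 na; pose Y := fun K i => (Qb K i (inl (j, l1))).[tb (inl (j, l1))] * pii - (Qb K i (inl (j, l2))).[tb (inl (j, l2))] * pii.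
  have hm m : (0 < m <= D)%N -> Pgen Y m a *m l = 0.
    by move=> hm; have := hl (exist _ (j, (l1, l2), (m, a)) (And4 h1 h2 hm na)).
  have : (\sum_(1 <= m < D.+1) Pgen Y m a) *m l = 0.
    by rewrite mulmx_suml big_nat big1 // => m /andP[m1 m2]; apply: hm; rewrite m1.
  move=> /rowP/(_ 0); rewrite mxE [RHS]mxE => h. apply/eqP; rewrite -(mulrI_eq0 _ (mulfI pii0)); apply/eqP; rewrite -[RHS]h.
  under [RHS]eq_bigr do rewrite Pgen_sum mulr_suml. rewrite exchange_big mulr_sumr; apply: eq_bigr => i _ /=; rewrite thS mulr_sumr.
  apply: eq_bigr => c _; rewrite mulr_sumr mulr_suml; apply: eq_bigr => u _ /=; rewrite /Y; ring.
have HTh := Th_eq0 pD LD thD ker. pose q i x := \sum_c w x i c * l c 0 - peval (th i) x.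
have pE i x : peval (th i) x = \sum_c peval (pw i c) x * l c 0.
  rewrite /peval thS; apply: eq_bigr => c _; rewrite mulr_suml; apply: eq_bigr => u _ /=; ring.
pose Gq i x := \sum_c l c 0 *: Gw i c x - pgrad (th i) x. have hq i : grads (q i) (Gq i) 0 r0.
  move=> x hx; apply: fd_ext (fd_add _ (_ : fd (fun x => -1 * peval (th i) x) x (- pgrad (th i) x))) => [y||].
  - rewrite mulN1r; reflexivity.
  - elim: (index_enum _) => [|c r IH].
      by rewrite big_nil; apply: fd_ext (fd_cst 0 x) => y; rewrite big_nil.
    rewrite big_cons; apply: fd_ext (fd_add (_ : fd (fun y => w y i c * l c 0) x (l c 0 *: Gw i c x)) IH) => [y|].
      by rewrite big_cons.
    have := fd_mul (hGw i c hx) (fd_cst (l c 0) x); rewrite scaler0 addr0; exact.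
  have := fd_mul (fd_cst (-1) x) (fd_peval (th i) x); rewrite scaler0 add0r scaleN1r; exact.
have [SL SL0 HSL] := pos_max (fun c => nc (l c 0)). have ql i x : vn x < rT -> nc (q i x) <= N%:R * (KT * SL) * vn x ^+ D.
  move=> hx; rewrite /q pE -sumrB; apply: le_trans (ler_normc_sum _ _ _) _. apply: (@le_trans _ _ (\sum_(c < N) KT * SL * vn x ^+ D)).
    apply: ler_sum => c _; rewrite -mulrBl normcM mulrAC; apply: ler_pM; rewrite //; exact: pwE.
  by rewrite sumr_const card_ord -[leLHS]mulr_natl mulrA.
have qbd i : exists B : R, forall x, vn x < minr r0 rT -> nc (q i x) <= B.
  exists (N%:R * (KT * SL) * rT ^+ D) => x; rewrite lt_min => /andP[_ hx]. apply: le_trans (ql i x hx) _; rewrite ler_wpM2l ?mulr_ge0 //.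
  by rewrite lerXn2r ?nnegrE // ltW.
have /choice[Kf /choice[rf hf]] : forall i, exists K r : R, [/\ 0 <= K, 0 < r & forall j x, vn x < r -> nc (Gq i x 0 j) <= K * vn x ^+ D.-1].
  move=> i; have [B hB] := qbd i. have m0 : 0 < minr r0 rT by rewrite lt_min r00.
  apply: (@vanish_partial R n.+2 D.-1 (q i) (Gq i) (minr r0 rT) B (N%:R * (KT * SL)) rT m0 _ hB rT0).
  - by move=> x hx; apply: hq; move: hx; rewrite lt_min => /andP[].
  - by apply: mulr_ge0 => //; exact: mulr_ge0. by move=> x hx; rewrite prednK //; exact: ql.
have [K K0 HK] := pos_max Kf; have [r rr0 Hr] := pos_min (fun i => let: And3 _ h _ := hf i in h).
have HG x i j : vn x < r -> nc (Gq i x 0 j) <= K * vn x ^+ D.-1.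
  move=> hx; have [_ _ H] := hf i; apply: le_trans (H j x (lt_le_trans hx (Hr i))) _. by rewrite ler_wpM2r ?exprn_ge0.
(* [Th_eq0] covers points with nonzero coordinates. Moving x slightly in the direction (1, ..., 1)
   reaches such points, and continuity does the rest. *)
have Th0 i j x : peval (pder j (th i)) x = peval (pder i (th j)) x.
  apply/eqP; rewrite -subr_eq0; apply/eqP. pose v : 'rV[C]_n.+2 := const_mx 1.
  pose fT s := peval (pder j (th i)) (x + s *: v) - peval (pder i (th j)) (x + s *: v). have cT : cts fT 0.
    by apply: ctsB; apply: cd_cts (fd_line (fd_peval _ _)).
  have [d d0 Hd] : somepos d, forall s : C, 0 < nc s < d -> fT s = 0.
    have hl' m : exists d : R, 0 < d /\ forall s : C, 0 < nc s < d -> x 0 m + s != 0.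
      have [x0|x0] := eqVneq (x 0 m) 0.
        by exists 1; split=> // s /andP[s0 _]; rewrite x0 add0r -normc_gt0.
      exists (nc (x 0 m)); rewrite normc_gt0; split=> // s /andP[_ hs].
      by apply: contraTneq hs => /eqP; rewrite addr_eq0 => /eqP->; rewrite normcN ltxx.
    have /choice[dm hdm] := hl'; have [d d0 Hd] := pos_min (fun m => (hdm m).1).
    exists d => // s /andP[s0 s1]; have nzx m : (x + s *: v) 0 m != 0.
      by rewrite !mxE mulr1; apply: (hdm m).2; rewrite s0 (lt_le_trans s1).
    by have := @HTh j i (x + s *: v) (conj (nzx _) (fun m _ => nzx m)); rewrite /Th.
  have : fT 0 = 0.
    apply/eqP/negPn/negP => n0; have [r' r'0 hr'] := cts_away cT n0. pose s : R := minr d r' / 2; have m0 : 0 < minr d r' by pos.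
    have [sd sr] : s < d /\ s < r' by apply/lt_minP; rewrite /s; lra. have s0 : 0 < s by rewrite /s; lra.
    have := hr' s%:C; rewrite subr0 normc_real gtr0_norm // => /(_ sr). rewrite (Hd s%:C); last by rewrite normc_real gtr0_norm ?s0.
    by rewrite normc0; have := normc_ge0 (fT 0); lra.
  by rewrite /fT scale0r addr0.
exists (2 * K), r; split=> // x hx i j. have GqE i' j' : Gq i' x 0 j' = \sum_c l c 0 * Gw i' c x 0 j' - peval (pder j' (th i')) x.
  by rewrite /Gq mxE summxE mxE mxE; congr (_ - _); apply: eq_bigr => c _; rewrite mxE.
have -> : \sum_c (Gw i c x 0 j - Gw j c x 0 i) * l c 0 = Gq i x 0 j - Gq j x 0 i.
  rewrite !GqE Th0 opprD opprK addrACA addNr addr0 -sumrB; apply: eq_bigr => c _; ring.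
apply: le_trans (ler_normcB _ _) _; have := HG x i j hx; have := HG x j i hx; lra.
Qed.
Lemma th_le (i : 'I_n.+2) : nc (th i ('i%C : C)) <= 1.
by rewrite /th; case: eqP; rewrite ?normc_i ?normc1. Qed.

(* For small exponents the periods of the holonomy germs span the kernel of T,
   and leaves are dense in the levels of the first integral near 0 over 'i. *)
Definition spanned (e : R) (v : Z) := exists r (f : 'I_r -> fam) (c : 'I_r -> C), v = \sum_i c i *: Pv e (f i).
 Lemma spanned_small : somepos e0, forall e : R, 0 < e < e0 -> forall v : Z, v *m T = 0 -> spanned e v.
exact: (span_stable (fun e f h => Pv_T h f) Pv_lim Lv_full). Qed.
 Lemma fibre_density (e : R) : 0 < e -> (forall v : Z, v *m T = 0 -> spanned e v) ->
  somepos rho, forall (a0 a1 : H) (z0 z1 : Z), nz a0 -> nz a1 -> vn a0 < rho -> vn a1 < rho -> vn z0 < rho -> vn z1 < rho ->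
    z0 *m T - g0 (pt 'i%C a0) = z1 *m T - g0 (pt 'i%C a1) -> Q (@rch R n L p e N w r1) a0 z0 a1 z1.
move=> ep He. have [Fde hFd] := hgerm_de L p ep r10 Bw0 Lw0 (@wfd) (@wB) wL.
have [C0 C00 hC] := contract (@rch_refl R n L p e N w r1) (@rch_trans R n L p e N w r1) (de01 ep) hFd.
pose rho := minr (r1 / 8) (minr (r1 / 8 / C0) (r1 / (2 * n.+2%:R))). have rho0 : 0 < rho by pos.
have rho1 : rho <= r1 / 8 by rewrite ge_min lexx. have rho2 : rho <= r1 / 8 / C0 by rewrite !ge_min lexx orbT.
have rho3 : rho <= r1 / (2 * n.+2%:R) by rewrite !ge_min lexx !orbT. clearbody rho.
exists rho => // a0 a1 z0 z1 na0 na1 ha0 ha1 hz0 hz1 eqT. have sm (x y : R) : x < rho -> y < rho -> x < r1 / 8 /\ C0 * y < r1 / 8.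
  move=> hx hy; split; first exact: lt_le_trans rho1. by rewrite mulrC -ltr_pdivlMr //; exact: lt_le_trans rho2.
have dm := @dense_mult R n L p e ep N w r1 Bw Lw r10 Bw0 Lw0 (@wfd) (@wB) wL.
have tr := @rch_transport R n L p e N w r1 Bw Lw r10 Bw0 Lw0 (@wfd) (@wB) wL.
apply: (@fill R n N (@rch R n L p e N w r1) r1 r10 (@rch_refl R n L p e N w r1) (@rch_sym R n L p e N w r1)
  (@rch_trans R n L p e N w r1) (@rch_nz R n L p e N w r1) tr (de e) (de01 ep) dm a0 z0 na0 C0 C00 hC k T (fun a => g0 (pt 'i%C a))) => //.
- move=> v /He[r [f [c ->]]]; apply: V_sum => i _; apply: V_scale. have [h1 h2 hm na] := svalP (f i).
  have [K [s [K0 s0 HK]]] := Fd_expand e (fj (f i)) (fl (f i)) (fl' (f i)).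
  apply: (@V_P R n N (@rch R n L p e N w r1) r1 r10 (@rch_sym R n L p e N w r1)
   (@rch_trans R n L p e N w r1) (@rch_nz R n L p e N w r1) tr (de e) (de01 ep) dm a0 z0 na0 C0 C00 hC
   (Fd e (fj (f i)) (fl (f i)) (fl' (f i))) (Pgen (Ydiff e (f i))) D K s _ _ _ s0 HK) => //.
  + exact: germ_diff.
  + exact: PgenZ.
  + exact: Pgen_cts.
- by move=> a z b u _; exact: rch_HD.
- move=> d dd0. have hx : vn (pt 'i%C a1) < r1.
    apply: (@le_lt_trans _ _ (n.+2%:R * vn a1)).
      apply: vn_le => i; rewrite mxE normcM. have h := th_le i. by rewrite -[leRHS]mul1r; apply: ler_pM; rewrite ?vn_coord.
    apply: le_lt_trans (_ : n.+2%:R * (r1 / (2 * n.+2%:R)) < r1).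
      by rewrite ler_wpM2l // ltW // (lt_le_trans ha1).
    rewrite (_ : n.+2%:R * (r1 / (2 * n.+2%:R)) = r1 / 2); first by lra. by field; rewrite -natr1 -natr1; have : 0 <= n%:R :> R by []; lra.
  have e1 : 0 < d / k.+1%:R by rewrite divr_gt0 ?ltr0Sn.
  have /choice[dc Hd] : forall c, exists d' : R, 0 < d' /\ forall y, vn (y - pt 'i%C a1) < d' ->
      nc (g0 y 0 c - g0 (pt 'i%C a1) 0 c) < d / k.+1%:R.
    by move=> c; have [d' d'0 h] := fd_vn_cts (ex_intro _ _ (hg0 hx c)) e1; exists d'.
  have [d' d'0 hd] := pos_min (fun c => (Hd c).1). exists (d' / n.+2%:R); first by rewrite divr_gt0 ?ltr0Sn.
  move=> b; rewrite ltr_pdivlMr ?ltr0Sn // => hb. apply: (@le_lt_trans _ _ (k%:R * (d / k.+1%:R))).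
    apply: vn_le => c; rewrite !mxE; apply/ltW/(Hd c).2; apply: lt_le_trans (hd c).
    apply: le_lt_trans (_ : n.+2%:R * vn (b - a1) < _); last by rewrite mulrC. apply: vn_le => i; rewrite !mxE -mulrBr normcM.
    have h := th_le i. have h2 := vn_coord (b - a1) (sg i); rewrite !mxE in h2. by rewrite -[leRHS]mul1r; apply: ler_pM.
  by rewrite mulrA ltr_pdivrMr ?ltr0Sn // mulrC ltr_pM2l // ltr_nat.
- exact: sm.
- exact: sm.
Qed.
End Assembly.

(** * Translation to the library notions of neighbourhood, differential and connectedness *)

Section Bridges.
Context {R : realType}.
Local Notation C := R[i].
Lemma ler_normcC (z : C) (e : R) : (`|z| <= e%:C) = (nc z <= e).
by rewrite normcE lecR. Qed.
 Lemma ball_mx m (x y : 'rV[C]_m) (e : R) : 0 < e -> (ball x e%:C y <-> forall i, nc (y 0 i - x 0 i) < e).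
move=> e0; split=> [[_ h] i|h].
  by have := h 0 i; rewrite -ball_normE /= ltr_normc normc_distC.
by split=> [|i j]; rewrite ?ltcR // -ball_normE /= ltr_normc normc_distC (ord1 i).
Qed.
Lemma nbhs_vn m (x : 'rV[C]_m) (A : set 'rV[C]_m) :
  nbhs x A <-> somepos r, forall y, vn (y - x) < r -> A y.
split=> [/nbhs_ballP[e /= e0 h]|[r r0 h]].
  have [e1 e2] := pos_complex e0; exists (Re e) => // y hy; apply: h; rewrite e2.
  by apply/ball_mx => // i; have := vn_coord (y - x) i; rewrite !mxE => /le_lt_trans; apply.
have q0 : 0 < r / (m.+1)%:R by pos. apply/nbhs_ballP; exists (r / m.+1%:R)%:C; first by rewrite /= ltcR.
move=> y /ball_mx => /(_ q0) hy; apply: h. apply: (@le_lt_trans _ _ (m%:R * (r / m.+1%:R))).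
  by apply: vn_le => i; rewrite !mxE; apply/ltW/hy.
rewrite mulrCA gtr_pMr // ltr_pdivrMr ?ltr0n // mul1r ltr_nat //.
Qed.
Lemma open_vn m (A : set 'rV[C]_m) :
  open A <-> forall x, A x -> somepos r, forall y, vn (y - x) < r -> A y.
rewrite openE; split=> h x /h; first by move/nbhs_vn. by move=> ?; apply/nbhs_vn.
Qed.
Lemma open_op (A : set C) : open A <-> op A.
rewrite openE; split=> h x /h; first by move/nbhs_normc. by move=> ?; apply/nbhs_normc.
Qed.
Lemma norm_le_vn m (x : 'rV[C]_m) : `|x| <= (vn x)%:C.
have [->|x0] := eqVneq x 0; first by rewrite normr0 vn0.
have [|i hi] := @mx_norm_neq0 _ _ _ x; first by rewrite -[mx_norm x]/(`|x|) normr_eq0. rewrite -[`|x|]/(mx_norm x) hi.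
by rewrite ler_normcC (ord1 i.1); exact: vn_coord.
Qed.
Lemma vn_le_norm m (x : 'rV[C]_m) : (vn x)%:C <= m%:R * `|x|.
have /pos_complex[e1 e2] : 0 < `|x| + 1 by pos. have h (i : 'I_m) : nc (x 0 i) <= Re `|x|.
  have hb : `|x 0 i| <= `|x|.
    by rewrite [leRHS]mx_normE; apply: (@le_bigmax _ _ _ _ (fun i => `|x i.1 i.2|%:nng) (0, i)).
  by move: hb; rewrite normcE lecE /= => /andP[_].
have -> : `|x| = (Re `|x|)%:C by move: (normr_ge0 x); rewrite lecE => /andP[/eqP hi _]; case: `|x| hi => a b /= ->.
have -> : m%:R = (m%:R : R)%:C by rewrite rmorph_nat. by rewrite -rmorphM lecR; exact: vn_le.
Qed.
Lemma dot_linear m (g : 'rV[C]_m) : linear (dot g : 'rV[C]_m -> C).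
by move=> a x y; rewrite dotDr dotZr. Qed. HB.instance Definition _ m (g : 'rV[C]_m) :=
  GRing.isLinear.Build C 'rV[C]_m C *:%R (dot g) (@dot_linear m g).
 Lemma linear_dot m (f : {linear 'rV[C]_m -> C}) x : f x = dot (\row_i f (delta_mx 0 i)) x.
rewrite {1}(row_sum_delta x) linear_sum; apply: eq_bigr => i _. by rewrite linearZ /= !mxE mulrC.
Qed.
Lemma diff_fd m (f : 'rV[C]_m -> C) x : differentiable f x -> fd f x (\row_i 'd f x (delta_mx 0 i)).
move=> /diff_locallyP[_ h] e e0. move/eqaddoP: h => /(_ e%:C); rewrite ltcR => /(_ e0) /nbhs_vn[r r0 h]; exists r => // y hy.
have := h y; rewrite subr0 => /(_ hy) hy'. rewrite -ler_normcC rmorphM /= [x + y]addrC -linear_dot.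
apply: le_trans (_ : e%:C * `|y| <= _); first last.
  by apply: ler_wpM2l (norm_le_vn y); rewrite lecR ltW.
apply: le_trans hy'; rewrite le_eqVlt; apply/orP; left; apply/eqP; congr (`| _ |). by rewrite -addrA -opprD.
Qed.
Lemma fd_diff m (f : 'rV[C]_m -> C) x g : fd f x g ->
  differentiable f x /\ 'd f x = dot g :> ('rV[C]_m -> C).
move=> h. have cg : continuous (dot g : 'rV[C]_m -> C).
  move=> y A /nbhs_normc[e e0 hA]; apply/nbhs_vn. have k0 : 0 < vn g + 1 by pos. exists (e / (vn g + 1)); first by pos.
  move=> z hz; apply: hA; rewrite -raddfB /=. apply: le_lt_trans (dot_le _ _) _; move: hz; rewrite ltr_pdivlMr // => hz.
  by apply: le_lt_trans hz; rewrite mulrC ler_wpM2l // lerDl.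
have K := fun eqo => conj (@diff_unique C 'rV[C]_m C f (dot g) x cg eqo) eqo. case: K => [|E eqo].
  apply/eqaddoP => e /pos_complex[e0 ->]; apply/nbhs_vn. have m0 : 0 < m.+1%:R :> R by pos. have e1 : 0 < Re e / m.+1%:R by pos.
  have [r r0 hr] := h _ e1; exists r => // y; rewrite subr0 => hy. have := hr _ hy; rewrite -ler_normcC => hy'.
  apply: le_trans (_ : `|f (x + y) - f x - dot g y| <= _).
    apply: eq_ler; congr (`| _ |). by rewrite [x + y]addrC -addrA -opprD.
  apply: le_trans hy' _; rewrite rmorphM /= rmorphM /= -mulrA ler_wpM2l ?lecR ?(ltW e0) //.
  rewrite -mulrC rmorphV ?unitfE ?gt_eqF // ler_pdivrMr ?ltcR //.
  apply: le_trans (vn_le_norm y) _; rewrite mulrC rmorph_nat ler_wpM2l // ler_nat //.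
split; last exact: E. by apply/diff_locallyP; rewrite E.
Qed.
Lemma diff_entry m p q (F : 'rV[C]_m -> 'M[C]_(p, q)) x i j : differentiable F x ->
  fd (fun y => F y i j) x (\row_k 'd F x (delta_mx 0 k) i j).
move=> dF. have dc := @differentiable_coord C p q (F x) i j.
have dd : differentiable (fun y => F y i j) x by apply: (differentiable_comp dF dc). have := diff_fd dd; congr (fd _ _ _).
apply/rowP => k; rewrite !mxE. rewrite (_ : (fun y => F y i j) = (fun M : 'M[C]_(p, q) => M i j) \o F) // diff_comp //=.
have @f : {linear 'M[C]_(p, q) -> C}.
  by exists (fun N : 'M[C]_(p, q) => N i j); do 2![eexists]; do ?[constructor];
     rewrite ?mxE// => ? *; rewrite ?mxE//; move=> ?; rewrite !mxE.
rewrite (_ : (fun M : 'M[C]_(p, q) => M i j) = f) // diff_lin //. exact: coord_continuous.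
Qed.
Lemma fd_diff_mx m q (F : 'rV[C]_m -> 'rV[C]_q) x :
  (forall j, exists g, fd (fun y => F y 0 j) x g) -> differentiable F x.
move=> h; have -> : F = (\sum_j (fun y => F y 0 j *: delta_mx 0 j)).
  by apply/funext => y; rewrite fct_sumE {1}(row_sum_delta (F y)).
apply: differentiable_sum => j; have [g /fd_diff[d _]] := h j. exact: differentiableZl.
Qed.
Lemma cvg_dnbhs m (G : C -> 'rV[C]_m) (v : 'rV[C]_m) :
  (G @ (0 : C)^' --> v) <-> forall e : R, 0 < e -> somepos r, forall h, nc h < r -> h != 0 -> forall i, nc (G h 0 i - v 0 i) < e.
split=> [h e e0|h A /nbhs_vn[e e0 hA]].
  have /h /nbhs_normc[r r0 hr] : nbhs v [set y | forall i, nc (y 0 i - v 0 i) < e].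
    apply/nbhs_vn; exists e => // y hy i. by apply: le_lt_trans hy; have := vn_coord (y - v) i; rewrite !mxE.
  by exists r => // z hz z0; apply: hr; rewrite ?subr0.
have q0 : 0 < e / (m.+1)%:R by pos. have [r r0 hr] := h _ q0; apply/nbhs_normc; exists r => // z; rewrite subr0 => hz z0.
apply: hA; apply: (@le_lt_trans _ _ (m%:R * (e / m.+1%:R))).
  by apply: vn_le => i; rewrite !mxE; apply/ltW/hr.
by rewrite mulrCA gtr_pMr // ltr_pdivrMr ?ltr0n // mul1r ltr_nat.
Qed.
Lemma is_derive_cdv m (phi : C -> 'rV[C]_m) u v : is_derive u (1 : C) phi v <-> cdv phi u v.
pose q h := h^-1 *: (phi (h *: 1 + u) - phi u). have qE h i : q h 0 i - v 0 i = h^-1 * (phi (h + u) 0 i - phi u 0 i) - v 0 i.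
  by rewrite !mxE [h *: 1]mulr1.
have -> : is_derive u (1 : C) phi v <-> (q @ (0 : C)^' --> v).
  split=> [[d <-]|h]; first exact: d. by split; [exact: (cvgP _ h) | exact: (cvg_lim _ h)].
split=> [/cvg_dnbhs h i|h]; last (apply/cvg_dnbhs => e e0).
  apply/cdP => e e0; have [r r0 hr] := h e e0; exists r => // w hw.
  have [->|wu] := eqVneq w u; first by rewrite !subrr mulr0 subr0 normc0 mulr0. have d0 : w - u != 0 by rewrite subr_eq0.
  have := hr _ hw d0 i; rewrite qE subrK => /ltW hi. rewrite (_ : _ - _ = (w - u) * ((w - u)^-1 * (phi w 0 i - phi u 0 i) - v 0 i)).
    by rewrite normcM mulrC ler_wpM2r.
  by rewrite [RHS]mulrBr mulVKf // [in RHS](mulrC (w - u)).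
have e1 : 0 < e / 2 by pos. have /choice[rr hr] : forall i, exists r : R, 0 < r /\ forall w, nc (w - u) < r ->
    nc (phi w 0 i - phi u 0 i - v 0 i * (w - u)) <= e / 2 * nc (w - u).
  by move=> i; have /cdP/(_ _ e1)[r r0 hr] := h i; exists r.
have [r r0 hm] := pos_min (fun i => (hr i).1); exists r => // z hz z0 i.
have /(hr i).2 : nc (z + u - u) < rr i by rewrite addrK (lt_le_trans hz). rewrite addrK qE => hi. have n0 : 0 < nc z by rewrite normc_gt0.
rewrite (_ : _ - _ = z^-1 * (phi (z + u) 0 i - phi u 0 i - v 0 i * z)).
  rewrite normcM normcV mulrC ltr_pdivrMr //; apply: le_lt_trans hi _. by rewrite ltr_pM2r // ltr_pdivrMr // ltr_pMr // ltr1n.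
by rewrite [in RHS]mulrBr; congr (_ - _); rewrite mulrC mulfK.
Qed.
(** The points of D where P holds and those where it fails form two open sets. *)
Lemma connected_local (P : C -> Prop) (D : set C) s t : open D -> connected D -> D s -> D t -> P s ->
  (forall u, D u -> somepos r, forall w, nc (w - u) < r -> P u <-> P w) -> P t.
move=> /open_op oD cD Ds Dt Ps h. suff : [set u | D u /\ P u] = D by move=> E; have : D t := Dt; rewrite -E => -[].
apply: cD; first by exists s.
  exists [set u | D u /\ P u]; last by apply/seteqP; split=> x /=; [case|case].
  apply/open_op => u [Du Pu]; have [r r0 hr] := oD u Du; have [r' r0' hr'] := h u Du. exists (minr r r'); first by pos.
  by move=> w /lt_minP[/hr Dw /hr' hw]; split=> //; apply/hw.
exists (~` [set u | D u /\ ~ P u]).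
  apply: open_closedC; apply/open_op => u [Du Pu]; have [r r0 hr] := oD u Du; have [r' r0' hr'] := h u Du. exists (minr r r'); first by pos.
  by move=> w /lt_minP[/hr Dw /hr' hw]; split=> // /hw.
apply/seteqP; split=> x /= [Dx Px]; split=> //; first by case. by apply: contrapT => nP; apply: Px.
Qed.
Lemma cvx_connected (D : set C) : cvx D -> connected D.
move=> cD A [a Aa] [B oB AB] [F cF AF]. have /open_op oF : open (~` F) by apply: closed_openC. have oB' := (open_op B).1 oB.
apply/seteqP; split=> x; first by rewrite AB => -[]. have Da : D a by move: Aa; rewrite AB => -[]. move=> Dx.
suff h : A (seg a x 0) <-> A (seg a x 1) by rewrite -(seg1 a x); apply/h; rewrite seg0.
apply: (@cousin R (fun s t => A (seg a x s) <-> A (seg a x t))) => [s t u _ _ _ _|s s01]; first by tauto.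
have Ds u : in01 u -> D (seg a x u) by move=> ?; apply: cD.
suff [d d0 hd] : somepos d, forall t, in01 t -> `|t - s| < d -> (A (seg a x t) <-> A (seg a x s)).
  exists d => // u v u0 us sv v1 uv; move: (s01) => /andP[s0 s1]. rewrite (hd u) ?(hd v) //; first by rewrite /in01; apply/andP; split; lra.
  - by rewrite ger0_norm; lra.
  - by rewrite /in01; apply/andP; split; lra. by rewrite ler0_norm; lra.
have [As|As] := pselect (A (seg a x s)).
  have [_ Bs] : (D `&` B) (seg a x s) by rewrite -AB. have [r r0 hr] := oB' _ Bs; have [d d0 hd] := seg_near a x s r0.
  exists d => // t t01 /hd /hr Bt; split=> // _; rewrite AB; split=> //; exact: Ds.
have Fs : (~` F) (seg a x s) by move=> Fs; apply: As; rewrite AF; split=> //; exact: Ds.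
have [r r0 hr] := oF _ Fs; have [d d0 hd] := seg_near a x s r0. exists d => // t t01 /hd /hr Ft; split=> // At; exfalso; apply: Ft.
by move: At; rewrite AF => -[].
Qed.
End Bridges.

(** * Holomorphic local inverses; curves contained in a leaf *)

Section LocalInverse.
Context {R : realType}.
Local Notation C := R[i].
Lemma normc_limit (s : nat -> C) (c : R) : (forall n, nc (s n.+1 - s n) <= c / 2 ^+ n.+1) ->
  exists l, forall n, nc (s n - l) <= 4 * c / 2 ^+ n.
move=> h. have hRe n : `|Re (s n.+1) - Re (s n)| <= c / 2 ^+ n.+1.
  by rewrite -ReB; exact: le_trans (ler_Re_normc _) (h n).
have hIm n : `|Im (s n.+1) - Im (s n)| <= c / 2 ^+ n.+1.
  by rewrite -ImB; exact: le_trans (ler_Im_normc _) (h n).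
have [a ha] := @geometric_limit R (fun n => Re (s n)) c hRe. have [b hb] := @geometric_limit R (fun n => Im (s n)) c hIm.
exists (a +i* b) => n; apply: le_trans (ler_normc_ReIm _) _. rewrite ReB ImB /=; have := ha n; have := hb n.
set x := `|_|; set y := `|_| => h1 h2. by rewrite (_ : 4 * c / 2 ^+ n = 2 * c / 2 ^+ n + 2 * c / 2 ^+ n) ?lerD //; ring.
Qed.
(** Newton's iteration with the derivative frozen at s0. Where k varies by at most half of |k(s0)|,
    the map K is injective with a Lipschitz inverse and the iteration halves the error at each
    turn. *)
Lemma local_inverse (K : C -> C) (k : C -> C) (D : C -> Prop) s0 : op D -> D s0 ->
    (forall s, D s -> cd K s (k s)) -> cts k s0 -> k s0 != 0 ->
  exists (r rho : R) (psi : C -> C), [/\ 0 < r, 0 < rho &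
   (forall s, nc (s - s0) < r -> nc (K s - K s0) < rho /\ psi (K s) = s) /\
   (forall u, nc (u - K s0) < rho -> [/\ D (psi u), K (psi u) = u & cd psi u (k (psi u))^-1])].
move=> oD D0 hK ck k0. have n0 : 0 < nc (k s0) by rewrite normc_gt0. have [r1 r10 hr1] := oD _ D0. have e0 : 0 < nc (k s0) / 2 by pos.
have [r2 r20 hr2] := ck _ e0. pose r := minr r1 r2. have r0 : 0 < r by pos.
have inD s : nc (s - s0) < r -> D s by rewrite lt_min => /andP[/hr1]. have kd s : nc (s - s0) < r -> nc (k s - k s0) <= nc (k s0) / 2.
  by rewrite lt_min => /andP[_ /hr2/ltW].
have lin s t : nc (s - s0) < r -> nc (t - s0) < r -> nc (K t - K s - k s0 * (t - s)) <= nc (k s0) / 2 * nc (t - s).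
  move=> hs ht. rewrite (_ : K t - K s - _ = (K t - k s0 * t) - (K s - k s0 * s)); last by ring.
  apply: (@cd_mvt R (fun u => K u - k s0 * u) (fun u => k u - k s0)) => a a01.
    have hu := segB_lt a01 hs ht. by apply: (@cd_ext _ _ _ _ _ _ _ _ (cdB (hK _ (inD _ hu)) (cdZ (k s0) (cd_id _)))) => //; rewrite mulr1.
  exact: kd (segB_lt a01 hs ht).
have low s t : nc (s - s0) < r -> nc (t - s0) < r -> nc (k s0) / 2 * nc (t - s) <= nc (K t - K s).
  move=> hs ht; have := lin s t hs ht; have := lerB_normc (k s0 * (t - s)) (k s0 * (t - s) - (K t - K s)).
  rewrite subKr normcM [nc (_ - (K t - K s))]normc_distC => h1 h2.
  have : nc (k s0) * nc (t - s) = nc (k s0) / 2 * nc (t - s) + nc (k s0) / 2 * nc (t - s) by field.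
  move: h1 h2; set x := nc (K t - K s - _); set y := nc (K t - K s); set z := nc (k s0) / 2 * _. by set q := _ * _; lra.
have inj s t : nc (s - s0) < r -> nc (t - s0) < r -> K s = K t -> s = t.
  move=> hs ht E; have := low s t hs ht; rewrite E subrr normc0 pmulr_rle0 // => h.
  by apply/esym/eqP; rewrite -subr_eq0 -normc_eq0 eq_le h normc_ge0.
pose rho := nc (k s0) * (r / 4). have rho0 : 0 < rho by pos. have surj u : exists s, nc (u - K s0) < rho -> nc (s - s0) < r /\ K s = u.
  have [hu|] := ltrP (nc (u - K s0)) rho; last by exists 0. pose sn n := iter n (fun s => s - (K s - u) / k s0) s0.
  have st n : nc (sn n.+1 - sn n) <= (r / 2) / 2 ^+ n.+1 /\ nc (sn n - s0) <= r / 2 - r / 2 / 2 ^+ n.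
    elim: n => [|n [IH1 IH2]].
      rewrite /sn /= subrr normc0 expr0 divr1 subrr; split=> //.
      rewrite [_ - s0]addrC addrA addNr add0r normcN normcM normcV normc_distC ler_pdivrMr // expr1.
      by apply/ltW; apply: lt_le_trans hu _; rewrite /rho; apply: eq_ler; field.
    have p0 : 0 < (2 : R) ^+ n by pos. have p1 : 0 < (2 : R) ^+ n.+1 by pos. have hn1 : nc (sn n.+1 - s0) <= r / 2 - r / 2 / 2 ^+ n.+1.
      apply: le_trans (ler_normc_dist _ (sn n) _) _; apply: le_trans (lerD IH1 IH2) _.
      by apply: eq_ler; rewrite exprS; field; rewrite gt_eqF.
    split=> //. have lt n' : nc (sn n' - s0) <= r / 2 - r / 2 / 2 ^+ n' -> nc (sn n' - s0) < r.
      move=> /le_lt_trans; apply. have : 0 < r / 2 / 2 ^+ n' by pos. by set q := _ / _ / _ => ?; lra.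
    have := lin _ _ (lt _ IH2) (lt _ hn1). have E : K (sn n.+1) - K (sn n) - k s0 * (sn n.+1 - sn n) = K (sn n.+1) - u.
      by rewrite {2 3}/sn iterS -/(sn n); field.
    rewrite E => h. have E2 : sn n.+2 - sn n.+1 = - ((K (sn n.+1) - u) / k s0).
      by rewrite {1}/sn iterS -/(sn n.+1); ring.
    rewrite E2 normcN normcM normcV ler_pdivrMr //. apply: le_trans h _. apply: le_trans (ler_wpM2l (ltW e0) IH1) _.
    by apply: eq_ler; rewrite [in RHS]exprS; field; rewrite gt_eqF.
  have [l hl] := @normc_limit sn (r / 2) (fun n => (st n).1). have l4 : nc (l - s0) < r.
    have [n hn] := @half_pow_small R (4 * (r / 2)) (r / 2) ltac:(lra). apply: le_lt_trans (ler_normc_dist _ (sn n) _) _.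
    have := (st n).2; have := hl n; rewrite normc_distC. have : 0 < r / 2 / 2 ^+ n by pos.
    move: hn; set a := _ / _; set b := _ / _ / _; set c := nc _; set d := nc _ => *; lra.
  exists l => _; split=> //. apply/eqP; rewrite -subr_eq0 -normc_eq0 eq_le normc_ge0 andbT. apply/ler_addgt0Pr => e ep; rewrite add0r.
  have ee : 0 < e / 2 by pos. have [q q0 hq] := cd_cts (hK _ (inD _ l4)) ee.
  have [n hn] := @half_pow_small R (4 * (r / 2)) (minr q (e / 2 / nc (k s0))) ltac:(by rewrite lt_min q0 divr_gt0).
  move: (le_lt_trans (hl n) hn); rewrite lt_min => /andP[/hq h1 _]. have h2 : nc (k s0) * nc (sn n.+1 - sn n) < e / 2.
    rewrite mulrC -ltr_pdivlMr //; apply: le_lt_trans (st n).1 _. move: hn; rewrite lt_min => /andP[_]; apply: le_lt_trans.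
    have p0 : 0 < (2 ^+ n : R)^-1 by rewrite invr_gt0 exprn_gt0. by rewrite exprS invfM [r / 2 * _]mulrA ler_pM2r //; lra.
  have E2 : K (sn n) - u = - (k s0 * (sn n.+1 - sn n)) by rewrite {2}/sn iterS -/(sn n); field.
  have := ler_normcB (K (sn n) - u) (K (sn n) - K l). rewrite (_ : _ - _ = K l - u); last by ring.
  by rewrite E2 normcN normcM; move: h1 h2; set a := nc (_ - K l); set b := nc _ * _; set c := nc _ => *; lra.
have /choice[psi hpsi] := surj. have cK : cts K s0 := cd_cts (hK _ D0). have [r3 r30 hr3] := cK _ rho0.
exists (minr r r3), rho, psi; split=> //; first by rewrite lt_min r0. split=> [s|u hu].
  move=> /lt_minP[hs /hr3 hs3]; split=> //. by have [h1 h2] := hpsi _ hs3; apply: inj.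
have [h1 h2] := hpsi _ hu; split=> //; first exact: inD. have kn : 0 < nc (k (psi u)).
  have := kd _ h1; have := lerB_normc (k s0) (k s0 - k (psi u)). rewrite subKr [nc (k s0 - _)]normc_distC => a b.
  by move: a b n0; set x := nc _; set y := nc _; set z := nc _; lra.
have kn' : k (psi u) != 0 by rewrite -normc_gt0. apply/cdP => e ep.
have e1 : 0 < e * (nc (k (psi u)) * (nc (k s0) / 2)) by rewrite !mulr_gt0. have /cdP/(_ _ e1)[r4 r40 hr4] := hK _ (inD _ h1).
exists (minr (rho - nc (u - K s0)) (r4 * (nc (k s0) / 2))); first by rewrite lt_min subr_gt0 hu mulr_gt0. move=> v /lt_minP[hv1 hv2].
have hv : nc (v - K s0) < rho.
  by apply: le_lt_trans (ler_normc_dist _ u _) _; rewrite -ltrBrDr.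
have [g1 g2] := hpsi _ hv. have l1 := low _ _ h1 g1; rewrite g2 h2 in l1.
have : nc (psi v - psi u) < r4 by rewrite -(ltr_pM2r e0); apply: le_lt_trans hv2; rewrite mulrC. move=> /hr4; rewrite g2 h2 => hh.
rewrite (_ : psi v - psi u - _ = - ((v - u - k (psi u) * (psi v - psi u)) / k (psi u))); last by field.
rewrite normcN normcM normcV ler_pdivrMr //. apply: le_trans hh _.
have -> : e * nc (v - u) * nc (k (psi u)) = e * nc (k (psi u)) * nc (v - u) by ring.
apply: (@le_trans _ _ (e * nc (k (psi u)) * (nc (k s0) / 2 * nc (psi v - psi u)))); first by rewrite !mulrA.
by apply: ler_wpM2l => //; apply: mulr_ge0; exact: ltW.
Qed.
(** A curve tangent to Z with factor k becomes an integral curve when composed with the inverse of a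
    primitive of k. The inverse is only local, so the segment from s0 to s1 is cut into finitely
    many arcs by [cousin]. *)
Lemma leaf_curve m (Om : set 'rV[C]_m) (Z : 'rV[C]_m -> 'rV[C]_m) (G : C -> 'rV[C]_m) (k : C -> C) (D : C -> Prop) s0 s1 :
    op D -> cvx D -> D s0 -> D s1 ->
    (forall s, D s -> [/\ cdv G s (k s *: Z (G s)), k s != 0 & exists d, cd k s d]) ->
    (forall s, D s -> Om (G s) /\ Z (G s) != 0) ->
  leaf_through Om Z (G s0) (G s1).
move=> oD cD D0 D1 hG hO. have [K hK] : exists K, forall s, D s -> cd K s (k s).
  by apply: primitive => // s /hG[_ _].
have loc s : D s -> somepos r, forall a b, nc (a - s) < r -> nc (b - s) < r -> integral_arc Om Z (G a) (G b).
  move=> Ds; have [_ ks [d /cd_cts ck]] := hG _ Ds. have [r [rho [psi [r0 rho0 [h1 h2]]]]] := local_inverse oD Ds hK ck ks.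
  exists r => // a b /h1[ha1 ha2] /h1[hb1 hb2]. pose B : set C := fun u => nc (u - K s) < rho.
  exists B, (fun u => G (psi u)), (K a), (K b); split.
  - apply/open_op => u hu; exists (rho - nc (u - K s)); first by rewrite subr_gt0.
    by move=> w hw; apply: le_lt_trans (ler_normc_dist _ u _) _; rewrite -ltrBrDr.
  - by apply: cvx_connected => u v t hu hv t01; exact: segB_lt.
  - by split.
  - by rewrite ha2 hb2. move=> u /h2[Dp Kp cp]; have [cG kp _] := hG _ Dp; have [Op Zp] := hO _ Dp; split=> //.
  apply/is_derive_cdv => i; apply: (@cd_ext _ _ _ _ _ _ _ _ (cd_comp cp (cG i))) => //. by rewrite mxE mulrAC mulfV // mul1r.
have Ds u : in01 u -> D (seg s0 s1 u) by move=> ?; apply: cD.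
suff : leaf_through Om Z (G (seg s0 s1 0)) (G (seg s0 s1 1)) by rewrite seg0 seg1.
apply: (@cousin R (fun s t => leaf_through Om Z (G (seg s0 s1 s)) (G (seg s0 s1 t)))) => [s t u _ _ _ _|s s01].
  exact: rt_trans.
have [r r0 hr] := loc _ (Ds _ s01); have [d d0 hd] := seg_near s0 s1 s r0.
exists d => // u v u0 us sv v1 uv; apply: rt_step; apply: hr; apply: hd.
  by rewrite ler0_norm; lra.
by rewrite ger0_norm; lra.
Qed.
End LocalInverse.

(** * Orders of vanishing and iterated partial derivatives *)

Section Jets.
Context {R : realType}.
Local Notation C := R[i].
Lemma max_span (F : fieldType) (V : vectType F) (A : V -> Prop) : exists s : seq V,
  (forall v, v \in s -> A v) /\ forall v, A v -> v \in span s.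
pose P d := `[< exists s : seq V, (forall v, v \in s -> A v) /\ \dim (span s) = d >].
have P0 : exists d, P d by exists 0%N; apply/asboolP; exists [::]; rewrite span_nil dimv0; split.
have PN d : P d -> (d <= \dim {:V})%N by move=> /asboolP[s [_ <-]]; apply/dimvS/subvf.
have := ex_maxnP P0 PN; case=> d /asboolP[s [sA sd]] dmax. exists s; split=> // v Av.
have le : (span s <= span (v :: s))%VS by rewrite span_cons addvSr. have : P (\dim (span (v :: s))).
  apply/asboolP; exists (v :: s); split=> // u; rewrite inE => /orP[/eqP ->//|]; exact: sA.
move=> /dmax; rewrite -sd => hd. have /eqP -> : span s == span (v :: s) by rewrite eqEdim le. by apply: memv_span; rewrite inE eqxx.
Qed.
Variables (m N : nat).
Implicit Types F : 'rV[C]_m -> 'rV[C]_N.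
(** Holomorphic and bounded near 0, the form in which Cauchy's estimates can be iterated. *)
Definition hb F := exists (r B : R) (G : 'I_N -> 'rV[C]_m -> 'rV[C]_m), 0 < r /\
  forall c, grads (fun x => F x 0 c) (G c) 0 r /\ forall x, vn x < r -> nc (F x 0 c) <= B.
Lemma partialE i F (g : 'I_N -> 'rV[C]_m) x : (forall c, fd (fun y => F y 0 c) x (g c)) ->
  partial i F x = \row_c g c 0 i.
move=> h; have dF : differentiable F x by apply: fd_diff_mx => c; exists (g c). apply/rowP => c; rewrite mxE /partial deriveE //.
by have := fd_unique (diff_entry 0 c dF) (h c) => <-; rewrite mxE.
Qed.
Lemma partial_near i F r G : (forall c, grads (fun x => F x 0 c) (G c) 0 r) ->
  forall x, vn x < r -> partial i F x = \row_c G c x 0 i.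
by move=> h x hx; apply: partialE => c; apply: h; rewrite subr0. Qed.
 Lemma hb_partial i F : hb F -> hb (partial i F).
move=> [r [B [G [r0 h]]]]; have [A A0 HA] := @partial_holomorphic R.
have hB c x : vn (x - 0) < r -> nc (F x 0 c) <= B by rewrite subr0; apply: (h c).2.
have /choice[G' hG'] : forall c, exists G', grads (fun x => G c x 0 i) G' 0 (r / 4) /\
    forall x, vn (x - 0) < r / 4 -> nc (G c x 0 i) <= A * B / r.
  by move=> c; have [G' h1 h2] := HA _ _ _ _ _ _ r0 (h c).1 (hB c) i; exists G'.
have r4 : 0 < r / 4 by pos. have r4r : r / 4 < r by lra. have E x c : vn x < r / 4 -> partial i F x 0 c = G c x 0 i.
  by move=> hx; rewrite (partial_near i (fun c => (h c).1)) ?mxE // (lt_trans hx).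
exists (r / 4), (A * B / r), G'; split=> // c; have [h1 h2] := hG' c; split; last first.
  by move=> x hx; rewrite E //; apply: h2; rewrite subr0.
move=> x; rewrite subr0 => hx e e0. have hx0 : vn (x - 0) < r / 4 by rewrite subr0. have [d d0 hd] := h1 x hx0 e e0.
exists (minr d (r / 4 - vn x)); first by rewrite lt_min d0 subr_gt0.
move=> y /lt_minP[hy1 hy2]; have hxy : vn (x + y) < r / 4 by apply: le_lt_trans (vnD _ _) _; rewrite addrC -ltrBrDr.
have := hd _ hy1; rewrite -(E _ c hx) -(E _ c hxy); exact.
Qed.
Lemma hbB F1 F2 : hb F1 -> hb F2 -> hb (fun x => F1 x - F2 x).
move=> [r [B [G [r0 h]]]] [r' [B' [G' [r0' h']]]]. exists (minr r r'), (B + B'), (fun c x => G c x - G' c x); split; first by pos.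
move=> c; split=> x; rewrite ?subr0 lt_min => /andP[hx hx'].
  have h1 := (h c).1 x; have h2 := (h' c).1 x; rewrite subr0 in h1 h2. have := fd_add (h1 hx) (fd_mul (fd_cst (-1) x) (h2 hx')).
  rewrite !scaler0 ?addr0 ?add0r => h3. rewrite -scaleN1r; apply: fd_ext h3 => y; by rewrite !mxE mulN1r.
rewrite !mxE; apply: le_trans (ler_normcB _ _) _. by apply: lerD; [apply: (h c).2|apply: (h' c).2].
Qed.
Variable l : 'cV[C]_N.
Definition bd F k := exists K r : R, [/\ 0 <= K, 0 < r &
  forall x, vn x < r -> nc ((F x *m l) 0 0) <= K * vn x ^+ k].
Lemma fd_lin (I : Type) (s : seq I) (a : I -> C) (f : I -> 'rV[C]_m -> C) g x : (forall c, fd (f c) x (g c)) ->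
  fd (fun y => \sum_(c <- s) a c * f c y) x (\sum_(c <- s) a c *: g c).
move=> h; elim: s => [|c s IH].
  by rewrite big_nil; apply: fd_ext (fd_cst 0 x) => y; rewrite big_nil.
rewrite big_cons; apply: fd_ext (_ : fd (fun y => a c * f c y + \sum_(c <- s) a c * f c y) _ _) => [y|].
  by rewrite big_cons.
apply: fd_add => //. by have := fd_mul (fd_cst (a c) x) (h c); rewrite scaler0 add0r.
Qed.
Lemma bd_partial i F k : hb F -> bd F k.+1 -> bd (partial i F) k.
move=> [r [B [G [r0 h]]]] [K [r' [K0 r0' hK]]]. pose f x := (F x *m l) 0 0; pose g x := \sum_c l c 0 *: G c x.
have fE x : f x = \sum_c F x 0 c * l c 0 by rewrite /f mxE. have gf : grads f g 0 r.
  move=> x hx; apply: fd_ext (fd_lin _ _ (fun c => (h c).1 x hx)) => y. by rewrite fE; apply: eq_bigr => c _; rewrite mulrC.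
have fB x : vn x < r -> nc (f x) <= \sum_c B * nc (l c 0).
  move=> hx; rewrite fE; apply: le_trans (ler_normc_sum _ _ _) _; apply: ler_sum => c _. by rewrite normcM ler_wpM2r //; apply: (h c).2.
have [D [d [D0 d0 hd]]] := vanish_partial r0 gf fB r0' K0 hK. exists D, (minr r d); split=> //; first by pos.
move=> x /lt_minP[hx hx']; apply: le_trans (hd i x hx'); apply: eq_ler; congr nc; rewrite mxE /g summxE; apply: eq_bigr => c _.
by rewrite (partial_near i (fun c => (h c).1)) // !mxE mulrC.
Qed.
Lemma bd_iter i F j k : hb F -> bd F (j + k) -> hb (iter j (partial i) F) /\ bd (iter j (partial i) F) k.
elim: j k => [|j IH] k hF bF; first by []. have [|h1 h2] := IH k.+1 hF; first by rewrite addnS.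
by split; [exact: hb_partial|exact: bd_partial].
Qed.
Lemma bd_mpartial (K : multinom m) F k : hb F -> bd F (mdeg K + k) -> bd (mpartial K F) k.
move=> hF; rewrite mdegE -big_enum /mpartial => bF. suff : hb (foldr (fun i h => iter (K i) (partial i) h) F (enum 'I_m)) /\
   bd (foldr (fun i h => iter (K i) (partial i) h) F (enum 'I_m)) k by case.
elim: (enum 'I_m) k bF => [|i s IH] k; first by rewrite big_nil. rewrite big_cons addnAC addnC => /IH[h1 h2]; exact: bd_iter.
Qed.
Lemma bd0 F k : bd F k.+1 -> F 0 *m l = 0.
move=> [K [r [K0 r0 h]]]. have := h 0; rewrite vn0 exprS mul0r mulr0 => /(_ r0) h0. apply/matrixP => i j; rewrite !ord1 [RHS]mxE; apply/eqP.
by rewrite -normc_eq0 eq_le h0 normc_ge0.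
Qed.
End Jets.

(** * Bounds for the forms and choice of the jet order *)

Section FormData.
Context {R : realType}.
Local Notation C := R[i].
Variables (n N : nat) (om : one_forms R n.+2 N).
Local Notation w := (Defs.form om).
Lemma dom_ball : somepos r, forall x, vn x < r -> dom om x.
have [r r0 h] := (open_vn (dom om)).1 (@dom_open _ _ _ om) 0 (@dom_0 _ _ _ om); exists r => // x hx. by apply: h; rewrite subr0.
Qed.
Definition Gw (i : 'I_n.+2) (c : 'I_N) (x : 'rV[C]_n.+2) : 'rV[C]_n.+2 := (\row_k 'd w x (delta_mx 0 k) i c).
Lemma Gw_fd i c x : dom om x -> fd (fun y => w y i c) x (Gw i c x).
by move=> dx; apply: diff_entry; apply: form_holomorphic. Qed.
 Lemma form_bound : exists r B : R, [/\ 0 < r, 0 <= B, forall x, vn x < r -> dom om x &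
  forall x, vn x < r -> forall i c, nc (w x i c) <= B].
have [r r0 hr] := dom_ball. have /choice[d hd] : forall ic : 'I_n.+2 * 'I_N, exists d : R, 0 < d /\ forall y, vn (y - 0) < d ->
    nc (w y ic.1 ic.2 - w 0 ic.1 ic.2) < 1.
  by move=> ic; have [d d0 h] := fd_cts (Gw_fd ic.1 ic.2 (@dom_0 _ _ _ om)) ltr01; exists d.
have [r' r'0 hr'] := pos_min (fun ic => (hd ic).1). have [K K0 hK] := pos_max (fun ic : 'I_n.+2 * 'I_N => nc (w 0 ic.1 ic.2)).
exists (minr r r'), (K + 1); split; first by pos.
- by apply: addr_ge0.
- by move=> x /lt_minP[/hr]. move=> x /lt_minP[_ hx] i c. have := (hd (i, c)).2 x; rewrite subr0 => /(_ (lt_le_trans hx (hr' _))) h.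
have := hK (i, c) => /= h2; have := lerB_normc (w x i c) (w 0 i c) => h3.
by move: h h2 h3 => /=; set a := nc (_ - _); set b := nc _; set e := nc _ => *; lra.
Qed.
Lemma form_lipschitz (r B : R) : 0 < r -> 0 <= B -> (forall x, vn x < r -> dom om x) ->
    (forall x, vn x < r -> forall i c, nc (w x i c) <= B) ->
  exists2 L : R, 0 <= L & forall x y, vn x < r / 2 -> vn y < r / 2 -> forall i c,
    nc (w x i c - w y i c) <= L * vn (x - y).
move=> r0 B0 hd hB; have [A A0 HA] := @lipschitz R n.+2. exists (A * B / r) => [|x y hx hy i c]; first by pos.
apply: (HA (fun x => w x i c) (Gw i c) 0 r B) => //; rewrite ?subr0 //.
  by move=> z; rewrite subr0 => hz; apply: Gw_fd; apply: hd.
by move=> z; rewrite subr0 => hz; apply: hB.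
Qed.
Lemma hb_row i : hb (fun y => row i (w y)).
have [r [B [r0 B0 hd hB]]] := form_bound.
exists r, B, (Gw i); split=> // c; split=> x; rewrite ?subr0 => hx; last by rewrite mxE; apply: hB.
by apply: fd_ext (Gw_fd i c (hd _ hx)) => y; rewrite mxE.
Qed.
Lemma hb_dform i j : hb (dform om i j).
by apply: hbB; apply: hb_partial; apply: hb_row. Qed.
 Lemma dformE i j x c : dom om x -> dform om i j x 0 c = Gw j c x 0 i - Gw i c x 0 j.
move=> dx; rewrite /dform (partialE i (g := fun c => Gw j c x)) ?(partialE j (g := fun c => Gw i c x)).
- by rewrite !mxE.
- by move=> c'; apply: fd_ext (Gw_fd i c' dx) => y; rewrite mxE. by move=> c'; apply: fd_ext (Gw_fd j c' dx) => y; rewrite mxE.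
Qed.
(** Each partial derivative lowers the order of vanishing by one; fewer than D - 1 of them leave a
    function that is still 0 at the origin. *)
Lemma dcoef_jet (l : 'cV[C]_N) (D : nat) : (exists K r : R, 0 < r /\ forall x, vn x < r -> forall i j,
    nc (\sum_c (Gw i c x 0 j - Gw j c x 0 i) * l c 0) <= K * vn x ^+ D.-1) ->
  forall K i j, (mdeg K < D.-1)%N -> dcoef om K i j *m l = 0.
move=> [K0 [r [r0 h]]] K i j hK; rewrite /dcoef -scalemxAl. have [r' r0' hr'] := dom_ball.
suff -> : mpartial K (dform om i j) 0 *m l = 0 by rewrite scaler0. apply: (@bd0 _ _ _ _ _ (D.-1 - mdeg K).-1).
apply: bd_mpartial; first exact: hb_dform.
have -> : (mdeg K + (D.-1 - mdeg K).-1.+1)%N = D.-1 by rewrite prednK ?subn_gt0 // subnKC // ltnW.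
exists `|K0|, (minr r r'); split; rewrite ?lt_min ?r0 ?normr_ge0 //. move=> x /lt_minP[hx /hr' dx].
apply: le_trans (_ : K0 * vn x ^+ D.-1 <= _); last first.
  by rewrite ler_wpM2r ?exprn_ge0 // ler_norm.
apply: le_trans (h _ hx j i); apply: eq_ler; congr normc. by rewrite mxE; apply: eq_bigr => c _; rewrite dformE.
Qed.
(** Finitely many $c_K^{ij}$ span $W$, and D is chosen beyond all their orders: vanishing of
    $d(\omega\cdot l)$ to order D - 1 then forces l to kill each of them. *)
Lemma jet_order : exists2 D : nat, (0 < D)%N & forall (l : 'cV[C]_N), (exists K r : R, 0 < r /\
    forall x, vn x < r -> forall i j,
    nc (\sum_c (Gw i c x 0 j - Gw j c x 0 i) * l c 0) <= K * vn x ^+ D.-1) ->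
  forall h : first_integral om, forall v, v \in WD h -> v *m l = 0.
have [s [sA hs]] := max_span (dcoefs om : _ -> Prop).
have [d hd] : exists d, forall v, v \in s -> exists K (i j : 'I_n.+2), [/\ (i < j)%N, v = dcoef om K i j & (mdeg K < d)%N].
  elim: s sA {hs} => [|v s IH] sA; first by exists 0%N. have [|d hd] := IH; first by move=> u us; apply: sA; rewrite inE us orbT.
  have [|K [i [j [ij vE]]]] := sA v; first by rewrite inE eqxx.
  exists (maxn d (mdeg K).+1) => u; rewrite inE => /orP[/eqP ->|/hd[K' [i' [j' [h1 h2 h3]]]]].
    by exists K, i, j; split=> //; rewrite leq_max leqnn orbT.
  by exists K', i', j'; split=> //; rewrite leq_max h3.
exists d.+1 => // l /dcoef_jet hl h v vW. have : v \in span s by move: v vW; apply/subvP; apply: (WD_span h).2.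
move: v {vW}; suff : (span s <= lker (linfun (mulmxr l)))%VS.
  by move=> /subvP hk v /hk; rewrite memv_ker lfunE /= => /eqP.
apply/span_subvP => v /hd[K [i [j [ij -> hK]]]]; rewrite memv_ker lfunE /=. by apply/eqP; apply: hl.
Qed.
End FormData.

(** * The first integral as a matrix and a function; the local statement *)

Section FirstIntegral.
Context {R : realType}.
Local Notation C := R[i].
Variables (n N : nat) (om : one_forms R n.+2 N).
Local Notation w := (Defs.form om).
Definition HDmx (h : first_integral om) : 'M[C]_(N, N - \dim (WD h)) := lin1_mx (HD_T h).
Lemma HDmxE h z : z *m HDmx h = HD_T h z.
by rewrite mul_rV_lin1. Qed.
 Lemma HDE h x z : HD h (row_mx x z) = z *m HDmx h - HD_g h x.
by rewrite /HD row_mxKl row_mxKr HDmxE. Qed.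
 Lemma HDmx_ker h z : (z *m HDmx h = 0) <-> z \in WD h.
have -> : (z \in WD h) = (HD_T h z == 0) by rewrite -memv_ker HD_T_kernel. by rewrite HDmxE; split=> /eqP.
Qed.
Lemma WD_unique (h h' : first_integral om) : WD h = WD h'.
have [a b] := WD_span h; have [c d] := WD_span h'. by apply/eqP; rewrite eqEsubv b // d.
Qed.
Lemma HD_V_ball (h : first_integral om) : somepos r, forall x, vn x < r -> HD_V h x.
have [r0 rE] := pos_complex (HD_radius_gt0 h); exists (Re (HD_radius h)) => // x hx. rewrite /HD_V /euclidean_ball /= rE.
apply: (@le_lt_trans _ _ ((vn x) ^+ 2)%:C); last first.
  by rewrite -rmorphXn /= ltcR ltrXn2r // // ltW.
rewrite (_ : \sum_(i < n.+2) _ = (\sum_i nc (x 0 i) ^+ 2)%:C); last first.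
  by rewrite rmorph_sum /=; apply: eq_bigr => i _; rewrite normcE rmorphXn.
rewrite lecR expr2 [X in _ <= X * _]/vn mulr_suml; apply: ler_sum => i _. by rewrite expr2 ler_wpM2l // vn_coord.
Qed.
Lemma HD_g_fd (h : first_integral om) x : HD_V h x -> forall c,
  fd (fun y => HD_g h y 0 c) x (\row_i ((w x *m HDmx h) i c)).
move=> hx c; have dg := HD_g_holomorphic hx. have := diff_entry 0 c dg; congr (fd _ _ _); apply/rowP => i; rewrite !mxE.
rewrite HD_g_diff // -HDmxE -rowE -row_mul !mxE. by apply: eq_bigr.
Qed.
(** D and the threshold q0 are chosen before the first integral and the radius, since the field may
    not depend on these. This is possible because T enters the spanning of periods only through its
    kernel $W$, common to all first integrals. *)
Lemma local_density : exists D q0 : nat, (0 < D)%N /\ forall q, (q0 <= q)%N ->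
  forall (h : first_integral om) (R0 : R), 0 < R0 -> exists r1 Bw Lw rho : R,
  [/\ [/\ 0 < r1, r1 <= R0, 0 <= Bw & 0 <= Lw],
   [/\ forall x, vn x < r1 -> forall i c, exists g, fd (fun y => w y i c) x g,
       forall x, vn x < r1 -> forall i c, nc (w x i c) <= Bw &
       forall x y, vn x < r1 -> vn y < r1 -> forall i c, nc (w x i c - w y i c) <= Lw * vn (x - y)],
   (forall x, vn x < r1 -> HD_V h x),
   (forall a b, reach (@tb R n (D * D.+1).+1 D) (ex q.+1%:R^-1) w (Om r1) a b ->
      HD h (row_mx (pt a.1.1 a.1.2) a.2) = HD h (row_mx (pt b.1.1 b.1.2) b.2)) &
   0 < rho /\ forall a0 a1 z0 z1, nz a0 -> nz a1 -> vn a0 < rho -> vn a1 < rho -> vn z0 < rho -> vn z1 < rho ->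
    HD h (row_mx (pt 'i a0) z0) = HD h (row_mx (pt 'i a1) z1) ->
    Q (@rch R n (D * D.+1).+1 D q.+1%:R^-1 N w r1) a0 z0 a1 z1].
have [D D0 hD] := jet_order om. have [r0 [Bw [r00 Bw0 hd hB]]] := form_bound om. have [Lw Lw0 hL] := form_lipschitz r00 Bw0 hd hB.
have r02 : 0 < r0 / 2 by pos. have hG i c : grads (fun y => w y i c) (Gw om i c) 0 r0.
  by move=> x; rewrite subr0 => hx; apply: Gw_fd; apply: hd.
have r2r : r0 / 2 <= r0 by lra. have [pw [KT [rT [pwD KT0 rT0 pwE]]]] := jets D r02 r2r hG hB. have LD : (D * D.+1 < (D * D.+1).+1)%N by [].
have chart (h : first_integral om) (R0 : R) : 0 < R0 -> exists r1 : R, [/\ 0 < r1, r1 <= R0, r1 <= r0 / 2 & forall x, vn x < r1 -> HD_V h x].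
  move=> R00; have [s s0 hs] := HD_V_ball h. exists (minr R0 (minr (r0 / 2) s)); split.
  - by rewrite !lt_min R00 r02.
  - by rewrite ge_min lexx.
  - by rewrite !ge_min lexx orbT. by move=> x; rewrite !lt_min => /andP[_ /andP[_ /hs]].
have [q0 hq] : exists q0 : nat, forall q, (q0 <= q)%N -> forall (h : first_integral om) v, v \in WD h ->
    spanned D D (D * D.+1).+1 pw (q.+1%:R^-1 : R) v.
  (* Any first integral may be used to find q0, by uniqueness of [WD]; if there is none, every q0
     will do. *)
  have [[h]|no] := pselect (exists h : first_integral om, True); last first.
    by exists 0%N => q _ h; exfalso; apply: no; exists h.
  move=> _. have [r1 [r10 _ r12 hV]] := chart h 1 ltr01. have r1r0 : r1 <= r0 by apply: le_trans r2r.
  have wL x y : vn x < r1 -> vn y < r1 -> forall i c, nc (w x i c - w y i c) <= Lw * vn (x - y).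
    by move=> hx hy; apply: hL; apply: lt_le_trans r12.
  have hg x : vn x < r1 -> forall c, fd (fun y => HD_g h y 0 c) x (\row_i ((w x *m HDmx h) i c)).
    by move=> /hV; apply: HD_g_fd.
  have ck (l : 'cV[C]_N) : (exists K r : R, 0 < r /\ forall x, vn x < r -> forall i j,
    nc (\sum_c (Gw om i c x 0 j - Gw om j c x 0 i) * l c 0) <= K * vn x ^+ D.-1) -> forall v : 'rV[C]_N, v *m HDmx h = 0 -> v *m l = 0.
    by move=> /hD hl v /HDmx_ker; apply: hl.
  have [e0 e00 he] := spanned_small D0 (leqnn D) LD r10 Bw0 Lw0 r1r0 hG hB wL hg ck pwD KT0 rT0 pwE. have [q0 hq0] := nat_approx e00.
  exists q0 => q q0q h' v; rewrite (WD_unique h' h) => /HDmx_ker; apply: he. rewrite invr_gt0 ltr0Sn /= -div1r ltr_pdivrMr ?ltr0Sn //.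
  apply: lt_le_trans hq0.2 _; rewrite -[X in _ + X]mul1r -mulrDl natr1 mulrC ler_pM2l //. by rewrite ler_nat.
exists D, q0; split=> // q q0q h R0 R00. have [r1 [r10 r1R r12 hV]] := chart h R0 R00. have r1r0 : r1 <= r0 by apply: le_trans r2r.
have wL x y : vn x < r1 -> vn y < r1 -> forall i c, nc (w x i c - w y i c) <= Lw * vn (x - y).
  by move=> hx hy; apply: hL; apply: lt_le_trans r12.
have hg x : vn x < r1 -> forall c, fd (fun y => HD_g h y 0 c) x (\row_i ((w x *m HDmx h) i c)).
  by move=> /hV; apply: HD_g_fd.
have ep : 0 < q.+1%:R^-1 :> R by pos. have [rho rho0 hrho] := fibre_density r10 Bw0 Lw0 r1r0 hG hB wL hg pwD KT0 rT0 pwE ep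
  (fun v hv => hq q q0q h v ((HDmx_ker h v).1 hv)).
exists r1, Bw, Lw, rho; split=> //.
- split=> // x hx; first by move=> i c; apply: (wfd r1r0 hG hx). by apply: hB; apply: lt_le_trans r1r0.
- move=> a b /(reach_HD hg); rewrite !HDE; exact. by split=> // a0 a1 z0 z1; rewrite !HDE; apply: hrho.
Qed.
End FirstIntegral.

(** * Moving a state to a nearby value of t *)

Section Slide.
Context {R : realType}.
Local Notation C := R[i].
Lemma ball_op (z : C) (r : R) : op (fun u => nc (u - z) < r).
move=> u hu; exists (r - nc (u - z)); first by rewrite subr_gt0.
by move=> v hv; apply: le_lt_trans (ler_normc_dist _ u _) _; rewrite -ltrBrDr.
Qed.
Lemma ball_cvx (z : C) (r : R) : cvx (fun u => nc (u - z) < r).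
by move=> u v s hu hv s01; exact: segB_lt. Qed.
 Lemma cts_max (I : finType) (f : I -> C -> C) z : (forall i, cts (f i) z) -> exists K d : R, [/\ 0 <= K, 0 < d &
  forall u, nc (u - z) < d -> forall i, nc (f i u) <= K].
move=> h. have /choice[d hd] : forall i, exists d : R, 0 < d /\ forall u, nc (u - z) < d -> nc (f i u - f i z) < 1.
  by move=> i; have [d d0 hd] := h i 1 ltr01; exists d.
have [r r0 hr] := pos_min (fun i => (hd i).1). have [K K0 hK] := pos_max (fun i => nc (f i z)).
exists (K + 1), r; split=> //; first exact: addr_ge0. move=> u hu i; have /(hd i).2 h1 : nc (u - z) < d i by apply: lt_le_trans (hr i).
have h2 := hK i; have := lerB_normc (f i u) (f i z). by move: h1 h2; set a := nc _; set b := nc _; set c := nc _ => *; lra.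
Qed.
Variables (n N : nat) (B : finType) (tb : B -> C) (ex : B -> 'I_n.+1 -> C).
Variables (w : 'rV[C]_n.+2 -> 'M[C]_(n.+2, N)) (r1 Bw Lw : R).
Hypotheses (r10 : 0 < r1) (Bw0 : 0 <= Bw) (Lw0 : 0 <= Lw).
Hypothesis wfd : forall x, vn x < r1 -> forall i c, exists g, fd (fun y => w y i c) x g.
Hypothesis wB : forall x, vn x < r1 -> forall i c, nc (w x i c) <= Bw.
Hypothesis wL : forall x y, vn x < r1 -> vn y < r1 -> forall i c,
  nc (w x i c - w y i c) <= Lw * vn (x - y).
Lemma vn_const1 : vn (const_mx 1 : 'rV[C]_n.+1) = n.+1%:R.
by rewrite /vn (eq_bigr (fun=> 1)) ?sumr_const ?card_ord // => i _; rewrite mxE normc1. Qed.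
 Lemma actB mu nu (eta : 'rV[C]_n.+1) : act mu eta - act nu eta = act (mu - nu) eta.
by apply/rowP => j; rewrite !mxE mulrBl. Qed.
 Lemma actBr mu (eta eta' : 'rV[C]_n.+1) : act mu eta - act mu eta' = act mu (eta - eta').
by apply/rowP => j; rewrite !mxE mulrBr. Qed.
 (** Transport keeps t fixed; a short straight path supplies the missing direction. All bounds are
     taken at the fixed end t, to which the multipliers from t' are referred by the cocycle
     relation. *)
 Lemma slide t eta z : (forall b, t != tb b) -> nz eta -> vn (pt t eta) < r1 -> vn z < r1 ->
  forall e : R, 0 < e -> somepos d, forall t' eta' z', nz eta' -> nc (t' - t) < d -> vn (eta' - eta) < d -> vn (z' - z) < d ->
  exists eta'' z'', [/\ step tb ex w (Om r1) (t', eta', z') (t, eta'', z''), vn (eta'' - eta) < e & vn (z'' - z) < e].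
move=> ht neta hx hz e e0. have h0 b : 0 < nc (t - tb b) by rewrite normc_gt0 subr_eq0. have [d0 d00 hd0] := pos_min h0.
have [lam Pok] : exists lam, piece_ok tb (Piece (fun s : C => s) (fun=> 1) lam (fun u => nc (u - t) < d0)).
  apply: mk_piece; [exact: ball_op|exact: ball_cvx|] => s hs; split.
  - exact: cd_id.
  - by exists 0; exact: cd_cst.
  - exact: oner_neq0.
  - move=> b; apply: contraTneq hs => ->; rewrite -leNgt normc_distC; exact: hd0.
set P := Piece _ _ _ _ in Pok. have Pt : dm P t by rewrite /P /= subrr normc0.
have [K1 [d1 [K10 d10 hK1]]] := cts_max (fun i => cd_cts (cd_cA ex Pok t i Pt)).
have cA't i : cts (cA' tb ex P t i) t by have [d' /cd_cts] := hol_cA' ex Pok t i Pt. have [K2 [d2 [K20 d20 hK2]]] := cts_max cA't.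
pose K := K1 + K2; have K0 : 0 <= K by pos. pose g := r1 - vn (pt t eta); have g0 : 0 < g by rewrite subr_gt0. have g4 : 0 < g / 4 by pos.
have [d3 d30 hd3] := vn_cts (fun i => cts_xl ex Pok t eta i Pt) g4.
pose gz := minr e (r1 - vn z); have gz0 : 0 < gz by rewrite lt_min e0 subr_gt0. have gze : gz <= e by rewrite ge_min lexx.
have gzr : gz <= r1 - vn z by rewrite ge_min lexx orbT. pose e2 := minr e (minr 1 (g / (4 * (n.+2%:R * (K + 1))))).
have K1p : 0 < K + 1 by pos. have nK : 0 < 4 * (n.+2%:R * (K + 1)) by pos. have e20 : 0 < e2 by pos.
have e2e : e2 <= e by rewrite ge_min lexx. have e21 : e2 <= 1 by rewrite !ge_min lexx orbT.
have e2g : e2 <= g / (4 * (n.+2%:R * (K + 1))) by rewrite !ge_min lexx !orbT. have v1 : 0 < vn eta + 1 by pos.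
pose e1 := minr 1 (e2 / (2 * (vn eta + 1))). have e10 : 0 < e1 by pos. have e11 : e1 <= 1 by rewrite ge_min lexx.
have e12 : e1 * (vn eta + 1) <= e2 / 2.
  apply: (@le_trans _ _ (e2 / (2 * (vn eta + 1)) * (vn eta + 1))).
    by rewrite ler_wpM2r ?(ltW v1) // ge_min lexx orbT.
  by apply: eq_ler; field; rewrite gt_eqF.
have cnu j : cts (fun u => nuv ex P u t 0 j) t.
  apply: (@cts_ext _ (fun u => (nu ex P t j u)^-1)) => [u|].
    rewrite mxE; apply: (mulIf (nu_neq0 ex P t j u)); rewrite mulVf ?nu_neq0 //. by rewrite nu_cocycle nu_refl.
  by apply: ctsV; [exact: nu_neq0|exact: cd_cts (cd_nu ex Pok t j Pt)].
have [d4 d40 hd4] := vn_cts cnu e10. have nutt : nuv ex P t t = const_mx 1 by apply/rowP => j; rewrite !mxE nu_refl.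
pose Kz := n.+2%:R * (K * (vn eta + 1) * Bw). have Kz0 : 0 <= Kz by pos. have Kz1 : 0 < Kz + 1 by pos.
have NK : 0 < N.+1%:R * (Kz + 1) by pos. pose d := minr (minr (minr d0 d1) (minr d2 d3)) (minr (minr d4 (e2 / (2 * n.+3%:R)))
   (gz / (8 * (N.+1%:R * (Kz + 1))))).
have dd : 0 < d by pos. have [l0 l1 l2 l3] : [/\ d <= d0, d <= d1, d <= d2 & d <= d3].
  by split; rewrite /d !ge_min lexx ?orbT.
have [l4 l5 l6] : [/\ d <= d4, d <= e2 / (2 * n.+3%:R) & d <= gz / (8 * (N.+1%:R * (Kz + 1)))].
  by split; rewrite /d !ge_min lexx ?orbT.
clearbody d gz e2 e1. exists d => // t' eta' z' neta' ht' heta' hz'. pose mu := nuv ex P t' t; pose eta2 := act mu eta'.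
have hmu : vn (mu - const_mx 1) < e1.
  by rewrite -nutt; apply: hd4; apply: lt_le_trans l4.
have heta2 : vn (eta2 - eta) < e2.
  rewrite (_ : eta2 - eta = act mu (eta' - eta) + act (mu - const_mx 1) eta); last first.
    by rewrite -actBr -actB act1 addrA subrK.
  apply: le_lt_trans (vnD _ _) _. have m1 : vn mu <= n.+2%:R.
    rewrite -[mu](subrK (const_mx 1)); apply: le_trans (vnD _ _) _.
    by rewrite vn_const1 -natr1 addrC -[n.+2%:R]natr1 -natr1 lerD2l; apply: ltW; apply: lt_le_trans e11.
  have a1 : vn (act mu (eta' - eta)) < e2 / 2.
    apply: le_lt_trans (act_le _ _) _. apply: (@le_lt_trans _ _ (n.+2%:R * d)).
      by apply: ler_pM; rewrite // ltW.
    have : n.+3%:R * d <= e2 / 2.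
      apply: (@le_trans _ _ (n.+3%:R * (e2 / (2 * n.+3%:R)))); first by rewrite ler_pM2l ?ltr0Sn.
      by apply: eq_ler; field; rewrite -!natr1; have : 0 <= n%:R :> R by []; lra.
    by apply: lt_le_trans; rewrite ltr_pM2r // ltr_nat.
  have a2 : vn (act (mu - const_mx 1) eta) <= e2 / 2.
    apply: le_trans (act_le _ _) _; apply: le_trans e12. by apply: ler_pM; rewrite ?(ltW hmu) // lerDl.
  by rewrite [e2]splitr; exact: ltr_leD.
have veta2 : vn eta2 <= vn eta + 1.
  rewrite -[eta2](subrK eta) [leRHS]addrC; apply: le_trans (vnD _ _) _; apply: lerD => //. by apply: ltW; apply: lt_le_trans e21.
have xlb u : nc (u - t) < d -> vn (xl ex P t eta2 u) < r1.
  move=> hu. have b1 : vn (xl ex P t eta u - xl ex P t eta t) < g / 4 by apply: hd3; apply: lt_le_trans l3.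
  have kb i : nc (cA ex P t i u) <= K.
    by apply: le_trans (hK1 u (lt_le_trans hu l1) i) _; rewrite lerDl.
  have b2 := xl_le eta2 eta kb. have b3 : n.+2%:R * (K * vn (eta2 - eta)) <= g / 4.
    apply: (@le_trans _ _ (n.+2%:R * ((K + 1) * (g / (4 * (n.+2%:R * (K + 1))))))).
      rewrite ler_pM2l ?ltr0Sn //; apply: ler_pM; rewrite ?lerDl //. by apply: ltW; apply: lt_le_trans e2g.
    apply: eq_ler; field; apply/andP; split; first by rewrite gt_eqF. by rewrite -!natr1; have : 0 <= n%:R :> R by []; lra.
  have b4 : xl ex P t eta t = pt t eta by rewrite xl0. rewrite b4 in b1.
  rewrite (_ : xl ex P t eta2 u = (xl ex P t eta2 u - xl ex P t eta u) + (xl ex P t eta u - pt t eta) + pt t eta); last by rewrite addrA !subrK.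
  apply: le_lt_trans (vnD _ _) _; rewrite -ltrBrDr -/g. apply: le_lt_trans (vnD _ _) _.
  move: (le_trans b2 b3) b1 g0; set q1 := vn _; set q2 := vn _ => *; lra.
have shift u : xl ex P t' eta' u = xl ex P t eta2 u by rewrite xl_shift.
have inb u : nc (u - t) < d -> dm P u by move=> hu; apply: lt_le_trans l0. have ht0 : nc (t - t) < d by rewrite subrr normc0.
have incb v : nc (v - t) < d -> vn (inc tb ex w P t' eta' v) <= gz / 4.
  move=> hv. apply: (@le_trans _ _ (N%:R * (Kz * (2 * d)))); last first.
    apply: (@le_trans _ _ (N.+1%:R * ((Kz + 1) * (2 * (gz / (8 * (N.+1%:R * (Kz + 1)))))))).
      apply: ler_pM => //; first by apply: mulr_ge0 => //; apply: mulr_ge0 => //; exact: ltW.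
        by rewrite ler_nat.
      by apply: ler_pM; rewrite ?lerDl ?ler_pM2l // mulr_ge0 // ltW.
    apply: eq_ler; field; apply/andP; split; first by rewrite gt_eqF // ltr_wpDl. by rewrite addrC natr1 pnatr_eq0.
  apply: vn_le => c; rewrite mxE. have hb a : in01 a -> nc (seg t' v a - t) < d by move=> a01; exact: segB_lt.
  have ct : ctseg (fun u => zd tb ex w P t' eta' u 0 c) t' v.
    apply: (ctseg_zd wfd Pok); [exact: inb|exact: inb|] => a a01. by rewrite shift; apply: xlb; exact: hb.
  apply: le_trans (cint_le (K := Kz) ct _) _.
    move=> a a01; have hs := hb a a01; set u := seg t' v a in hs *. rewrite /zd mxE; apply: le_trans (ler_normc_sum _ _ _) _.
    rewrite /Kz -[n.+2 in leRHS]card_ord mulr_natl -sumr_const; apply: ler_sum => i _.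
    rewrite normcM; apply: ler_pM; rewrite //; last first.
      by apply: wB; rewrite shift; exact: xlb.
    rewrite -(xd_shift tb ex P t' t) -/mu -/eta2 mxE normcM; apply: ler_pM => //.
      by apply: le_trans (hK2 u (lt_le_trans hs l2) i) _; rewrite lerDr.
    by apply: le_trans veta2; exact: vn_coord.
  rewrite ler_wpM2l // [2 * d](_ : _ = d + d); last by ring. apply: le_trans (ler_normc_dist _ t _) _; apply: lerD; first exact: ltW.
  by rewrite normc_distC ltW.
have dgz : d <= gz / 8.
  have X1 : 1 <= N.+1%:R * (Kz + 1) by rewrite -[leLHS]mulr1; apply: ler_pM => //; rewrite ?ler1n // lerDr.
  apply: le_trans l6 _; rewrite ler_pdivrMr ?mulr_gt0 // //.
  have -> : gz / 8 * (8 * (N.+1%:R * (Kz + 1))) = gz * (N.+1%:R * (Kz + 1)) by field. by rewrite -[leLHS]mulr1 ler_pM2l.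
exists eta2, (z' + inc tb ex w P t' eta' t); split.
- have := @step_seg R n N B tb ex w r1 wfd P Pok t' t eta' z'. apply; [exact: inb|exact: inb|exact: neta'| |].
  + by move=> a a01; rewrite shift; apply: xlb; exact: segB_lt. move=> a a01; have hs : nc (seg t' t a - t) < d by exact: segB_lt.
  have := incb _ hs; set q := inc _ _ _ _ _ _ _ => hq. rewrite (_ : z' + q = (z' - z) + z + q); last by rewrite subrK.
  apply: le_lt_trans (vnD _ _) _; apply: le_lt_trans (lerD (vnD _ _) (lexx _)) _.
  move: hq hz' dgz gzr gz0; set q1 := vn _; set q2 := vn _; set q3 := vn _ => *; lra.
- exact: lt_le_trans e2e. have hq := incb _ ht0. rewrite addrAC; apply: le_lt_trans (vnD _ _) _.
move: hq hz' dgz gze gz0; set q1 := vn _; set q2 := vn _ => *; lra.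
Qed.
End Slide.

Section Cylinder.
Context {R : realType}.
Local Notation C := R[i].
Variables n N : nat.
Lemma cyl_fd q (F : 'rV[C]_n.+2 -> C) g : fd F (lsubmx q) g -> fd (fun q' : 'rV[C]_(n.+2 + N) => F (lsubmx q')) q (row_mx g 0).
move=> hF e e0; have [r rp hr] := hF e e0; exists r => // y hy. have hl : vn (lsubmx y) <= vn y.
  by rewrite /vn big_split_ord /=; rewrite (eq_bigr (fun i => nc (y 0 (lshift N i)))) ?lerDl ?sumr_ge0 // => i _; rewrite // mxE.
rewrite raddfD /= (_ : dot (row_mx g 0) y = dot g (lsubmx y)).
  by apply: le_trans (hr _ (le_lt_trans hl hy)) _; rewrite ler_wpM2l // ltW.
rewrite /dot big_split_ord /= [X in _ + X]big1 ?addr0 => [|i _]; last by rewrite row_mxEr mxE mul0r.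
by apply: eq_bigr => i _; rewrite row_mxEl mxE.
Qed.
End Cylinder.

(** * The open set with dense leaves *)

Section Leaves.
Context {R : realType}.
Local Notation C := R[i].
Variables (n N L p : nat) (eps : R) (om : one_forms R n.+2 N) (h : first_integral om).
Local Notation w := (Defs.form om).
Local Notation tb := (@tb R n L p).
Local Notation ex := (@ex R n L p eps).
Local Notation FF := (FF tb ex).
Definition st (a : state (R := R) n N) : 'rV[C]_(n.+2 + N) := row_mx (pt a.1.1 a.1.2) a.2.
Definition Zf (q : 'rV[C]_(n.+2 + N)) := row_mx (FF (lsubmx q)) (FF (lsubmx q) *m w (lsubmx q)).
Definition off (t : C) := forall b, t != tb b.
Lemma tb_real b : Im (tb b) = 0.
by rewrite /Submission.tb /tbn -(rmorph_nat (real_complex R)). Qed.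
 Lemma off_nonreal t : Im t != 0 -> off t.
by move=> h0 b; apply: contraNneq h0 => ->; rewrite tb_real. Qed.
 Lemma FF_neq0 t eta : nz eta -> off t -> FF (pt t eta) != 0.
move=> ne ot; apply/eqP => /rowP F0. have e0 : pt t eta 0 (i0 n) != 0 by rewrite mxE th_i0 mul1r. have q0 : qq tb ex ord0 (pt t eta) = 0.
  have := F0 (i0 n); rewrite /Submission.FF !mxE thd_i0 mul0r addr0 sg0 => /eqP.
  by rewrite mulf_eq0 => /orP[|/eqP //]; have := e0; rewrite mxE sg0 => /negPf ->.
have := F0 (i1 n); rewrite /Submission.FF mxE sg1 q0 mulr0 add0r /thd eqxx mul1r mxE => /eqP.
apply/negP/prodf_neq0 => b _; rewrite LL_pt mulf_neq0 //. by rewrite subr_eq0.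
Qed.
Variables (r1 rho : R).
Hypotheses (r10 : 0 < r1) (rho0 : 0 < rho).
Hypothesis wfd : forall x, vn x < r1 -> forall i c, exists g, fd (fun y => w y i c) x g.
Local Notation step := (step tb ex w (Om r1)).
Local Notation reach := (reach tb ex w (Om r1)).
(** States joined, within the region, to the small ball of the fibre over t = i. The condition is
    preserved by [reach], so chains inside it remain in one leaf of the restriction to [AA], the set
    that serves as $\Delta^*$. *)
Definition okS (a : state (R := R) n N) := [/\ nz a.1.2, Om r1 (pt a.1.1 a.1.2) a.2 &
  exists a', [/\ reach a a', a'.1.1 = 'i, vn a'.1.2 < rho & vn a'.2 < rho]].
Definition AA : set 'rV[C]_(n.+2 + N) := [set q | exists2 a, okS a & q = st a].
Lemma step_off a b : step a b -> off a.1.1 /\ off b.1.1.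
move=> [q [D [zc [s0 [s1 [qok [oD cD D0 D1 Dd] _ [-> -> _]]]]]]] /=.
by case: qok => _ _ hq; split=> b'; [have [_ _ _ /(_ b')[]] := hq _ (Dd _ D0)|have [_ _ _ /(_ b')[]] := hq _ (Dd _ D1)].
Qed.
Lemma reach_off a b : reach a b -> off b.1.1 -> off a.1.1.
by elim=> [x y /step_off[]|//|x y z _ IH1 _ IH2 /IH2/IH1]. Qed.
 Lemma reach_Om a b : reach a b -> Om r1 (pt a.1.1 a.1.2) a.2 -> Om r1 (pt b.1.1 b.1.2) b.2.
elim=> [x y hs _|//|x y z _ IH1 _ IH2 /IH1/IH2 //]. case: hs => q [D [zc [s0 [s1 [_ [_ _ _ D1 _] _ [_ -> hD]]]]]] /=.
by have [_] := hD _ D1; rewrite xlE.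
Qed.
Lemma okS_reach a b : okS a -> reach a b -> okS b.
move=> [ne ho [a' [ha h1 h2 h3]]] hr; split; [exact: reach_nz hr ne|exact: reach_Om hr ho|].
by exists a'; split=> //; apply: reach_trans ha; apply: reach_sym.
Qed.
Lemma okS_off a : okS a -> off a.1.1.
move=> [_ _ [a' [/reach_off hr h1 _ _]]]; apply: hr; apply: off_nonreal. by rewrite h1 /=; exact: oner_neq0.
Qed.
Lemma Zf_st a : nz a.1.2 -> off a.1.1 -> Zf (st a) != 0.
move=> ne oa; have := FF_neq0 ne oa; apply: contraNneq => /eqP. by rewrite /Zf /st row_mx_eq0 row_mxKl => /andP[].
Qed.
Lemma step_leaf a b : step a b -> okS a -> leaf_through AA Zf (st a) (st b).
move=> [q [D [zc [s0 [s1 [qok [oD cD D0 D1 Dd] ne [aE bE hD]]]]]]] oa. pose G s : 'rV[C]_(n.+2 + N) := row_mx (xl ex q s0 a.1.2 s) (zc s).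
have GE s : G s = st (tau q s, act (nuv ex q s0 s) a.1.2, zc s) by rewrite /G xlE.
have okG s : D s -> okS (tau q s, act (nuv ex q s0 s) a.1.2, zc s).
  move=> Ds; apply: okS_reach oa _; apply: rt_step. by exists q, D, zc, s0, s; split.
have -> : st a = G s0 by rewrite GE act_nuv_refl {1}aE. have -> : st b = G s1 by rewrite GE {1}bE. have Zn s : D s -> Zf (G s) != 0.
  by move=> /okG os; rewrite GE; apply: Zf_st; [case: os|exact: okS_off os].
apply: (@leaf_curve R _ AA Zf G (kap tb ex q s0 a.1.2) D) => // s Ds; last first.
  split; last exact: Zn. by rewrite GE; exists (tau q s, act (nuv ex q s0 s) a.1.2, zc s) => //; exact: okG.
split; [|exact: kap_neq0 (Dd _ Ds)|exact: hol_kap (Dd _ Ds)].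
have E : kap tb ex q s0 a.1.2 s *: Zf (G s) = row_mx (xd tb ex q s0 a.1.2 s) (zd tb ex w q s0 a.1.2 s).
  by rewrite /Zf /G row_mxKl scale_row_mx scalemxAl -xdE //; exact: Dd.
rewrite E => i; have [hz _] := hD s Ds. case: (split_ordP i) => j ->; rewrite /G ?row_mxEl ?row_mxEr.
  by apply: (@cd_ext _ (fun u => xl ex q s0 a.1.2 u 0 j)) (cdv_xl ex qok s0 a.1.2 (Dd _ Ds) j) => [u|//]; rewrite row_mxEl.
by apply: (@cd_ext _ (fun u => zc u 0 j)) (hz j) => [u|//]; rewrite row_mxEr.
Qed.
Lemma reach_leaf a b : reach a b -> okS a -> leaf_through AA Zf (st a) (st b).
elim=> [x y|x _|x y z h1 IH1 h2 IH2 ox]; [exact: step_leaf|exact: rt_refl|]. by apply: rt_trans (IH1 ox) (IH2 (okS_reach ox h1)).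
Qed.
Hypothesis hV : forall x, vn x < r1 -> HD_V h x.
Lemma AA_Om q : AA q -> vn (lsubmx q) < r1 /\ vn (rsubmx q) < r1.
by move=> [a [_ ho _] ->]; rewrite row_mxKl row_mxKr. Qed.
 Lemma HD_arc q q' : integral_arc AA Zf q q' -> HD h q' = HD h q.
move=> [D [phi [s [t [oD cD [Ds Dt] [<- <-] hphi]]]]]. apply/rowP => c.
refine (@connected_local R (fun u => HD h (phi u) 0 c = HD h (phi s) 0 c) D s t oD cD Ds Dt (erefl _) _) => u Du.
have [r r0 hr] := (open_op D).1 oD u Du. suff cst v : nc (v - u) < r -> HD h (phi v) 0 c = HD h (phi u) 0 c.
  by exists r => // v /cst ->.
move=> hv; apply/eqP; rewrite -subr_eq0 -normc_eq0 eq_le normc_ge0 andbT. rewrite -[leRHS](mul0r (nc (v - u))).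
apply: (@cd_mvt R (fun u => HD h (phi u) 0 c) (fun=> 0)) => a a01; last by rewrite normc0. have u0 : nc (u - u) < r by rewrite subrr normc0.
have Da := hr _ (segB_lt a01 u0 hv); set y := seg u v a in Da *. have [Ay _ /is_derive_cdv dy] := hphi _ Da. have [hx _] := AA_Om Ay.
have cx : cdv (fun u => lsubmx (phi u)) y (lsubmx (Zf (phi y))).
  by move=> i; rewrite mxE; apply: (@cd_ext _ (fun u => phi u 0 (lshift N i))) (dy _) => // v'; rewrite mxE.
have cz i : cd (fun u => rsubmx (phi u) 0 i) y (rsubmx (Zf (phi y)) 0 i).
  by rewrite mxE; apply: (@cd_ext _ (fun u => phi u 0 (rshift n.+2 i))) (dy _) => // v'; rewrite mxE.
have cg := fd_cd (HD_g_fd (hV hx) c) cx. have cT := cd_sum (index_enum _) (fun i => cdZ (HDmx h i c) (cz i)).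
apply: (@cd_ext _ _ _ _ _ _ _ _ (cdB cT cg)) => [v'|].
  rewrite -[in RHS](hsubmxK (phi v')) HDE !mxE; congr (_ - _). by apply: eq_bigr => i _; rewrite mulrC.
rewrite /Zf row_mxKl row_mxKr; set x := lsubmx (phi y). apply/eqP; rewrite subr_eq0; apply/eqP. transitivity ((FF x *m w x *m HDmx h) 0 c).
  by rewrite mxE; apply: eq_bigr => i _; rewrite mulrC.
rewrite -mulmxA mxE; apply: eq_bigr => i _; rewrite mulrC; congr (_ * _). by rewrite [RHS]mxE.
Qed.
Lemma leaf_AA q q' : AA q -> leaf_through AA Zf q q' -> AA q' /\ HD h q' = HD h q.
move=> Aq hl; elim: hl Aq => [x y hxy _|//|x y z _ IH1 _ IH2 /IH1[/IH2[Az -> <-]] //].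
  split; last exact: HD_arc hxy. by have [D [phi [s [t [_ _ [_ Dt] [_ <-] hphi]]]]] := hxy; have [] := hphi _ Dt.
Qed.
Lemma is_leaf_dense : (forall q q', AA q -> AA q' -> HD h q = HD h q' -> forall e : R, 0 < e ->
    exists2 q'', leaf_through AA Zf q q'' & vn (q'' - q') < e) ->
  forall S, is_leaf AA Zf S -> forall q, S q -> S `<=` level h AA q /\ level h AA q `<=` closure S.
move=> hd S [q0 [Aq0 _ ->]] q Sq; have [Aq Hq] := leaf_AA Aq0 Sq; split=> [x /(leaf_AA Aq0)[Ax Hx]|x [Ax Hx] B].
  by split=> //; rewrite Hx Hq.
move=> /nbhs_vn[r rp hB]; have [|y hy yx] := hd q0 x Aq0 Ax _ r rp; first by rewrite Hx Hq. by exists y; split=> //; apply: hB.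
Qed.
Lemma lift_sg (i : 'I_n.+2) : i != i1 n -> lift (i1 n) (sg i) = i.
move=> ii; apply/val_inj; rewrite /= inordK; last by case: i {ii} => -[|k]. move: ii; rewrite -val_eqE /=; by case: i => -[|[|k]] hi.
Qed.
Lemma pt_param (x : 'rV[C]_n.+2) : x 0 (i0 n) != 0 ->
  x = pt (x 0 (i1 n) / x 0 (i0 n)) (\row_j x 0 (lift (i1 n) j)).
move=> x0; apply/rowP => i; rewrite !mxE /th. have [->|ii] := eqVneq i (i1 n); last by rewrite mul1r lift_sg.
by rewrite sg1 -sg0 lift_sg // mulfVK.
Qed.
Lemma pt_eta t (eta : 'rV[C]_n.+1) : (\row_j pt t eta 0 (lift (i1 n) j)) = eta.
apply/rowP => j; rewrite !mxE /th eq_sym (negPf (neq_lift _ _)) mul1r; congr (eta 0 _).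
by apply/val_inj; rewrite /= inordK /bump; case: j => -[|k] /= hk //; rewrite ltnW.
Qed.
Variables (Bw Lw : R).
Hypotheses (Bw0 : 0 <= Bw) (Lw0 : 0 <= Lw).
Hypothesis wB : forall x, vn x < r1 -> forall i c, nc (w x i c) <= Bw.
Hypothesis wL : forall x y, vn x < r1 -> vn y < r1 -> forall i c,
  nc (w x i c - w y i c) <= Lw * vn (x - y).
Lemma vn_sub m k (q : 'rV[C]_(m + k)) : vn (lsubmx q) <= vn q /\ vn (rsubmx q) <= vn q.
have E : vn q = vn (lsubmx q) + vn (rsubmx q).
  by rewrite /vn big_split_ord /=; congr (_ + _); apply: eq_bigr => i _; rewrite mxE.
by rewrite E lerDl lerDr !vn_ge0.
Qed.
Lemma vn_row_mx m k (x : 'rV[C]_m) (z : 'rV[C]_k) : vn (row_mx x z) = vn x + vn z.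
by rewrite /vn big_split_ord /=; congr (_ + _); apply: eq_bigr => i _; rewrite ?row_mxEl ?row_mxEr.
Qed.
(** A nearby point has coordinates (t', eta', z') close to the given ones; it is slid to the fibre
    over t and then transported along the chain that leads to the base fibre, where the bounds are
    strict. *)
Lemma AA_open : open AA.
apply/open_vn => q [[[t eta] z] os ->]. have [/= ne [hx hz] [a' [ha a't a'1 a'2]]] := os. have ot : off t := okS_off os.
have g0 : 0 < minr (rho - vn a'.1.2) (rho - vn a'.2) by rewrite lt_min !subr_gt0 a'1.
have [d d0 hd] := reach_transport r10 Bw0 Lw0 wfd wB wL ha ne g0. have [d2 d20 hd2] := slide ex Bw0 wfd wB ot ne hx hz d0.
have e0 : eta 0 ord0 != 0 by exact: ne. have [m m0 hm] : somepos m, forall j, m <= nc (eta 0 j) / 2.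
  by apply: pos_min => j; rewrite divr_gt0 // normc_gt0.
have t1 : 0 < 1 + nc t by pos. pose dl := minr (minr d2 m) (minr (d2 * m / (1 + nc t)) (minr (r1 - vn (pt t eta)) (r1 - vn z))).
have dl0 : 0 < dl by rewrite !lt_min d20 m0 divr_gt0 ?mulr_gt0 // !subr_gt0 hx hz.
have [l1 l2 l3] : [/\ dl <= d2, dl <= m & dl <= d2 * m / (1 + nc t)].
  by split; rewrite /dl !ge_min lexx ?orbT.
have [l4 l5] : dl <= r1 - vn (pt t eta) /\ dl <= r1 - vn z by split; rewrite /dl !ge_min lexx ?orbT. clearbody dl. exists dl => // y hy.
pose x' := lsubmx y; pose z' := rsubmx y. have [hx' hz'] : vn (x' - pt t eta) < dl /\ vn (z' - z) < dl.
  have [a b] := vn_sub (y - st (t, eta, z)). rewrite !raddfB /= row_mxKl row_mxKr in a b.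
  by split; [exact: le_lt_trans a hy|exact: le_lt_trans b hy].
have co i : nc (x' 0 i - pt t eta 0 i) < dl.
  by apply: le_lt_trans hx'; have := vn_coord (x' - pt t eta) i; rewrite !mxE.
pose eta' : 'rV[C]_n.+1 := \row_j x' 0 (lift (i1 n) j). have eta'E : vn (eta' - eta) <= vn (x' - pt t eta).
  rewrite -{1}(pt_eta t eta) /vn (bigD1_ord (i1 n)) //= -[leLHS]add0r lerD //. by apply: eq_ler; apply: eq_bigr => j _; rewrite !mxE.
have big j : m <= nc (eta' 0 j).
  have h1 := le_lt_trans (le_trans (vn_coord (eta' - eta) j) eta'E) (lt_le_trans hx' l2).
  have := lerB_normc (eta 0 j) (eta' 0 j); have h2 := hm j; move: h1. rewrite mxE [(- eta) _ _]mxE normc_distC.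
  by move: h2; set u := nc _; set v := nc _; set s := nc _ => *; lra.
have ne' : nz eta' by move=> j; rewrite -normc_gt0; apply: lt_le_trans (big j).
have x'0 : x' 0 (i0 n) = eta' 0 ord0 by rewrite [RHS]mxE; congr (x' 0 _); apply/val_inj. pose t' := x' 0 (i1 n) / x' 0 (i0 n).
have yE : y = st (t', eta', z').
  rewrite /st /= -pt_param ?x'0; first by rewrite hsubmxK. exact: ne'.
have ht' : nc (t' - t) < d2.
  have -> : t' - t = ((x' 0 (i1 n) - pt t eta 0 (i1 n)) - t * (x' 0 (i0 n) - pt t eta 0 (i0 n))) / x' 0 (i0 n).
    have := ne' ord0; rewrite -x'0 => nx. rewrite [pt t eta 0 (i1 n)]mxE [pt t eta 0 (i0 n)]mxE th_i1 th_i0 sg0 sg1 /t'.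
    by move: (x' 0 (i0 n)) nx (x' 0 (i1 n)) (eta 0 ord0) => X0 nX X1 E; field.
  rewrite normcM normcV ltr_pdivrMr ?x'0; last exact: lt_le_trans (big ord0). apply: le_lt_trans (ler_normcB _ _) _; rewrite normcM.
  apply: (@lt_le_trans _ _ (dl + nc t * dl)).
    by apply: ltr_leD; [exact: co|rewrite ler_wpM2l // -x'0 ltW].
  have -> : dl + nc t * dl = dl * (1 + nc t) by ring. apply: (@le_trans _ _ (d2 * m)); first by rewrite -ler_pdivlMr. by rewrite ler_pM2l.
have [eta2 [z2 [hs he2 hz2]]] := hd2 t' eta' z' ne' ht' (le_lt_trans eta'E (lt_le_trans hx' l1)) (lt_le_trans hz' l1).
have [_ /= ne2] := step_nz hs. have [eta3 [z3 [hr he3 hz3]]] := hd eta2 z2 ne2 he2 hz2. exists (t', eta', z') => //; split=> //.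
  split; rewrite /=.
    rewrite -pt_param ?x'0; last exact: ne'. by apply: (@vn_lt _ _ _ (pt t eta)); apply: lt_le_trans l4.
  by apply: (@vn_lt _ _ _ z); apply: lt_le_trans l5.
exists (a'.1.1, eta3, z3); split=> //=.
- by apply: rt_trans hr; apply: rt_step.
- apply: (@vn_lt _ _ _ a'.1.2); apply: lt_le_trans he3 _; by rewrite ge_min lexx.
- apply: (@vn_lt _ _ _ a'.2); apply: lt_le_trans hz3 _; by rewrite ge_min lexx orbT.
Qed.
Lemma vn_const m (x : C) : vn (const_mx x : 'rV[C]_m) = m%:R * nc x.
by rewrite /vn (eq_bigr (fun=> nc x)) ?sumr_const ?card_ord ?mulr_natl // => i _; rewrite mxE. Qed.
 Lemma vn_pt_le t (eta : 'rV[C]_n.+1) : nc t <= 1 -> vn (pt t eta) <= n.+2%:R * vn eta.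
move=> t1; apply: vn_le => i; rewrite mxE normcM -[leRHS]mul1r; apply: ler_pM; rewrite ?vn_coord //.
by rewrite /th; case: ifP => // _; rewrite normc1.
Qed.
Lemma AA_nonempty : AA !=set0.
pose e := minr (rho / 2) (r1 / (2 * n.+2%:R)). have e0 : 0 < e by pos. pose eta : 'rV[C]_n.+1 := const_mx (e / n.+1%:R)%:C.
have ve : vn eta = e.
  rewrite vn_const normc_real ger0_norm; last by pos. by rewrite mulrC divfK // pnatr_eq0.
exists (st ('i, eta, 0)); exists ('i, eta, 0) => //; split=> /=.
- by move=> j; rewrite mxE -normc_gt0 normc_real gtr0_norm divr_gt0 // ltr0Sn.
- split; last by rewrite vn0. apply: le_lt_trans (vn_pt_le _ _) _; first by rewrite normc_i.
  rewrite ve; apply: le_lt_trans (_ : n.+2%:R * (r1 / (2 * n.+2%:R)) < r1).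
    by rewrite ler_pM2l ?ltr0Sn // ge_min lexx orbT.
  have -> : n.+2%:R * (r1 / (2 * n.+2%:R)) = r1 / 2.
    by field; rewrite -!natr1; have : 0 <= n%:R :> R by []; lra.
  by rewrite ltr_pdivrMr // ltr_pMr // ltr1n.
exists ('i, eta, 0); split=> //=; first exact: rt_refl.
  by rewrite ve; apply: le_lt_trans (_ : rho / 2 < rho); [rewrite ge_min lexx|rewrite ltr_pdivrMr // ltr_pMr // ltr1n].
by rewrite vn0.
Qed.
Hypothesis hreach : forall a b, reach a b -> HD h (st a) = HD h (st b).
Hypothesis hrho : forall a0 a1 z0 z1, nz a0 -> nz a1 -> vn a0 < rho -> vn a1 < rho -> vn z0 < rho -> vn z1 < rho ->
    HD h (row_mx (pt 'i a0) z0) = HD h (row_mx (pt 'i a1) z1) -> Q (rch L p eps w r1) a0 z0 a1 z1.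
(** Both points are joined to the fibre over i at the same level; density there is carried back to
    the second point by transport along its chain. *)
Lemma AA_dense q q' : AA q -> AA q' -> HD h q = HD h q' -> forall e : R, 0 < e ->
    exists2 q'', leaf_through AA Zf q q'' & vn (q'' - q') < e.
move=> [a oa ->] [b ob ->] Hab e e0. have [na _ [a' [ra a't a'1 a'2]]] := oa; have [nb _ [b' [rb b't b'1 b'2]]] := ob.
have na' := reach_nz ra na; have nb' := reach_nz rb nb.
case: a' ra a't a'1 a'2 na' => -[ta a'] az /= ra aE; rewrite {ta}aE in ra => a'1 a'2 na'.
case: b' rb b't b'1 b'2 nb' => -[tb' b'] bz /= rb bE; rewrite {tb'}bE in rb => b'1 b'2 nb'.
have HE : HD h (row_mx (pt 'i a') az) = HD h (row_mx (pt 'i b') bz).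
  by rewrite -[LHS](hreach ra) -[RHS](hreach rb).
have [_ hQ] := hrho na' nb' a'1 b'1 a'2 b'2 HE. have e1 : 0 < e / (n.+3%:R * (1 + nc b.1.1)).
  by rewrite divr_gt0 // mulr_gt0 ?ltr0Sn // ltr_pwDl // normc_ge0.
have [d d0 hd] := reach_transport r10 Bw0 Lw0 wfd wB wL (reach_sym rb) nb' e1. have [c [cz [hc1 hc2 hc3]]] := hQ d d0.
have rac : reach a ('i, c, cz) by apply: reach_trans ra hc1. have [c' [cz' [hr h1 h2]]] := hd c cz (reach_nz rac na) hc2 hc3.
exists (st (b.1.1, c', cz')).
  by apply: reach_leaf oa; apply: reach_trans rac hr.
rewrite (_ : st _ - st b = row_mx (pt b.1.1 (c' - b.1.2)) (cz' - b.2)); last first.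
  by rewrite /st /= opp_row_mx add_row_mx; congr row_mx; apply/rowP => i; rewrite !mxE -mulrBr.
rewrite vn_row_mx. have vp : vn (pt b.1.1 (c' - b.1.2)) <= n.+2%:R * ((1 + nc b.1.1) * vn (c' - b.1.2)).
  apply: vn_le => i; rewrite mxE normcM; apply: ler_pM; rewrite ?vn_coord //. by rewrite /th; case: ifP => _; rewrite ?normc1 ?lerDr ?lerDl.
apply: le_lt_trans (lerD vp (lexx _)) _. have p1 : 0 < 1 + nc b.1.1 by rewrite ltr_pwDl // normc_ge0.
have -> : e = n.+2%:R * ((1 + nc b.1.1) * (e / (n.+3%:R * (1 + nc b.1.1)))) + (1 + nc b.1.1) * (e / (n.+3%:R * (1 + nc b.1.1))).
  rewrite -[n.+3%:R]natr1; have X0 : 0 < n.+2%:R + 1 :> R by rewrite natr1 ltr0Sn.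
  move: X0; set X := n.+2%:R => X0; field; rewrite !gt_eqF //.
apply: ler_ltD; first by rewrite ler_pM2l ?ltr0Sn // ler_pM2l // ltW.
apply: lt_le_trans h2 _; rewrite -[leLHS]mul1r ler_pM2r // lerDl normc_ge0 //.
Qed.
Lemma AA_leaves S : is_leaf AA Zf S -> forall q, S q -> S `<=` level h AA q /\ level h AA q `<=` closure S.
exact: is_leaf_dense AA_dense S. Qed. End Leaves.

 (** * Bounds for products of complex powers, uniform near their singularities *)

 Section Escape.
Context {R : realType}. Local Notation C := R[i].
Definition rder (g : R -> R) (x d : R) := forall e : R, 0 < e -> somepos r, forall t, in01 t -> `|t - x| < r -> `|g t - g x - (t - x) * d| <= e * `|t - x|.
 Lemma rder_is (g : R -> R) x d : is_derive x (1 : R) g d -> rder g x d.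
by move=> /is_derive_le h e /h[r r0 hr]; exists r => // t _; apply: hr. Qed.
 Lemma comparison_to (h h' : R -> C) (g g' : R -> R) (b : R) : in01 b ->
   (forall u, in01 u -> rd h u (h' u)) -> (forall u, in01 u -> rder g u (g' u)) ->
   (forall u, in01 u -> nc (h' u) <= g' u) -> nc (h b - h 0) <= g b - g 0.
move=> b01 hh hg hle; have /andP[b0 b1] := b01.
have := @comparison R (fun a => h (a * b)) (fun a => h' (a * b) * b%:C) (fun a => g (a * b)) (fun a => b * g' (a * b)).
rewrite mul0r mul1r; apply => a a01; have ab := in01M a01 b01.
- move=> e e0; have [r r0 hr] := hh _ ab e e0; exists r => // t t01 ht.
  have tb : `|t * b - a * b| <= `|t - a| by rewrite -mulrBl normrM (ger0_norm b0) -[leRHS]mulr1 ler_wpM2l.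
  have := hr _ (in01M t01 b01) (le_lt_trans tb ht) => /le_trans.
  rewrite (_ : (t - a)%:C * (h' (a * b) * b%:C) = (t * b - a * b)%:C * h' (a * b)); last first.
    by rewrite -mulrBl rmorphM /=; ring.
  by apply; rewrite ler_wpM2l // ltW.
- move=> e e0; have [r r0 hr] := hg _ ab e e0; exists r => // t t01 ht.
  have tb : `|t * b - a * b| <= `|t - a| by rewrite -mulrBl normrM (ger0_norm b0) -[leRHS]mulr1 ler_wpM2l.
  have := hr _ (in01M t01 b01) (le_lt_trans tb ht) => /le_trans.
  rewrite (_ : (t - a) * (b * g' (a * b)) = (t * b - a * b) * g' (a * b)); last by ring. by apply; rewrite ler_wpM2l // ltW.
by rewrite normcM normc_real (ger0_norm b0) mulrC ler_wpM2l //; apply: hle.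
Qed.
Lemma rd_cd (f : C -> C) (u : R) d : cd f u%:C d -> rd (fun t => f t%:C) u d.
move=> /cdP h e /h[r r0 hr]; exists r => // t _ ht. have E : t%:C - u%:C = (t - u)%:C :> C by rewrite rmorphB.
by have := hr t%:C; rewrite E normc_real [d * _]mulrC; apply.
Qed.
Lemma rd_rder (g : R -> R) u d : rder g u d -> rd (fun t => (g t)%:C) u d%:C.
move=> h e /h[r r0 hr]; exists r => // t t01 ht; have := hr t t01 ht. rewrite (_ : _ - _ - _ = (g t - g u - (t - u) * d)%:C) ?normc_real //.
by rewrite [RHS]rmorphB rmorphM !rmorphB.
Qed.
(** It equals $1-(1-u)q$: as u goes from 0 to 1, the vector from the contracted point $(1-u)q$ of
    the unit disc to the boundary point 1. *)
Definition Aq (q : C) (u : C) := 1 - q + u * q.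
Lemma Aq_ge (q : C) (u : R) : nc q <= 1 -> in01 u -> u + nc (1 - q) <= 3 * nc (Aq q u%:C).
move=> q1 /andP[u0 u1]. have h1 : u <= nc (Aq q u%:C).
  have -> : Aq q u%:C = 1 - (1 - u%:C) * q by rewrite /Aq; ring. apply: le_trans (lerB_normc _ _); rewrite normcM normc1.
  have -> : 1 - u%:C = (1 - u)%:C :> C by rewrite rmorphB. rewrite normc_real ger0_norm ?subr_ge0 //.
  have : (1 - u) * nc q <= 1 - u by rewrite -[leRHS]mulr1 ler_wpM2l ?subr_ge0. by set a := _ * _ => ?; lra.
have h2 : nc (1 - q) <= 2 * nc (Aq q u%:C).
  have -> : 1 - q = Aq q u%:C - u%:C * q by rewrite /Aq addrK. apply: le_trans (ler_normcB _ _) _; rewrite normcM normc_real ger0_norm //.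
  have : u * nc q <= u by rewrite -[leRHS]mulr1 ler_wpM2l. by move: h1; set a := nc _; set b := _ * nc q => *; lra.
by move: h1 h2; set a := nc _; set b := nc _ => *; lra.
Qed.
Lemma Im_le (q : C) : `|Im q| <= nc (1 - q).
by have := ler_Im_normc (1 - q); rewrite ImB /= sub0r normrN. Qed.
 Lemma Im_ratio (q : C) (u : R) : Aq q u%:C != 0 -> `|Im (q / Aq q u%:C)| = `|Im q| / nc (Aq q u%:C) ^+ 2.
case: q => a b A0; set N := nc _ ^+ 2. have NE : N = (1 - a + u * a) ^+ 2 + (u * b - b) ^+ 2.
  rewrite /N /Aq /= sqr_sqrtr ?addr_ge0 ?sqr_ge0 //; congr (_ ^+ 2 + _ ^+ 2); ring.
have N0 : 0 < N by rewrite exprn_gt0 // normc_gt0. rewrite (_ : Im (_ / _) = b / N).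
  by rewrite normrM normfV (gtr0_norm N0).
have N1 : (1 - a + (u * a - 0 * b)) ^+ 2 + (0 - b + (u * b + 0 * a)) ^+ 2 = N by rewrite NE; ring.
rewrite /Aq /= N1; have := lt0r_neq0 N0; move: N {NE N0 N1} => N N0; field. by [].
Qed.
Lemma Im_cd (f : C -> C) (u : R) d : cd f u%:C d -> rder (fun t => Im (f t%:C)) u (Im d).
move=> /cdP h e /h[r r0 hr]; exists r => // t _ ht. have E : t%:C - u%:C = (t - u)%:C :> C by rewrite rmorphB.
have := hr t%:C; rewrite E normc_real => /(_ ht); apply: le_trans. by apply: le_trans (ler_Im_normc _); rewrite !ImB [d * _]mulrC Im_realM.
Qed.
(** The power $(d/(u+d))^\rho$. *)
Definition Rr (rho d u : R) := expR (rho * (ln d - ln (u + d))).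
Lemma Rr_der (rho d u : R) : 0 < d -> 0 <= u -> is_derive u (1 : R) (Rr rho d) (- (rho * Rr rho d u / (u + d))).
move=> d0 u0; have ud : 0 < u + d by pos. have h1 : is_derive u (1 : R) (fun u => u + d) 1.
  by apply: is_derive_eq (is_deriveD (is_derive_id u 1) (is_derive_cst d u 1)) _; rewrite addr0.
have h2 := @is_derive1_comp _ (@ln R) (fun u => u + d) u _ _ (is_derive1_ln ud) h1.
have h3 := is_deriveZ rho (is_deriveB (is_derive_cst (ln d) u (1 : R)) h2).
have h4 := @is_derive1_comp _ expR _ u _ _ (is_derive_expR _) h3. apply: is_derive_eq h4 _.
by rewrite /= sub0r mulr1 /Rr /GRing.scale /= mulrN mulrN; congr (- _); rewrite mulrCA mulrA.
Qed.
Lemma rder_sum (I : finType) (a : I -> R) (g : I -> R -> R) u d : (forall i, rder (g i) u (d i)) ->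
  rder (fun t => \sum_i a i * g i t) u (\sum_i a i * d i).
move=> h e e0. pose S := \sum_i `|a i| + 1. have S0 : 0 < S by pos. have eS : 0 < e / S by pos.
have /choice[r hr] : forall i, exists r : R, 0 < r /\ forall t, in01 t -> `|t - u| < r ->
    `|g i t - g i u - (t - u) * d i| <= e / S * `|t - u|.
  by move=> i; have [r r0 hr] := h i _ eS; exists r.
have [r0 r00 hr0] := pos_min (fun i => (hr i).1). exists r0 => // t t01 ht.
rewrite (_ : _ - _ - _ = \sum_i a i * (g i t - g i u - (t - u) * d i)); last first.
  rewrite -sumrB mulr_sumr -sumrB; apply: eq_bigr => i _; ring.
apply: le_trans (ler_norm_sum _ _ _) _. apply: (@le_trans _ _ (\sum_i `|a i| * (e / S * `|t - u|))).
  apply: ler_sum => i _; rewrite normrM ler_wpM2l //; apply: (hr i).2 => //. exact: lt_le_trans (hr0 i).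
rewrite -mulr_suml mulrA ler_wpM2r // mulrCA -[leRHS]mulr1 ler_pM2l //. by rewrite ler_pdivrMr // mul1r /S lerDl.
Qed.
(** [Lam] is a branch of the logarithm of 1 / Aq. With $\beta=|\mathrm{Im}\,q|$ its argument has
    speed $\beta/|A|^2$, and $3|A|\ge u+\beta$, so its variation is at most $\int
    9\beta/(u+\beta)^2\,du\le 9$, whatever q. *)
Lemma dLam (q : C) (Lam : C -> C) : nc q <= 1 -> q != 1 ->
    (forall u, in01 u -> cd Lam u%:C (- q / Aq q u%:C)) -> forall u, in01 u ->
  [/\ Aq q u%:C != 0, cexp (Lam u%:C - Lam 0) = (1 - q) / Aq q u%:C & `|Im (Lam u%:C - Lam 0)| <= 9].
move=> q1 nq hL. have d0 : 0 < nc (1 - q) by rewrite normc_gt0 subr_eq0 eq_sym. have An u : in01 u -> 0 < nc (Aq q u%:C).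
  move=> u01; have := Aq_ge q1 u01; have /andP[u0 _] := u01; move: u0 d0. by set a := nc _; set b := nc _ => *; lra.
have A0 u : in01 u -> Aq q u%:C != 0 by move=> /An; rewrite normc_gt0. have cA u : cd (Aq q) u q.
  by apply: (@cd_ext _ _ _ _ _ _ _ _ (cdD (cd_cst (1 - q) u) (cdM (cd_id u) (cd_cst q u)))) => //; ring.
move=> u u01; split; first exact: A0.
  apply: (mulIf (A0 _ u01)); rewrite divfK ?A0 //. pose f v := cexp (Lam v - Lam 0) * Aq q v.
  have f0 : f 0 = 1 - q by rewrite /f subrr cexp0 mul1r /Aq mul0r addr0.
  have := @comparison_to (fun v => f v%:C) (fun=> 0) (fun=> 0) (fun=> 0) u u01.
  rewrite f0 subrr => hc; apply/eqP; rewrite -subr_eq0 -normc_eq0 eq_le normc_ge0 andbT; apply: hc.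
  - move=> v v01; apply: rd_cd; have h1 := cd_comp (cdB (hL v v01) (cd_cst (Lam 0) v%:C)) (cd_cexp _).
    apply: (@cd_ext _ _ _ _ _ _ _ _ (cdM h1 (cA v%:C))) => //. by rewrite subr0 -mulrA divfK ?A0 // -mulrDr addNr mulr0.
  - by move=> v _; apply: rder_is; exact: is_derive_cst. by move=> v _; rewrite normc0.
have hI v : in01 v -> rd (fun t => (Im (Lam t%:C))%:C) v (Im (- q / Aq q v%:C))%:C.
  by move=> v01; apply: rd_rder; apply: Im_cd; exact: hL.
have hle v : in01 v -> nc (Im (- q / Aq q v%:C))%:C = `|Im q| / nc (Aq q v%:C) ^+ 2.
  by move=> v01; rewrite normc_real mulNr raddfN normrN Im_ratio // A0.
have E : `|Im (Lam u%:C - Lam 0)| = nc ((Im (Lam u%:C))%:C - (Im (Lam 0))%:C) by rewrite -rmorphB normc_real ImB.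
have [b0|bn] := eqVneq (Im q) 0.
  have := @comparison_to (fun t => (Im (Lam t%:C))%:C) _ (fun=> 0) (fun=> 0) u u01 hI.
  rewrite E subrr => hc; apply: le_trans (hc _ _) _ => [v v01|v v01|//].
    by apply: rder_is; exact: is_derive_cst.
  by rewrite hle // b0 normr0 mul0r.
pose be := `|Im q|; have be0 : 0 < be by rewrite normr_gt0.
have := @comparison_to (fun t => (Im (Lam t%:C))%:C) _ (fun t => - 9 * be / (t + be)) (fun t => 9 * be / (t + be) ^+ 2) u u01 hI.
rewrite E => hc; apply: le_trans (hc _ _) _ => [v v01|v v01|].
- have /andP[v0 _] := v01; have vb : v + be != 0 by rewrite gt_eqF // ltr_wpDl. apply: rder_is.
  have h1 : is_derive v (1 : R) (fun u => u + be) 1.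
    by apply: is_derive_eq (is_deriveD (is_derive_id v 1) (is_derive_cst be v 1)) _; rewrite addr0.
  have h2 := is_deriveZ (- 9 * be) (@is_deriveV _ (fun u => u + be) v _ _ vb h1). apply: is_derive_eq h2 _; rewrite /GRing.scale /=; field.
  by [].
- rewrite hle // -/be; have Ap := An v v01; have := Aq_ge q1 v01; have := Im_le q; rewrite -/be => h1 h2.
  have /andP[v0 _] := v01; have vb : 0 < v + be by pos.
  rewrite ler_pdivlMr ?exprn_gt0 // mulrAC ler_pdivrMr ?exprn_gt0 // [9 * be]mulrC -mulrA ler_pM2l //.
  rewrite (_ : 9 * _ = (3 * nc (Aq q v%:C)) ^+ 2); last by ring.
  by rewrite ler_sqr ?nnegrE; [|exact: ltW|rewrite mulr_ge0 // ltW]; move: h1 h2; lra.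
rewrite add0r mulfK ?gt_eqF // opprK; have /andP[v0 _] := u01. rewrite -[leRHS]add0r lerD2r mulNr mulNr oppr_le0 divr_ge0 ?mulr_ge0 ?ltW //.
by pos.
Qed.
(** Put $r_o=(d_o/(u+d_o))^{\mathrm{Re}\,c_o}$ with $d_o=|1-q_o|$. Then |V| is at most a constant
    times $\prod r_o$, and |V'| at most a weighted sum of the $-r_o'$. Since each $r_o$ decreases
    and starts at 1, size and total variation of V are bounded however close the $q_o$ are to 1. *)
Lemma escape_core (O : finType) (c : O -> C) : (forall o, 0 < Re (c o)) -> exists2 K : R, 0 <= K &
  forall (q : O -> C) (Lam : O -> C -> C), (forall o, nc (q o) <= 1) -> (forall o, q o != 1) ->
    (forall o u, in01 u -> cd (Lam o) u%:C (- q o / Aq (q o) u%:C)) ->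
  let V u := cexp (\sum_o c o * (Lam o u - Lam o 0)) in
  let V' u := V u * \sum_o c o * (- q o / Aq (q o) u) in
  exists g g' : R -> R, (forall b, in01 b -> g b - g 0 <= K) /\ forall u, in01 u ->
    [/\ rder g u (g' u), cd V u%:C (V' u%:C), nc (V u%:C) <= K & nc (V' u%:C) <= g' u].
(* The 3 comes from $|1-(1-u)q|\ge(u+d)/3$ and $e^3\ge3$, the 9 from the bound on the argument in
   [dLam]. *)
move=> c0. pose k o := expR (3 * Re (c o) + 9 * `|Im (c o)|). have k1 o : 1 <= k o by rewrite -expR0 ler_expR addr_ge0 ?mulr_ge0 // ltW.
pose KK := \prod_o k o. have KK0 : 0 <= KK by apply: prodr_ge0 => o _; exact: expR_ge0. pose a o := KK * 3 * nc (c o) / Re (c o).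
have a0 o : 0 <= a o by pos. have sa : 0 <= \sum_o a o by pos. exists (KK + \sum_o a o) => [|q Lam q1 nq hL V V']; first exact: addr_ge0.
pose d o := nc (1 - q o). have d0 o : 0 < d o by rewrite normc_gt0 subr_eq0 eq_sym. pose r o u := Rr (Re (c o)) (d o) u.
have r1 o u : in01 u -> 0 <= r o u <= 1.
  move=> /andP[u0 _]; rewrite expR_ge0 /= -expR0 ler_expR mulr_ge0_le0 ?(ltW (c0 o)) //.
  by rewrite subr_le0 ler_ln ?posrE ?lerDr // ltr_wpDl.
have r0 o : r o 0 = 1 by rewrite /r /Rr add0r subrr mulr0 expR0.
have E o u : in01 u -> nc (cexp (c o * (Lam o u%:C - Lam o 0))) <= k o * r o u.
  move=> u01; have [A0 hc hI] := dLam (q1 o) (nq o) (hL o) u01. have /andP[u0 _] := u01; have ud : 0 < u + d o by pos.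
  set D := Lam o u%:C - Lam o 0 in hc hI *. have hR : Re D <= 3 + (ln (d o) - ln (u + d o)).
    rewrite -ler_expR expRD expRD expRN !lnK ?posrE // -normc_cexp hc normcM normcV -/(d o).
    have A0' : 0 < nc (Aq (q o) u%:C) by rewrite normc_gt0. rewrite mulrCA ler_pM2l // -[leLHS]mul1r.
    rewrite -(ler_pM2r A0') mulfVK ?gt_eqF // -mulrA [_^-1 * _]mulrC mulrA ler_pdivlMr // mul1r.
    apply: le_trans (Aq_ge (q1 o) u01) _; rewrite ler_pM2r //. by apply: le_trans (expR_ge1Dx 3); lra.
  rewrite normc_cexp /k /r /Rr -expRD ler_expR. have -> : Re (c o * D) = Re (c o) * Re D - Im (c o) * Im D by case: (c o) (D) => x y [].
  have h1 : Re (c o) * Re D <= Re (c o) * (3 + (ln (d o) - ln (u + d o))) by rewrite ler_pM2l.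
  have h2 : - (Im (c o) * Im D) <= 9 * `|Im (c o)|.
    apply: le_trans (ler_norm _) _; rewrite normrN normrM mulrC ler_wpM2r //.
  apply: le_trans (lerD h1 h2) _; apply: eq_ler; ring.
have VE u : V u = \prod_o cexp (c o * (Lam o u - Lam o 0)) by rewrite /V cexp_sum. have Vle u : in01 u -> nc (V u%:C) <= KK * \prod_o r o u.
  move=> u01; rewrite VE normc_prod -big_split; apply: ler_prod => o _. by apply/andP; split; [exact: normc_ge0|exact: E].
have prle u o : in01 u -> \prod_o r o u <= r o u.
  move=> u01; rewrite (bigD1 o) //= -[leRHS]mulr1; have /andP[h0 h1] := r1 o u u01.
  by apply: ler_wpM2l => //; apply: prodr_ile1 => o' _; exact: r1.
have pr1 u : in01 u -> \prod_o r o u <= 1 by move=> u01; apply: prodr_ile1 => o _; exact: r1.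
exists (fun u => \sum_o a o * - r o u), (fun u => \sum_o a o * (Re (c o) * r o u / (u + d o))); split=> [b b01|u u01].
  rewrite -sumrB; apply: (@le_trans _ _ (\sum_o a o)); last by rewrite lerDr.
  apply: ler_sum => o _; rewrite r0 mulrN mulrN1 opprK -[leRHS]add0r lerD2r oppr_le0 mulr_ge0 //. by have /andP[] := r1 o b b01.
have /andP[u0 _] := u01. split.
- apply: (@rder_sum _ a (fun o u => - r o u)) => o; apply: rder_is. by have := is_deriveN (Rr_der (Re (c o)) (d0 o) u0); rewrite opprK.
- have h : cd (fun u => \sum_o c o * (Lam o u - Lam o 0)) u%:C (\sum_o c o * (- q o / Aq (q o) u%:C)).
    apply: cd_sum => o; apply: cdZ; apply: (@cd_ext _ _ _ _ _ _ _ _ (cdB (hL o u u01) (cd_cst (Lam o 0) _))) => //. by rewrite subr0.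
  by have := cd_comp h (cd_cexp _).
- apply: le_trans (Vle u u01) _; rewrite -[leLHS]addr0; apply: lerD => //. by rewrite -[leRHS]mulr1 ler_wpM2l // pr1.
rewrite normcM; apply: le_trans (ler_pM (normc_ge0 _) (normc_ge0 _) (Vle u u01) (ler_normc_sum _ _ _)) _.
rewrite mulr_sumr; apply: ler_sum => o _. have ud : 0 < u + d o by pos. have [A0 _ _] := dLam (q1 o) (nq o) (hL o) u01.
have A0' : 0 < nc (Aq (q o) u%:C) by rewrite normc_gt0. have hA : nc (- q o / Aq (q o) u%:C) <= 3 / (u + d o).
  rewrite normcM normcN normcV ler_pdivrMr // mulrAC ler_pdivlMr //. by apply: le_trans (Aq_ge (q1 o) u01); rewrite -[leRHS]mul1r ler_pM2r.
rewrite normcM (_ : a o * (Re (c o) * r o u / (u + d o)) = (KK * r o u) * (nc (c o) * (3 / (u + d o)))); last first.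
  have X0 : Re (c o) != 0 by rewrite gt_eqF. have Y0 : u + d o != 0 by rewrite gt_eqF.
  rewrite /a; move: (u + d o) Y0 (Re (c o)) X0 (nc (c o)) (r o u) => y Y0 x X0 z t. by field; rewrite X0 Y0.
have /andP[hr0 _] := r1 o u u01. apply: ler_pM; rewrite ?mulr_ge0 //.
- by apply: prodr_ge0 => o' _; have /andP[] := r1 o' u u01.
- by rewrite ler_wpM2l // prle. by rewrite ler_wpM2l.
Qed.
End Escape.

(** * The case M = 2: from any t to i or -i at linear cost *)

Section Cayley.
Context {R : realType}.
Local Notation C := R[i].
Variables (N : nat) (B : finType) (tb : B -> C) (ex : B -> 'I_1 -> C).
Hypothesis tbR : forall b, Im (tb b) = 0.
Hypothesis ex0 : forall b, Re (ex b ord0) < 0.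
Hypothesis ex1 : 0 < Re (1 + \sum_b ex b ord0).
Variables (w : 'rV[C]_2 -> 'M[C]_(2, N)) (r1 Bw Lw : R).
Hypotheses (r10 : 0 < r1) (Bw0 : 0 <= Bw).
Hypothesis wfd : forall x, vn x < r1 -> forall i c, exists g, fd (fun y => w y i c) x g.
Hypothesis wB : forall x, vn x < r1 -> forall i c, nc (w x i c) <= Bw.
Local Notation reach := (reach tb ex w (Om r1)).
Local Notation i0 := (i0 0).
Local Notation i1 := (i1 0).
(** [None] is the point $t=\infty$, where $x_1=t\,x_0$ grows like t to this power; at a pole the
    sign is reversed, so that all real parts are positive. *)
Definition ce (o : option B) : C := if o is Some b then - ex b ord0 else 1 + \sum_b ex b ord0.
Lemma ce0 o : 0 < Re (ce o).
case: o => [b|]; last exact: ex1. by have := ex0 b; rewrite /ce; case: (ex b ord0) => x y /=; rewrite oppr_gt0.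
Qed.
Lemma cd_Aq (q : C) u : cd (Aq q) u q.
by apply: (@cd_ext _ _ _ _ _ _ _ _ (cdD (cd_cst (1 - q) u) (cdM (cd_id u) (cd_cst q u)))) => //; ring. Qed.
 Lemma Aq_neq0 (q : C) (u : R) : nc q <= 1 -> q != 1 -> in01 u -> Aq q u%:C != 0.
move=> q1 nq u01; have d0 : 0 < nc (1 - q) by rewrite normc_gt0 subr_eq0 eq_sym.
have /andP[u0 _] := u01; rewrite -normc_gt0; have := Aq_ge q1 u01; move: d0 u0. by set a := nc _; set b := nc _ => *; lra.
Qed.
Lemma Aq_le2 (q : C) (u : R) : nc q <= 1 -> in01 u -> nc (Aq q u%:C) <= 2.
move=> q1 /andP[u0 u1]. have -> : Aq q u%:C = 1 - (1 - u)%:C * q by rewrite /Aq rmorphB /=; ring.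
apply: le_trans (ler_normcB _ _) _; rewrite normc1 normcM normc_real ger0_norm ?subr_ge0 //.
have : (1 - u) * nc q <= 1 * 1 by apply: ler_pM; rewrite ?subr_ge0 // lerBlDr lerDl. by set a := _ * nc _ => ?; lra.
Qed.
Lemma sg_ord0 (i : 'I_2) : sg i = ord0.
by rewrite ord1. Qed.
 Lemma comparison_cd (f f' : C -> C) (g g' : R -> R) (a b u : R) : in01 u -> f 0 = 0 ->
    (forall v, in01 v -> cd f v%:C (f' v%:C)) -> (forall v, in01 v -> rder g v (g' v)) ->
    (forall v, in01 v -> nc (f' v%:C) <= a * g' v + b) ->
  nc (f u%:C) <= a * (g u - g 0) + b * u.
move=> u01 f0 cf cg le.
have := @comparison_to R (fun t => f t%:C) (fun t => f' t%:C) (fun t => a * g t + b * t) (fun t => a * g' t + b) u u01.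
have z0 : 0%:C = 0 :> C by []. rewrite z0 f0 subr0 => hc; apply: le_trans (hc _ _ le) _ => [v v01|v v01|].
- by apply: rd_cd; exact: cf.
- have h2 : rder (fun t : R => t) v 1 by apply: rder_is; exact: is_derive_id.
  have : rder (fun t => \sum_(c : bool) (if c then a else b) * (if c then g else fun t => t) t) v
        (\sum_(c : bool) (if c then a else b) * (if c then g' v else 1)).
    by apply: (@rder_sum R bool (fun c => if c then a else b) (fun c => if c then g else fun t => t)); case=> //; apply: cg.
  rewrite big_bool mulr1 => hs3 e e0; have [r r0 hr0] := hs3 e e0; exists r => // t t01 ht. by have := hr0 t t01 ht; rewrite !big_bool.
by apply: eq_ler; ring.
Qed.
Lemma sum_option (F : option B -> C) : \sum_o F o = F None + \sum_b F (Some b).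
rewrite (bigD1 None) //=; congr (_ + _). rewrite (reindex_omap Some id) //=; last by case. by apply: eq_bigl => b; rewrite eqxx.
Qed.
(** In the coordinate $\xi=(t-s)/(t+s)$ the half-plane of s is the unit disc, the poles and infinity
    lie on the circle, and the radius leads to s. Along it $x_0$ and $x_1$ are [W * V] times affine
    functions of u, and [escape_core] bounds the curve and its length linearly in |x|, uniformly in
    t0. *)
Lemma escape_half : somepos K, forall (s t0 : C) (eta : 'rV[C]_1) z, s = 'i \/ s = - 'i ->
  (forall b, t0 != tb b) -> t0 + s != 0 -> nc (t0 - s) <= nc (t0 + s) -> nz eta ->
  K * vn (pt t0 eta) < r1 -> vn z + K * vn (pt t0 eta) < r1 ->
  exists eta' z', [/\ reach (t0, eta, z) (s, eta', z'), vn eta' <= K * vn (pt t0 eta) &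
    vn z' <= vn z + K * vn (pt t0 eta)].
have [K K0 HK] := escape_core ce0. pose K' := 1 + 4 * K + N%:R * (6 * K * Bw). have k1 : 0 <= N%:R * (6 * K * Bw) by pos.
have k2 : 0 <= 4 * K by pos. have K'1 : 1 <= K' by rewrite /K'; lra. exists K' => [|s t0 eta z hs ht ts tsle neta hX hzX]; first by lra.
have ss : s * s = -1 by case: hs => ->; rewrite ?mulrNN -expr2 sqr_i.
have s0 : s != 0 by apply: contra_eq_neq ss => ->; rewrite mul0r eq_sym oppr_eq0 oner_neq0.
have ns : nc s = 1 by case: hs => ->; rewrite ?normcN normc_i. pose X := vn (pt t0 eta); have X0 : 0 <= X := vn_ge0 _.
have etaX : vn eta <= X.
  have := vn_coord (pt t0 eta) i0; rewrite mxE th_i0 mul1r sg_ord0 => h. by rewrite {1}/vn big_ord_recl big_ord0 addr0.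
have XK : X <= K' * X by rewrite -[leLHS]mul1r ler_wpM2r. have [E|ts0] := eqVneq t0 s.
  exists eta, z; rewrite -E -/X; split; [exact: rt_refl|exact: le_trans XK|]. by rewrite lerDl mulr_ge0 // (le_trans ler01).
pose xi := (t0 - s) / (t0 + s). have xi0 : xi != 0 by rewrite mulf_neq0 ?invr_eq0 // subr_eq0.
have nts : 0 < nc (t0 + s) by rewrite normc_gt0. have xi1 : nc xi <= 1 by rewrite normcM normcV ler_pdivrMr // mul1r.
have s2 : 2 * s != 0 by rewrite mulf_neq0 // pnatr_eq0. have xiE : 1 - xi = 2 * s / (t0 + s) by rewrite /xi; field. have nxi : xi != 1.
  by rewrite -subr_eq0 -oppr_eq0 opprB xiE mulf_neq0 ?invr_eq0.
have tbs b : tb b - s != 0.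
  rewrite subr_eq0; apply: contra_neq (oner_neq0 R) => E; have := tbR b; rewrite E.
  by case: hs => ->; rewrite /= => // /eqP; rewrite oppr_eq0 => /eqP.
have tbsn b : nc (tb b + s) = nc (tb b - s).
  have := tbR b; case: hs => ->; case: (tb b) => x y /= ->; rewrite ?(addr0, subr0, opprK, oppr0); congr Num.sqrt; ring.
(* The quotient of xi by the Cayley image of the pole, a point of the circle: each pole is thereby
   rotated to 1. *)
pose q o := if o is Some b then xi * ((tb b + s) / (tb b - s)) else xi. have q1 o : nc (q o) <= 1.
  have tq b : nc ((tb b + s) / (tb b - s)) = 1 by rewrite normcM normcV tbsn mulfV // normc_eq0.
  by case: o => [b|] //=; rewrite normcM tq mulr1.
have nq o : q o != 1.
  case: o => [b|] //=; apply/eqP => E; have /negP := ht b; apply; apply/eqP.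
  have := congr1 (fun x => x * ((t0 + s) * (tb b - s))) E; rewrite mul1r /xi.
  rewrite (_ : _ * _ = (t0 - s) * (tb b + s)); last by field; rewrite ts tbs. move=> E2; apply: (mulfI s2).
  have : (t0 - s) * (tb b + s) - (t0 + s) * (tb b - s) = 0 by rewrite E2 subrr.
  move=> /eqP; rewrite (_ : _ - _ = 2 * s * t0 - 2 * s * tb b); last by ring. by rewrite subr_eq0 => /eqP.
have An o u : in01 u -> Aq (q o) u%:C != 0 by move=> u01; apply: Aq_neq0.
have [d d0 hd] : somepos d, forall u, tube 0 1 d u -> forall o, Aq (q o) u != 0.
  apply: tube_in => u u01. have /choice[r hr] : forall o, exists r : R, 0 < r /\ forall v, nc (v - u%:C) < r -> Aq (q o) v != 0.
    move=> o; have [r r0 hr] := cts_away (cd_cts (cd_Aq (q o) u%:C)) (An o u u01).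
    exists r; split=> // v /hr hv; rewrite -normc_gt0; apply: le_lt_trans hv. by pos.
  have [r0 r00 hr0] := pos_min (fun o => (hr o).1). exists r0 => // v; rewrite /seg subr0 mulr1 add0r => hv o; apply: (hr o).2.
  exact: lt_le_trans (hr0 o).
pose D := tube (0 : C) 1 d. have sE u : seg (0 : C) 1 u = u%:C by rewrite /seg subr0 mulr1 add0r.
have Din u : in01 u -> D u%:C by move=> u01; rewrite -sE; exact: tube_seg. have D0 : D 0 by have := Din 0 in01_0.
have oD : op D by apply: tube_op. have cD : cvx D by apply: tube_cvx. have A0 u : D u -> Aq xi u != 0 by move=> /hd /(_ None).
(* The inverse Cayley transform of (1 - u) xi. *)
pose ta u := s * Aq (- xi) u / Aq xi u. pose dta u := - (2 * s * xi) / Aq xi u ^+ 2.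
have taB b u : D u -> ta u - tb b = (s - tb b) * Aq (q (Some b)) u / Aq xi u.
  move=> Du; rewrite /ta /=; apply: (mulIf (A0 u Du)); rewrite mulrBl !divfK ?A0 //. by rewrite /Aq; field.
have tan b u : D u -> ta u != tb b.
  move=> Du; rewrite -subr_eq0 taB // mulf_neq0 ?invr_eq0 ?A0 // mulf_neq0 ?(hd u Du (Some b)) //. by rewrite -opprB oppr_eq0.
have cta u : D u -> cd ta u (dta u).
  move=> Du; have := cdM (cdM (cd_cst s u) (cd_Aq (- xi) u)) (cdV (A0 u Du) (cd_Aq xi u)).
  apply: cd_ext => //; rewrite /dta; have := A0 u Du; rewrite /Aq => h; field. by [].
have [lam Pok] : exists lam, piece_ok tb (Piece ta dta lam D).
  apply: mk_piece => // u Du; split.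
  - exact: cta.
  - eexists; apply: cdM (cd_cst _ _) (cdV _ (cdX 2 (cd_Aq xi u))). by rewrite expf_neq0 // A0.
  - by rewrite mulf_neq0 ?invr_eq0 ?expf_neq0 ?A0 // oppr_eq0 mulf_neq0. by move=> b; apply: tan.
set P := Piece _ _ _ _ in Pok. have /choice[Lam hLam] : forall o, exists F, forall u, D u -> cd F u (- q o / Aq (q o) u).
  move=> o; apply: primitive => // u Du; eexists; apply: cdM (cd_cst _ _) (cdV (hd u Du o) (cd_Aq (q o) u)).
have hL o u : in01 u -> cd (Lam o) u%:C (- q o / Aq (q o) u%:C) by move=> /Din; apply: hLam.
have lamE b u : D u -> lam b u - lam b 0 = - (Lam (Some b) u - Lam (Some b) 0) + (Lam None u - Lam None 0).
  move=> Du; rewrite (@prim_diff _ D (lam b) (fun u => - Lam (Some b) u + Lam None u) (fun u => dta u / (ta u - tb b)) 0 u) //.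
  - ring.
  - by move=> v Dv; have [_ _ /(_ v Dv)[_ _ _ /(_ b)[]]] := Pok.
  move=> v Dv; apply: (@cd_ext _ _ _ _ _ _ _ _ (cdD (cdN (hLam (Some b) v Dv)) (hLam None v Dv))) => //.
  rewrite taB // /dta; have h1 := A0 v Dv; have h2 := hd v Dv (Some b); have h3 := tbs b.
  have h4 : s - tb b != 0 by rewrite -opprB oppr_eq0. rewrite [q None]/=.
  have hQ : q (Some b) * Aq xi v - xi * Aq (q (Some b)) v = 2 * s * xi / (tb b - s) by rewrite /Aq /=; field.
  have alg (A A' Q : C) : A != 0 -> A' != 0 -> Q * A - xi * A' = 2 * s * xi / (tb b - s) ->
      - (- Q / A') + - xi / A = - (2 * s * xi) / A ^+ 2 / ((s - tb b) * A' / A).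
    move=> hA hA' hQ'; apply: (mulIf (mulf_neq0 hA hA')).
    have -> : (- (- Q / A') + - xi / A) * (A * A') = Q * A - xi * A' by field; rewrite hA hA'. by rewrite hQ'; field; rewrite hA hA' h3 h4.
  exact: alg.
pose V u := cexp (\sum_o ce o * (Lam o u - Lam o 0)). pose V' u := V u * \sum_o ce o * (- q o / Aq (q o) u).
have [g [g' [hg hu]]] := HK q Lam q1 nq hL. rewrite -/V -/V' in hu. have n1xi : 1 - xi != 0 by rewrite subr_eq0 eq_sym.
have LamN u : D u -> cexp (Lam None u - Lam None 0) * Aq xi u = 1 - xi.
  move=> Du; pose f v := cexp (Lam None v - Lam None 0) * Aq xi v. have f0 : f 0 = 1 - xi by rewrite /f subrr cexp0 mul1r /Aq mul0r addr0.
  rewrite -f0; apply/eqP; rewrite -subr_eq0 -normc_eq0 eq_le normc_ge0 andbT.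
  rewrite -[leRHS](mul0r (nc (u - 0))); apply: (@cd_mvt _ f (fun=> 0)) => a a01; last by rewrite normc0.
  have Da : D (seg 0 u a) by apply: cD.
  apply: (@cd_ext _ _ _ _ _ _ _ _ (cdM (cd_comp (cdB (hLam None _ Da) (cd_cst (Lam None 0) _)) (cd_cexp _)) (cd_Aq xi _))) => //.
  by rewrite subr0 -mulrA divfK ?A0 // -mulrDr addNr mulr0.
have nuE u : D u -> nu ex P 0 ord0 u = V u * Aq xi u / (1 - xi).
  move=> Du; rewrite -(LamN u Du). have nc := cexp_neq0 (Lam None u - Lam None 0).
  have frac (v e A : C) : e != 0 -> A != 0 -> v * A / (e * A) = v / e by move=> h1 h2; field; rewrite h1 h2.
  rewrite frac ?A0 // -cexpB /nu; congr cexp. rewrite sum_option mulrDl mul1r addrAC [_ + _ - _]addrAC subrr add0r mulr_suml -big_split /=.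
  by apply: eq_bigr => b _; rewrite (lamE b u Du); ring.
(* This is $(x_1+s\,x_0)/(2s)$ at the start, so it is bounded by |x| even when t0 is large and 1 -
   xi small. *)
pose W := eta 0 ord0 / (1 - xi). have WX : nc W <= X.
  have -> : W = (t0 * eta 0 ord0 + s * eta 0 ord0) / (2 * s) by rewrite /W xiE; field; rewrite ts s0.
  rewrite normcM normcV [nc (2 * s)]normcM ns mulr1 normc_nat ler_pdivrMr //.
  have h0 := vn_coord (pt t0 eta) i0; have h1 := vn_coord (pt t0 eta) i1. rewrite !mxE th_i0 th_i1 !sg_ord0 mul1r -/X in h0 h1.
  apply: le_trans (ler_normcD _ _) _; rewrite !normcM ns mul1r; rewrite normcM in h1.
  by move: h0 h1; set a := nc _; set b := _ * a => *; lra.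
pose a i u := if i == i1 then s * Aq (- xi) u else Aq xi u. pose a' i := if i == i1 then - (s * xi) else xi.
have ca i u : cd (a i) u (a' i).
  rewrite /a /a'; case: ifP => _; last exact: cd_Aq. by apply: cd_ext (cdZ s (cd_Aq (- xi) u)) => //; rewrite mulrN.
have a2 i u : in01 u -> nc (a i u%:C) <= 2.
  move=> u01; rewrite /a; case: ifP => _; rewrite ?normcM ?ns ?mul1r; apply: Aq_le2 => //. by rewrite normcN.
have a'1 i : nc (a' i) <= 1 by rewrite /a'; case: ifP => _ //; rewrite normcN normcM ns mul1r.
have xlE' i u : D u -> xl ex P 0 eta u 0 i = W * V u * a i u.
  move=> Du; rewrite mxE /cA sg_ord0 nuE // /a /th /W /= /ta; case: ifP => _; last by ring.
  by have := A0 u Du; move: (Aq xi u) (1 - xi) n1xi => A n hn hA; field; rewrite hA hn.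
have xdE' i u : in01 u -> xd tb ex P 0 eta u%:C 0 i = W * (V' u%:C * a i u%:C + V u%:C * a' i).
  move=> u01; have Du := Din u u01; have [_ cV _ _] := hu u u01. have h1 := cdv_xl ex Pok 0 eta Du i. have [r r0 hr] := oD _ Du.
  have h2 : cd (fun v => W * V v * a i v) u%:C (xd tb ex P 0 eta u%:C 0 i).
    by apply: cd_near r0 _ h1 => v /hr Dv; exact: xlE'.
  have cV' : cd V u%:C (V' u%:C) := cV. by rewrite (cd_unique h2 (cdM (cdZ W cV') (ca i _))) mulrDr !mulrA.
have xlX u : in01 u -> vn (xl ex P 0 eta u%:C) <= 4 * K * X.
  move=> u01; have [_ _ VK _] := hu u u01. have -> : 4 * K * X = 2 * (X * K * 2) by ring.
  apply: vn_le => i; rewrite (xlE' i _ (Din u u01)) normcM normcM. by apply: ler_pM; rewrite ?mulr_ge0 ?a2 //; apply: ler_pM.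
have lin4 : 4 * K * X <= K' * X by rewrite ler_wpM2r // /K'; lra. have xlr u : in01 u -> vn (xl ex P 0 eta u%:C) < r1.
  by move=> /xlX h; apply: le_lt_trans h (le_lt_trans lin4 hX).
have zdX u c : in01 u -> nc (zd tb ex w P 0 eta u%:C 0 c) <= (2 * (2 * X * Bw)) * g' u + 2 * (X * K * Bw).
  move=> u01; have [_ _ VK Vg] := hu u u01. rewrite /zd mxE big_ord_recl big_ord_recl big_ord0 addr0.
  have h i : nc (xd tb ex P 0 eta u%:C 0 i * w (xl ex P 0 eta u%:C) i c) <= (X * (g' u * 2 + K * 1)) * Bw.
    rewrite normcM; apply: ler_pM; rewrite //; last by apply: wB; exact: xlr. rewrite xdE' // normcM; apply: ler_pM => //.
    apply: le_trans (ler_normcD _ _) _; rewrite [nc (V' u%:C * _)]normcM [nc (V u%:C * _)]normcM.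
    by apply: lerD; apply: ler_pM; rewrite ?a2.
  apply: le_trans (ler_normcD _ _) _; apply: le_trans (lerD (h _) (h _)) _. by apply: eq_ler; ring.
have [d2 d20 hd2] : somepos d2, forall u, tube 0 1 d2 u -> D u /\ vn (xl ex P 0 eta u) < r1.
  apply: tube_in => u u01; rewrite sE; have Du := Din u u01. have [r r0 hr] := oD _ Du.
  have gp : 0 < r1 - vn (xl ex P 0 eta u%:C) by rewrite subr_gt0; exact: xlr.
  have [r' r'0 hr'] := vn_cts (fun i => cts_xl ex Pok 0 eta i Du) gp. exists (minr r r'); first by pos.
  move=> v /lt_minP[/hr Dv /hr' hv]; split=> //; exact: vn_lt hv.
have cinc c u : in01 u -> cd (fun v => inc tb ex w P 0 eta v 0 c) u%:C (zd tb ex w P 0 eta u%:C 0 c).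
  move=> u01. have in2 v : in01 v -> tube (0 : C) 1 d2 v%:C by move=> v01; rewrite -sE; exact: tube_seg.
  apply: (@cd_ext _ (cint (fun u => zd tb ex w P 0 eta u 0 c) 0) _ _ _ _ _ erefl) => [v|]; first by rewrite mxE.
  apply: (@primitive_cint _ (tube (0 : C) 1 d2)); [exact: tube_cvx|exact: tube_op| | |exact: in2].
    by move=> v /hd2[Dv xv]; apply: (hol_zd wfd Pok).
  by have := in2 0 in01_0.
have incX u : in01 u -> vn (inc tb ex w P 0 eta u%:C) <= N%:R * (6 * K * Bw) * X.
  move=> u01. have -> : N%:R * (6 * K * Bw) * X = N%:R * (6 * K * Bw * X) by ring. apply: vn_le => c.
  have ci0 (f : C -> C) : cint f 0 0 = 0 by rewrite /cint subrr mul0r. have E0 : inc tb ex w P 0 eta 0 0 c = 0 by rewrite mxE ci0.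
  have hg' v : in01 v -> rder g v (g' v) by move=> /hu[].
  apply: le_trans (@comparison_cd (fun v => inc tb ex w P 0 eta v 0 c) (fun v => zd tb ex w P 0 eta v 0 c)
    g g' (2 * (2 * X * Bw)) (2 * (X * K * Bw)) u u01 E0 (cinc c) hg' (fun v => zdX v c)) _.
  have /andP[u0 u1] := u01. have b0 : 0 <= 2 * (2 * X * Bw) by pos. have b1 : 0 <= 2 * (X * K * Bw) by pos.
  apply: le_trans (lerD (ler_wpM2l b0 (hg u u01)) (ler_wpM2l b1 u1)) _. by apply: eq_ler; ring.
have P0 : ta 0 = t0.
  rewrite /ta /Aq !mul0r !addr0 opprK; have -> : 1 + xi = 2 * t0 / (t0 + s) by rewrite /xi; field. by rewrite xiE; field; rewrite ts s0.
have P1 : ta 1 = s by rewrite /ta /Aq !mul1r !subrK mulr1 divr1. have := @step_seg R 0 N B tb ex w r1 wfd P Pok 0 1 eta z.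
have lin6 : N%:R * (6 * K * Bw) * X <= K' * X by rewrite ler_wpM2r // /K'; lra.
move=> hst; exists (act (nuv ex P 0 1) eta), (z + inc tb ex w P 0 eta 1); split.
- apply: rt_step. move: hst; rewrite /= P0 P1; apply => //; first exact: (Din 1 in01_1).
    by move=> v v01; rewrite sE; exact: xlr.
  move=> v v01; rewrite sE; apply: le_lt_trans (vnD _ _) _; apply: le_lt_trans hzX. by rewrite lerD2l; apply: le_trans (incX v v01) lin6.
- have := eta_le ex P 1 (act (nuv ex P 0 1) eta); rewrite mul1r xl_shift => /le_trans; apply. exact: le_trans (xlX 1 in01_1) lin4.
apply: le_trans (vnD _ _) _; rewrite lerD2l; exact: le_trans (incX 1 in01_1) lin6.
Qed.
End Cayley.

(** * Straight paths avoiding the poles *)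

Section Straight.
Context {R : realType}.
Local Notation C := R[i].
Lemma straight_piece (B : finType) (tb : B -> C) a b : (forall s, in01 s -> forall c, seg a b s != tb c) ->
  exists lam D, [/\ piece_ok tb (Piece (fun s => s) (fun=> 1) lam D), D a & D b].
move=> h. have [d d0 hd] : somepos d, forall u, tube a b d u -> forall c, u != tb c.
  apply: tube_in => s s01. have p c : 0 < nc (seg a b s - tb c) by rewrite normc_gt0 subr_eq0 h. have [r r0 hr] := pos_min p.
  exists r => // u hu c; apply: contraTneq hu => ->; rewrite -leNgt normc_distC; exact: hr.
have [lam ok] : exists lam, piece_ok tb (Piece (fun s => s) (fun=> 1) lam (tube a b d)).
  apply: mk_piece; [exact: tube_op|exact: tube_cvx|] => s hs; split.
  - exact: cd_id.
  - by exists 0; exact: cd_cst.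
  - exact: oner_neq0.
  - exact: hd.
exists lam, (tube a b d); split=> //.
  by rewrite -[X in tube _ _ _ X](seg0 a b); apply: tube_seg => //; exact: in01_0.
by rewrite -[X in tube _ _ _ X](seg1 a b); apply: tube_seg => //; exact: in01_1.
Qed.
Lemma seg_off n L p (a b : C) : (0 <= Im a /\ 0 < Im b) \/ (Im a <= 0 /\ Im b < 0) -> (forall c, a != tb (n:=n) (L:=L) (p:=p) c) ->
  forall s, in01 s -> forall c, seg a b s != tb (n:=n) (L:=L) (p:=p) c.
move=> hab ha s s01 c. have [->|s0] := eqVneq s 0; first by rewrite seg0.
have sp : 0 < s by have /andP[h _] := s01; rewrite lt_neqAle eq_sym s0. have /andP[_ s1] := s01.
apply/eqP => E; have := @tb_real R n L p c; rewrite -E /seg ImD Im_realM ImB; apply/eqP.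
have -> : Im a + s * (Im b - Im a) = (1 - s) * Im a + s * Im b by ring. case: hab => -[h1 h2].
  by rewrite gt_eqF // ltr_wpDl ?mulr_gt0 // mulr_ge0 // subr_ge0.
by rewrite lt_eqF // ltr_wnDl ?pmulr_rlt0 // mulr_ge0_le0 // subr_ge0.
Qed.
Lemma seg_ii n L p s : in01 s -> forall c, seg (- 'i) 'i s != tb (R := R) (n:=n) (L:=L) (p:=p) c.
move=> _ c; apply/eqP => /(congr1 Re); rewrite /seg ReD Re_realM /= !(oppr0, addr0, subr0, mulr0) => E.
have : 1 <= Re (tb (R := R) (n:=n) (L:=L) (p:=p) c).
  by rewrite /tb /tbn -(rmorph_nat (real_complex R)) /= ler1n.
by rewrite -E ler10.
Qed.
End Straight.

(** * Reaching t = i from every nonsingular point near 0, for M = 2 *)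

Section Plane.
Context {R : realType}.
Local Notation C := R[i].
Variables (L p : nat) (eps : R).
Hypotheses (eps0 : 0 < eps) (epsL : eps * (2 * (4 + L)%:R) < 1).
Lemma ex_Re (b : idx 0 L p) : - (eps * 2) <= Re (ex eps b ord0) < 0.
case: b => [[j l]|[[]//]] /=; rewrite (ord1 j) eqxx. have bl : 0 < Re (beta (R := R) l) <= 2.
  have s2 : 0 < Num.sqrt (2 : R) <= 2.
    rewrite sqrtr_gt0 ltr0n /=. rewrite -{2}(ger0_norm (ler0n R 2)) -sqrtr_sqr ler_sqrt ?exprn_ge0 // expr2.
    by rewrite -[leLHS]mulr1 ler_pM2l ?ltr0n // ler1n.
  rewrite /beta; case: ifP => _ //; case: ifP => _; first by rewrite /= ltr01 ler1n. case: ifP => _; last by rewrite /= ltr01 ler1n.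
  by rewrite Re_realM mulr1.
have -> : Re (- eps%:C * beta l) = - (eps * Re (beta l)) by rewrite -rmorphN Re_realM mulNr. have /andP[b0 b2] := bl.
by rewrite lerN2 ler_pM2l // b2 oppr_lt0 mulr_gt0.
Qed.
Lemma ex_sum : 0 < Re (1 + \sum_(b : idx 0 L p) ex eps b ord0).
have -> : Re (1 + \sum_(b : idx 0 L p) ex eps b ord0) = 1 + \sum_(b : idx 0 L p) Re (ex eps b ord0).
  by rewrite ReD; congr (_ + _); apply: (big_morph (@complex.Re R) (@ReD R)).
have h : - (eps * (2 * (4 + L)%:R)) <= \sum_(b : idx 0 L p) Re (ex eps b ord0).
  apply: (@le_trans _ _ (\sum_(b : idx 0 L p) - (eps * 2))); last first.
    by apply: ler_sum => b _; have /andP[] := ex_Re b.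
  rewrite sumr_const card_sum !card_prod !card_ord mul1n mul0n addn0 mulNrn mulrA (mulr_natr (eps * 2)). exact: lexx.
by move: h epsL; set a := \sum_b _; set b := _ * _ => *; lra.
Qed.
Variables (N : nat) (w : 'rV[C]_2 -> 'M[C]_(2, N)) (r1 Bw Lw : R).
Hypotheses (r10 : 0 < r1) (Bw0 : 0 <= Bw) (Lw0 : 0 <= Lw).
Hypothesis wfd : forall x, vn x < r1 -> forall i c, exists g, fd (fun y => w y i c) x g.
Hypothesis wB : forall x, vn x < r1 -> forall i c, nc (w x i c) <= Bw.
Hypothesis wL : forall x y, vn x < r1 -> vn y < r1 -> forall i c,
  nc (w x i c - w y i c) <= Lw * vn (x - y).
Local Notation reach := (reach (tb (n:=0) (L:=L) (p:=p)) (ex eps) w (Om r1)).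
(** From the closed upper half-plane the radius leads to i directly. From the lower one it leads to
    -i, and the segment from there to i crosses the real axis at 0, away from the poles, which are
    at least 1. *)
Lemma escape : somepos K, forall t0 (eta : 'rV[C]_1) z, (forall b, t0 != tb (n:=0) (L:=L) (p:=p) b) -> nz eta ->
  K * vn (pt t0 eta) < r1 -> vn z + K * vn (pt t0 eta) < r1 ->
  exists eta' z', [/\ reach (t0, eta, z) ('i, eta', z'), vn eta' <= K * vn (pt t0 eta) &
    vn z' <= vn z + K * vn (pt t0 eta)].
have [K K0 HK] := escape_half (@tb_real R 0 L p) (fun b => (andP (ex_Re b)).2) ex_sum Bw0 wfd wB.
have [lam [D [Pok D0 D1]]] := straight_piece (seg_ii (R := R) (n:=0) (L:=L) (p:=p)).
have [K2 K20 HK2] := small_step eps0 r10 Bw0 Lw0 wfd wB wL Pok D0 D1. set P := Piece _ _ _ _ in Pok HK2.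
pose nv := vn (nuv (ex eps) P (- 'i) 'i). have nv0 : 0 <= nv := vn_ge0 _. have KK2 : 0 <= K * K2 by pos. have Knv : 0 <= K * nv by pos.
exists (K + K * K2 + K * nv); first by rewrite ltr_wpDr // ltr_wpDr. move=> t0 eta z ht neta hX hzX; set X := vn (pt t0 eta) in hX hzX *.
have X0 : 0 <= X := vn_ge0 _. have XK : K * X + K * K2 * X + K * nv * X = (K + K * K2 + K * nv) * X by rewrite !mulrDl.
have p1 : 0 <= K * X by pos. have p2 : 0 <= K * K2 * X by pos. have p3 : 0 <= K * nv * X by pos. have [hI|hI] := leP 0 (Im t0).
  have [||||eta' [z' [h1 h2 h3]]] := HK 'i t0 eta z (or_introl erefl) ht _ _ neta.
  - by apply/eqP => /(congr1 Im); rewrite ImD /= => E; move: hI E; lra.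
  - case: t0 hI {ht hX hzX X X0 XK p1 p2 p3} => x y /= hI; rewrite ler_sqrt ?addr_ge0 ?sqr_ge0 //.
    by rewrite !subr0 addr0 lerD2l -subr_ge0; rewrite (_ : _ - _ = 4 * y); [rewrite mulr_ge0|ring].
  - by move: hX; rewrite -XK -/X; lra.
  - by move: hzX; rewrite -XK -/X; set v := vn z; lra.
  exists eta', z'; split=> //; rewrite -XK; first by apply: le_trans h2 _; rewrite -/X; lra.
  by apply: le_trans h3 _; rewrite -/X; set v := vn z; lra.
have [||||eta' [z' [h1 h2 h3]]] := HK (- 'i) t0 eta z (or_intror erefl) ht _ _ neta.
- by apply/eqP => /(congr1 Im); rewrite ImD /= => E; move: hI E; lra.
- case: t0 hI {ht hX hzX X X0 XK p1 p2 p3} => x y /= hI; rewrite ler_sqrt ?addr_ge0 ?sqr_ge0 //.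
  rewrite !oppr0 !addr0 opprK lerD2l -subr_ge0; rewrite (_ : _ - _ = 4 * (- y)); [rewrite mulr_ge0 // oppr_ge0 ltW //|ring].
- by move: hX; rewrite -XK -/X; lra.
- by move: hzX; rewrite -XK -/X; set v := vn z; lra. rewrite -/X in h2 h3. have n' := reach_nz h1 neta.
have K2e : K2 * vn eta' <= K * K2 * X by rewrite [K * K2]mulrC -mulrA ler_pM2l.
have c1 : K2 * vn eta' < r1 by apply: le_lt_trans K2e _; move: hX; rewrite -XK; lra. have [_ b2 b3] := HK2 eta' c1.
have c2 : vn z' + K2 * vn eta' < r1.
  by apply: le_lt_trans (lerD h3 K2e) _; move: hzX; rewrite -XK; set v := vn z; lra.
have hs := b3 n' z' c2.
exists (act (nuv (ex eps) P (- 'i) 'i) eta'), (z' + inc (tb (n:=0) (L:=L) (p:=p)) (ex eps) w P (- 'i) eta' 'i); split.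
- by apply: rt_trans h1 _; apply: rt_step.
- apply: le_trans (act_le _ _) _; rewrite -XK -/nv. apply: (@le_trans _ _ (K * nv * X)); last by lra.
  by rewrite [K * nv]mulrC -mulrA ler_wpM2l.
apply: le_trans (vnD _ _) _; apply: le_trans (lerD h3 (le_trans b2 K2e)) _; rewrite -XK. by set v := vn z; lra.
Qed.
End Plane.

(** * Density in the sense of the statement, locally and for M = 2 *)

Section Charts.
Context {R : realType}.
Local Notation C := R[i].
Definition chart n N (om : one_forms R n.+2 N) (h : first_integral om) L p (eps r1 Bw Lw rho : R) :=
  let w := Defs.form om in
  [/\ [/\ 0 < r1, 0 < rho, 0 <= Bw & 0 <= Lw],
   [/\ forall x, vn x < r1 -> forall i c, exists g, fd (fun y => w y i c) x g,
       forall x, vn x < r1 -> forall i c, nc (w x i c) <= Bw &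
       forall x y, vn x < r1 -> vn y < r1 -> forall i c, nc (w x i c - w y i c) <= Lw * vn (x - y)],
   (forall x, vn x < r1 -> HD_V h x),
   (forall a b, reach (@tb R n L p) (ex eps) w (Om r1) a b ->
      HD h (row_mx (pt a.1.1 a.1.2) a.2) = HD h (row_mx (pt b.1.1 b.1.2) b.2)) &
   forall a0 a1 z0 z1, nz a0 -> nz a1 -> vn a0 < rho -> vn a1 < rho -> vn z0 < rho -> vn z1 < rho ->
    HD h (row_mx (pt 'i a0) z0) = HD h (row_mx (pt 'i a1) z1) ->
    Q (@rch R n L p eps N w r1) a0 z0 a1 z1].
Lemma chart_dense n N (om : one_forms R n.+2 N) (h : first_integral om) L p (eps r1 Bw Lw rho : R)
    (Delta : set 'rV[C]_(n.+2 + N)) : chart h L p eps r1 Bw Lw rho ->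
  (forall q, vn (lsubmx q) < r1 -> vn (rsubmx q) < r1 -> Delta q) ->
  dense_leaves_on h (Zf L p eps om) Delta (AA L p eps om r1 rho).
move=> [[r10 rho0 Bw0 Lw0] [wfd wB wL] hV hr hd] hD; split.
- exact: (AA_open r10 wfd Bw0 Lw0 wB wL).
- exact: AA_nonempty.
- by move=> q /AA_Om[h1 h2]; apply: hD.
- by move=> q /AA_Om[h1 _]; split; [apply: HD_V_dom; apply: hV|apply: hV].
- exact: (AA_leaves r10 wfd hV Bw0 Lw0 wB wL hr hd).
Qed.
Definition singular n N L p (A : set 'rV[C]_n.+2) : set 'rV[C]_(n.+2 + N) :=
  [set q | A (lsubmx q) /\ (lsubmx q 0 (i0 n) = 0 \/ exists b, LL (@tb R n L p) b (lsubmx q) = 0)].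
(** [escape] brings every point near 0 and off the singular set into the small ball over i, so that
    [AA] fills a neighbourhood of 0 outside that set. *)
Lemma plane_dense N (om : one_forms R 2 N) (h : first_integral om) L p (eps r1 Bw Lw rho : R)
    (Delta : set 'rV[C]_(2 + N)) : 0 < eps -> eps * (2 * (4 + L)%:R) < 1 -> chart h L p eps r1 Bw Lw rho ->
  (forall q, vn (lsubmx q) < r1 -> vn (rsubmx q) < r1 -> Delta q) ->
  exists2 B : set 'rV[C]_(2 + N), nbhs (0 : 'rV[C]_(2 + N)) B &
    dense_leaves_on h (Zf L p eps om) Delta (B `\` @singular 0 N L p (dom om)).
move=> e0 eL ch hD; have [[r10 rho0 Bw0 Lw0] [wfd wB wL] hV hr hd] := ch. have [K K0 HK] := escape p e0 eL r10 Bw0 Lw0 wfd wB wL.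
set S := @singular 0 N L p (dom om); set A := AA L p eps om r1 rho. have AS q : A q -> ~ S q.
  move=> [a oa ->] [_]; rewrite /st row_mxKl. have [ne _ _] := oa; have ot := okS_off oa.
  case=> [|[b]]; first by rewrite mxE th_i0 mul1r; apply/eqP; exact: ne. by rewrite LL_pt; apply/eqP; rewrite mulf_neq0 ?ne // subr_eq0.
pose m := minr r1 rho; have m0 : 0 < m by pos. pose rr := m / (2 * (K + 1)); have rr0 : 0 < rr by pos.
have rrm : (K + 1) * rr = m / 2 by rewrite /rr; field; rewrite gt_eqF // ltr_wpDl // ltW. have mr : m <= r1 by rewrite ge_min lexx.
(* Adding the part of S near 0 to A makes a neighbourhood of 0 whose complement of S is still
   exactly A. *)
have mrho : m <= rho by rewrite ge_min lexx orbT. pose B := A `|` (S `&` [set q | vn q < rr]). exists B; last first.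
  have -> : B `\` S = A.
    apply/seteqP; split=> q; first by case=> -[//|[Sq _] /(_ Sq)]. by move=> Aq; split; [left|exact: AS].
  exact: (chart_dense ch).
apply/nbhs_vn; exists rr => // q; rewrite subr0 => hq. have [Sq|nS] := pselect (S q); first by right.
left; set x := lsubmx q in nS *; set z := rsubmx q. have [hx hz] := vn_sub q; rewrite -/x -/z in hx hz.
have xm : vn x < rr := le_lt_trans hx hq; have zm : vn z < rr := le_lt_trans hz hq. have r1x : rr <= m / 2.
  by rewrite -rrm mulrDl mul1r lerDr mulr_ge0 // ltW.
have xr : vn x < r1 by apply: lt_le_trans xm _; apply: le_trans r1x _; lra.
have zr : vn z < r1 by apply: lt_le_trans zm _; apply: le_trans r1x _; lra. have dx : dom om x by apply: HD_V_dom; apply: hV.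
have x0 : x 0 (i0 0) != 0 by apply/eqP => E; apply: nS; split=> //; left.
have LLx b : LL (@tb R 0 L p) b x != 0 by apply/eqP => E; apply: nS; split=> //; right; exists b.
have xE := pt_param x0; set t := x 0 (i1 0) / x 0 (i0 0) in xE; set eta := (\row_j _) in xE. have ne : nz eta.
  move=> j; rewrite mxE (_ : lift (i1 0) j = i0 0) //; apply/val_inj; rewrite /= (ord1 j) //.
have ot b : t != tb (n:=0) (L:=L) (p:=p) b.
  by have := LLx b; rewrite xE LL_pt; apply: contraNneq => ->; rewrite subrr mul0r.
have Kx : K * vn x < m / 2.
  rewrite -rrm; apply: le_lt_trans (_ : K * rr < _); first by rewrite ler_wpM2l // ltW. by rewrite ltr_pM2r // ltrDl.
have Kx2 : vn z + K * vn x < m / 2.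
  rewrite -rrm mulrDl mul1r addrC; apply: ler_ltD => //. by rewrite ler_wpM2l // ltW.
have [||eta' [z' [h1 h2 h3]]] := HK t eta z ot ne.
- by rewrite -xE; apply: lt_le_trans Kx _; lra.
- by rewrite -xE; apply: lt_le_trans Kx2 _; lra. rewrite -xE in h2 h3. exists (t, eta, z); last by rewrite /st /= -xE hsubmxK.
split=> //=; first by split; rewrite ?(esym xE). exists ('i, eta', z'); split=> //=.
- by apply: le_lt_trans h2 _; apply: lt_le_trans Kx _; lra.
- by apply: le_lt_trans h3 _; apply: lt_le_trans Kx2 _; lra.
Qed.
End Charts.

(** * Density of the orbits of X in the whole space *)

Section Global.
Context {R : realType}.
Local Notation C := R[i].
Variables (n L p : nat) (eps : R).
Hypothesis eps0 : 0 < eps.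
Local Notation tb := (@tb R n L p).
Local Notation ex := (@ex R n L p eps).
Local Notation FF := (FF tb ex).
Local Notation off := (@off R n L p).
(** An empty family of forms: with N = 0 and no restriction on the region, the constructions above
    describe the orbits of X itself. *)
Definition wt (x : 'rV[C]_n.+2) : 'M[C]_(n.+2, 0) := 0.
Definition Tr (x : 'rV[C]_n.+2) (z : 'rV[C]_0) := True.
Local Notation stepT := (step tb ex wt Tr).
Local Notation reachT := (reach tb ex wt Tr).
Lemma nz_scalep (c : C) (a : 'rV[C]_n.+1) : c != 0 -> nz a -> nz (c *: a).
by move=> c0 na j; rewrite mxE mulf_neq0. Qed.
 Lemma actZ mu (c : C) (a : 'rV[C]_n.+1) : act mu (c *: a) = c *: act mu a.
by apply/rowP => j; rewrite !mxE mulrCA. Qed.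
 (** The motion is linear in eta, so rescaling frees reachability from the bounds under which it was
     obtained. *)
 Lemma step_rescale (c : C) Om a b : c != 0 -> step tb ex wt Om a b -> stepT (a.1.1, c *: a.1.2, 0) (b.1.1, c *: b.1.2, 0).
move=> c0 [q [D [zc [s0 [s1 [qok hD ne [aE bE _]]]]]]]. exists q, D, (fun=> 0), s0, s1; split=> //=; first exact: nz_scalep. split.
- by rewrite {1}aE.
- by rewrite bE /= actZ. by move=> s _; split=> // -[].
Qed.
Lemma reach_rescale (c : C) Om a b : c != 0 -> reach tb ex wt Om a b ->
  reachT (a.1.1, c *: a.1.2, 0) (b.1.1, c *: b.1.2, 0).
move=> c0; elim=> [x y h|x|x y z _ IH1 _ IH2].
- by apply: rt_step; exact: step_rescale h.
- exact: rt_refl. exact: rt_trans IH1 IH2.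
Qed.
Lemma lin_step a b : (forall s, in01 s -> forall c, seg a b s != tb c) -> exists2 mu : 'rV[C]_n.+1, nz mu &
  forall eta, nz eta -> reachT (a, eta, 0) (b, act mu eta, 0).
move=> h; have [lam [D [ok Da Db]]] := straight_piece h. set P := Piece _ _ _ _ in ok.
exists (nuv ex P a b) => [|eta ne]; first exact: nz_nuv. apply: rt_step; exists P, D, (fun=> 0), a, b; split=> //.
  by case: ok.
by split=> // s _; split=> // -[].
Qed.
Lemma to_i t : off t -> exists2 mu : 'rV[C]_n.+1, nz mu & forall eta, nz eta -> reachT (t, eta, 0) ('i, act mu eta, 0).
move=> ot; have [hI|hI] := leP 0 (Im t).
  by apply: lin_step; apply: seg_off ot; left; rewrite /= ltr01.
have [mu nmu h1] : exists2 mu : 'rV[C]_n.+1, nz mu & forall eta, nz eta -> reachT (t, eta, 0) (- 'i, act mu eta, 0).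
  by apply: lin_step; apply: seg_off ot; right; rewrite /= oppr_lt0 ltr01 ltW.
have [mu' nmu' h2] : exists2 mu : 'rV[C]_n.+1, nz mu & forall eta, nz eta -> reachT (- 'i, eta, 0) ('i, act mu eta, 0).
  by apply: lin_step; exact: seg_ii.
exists (act mu' mu) => [|eta ne]; first exact: nz_act. rewrite -actA; apply: rt_trans (h1 _ ne) (h2 _ _); exact: nz_act.
Qed.
(** Germs act near 0 only: a is scaled down into the domain of the germ of mu, moved, and scaled
    back. *)
Lemma rotate_dense (a nu : 'rV[C]_n.+1) (e : R) : nz a -> nz nu -> 0 < e ->
  exists2 mu, vn (mu - nu) < e & reachT ('i, a, 0) ('i, act mu a, 0).
move=> na nn e0. have t1 (x : 'rV[C]_n.+2) : vn x < 1 -> forall i (c : 'I_0), exists g, fd (fun y => wt y i c) x g by move=> _ i c; case: c.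
have t2 (x : 'rV[C]_n.+2) : vn x < 1 -> forall i (c : 'I_0), nc (wt x i c) <= 0 by move=> _ i c; case: c.
have t3 (x y : 'rV[C]_n.+2) : vn x < 1 -> vn y < 1 -> forall i (c : 'I_0), nc (wt x i c - wt y i c) <= 0 * vn (x - y) by move=> _ _ i c; case: c.
have [mu [F [[K [nmu K0 hK]] hmu]]] := @dense_mult R n L p eps eps0 0 wt 1 0 0 ltr01 (lexx _) (lexx _) t1 t2 t3 nu e nn e0. exists mu => //.
have va : 0 < 2 * K * (vn a + 1) by pos. pose c : R := (2 * K * (vn a + 1))^-1. have c0 : 0 < c by pos.
have cC : c%:C != 0 :> C by rewrite -normc_gt0 normc_real gtr0_norm. have Kc : K * vn (c%:C *: a) < 1.
  rewrite vnZ normc_real gtr0_norm // /c mulrCA mulrC ltr_pdivrMr // mul1r -mulrA mulrCA ltr_pM2l //. by have := vn_ge0 a; lra.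
have [_ hz] := hK _ (nz_scalep cC na) Kc. have := hz 0; rewrite vn0 add0r => /(_ Kc) hr. have ic : c%:C^-1 != 0 :> C by rewrite invr_eq0.
have := reach_rescale ic hr; rewrite /= actZ !scalerA mulVf // !scale1r; exact.
Qed.
Lemma step_leafT a b : stepT a b -> leaf_through setT FF (pt a.1.1 a.1.2) (pt b.1.1 b.1.2).
move=> [q [D [zc [s0 [s1 [qok [oD cD D0 D1 Dd] ne [-> -> _]]]]]]] /=. have ne' : nz a.1.2 by exact: ne.
have -> : pt (tau q s0) a.1.2 = xl ex q s0 a.1.2 s0 by rewrite xl0. rewrite -xlE.
apply: (@leaf_curve R _ setT FF (xl ex q s0 a.1.2) (kap tb ex q s0 a.1.2) D) => // s Ds.
  split; [|exact: kap_neq0 (Dd _ Ds)|exact: hol_kap (Dd _ Ds)]. by rewrite -xdE //; [exact: (cdv_xl ex qok s0 a.1.2 (Dd _ Ds))|exact: Dd].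
split=> //; rewrite xlE; apply: FF_neq0; first by apply: nz_act => //; exact: nz_nuv.
by move=> b'; case: qok => _ _ hq; have [_ _ _ /(_ b')[]] := hq _ (Dd _ Ds).
Qed.
Lemma reach_leafT a b : reachT a b -> leaf_through setT FF (pt a.1.1 a.1.2) (pt b.1.1 b.1.2).
elim=> [x y|x|x y z _ h1 _ h2]; [exact: step_leafT|exact: rt_refl|]. exact: rt_trans h1 h2.
Qed.
Definition regular (x : 'rV[C]_n.+2) := (forall i, i != i1 n -> x 0 i != 0) /\ forall b, LL tb b x != 0.
Lemma regular_pt x : regular x -> exists t eta, [/\ x = pt t eta, nz eta & off t].
move=> [hx hL]; have x0 : x 0 (i0 n) != 0 by apply: hx. have xE := pt_param x0; set t := _ / _ in xE; set eta := (\row_j _) in xE.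
exists t, eta; split=> //; first by move=> j; rewrite mxE hx // eq_sym neq_lift.
by move=> b; have := hL b; rewrite xE LL_pt; apply: contraNneq => ->; rewrite subrr mul0r.
Qed.
Lemma near_nonreal (y : 'rV[C]_n.+2) (r : R) : 0 < r -> exists t eta, [/\ vn (pt t eta - y) < r, nz eta & Im t != 0].
move=> r0. pose d := r / (2 * n.+3%:R); have d0 : 0 < d by pos. have dC : d%:C != 0 :> C by rewrite -normc_gt0 normc_real gtr0_norm.
(* Zero entries are replaced by d, and a real ratio is then pushed off the real axis by a step small
   against eta_0. *)
pose eta : 'rV[C]_n.+1 := \row_j (let v := y 0 (lift (i1 n) j) in if v == 0 then d%:C else v). have ne : nz eta.
  move=> j; rewrite mxE; have [->|h] := eqVneq (y 0 (lift (i1 n) j)) 0; first by rewrite /= eqxx; exact: dC. by rewrite /= (negPf h).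
have e0 : eta 0 ord0 != 0 := ne ord0. pose t0 := y 0 (i1 n) / eta 0 ord0. have v1 : 0 < 1 + nc (eta 0 ord0) by pos.
pose c := d / (1 + nc (eta 0 ord0)); have c0 : 0 < c by pos. pose t := if Im t0 == 0 then t0 + c%:C * 'i else t0.
exists t, eta; split=> //; last first.
  rewrite /t; case: ifP => [/eqP E|/negbT //]. by rewrite ImD E add0r Im_realM /= mulr1 gt_eqF.
apply: (@le_lt_trans _ _ (n.+2%:R * d)); last first.
  rewrite /d mulrA ltr_pdivrMr ?mulr_gt0 ?ltr0Sn // mulrC ltr_pM2l //. have : n.+2%:R < n.+3%:R :> R by rewrite ltr_nat.
  by have : 0 <= n.+3%:R :> R by []; lra.
apply: vn_le => i; rewrite !mxE /th. have [->|ii] := eqVneq i (i1 n); last first.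
  rewrite mul1r lift_sg //; case: ifP => [/eqP ->|_]; last by rewrite subrr normc0 ltW. by rewrite subr0 normc_real gtr0_norm.
have yE : y 0 (i1 n) = t0 * eta 0 ord0 by rewrite divfK. rewrite sg1 -[X in t * X](_ : eta 0 ord0 = _); last by rewrite mxE.
rewrite yE -mulrBl normcM /t; case: ifP => _; last by rewrite subrr normc0 mul0r ltW.
rewrite addrC addKr normcM normc_real gtr0_norm // normc_i mulr1 /c mulrAC ler_pdivrMr //. by rewrite ler_pM2l // lerDr.
Qed.
(** The target is approximated by a point over a nonreal t1. Both points are moved over i, a dense
    multiplier nearly matches their eta, and the path of the target is followed backwards. *)
Lemma global_dense x : regular x -> FF x != 0 /\ dense (leaf_through setT FF x).
move=> /regular_pt[t [eta [-> ne ot]]]; split; first exact: FF_neq0. move=> O [y Oy] /open_vn /(_ y Oy)[r r0 hr].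
have r2 : 0 < r / 2 by rewrite divr_gt0. have [t1 [eta1 [hy ne1 ht1]]] := near_nonreal y r2. have [mu1 nm1 h1] := to_i ot.
have [mu2 nm2 h2] := to_i (off_nonreal ht1). pose a := act mu1 eta; have na : nz a := nz_act nm1 ne.
pose nu : 'rV[C]_n.+1 := \row_j (act mu2 eta1 0 j / a 0 j).
have nn : nz nu by move=> j; rewrite mxE mulf_neq0 ?invr_eq0 ?na //; apply: nz_act. pose im2 : 'rV[C]_n.+1 := \row_j (mu2 0 j)^-1.
have nim2 : nz im2 by move=> j; rewrite mxE invr_eq0. pose kk := n.+2%:R * ((1 + nc t1) * (vn im2 * vn a)) + 1. have kk0 : 0 < kk.
  by rewrite ltr_wpDl // mulr_ge0 // mulr_ge0 ?addr_ge0 // mulr_ge0.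
have e0 : 0 < r / 2 / kk by rewrite divr_gt0. have [mu hmu hrot] := rotate_dense na nn e0. pose eta2 := act im2 (act mu a).
have nmu : nz (act mu a) := reach_nz hrot na. have n2 : nz eta2 := nz_act nim2 nmu.
have E2 : act mu2 eta2 = act mu a by apply/rowP => j; rewrite !mxE mulrA divff ?mul1r. have r12 : reachT (t, eta, 0) (t1, eta2, 0).
  apply: rt_trans (h1 _ ne) _. apply: rt_trans hrot _. by apply: reach_sym; rewrite -E2; apply: h2.
exists (pt t1 eta2); split; last exact: reach_leafT r12. apply: hr; rewrite -(subrK (pt t1 eta1) (pt t1 eta2)) -addrA.
apply: le_lt_trans (vnD _ _) _; rewrite [r]splitr; apply: ltrD => //. have -> : pt t1 eta2 - pt t1 eta1 = pt t1 (act im2 (act (mu - nu) a)).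
  apply/rowP => i; rewrite !mxE -mulrBr; congr (_ * _). have := na (sg i); rewrite mxE.
  move: (mu1 0 _ * eta 0 _) (mu2 0 (sg i)) (nm2 (sg i)) => A M hM hA; field. by rewrite hM hA.
have vp : vn (pt t1 (act im2 (act (mu - nu) a))) <= n.+2%:R * ((1 + nc t1) * (vn im2 * (vn (mu - nu) * vn a))).
  apply: vn_le => i; rewrite mxE normcM; apply: ler_pM => //.
    by rewrite /th; case: ifP => _; rewrite ?normc1 ?lerDr ?lerDl.
  apply: le_trans (vn_coord _ _) _; apply: le_trans (act_le _ _) _. by rewrite ler_wpM2l // act_le.
apply: le_lt_trans vp _. rewrite (_ : n.+2%:R * _ = (kk - 1) * vn (mu - nu)); last by rewrite /kk addrK; ring.
apply: (@le_lt_trans _ _ (kk * vn (mu - nu))).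
  by rewrite ler_wpM2r // lerBlDr lerDl.
by rewrite -ltr_pdivlMl // mulrC.
Qed.
End Global.

(** * Invariant hyperplanes *)

Section Invariance.
Context {R : realType}.
Local Notation C := R[i].
Lemma hol_prod (I : Type) (r : seq I) (P : pred I) (f : I -> C -> C) z : (forall i, exists d, cd (f i) z d) ->
  exists d, cd (fun u => \prod_(i <- r | P i) f i u) z d.
move=> h; elim: r => [|i r [d IH]].
  by exists 0; apply: (@cd_ext _ (fun=> 1) _ _ _ _ _ erefl (cd_cst 1 z)) => u; rewrite big_nil.
have [e he] := h i; have [Pi|Pi] := boolP (P i).
  eexists; apply: (@cd_ext _ _ _ _ _ _ _ erefl (cdM he IH)) => u; by rewrite big_cons Pi.
by exists d; apply: (@cd_ext _ _ _ _ _ _ _ erefl IH) => u; rewrite big_cons (negPf Pi).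
Qed.
Lemma hol_sum (I : finType) (f : I -> C -> C) z : (forall i, exists d, cd (f i) z d) ->
  exists d, cd (fun u => \sum_i f i u) z d.
by move=> /choice[d hd]; eexists; apply: cd_sum. Qed.
 (** With a local primitive K of k as integrating factor, $f\,e^{-K}$ is locally constant. *)
 Lemma zero_flow (D : set C) (f k : C -> C) s t : open D -> connected D -> D s -> D t ->
  (forall u, D u -> cd f u (f u * k u)) -> (forall u, D u -> exists d, cd k u d) -> f s = 0 -> f t = 0.
move=> oD cD Ds Dt cf ck fs. refine (@connected_local R (fun u => f u = 0) D s t oD cD Ds Dt fs _) => u Du.
have [r r0 hr] := (open_op D).1 oD u Du. pose b v := nc (v - u) < r. have bc : cvx b := @ball_cvx _ u r.
have [K hK] : exists K, forall v, b v -> cd K v (k v).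
  apply: primitive => //; first exact: ball_op. by move=> v /hr /ck.
pose F v := f v * cexp (- K v). have u0 : b u by rewrite /b subrr normc0. have cst v : b v -> F v = F u.
  move=> bv; apply/eqP; rewrite -subr_eq0 -normc_eq0 eq_le normc_ge0 andbT.
  rewrite -[leRHS](mul0r (nc (v - u))); apply: (@cd_mvt _ F (fun=> 0)) => a a01; last by rewrite normc0.
  have ba : b (seg u v a) by apply: bc. apply: (@cd_ext _ _ _ _ _ _ _ _ (cdM (cf _ (hr _ ba)) (cd_comp (cdN (hK _ ba)) (cd_cexp _)))) => //.
  by ring.
exists r => // v bv; have := cst v bv; rewrite /F => E. split=> z0.
  move/eqP: E; rewrite z0 mul0r mulf_eq0 (negPf (cexp_neq0 _)) orbF => /eqP; exact.
by move/esym/eqP: E; rewrite z0 mul0r mulf_eq0 (negPf (cexp_neq0 _)) orbF => /eqP; exact.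
Qed.
Variables (n : nat) (B : finType) (tb : B -> C) (ex : B -> 'I_n.+1 -> C).
Local Notation FF := (FF tb ex).
Lemma cd_LL b (G : C -> 'rV[C]_n.+2) u d : cdv G u d -> cd (fun v => LL tb b (G v)) u (LL tb b d).
by move=> h; apply: cdB (h (i1 n)) (cdZ _ (h (i0 n))). Qed.
 Lemma hol_prodLL (P : pred B) (G : C -> 'rV[C]_n.+2) u d : cdv G u d -> exists e, cd (fun v => \prod_(b | P b) LL tb b (G v)) u e.
by move=> h; apply: hol_prod => b; exists (LL tb b d); apply: cd_LL. Qed.
 Lemma hol_qq j (G : C -> 'rV[C]_n.+2) u d : cdv G u d -> exists e, cd (fun v => qq tb ex j (G v)) u e.
move=> h; apply: (hol_sum (f := fun b v => ex b j * \prod_(b' | b' != b) LL tb b' (G v))) => b.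
by have [e he] := hol_prodLL (fun b' => b' != b) h; exists (ex b j * e); exact: (cdZ (ex b j) he).
Qed.
Definition form_at (f : 'I_n.+1 + B) (x : 'rV[C]_n.+2) : C :=
  match f with inl j => x 0 (lift (i1 n) j) | inr b => LL tb b x end.
(** Along the field the derivative of $L_b$ is $q_0L_b+\Pi$, and $L_b$ divides $\Pi$. *)
Lemma LL_FF b x : LL tb b (FF x) = LL tb b x * (qq tb ex ord0 x + \prod_(b' | b' != b) LL tb b' x).
rewrite /LL !mxE sg0 sg1 /thd eqxx /= -/(LL tb b x) /PI (bigD1 b) //= -/(LL tb b x). rewrite {2 3}/LL /LL; ring.
Qed.
Lemma form_flow (D : set C) (G : C -> 'rV[C]_n.+2) s t f : open D -> connected D -> D s -> D t ->
  (forall u, D u -> cdv G u (FF (G u))) -> form_at f (G s) = 0 -> form_at f (G t) = 0.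
move=> oD cD Ds Dt hG; case: f => [j|b] /=.
  apply: (@zero_flow D (fun u => G u 0 (lift (i1 n) j)) (fun u => qq tb ex (sg (lift (i1 n) j)) (G u))) => // u Du.
    apply: (@cd_ext _ _ _ _ _ _ _ _ (hG u Du (lift (i1 n) j))) => //. by rewrite mxE /thd eq_sym (negPf (neq_lift _ _)) mul0r addr0.
  exact: hol_qq (hG u Du).
apply: (@zero_flow D (fun u => LL tb b (G u)) (fun u => qq tb ex ord0 (G u) + \prod_(b' | b' != b) LL tb b' (G u))) => // u Du.
  by rewrite -LL_FF; apply: cd_LL; apply: hG.
have [d1 h1] := hol_qq ord0 (hG u Du); have [d2 h2] := hol_prodLL (fun b' => b' != b) (hG u Du). by exists (d1 + d2); apply: cdD.
Qed.
Definition form_vec (f : 'I_n.+1 + B) : 'cV[C]_n.+2 :=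
  match f with inl j => delta_mx (lift (i1 n) j) 0 | inr b => delta_mx (i1 n) 0 - tb b *: delta_mx (i0 n) 0 end.
Lemma mul_delta (x : 'rV[C]_n.+2) i : (x *m (delta_mx i 0 : 'cV[C]_n.+2)) 0 0 = x 0 i.
by rewrite -colE mxE. Qed.
 Lemma form_vecE f x : (x *m form_vec f = 0) <-> form_at f x = 0.
have -> : x *m form_vec f = (form_at f x)%:M.
  apply/matrixP => i j; rewrite !ord1 [RHS]mxE eqxx mulr1n; case: f => [k|b] /=; first exact: mul_delta.
  have E (A A' : 'M[C]_1) c : (A - c *: A') 0 0 = A 0 0 - c * A' 0 0 by rewrite !mxE. by rewrite mulmxBr -scalemxAr E !mul_delta.
split=> [/matrixP/(_ 0 0)|->]; first by rewrite !mxE eqxx mulr1n. by apply/matrixP => i j; rewrite !mxE mul0rn.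
Qed.
Lemma form_vec_neq0 f : form_vec f != 0.
apply/eqP => E; case: f E => [j|b] E.
  by have /matrixP/(_ (lift (i1 n) j) 0) := E; rewrite !mxE !eqxx /=; apply/eqP; exact: oner_neq0.
have /matrixP/(_ (i1 n) 0) := E; rewrite !mxE !eqxx /= mulr0 subr0; apply/eqP; exact: oner_neq0.
Qed.
Lemma forms_card : exists k, #|{: 'I_n.+1 + B}| = k.+1.
by exists (n + #|B|)%N; rewrite card_sum card_ord. Qed.
 Lemma hyperplane_list : exists (k : nat) (l : 'I_k.+1 -> 'cV[C]_n.+2),
  (forall i, l i != 0) /\ forall x, hyperplanes l x <-> exists f, form_at f x = 0.
have [k hk] := forms_card. exists k, (fun i => form_vec (enum_val (cast_ord (esym hk) i))); split=> [i|x]; first exact: form_vec_neq0.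
split=> [[i /form_vecE h]|[f /form_vecE h]]; first by exists (enum_val (cast_ord (esym hk) i)).
by exists (cast_ord hk (enum_rank f)); rewrite cast_ordK enum_rankK.
Qed.
Lemma form_invariant (S : set 'rV[C]_n.+2) : (forall x, S x <-> exists f, form_at f x = 0) ->
  invariant_by setT FF S.
move=> hS p _ Sp q hq; elim: hq Sp => [x y [D [phi [s [t [oD cD [Ds Dt] [<- <-] h]]]]]|//|x y z _ h1 _ h2 /h1/h2 //].
move=> /hS[f fx]; apply/hS; exists f; apply: (form_flow oD cD Ds Dt _ fx) => u Du. by have [_ _ /is_derive_cdv] := h u Du.
Qed.
Lemma form_invariant_lift N (Om : set 'rV[C]_(n.+2 + N)) (Z : 'rV[C]_(n.+2 + N) -> 'rV[C]_(n.+2 + N))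
    (S : set 'rV[C]_(n.+2 + N)) : (forall q, lsubmx (Z q) = FF (lsubmx q)) ->
  (forall q, S q <-> Om q /\ exists f, form_at f (lsubmx q) = 0) -> invariant_by Om Z S.
move=> hZ hS p _ Sp q hq; elim: hq Sp => [x y [D [phi [s [t [oD cD [Ds Dt] [<- <-] h]]]]]|//|x y z _ h1 _ h2 /h1/h2 //].
move=> /hS[_ [f fx]]; apply/hS; split; first by have [] := h t Dt.
exists f; apply: (form_flow (G := fun u => lsubmx (phi u)) oD cD Ds Dt _ fx) => u Du.
have [_ _ /is_derive_cdv hd] := h u Du; rewrite -hZ => i.
by rewrite mxE; apply: (@cd_ext _ (fun u => phi u 0 (lshift N i))) (hd _) => // v; rewrite mxE.
Qed.
End Invariance.

(** * Closure properties of holomorphic functions *)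

Section Holomorphy.
Context {R : realType}.
Local Notation C := R[i].
Variable m : nat.
Definition hf (F : 'rV[C]_m -> C) x := exists g, fd F x g.
Lemma hf_add F G x : hf F x -> hf G x -> hf (fun y => F y + G y) x.
by move=> [f hF] [g hG]; eexists; exact: fd_add hF hG. Qed.
 Lemma hf_mul F G x : hf F x -> hf G x -> hf (fun y => F y * G y) x.
by move=> [f hF] [g hG]; eexists; exact: fd_mul hF hG. Qed.
 Lemma hf_ext F G x : F =1 G -> hf F x -> hf G x.
by move=> E [f hF]; exists f; exact: fd_ext E hF. Qed.
 Lemma hf_cst a x : hf (fun=> a) x.
by exists 0; exact: fd_cst. Qed.
 Lemma hf_coord i x : hf (fun y => y 0 i) x.
by eexists; exact: fd_coord. Qed.
 Lemma hf_sum (I : Type) (r : seq I) (P : pred I) (F : I -> 'rV[C]_m -> C) x : (forall i, hf (F i) x) ->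
  hf (fun y => \sum_(i <- r | P i) F i y) x.
move=> h; elim: r => [|i r IH]; first by apply: hf_ext (hf_cst 0 x) => y; rewrite big_nil. have [Pi|Pi] := boolP (P i).
  by apply: hf_ext (hf_add (h i) IH) => y; rewrite big_cons Pi.
by apply: hf_ext IH => y; rewrite big_cons (negPf Pi).
Qed.
Lemma hf_prod (I : Type) (r : seq I) (P : pred I) (F : I -> 'rV[C]_m -> C) x : (forall i, hf (F i) x) ->
  hf (fun y => \prod_(i <- r | P i) F i y) x.
move=> h; elim: r => [|i r IH]; first by apply: hf_ext (hf_cst 1 x) => y; rewrite big_nil. have [Pi|Pi] := boolP (P i).
  by apply: hf_ext (hf_mul (h i) IH) => y; rewrite big_cons Pi.
by apply: hf_ext IH => y; rewrite big_cons (negPf Pi).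
Qed.
End Holomorphy.

(** * The polynomial field, its lift, and the singular hypersurface *)

Section FieldPolynomial.
Context {R : realType}.
Local Notation C := R[i].
Variables (n L p : nat) (eps : R).
Local Notation tb := (@tb R n L p).
Local Notation ex := (@ex R n L p eps).
Local Notation M := n.+2.
Lemma hf_LL b (x : 'rV[C]_M) : hf (LL tb b) x.
apply: hf_ext (hf_add (hf_coord (i1 n) x) (hf_mul (hf_cst (- tb b) x) (hf_coord (i0 n) x))) => y. by rewrite mulNr.
Qed.
Lemma hf_form (f : 'I_n.+1 + idx n L p) x : hf (form_at tb f) x.
by case: f => [j|b]; [exact: hf_coord|exact: hf_LL]. Qed.
 Lemma hf_FF i x : hf (fun y => FF tb ex y 0 i) x.
apply: (@hf_ext _ _ (fun y => y 0 i * qq tb ex (sg i) y + thd i * PI tb y)) => [y|]; first by rewrite mxE.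
apply: hf_add; apply: hf_mul; [exact: hf_coord| |exact: hf_cst|by apply: hf_prod => b; exact: hf_LL].
by apply: hf_sum => b; apply: hf_mul; [exact: hf_cst|by apply: hf_prod => b'; exact: hf_LL].
Qed.
Definition LLp (b : idx n L p) : mpoly M C :=
  mpolyX C (mnm1 (i1 n)) - mpolyC M (tb b) * mpolyX C (mnm1 (i0 n)).
Definition Xp : polynomial_field R M := [ffun i =>
  mpolyX C (mnm1 i) * (\sum_b mpolyC M (ex b (sg i)) * \prod_(b' | b' != b) LLp b') +
  mpolyC M (thd i) * \prod_b LLp b].
Lemma meval_LLp b (v : 'I_M -> C) : meval v (LLp b) = v (i1 n) - tb b * v (i0 n).
by rewrite mevalB mevalM mevalC !mevalXU. Qed.
 Lemma field_Xp x : field_at Xp x = FF tb ex x.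
apply/rowP => i; rewrite !mxE ffunE mevalD !mevalM !mevalC mevalXU; congr (_ * _ + _ * _).
  rewrite raddf_sum /=; apply: eq_bigr => b _; rewrite mevalM mevalC; congr (_ * _).
  by rewrite rmorph_prod; apply: eq_bigr => b' _; exact: meval_LLp.
by rewrite rmorph_prod; apply: eq_bigr => b' _; exact: meval_LLp.
Qed.
Variables (N : nat) (om : one_forms R M N).
Local Notation Z := (Zf L p eps om).
Lemma lift_Xp q : lift_field om Xp q = Z q.
by rewrite /lift_field field_Xp. Qed.
 Lemma Zf_holomorphic : holomorphic_on (cylinder (dom om)) Z.
move=> q dq; apply: fd_diff_mx => j. case: (split_ordP j) => k ->.
  have [g hg] := hf_FF k (lsubmx q); exists (row_mx g 0). by apply: fd_ext (cyl_fd hg) => y; rewrite row_mxEl.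
have [g hg] : hf (fun y => (FF tb ex y *m Defs.form om y) 0 k) (lsubmx q).
  apply: (@hf_ext _ _ (fun y => \sum_i FF tb ex y 0 i * Defs.form om y i k)) => [y|]; first by rewrite mxE.
  apply: hf_sum => i; apply: hf_mul; first exact: hf_FF. by eexists; exact: Gw_fd.
exists (row_mx g 0). by apply: fd_ext (cyl_fd hg) => y; rewrite row_mxEr.
Qed.
Definition wall (A : set 'rV[C]_M) : set 'rV[C]_(M + N) :=
  [set q | A (lsubmx q) /\ exists f, form_at tb f (lsubmx q) = 0].
Lemma open_cylinder (A : set 'rV[C]_M) : open A -> open (cylinder A : set 'rV[C]_(M + N)).
move=> /open_vn oA; apply/open_vn => q /oA[r r0 hr]; exists r => // y hy; apply: hr.
rewrite -raddfB; apply: le_lt_trans hy; exact: (vn_sub _).1.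
Qed.
(** The product of all the linear forms is a global equation. Its zero set has empty interior
    because points over nonreal t with nonzero eta are dense. *)
Lemma wall_hypersurface : hypersurface (cylinder (dom om)) (wall (dom om)).
split=> [q []//|q dq]. pose f (q : 'rV[C]_(M + N)) := \prod_(f : 'I_n.+1 + idx n L p) form_at tb f (lsubmx q).
exists (cylinder (dom om)), f; split=> //.
- by split=> //; apply: open_cylinder; exact: (@dom_open _ _ _ om).
- move=> y dy; have [g hg] : hf (fun x => \prod_(f : 'I_n.+1 + idx n L p) form_at tb f x) (lsubmx y).
    by apply: hf_prod => k; exact: hf_form.
  by have [] := fd_diff (cyl_fd hg).
- apply/seteqP; split=> y /=.
    move=> [[dy [k hk]] _]; split=> //; rewrite /f (bigD1 k) //= hk mul0r //.
  move=> [dy /eqP /prodf_eq0[k _ /eqP hk]]; split=> //. by split=> //; exists k.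
apply/seteqP; split=> // y /nbhs_vn[r r0 hr]. have [t [eta [hy ne ht]]] := near_nonreal (lsubmx y) r0.
have [] := hr (row_mx (pt t eta) (rsubmx y)) _.
  by rewrite -{2}(hsubmxK y) opp_row_mx add_row_mx vn_row_mx subrr vn0 addr0.
move=> [_ [k hk]] _; exfalso; move: hk; rewrite row_mxKl; apply/eqP; case: k => [j|b] /=.
  by have /rowP/(_ j) := pt_eta t eta; rewrite mxE => ->; exact: ne.
by rewrite LL_pt mulf_neq0 ?ne // subr_eq0; exact: off_nonreal.
Qed.
End FieldPolynomial.
Lemma wall_plane (R : realType) L p N (A : set 'rV[R[i]]_2) :
  wall (n := 0) L p (N := N) A = singular L p A.
have i0E : lift (i1 0) ord0 = i0 0 by apply/val_inj. apply/seteqP; split=> x [Ax hx]; split=> //.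
  by case: hx => -[j|b] /=; [rewrite (ord1 j) i0E; left|right; exists b].
by case: hx => [h|[b h]]; [exists (inl ord0); rewrite /= i0E|exists (inr b)].
Qed.

(** * Parameters of the field as a function of the forms *)

Section Decoding.
Context {R : realType}.
Local Notation C := R[i].
Variables (n N : nat).
(** The least L with D (p + 1) < L, for p = D. *)
Definition order_of (D : nat) := (D * D.+1).+1.
Definition param_of (q : nat) : R := q.+1%:R^-1.
Definition decode (k : nat) : nat * nat := odflt (0, 0)%N (unpickle k).
(** Every q from q0 on serves in [local_density]; adding 2 (4 + L) to q0 also makes eps small enough
    for the case M = 2, so that one field meets all the claims. *)
Lemma form_data : exists f : one_forms R n.+2 N -> nat * nat, forall om (h : first_integral om),
  param_of (f om).2 * (2 * (4 + order_of (f om).1)%:R) < 1 /\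
  forall R0 : R, 0 < R0 -> exists r1 Bw Lw rho, r1 <= R0 /\
    chart h (order_of (f om).1) (f om).1 (param_of (f om).2) r1 Bw Lw rho.
have /choice[f hf'] : forall om : one_forms R n.+2 N, exists Dq : nat * nat, forall (h : first_integral om),
  param_of Dq.2 * (2 * (4 + order_of Dq.1)%:R) < 1 /\ forall R0 : R, 0 < R0 -> exists r1 Bw Lw rho, r1 <= R0 /\
    chart h (order_of Dq.1) Dq.1 (param_of Dq.2) r1 Bw Lw rho.
  move=> om; have [D [q0 [D0 hq]]] := local_density om. pose q := (q0 + 2 * (4 + order_of D))%N. exists (D, q) => h /=; split.
    rewrite /param_of mulrC ltr_pdivrMr ?ltr0Sn // mul1r -natrM ltr_nat /q. by rewrite ltnS leq_addl.
  move=> R0 R00; have [r1 [Bw [Lw [rho [[h1 h2 h3 h4] hw hV hr [rho0 hd]]]]]] := hq q (leq_addr _ _) h R0 R00.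
  by exists r1, Bw, Lw, rho; split.
by exists f.
Qed.
End Decoding.

Theorem proposition5 (R : realType) (M N : nat) (hM : (2 <= M)%N)
    (hN : (1 <= N)%N) :
  exists (d : one_forms R M N -> nat)
         (X : one_forms R M N -> polynomial_field R M),
    finite_jet d X /\
    forall (omega : one_forms R M N) (h : first_integral omega),
    exists Z : 'rV[R[i]]_(M + N) -> 'rV[R[i]]_(M + N),
      [/\ holomorphic_on (cylinder (dom omega)) Z /\ legendrian omega Z,
          forall Delta : set 'rV[R[i]]_(M + N), nbhs (0 : 'rV[R[i]]_(M + N)) Delta ->
            exists A, dense_leaves_on h Z Delta A,
          M = 2%N ->
            exists S : set 'rV[R[i]]_(M + N),
              [/\ hypersurface (cylinder (dom omega)) S, S 0,
                  invariant_by (cylinder (dom omega)) Z S &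
                  forall Delta : set 'rV[R[i]]_(M + N), nbhs (0 : 'rV[R[i]]_(M + N)) Delta ->
                    exists2 B : set 'rV[R[i]]_(M + N), nbhs (0 : 'rV[R[i]]_(M + N)) B &
                      dense_leaves_on h Z Delta (B `\` S)],
          (forall p, cylinder (dom omega) p -> Z p = lift_field omega (X omega) p) /\
          (forall p q, cylinder (dom omega) p -> cylinder (dom omega) q ->
             lsubmx p = lsubmx q -> Z p = Z q) &
          exists (k : nat) (l : 'I_k.+1 -> 'cV[R[i]]_M),
            [/\ forall i, l i != 0,
                invariant_by setT (field_at (X omega)) (hyperplanes l) &
                forall p, ~ hyperplanes l p ->
                  field_at (X omega) p != 0 /\
                  dense (leaf_through setT (field_at (X omega)) p)]].
Proof.
case: M hM => [|[|n]] // _.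
have [f hf'] := form_data (R := R) n N.
(* The pair (D, q) determines the field. Its code is taken as the jet order, so that forms of equal
   order receive equal fields. *)
pose d om := pickle (f om).
pose X k : polynomial_field R n.+2 := Xp (R := R) n (order_of (decode k).1) (decode k).1 (param_of (decode k).2).
exists d, (fun om => X (d om)); split=> [om om' dE _|om h]; first by rewrite dE.
have [epsL hch] := hf' om h.
have Dd : decode (d om) = f om by rewrite /decode /d pickleK.
set D := (f om).1 in epsL hch; set q := (f om).2 in epsL hch.
have XE : X (d om) = Xp n (order_of D) D (param_of q) by rewrite /X Dd.
have eps0 : 0 < param_of q :> R by pos.
pose Z := Zf (order_of D) D (param_of q) om.
have FE : field_at (X (d om)) = FF (tb (n := n) (L := order_of D) (p := D)) (ex (param_of q)).
  by apply/funext => x; rewrite XE field_Xp.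
have small (Delta : set 'rV[R[i]]_(n.+2 + N)) : nbhs (0 : 'rV[R[i]]_(n.+2 + N)) Delta ->
    somepos R0, forall x, vn (lsubmx x) < R0 -> vn (rsubmx x) < R0 -> Delta x.
  move=> /nbhs_vn[r r0 hr]; exists (r / 2); first by pos.
  move=> x h1 h2; apply: hr; rewrite subr0 -(hsubmxK x) vn_row_mx [r]splitr; exact: ltrD.
exists Z; split.
- split; first exact: Zf_holomorphic.
  move=> x _; have : rsubmx (Z x) = lsubmx (Z x) *m Defs.form om (lsubmx x) by rewrite /Z /Zf row_mxKl row_mxKr.
  exact.
- move=> Delta /small[R0 R00 hD]; have [r1 [Bw [Lw [rho [r1R ch]]]]] := hch R0 R00.
  eexists; apply: (chart_dense ch) => x h1 h2; apply: hD; exact: lt_le_trans r1R.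
- case=> n0; subst n.
  exists (wall (order_of D) D (dom om)); split.
  + exact: wall_hypersurface.
  + split; first by rewrite linear0; exact: (@dom_0 _ _ _ om).
    by exists (inl ord0); rewrite /= linear0 mxE.
  + apply: (@form_invariant_lift _ _ _ (tb (R := R) (n := 0) (L := order_of D) (p := D)) (ex (param_of q))) => //.
    by move=> x; rewrite /Z /Zf row_mxKl.
  move=> Delta /small[R0 R00 hD]; have [r1 [Bw [Lw [rho [r1R ch]]]]] := hch R0 R00.
  rewrite wall_plane; apply: (plane_dense eps0 epsL ch) => x h1 h2; apply: hD; exact: lt_le_trans r1R.
- split=> [x _|x y _ _ E]; last by rewrite /Z /Zf E.
  by rewrite XE lift_Xp.
have [k [l [l0 hl]]] := @hyperplane_list R n _ (tb (R := R) (n := n) (L := order_of D) (p := D)).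
exists k, l; split=> //; rewrite FE; first exact: form_invariant.
move=> x nx; apply: global_dense => //; split=> [i ii|b]; apply/eqP => E; apply: nx; apply/hl.
  by exists (inl (sg i)); rewrite /= lift_sg.
by exists (inr b).
Qed.
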